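(* There exist transitive maps $g\in\mathrm{End}^{1+}(\mathbb T^2)$ with at least two inverse SRB measures $\mu_1,\mu_2$ such that: $F_{\mu_1}(g)\ne F_{\mu_2}(g)$; the unique $\hat g$-invariant lifts $\hat\mu_1,\hat\mu_2$ of $\mu_1,\mu_2$ to the natural extension $L_g$ disintegrate along the fibers $\pi_g^{-1}(x)$ in different ways (i.e. with different conditional measures); and the basin of each $\mu_i$ projects onto the whole torus, i.e. $\pi_g(B^-(\mu_i))=\mathbb T^2$ for $i=1,2$.
   Context: $\mathrm{End}^{1+}(\mathbb T^2)$ is the set of local diffeomorphisms of $\mathbb T^2=\mathbb R^2/\mathbb Z^2$ of class $C^{1+\alpha}$ for some $\alpha>0$. $L_g=\{(x_n)_{n\in\mathbb Z}:g(x_n)=x_{n+1}\}$, $\hat g((x_n)_n)=(x_{n+1})_n$, $\pi_g((x_n)_n)=x_0$. Each $g$-invariant probability $\mu$ has a unique $\hat g$-invariant lift $\hat\mu$ with $(\pi_g)_*\hat\mu=\mu$. The (backward) basin of $\mu$ is the basin of $\hat\mu$ under $\hat g^{-1}$: $B^-(\mu)=\{\hat x\in L_g:\frac1n\sum_{k=0}^{n-1}\delta_{\hat g^{-k}(\hat x)}\to\hat\mu\}$. The folding entropy is $F_\mu(g)=H_\mu(\mathcal E\mid g^{-1}\mathcal E)$, $\mathcal E$ the partition into points. Lyapunov exponents: $\chi^+(x)=\lim\frac1n\log\|Dg^n_x\|$, $\chi^-(x)=\lim\frac1n\log\|(Dg^n_x)^{-1}\|^{-1}$; a $g$-invariant Borel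 probability $\mu$ is hyperbolic if $\chi^-(x)<0<\chi^+(x)$ for $\mu$-a.e. $x$. A local stable manifold $W^s(x)$ is a $C^{1+}$ embedded manifold for which there are $\lambda>0$, $0<\epsilon<\lambda/200$, $0\le C_1\le1\le C_2$ with $d(g^n(x),g^n(y))\le C_1e^{-n\epsilon}$ and $d(g^n(x),g^n(y))\le C_2e^{-n\lambda}$ for all $y\in W^s(x)$, $n\ge0$; it is tangent at $x$ to the Oseledets space of the negative exponent (Pesin theory). A measurable partition $\xi$ is subordinate to stable manifolds if for $\mu$-a.e. $x$, $\xi(x)\subset W^s(x)$ and $\xi(x)$ contains an open neighborhood of $x$ in $W^s(x)$. $\mu$ is an inverse SRB measure if it is hyperbolic and for every such $\xi$ the conditional measures satisfy $\mu^\xi_x\ll\mathrm{Leb}_{W^s(x)}$ for $\mu$-a.e. $x$. *)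

(* Defs.v *)
From HB Require Import structures.
From mathcomp Require Import all_boot all_order all_algebra ring_quotient.
From mathcomp Require Import all_classical all_reals all_analysis.

Set Implicit Arguments.
Unset Strict Implicit.
Unset Printing Implicit Defensive.

Import Order.TTheory GRing.Theory Num.Theory.
Import numFieldNormedType.Exports.

Local Open Scope classical_set_scope.
Local Open Scope ring_scope.

(** * The torus [R^2 / Z^2] *)

Definition Z2 (R : realType) : {pred 'rV[R]_2} :=
  [pred v : 'rV[R]_2 | [forall i, v ord0 i \is a Num.int]]%B.

Lemma Z2_zmod_closed (R : realType) : zmod_closed (@Z2 R).
Proof.
split=> [|u v /forallP uZ /forallP vZ]; apply/forallP => i; rewrite !mxE.
  exact: rpred0.
by rewrite rpredB.
Qed.

HB.instance Definition _ (R : realType) :=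
  GRing.isZmodClosed.Build 'rV[R]_2 (@Z2 R) (@Z2_zmod_closed R).

Definition torus (R : realType) : Type :=
  quotient_topology (Quotient.quot (@Z2 R)).

HB.instance Definition _ (R : realType) := PointedTopological.on (torus R).
HB.instance Definition _ (R : realType) := Quotient.on (torus R).
HB.instance Definition _ (R : realType) :=
  GRing.Zmodule.copy (torus R) (Quotient.quot (@Z2 R)).
HB.instance Definition _ (R : realType) :=
  Measurable.copy (torus R) (g_sigma_algebraType (@open (torus R))).

Section torus.
Context {R : realType}.

Definition torus_proj (v : 'rV[R]_2) : torus R := \pi_(torus R)%qT v.

Definition enorm (v : 'rV[R]_2) : R := Num.sqrt (\sum_(i < 2) v 0 i ^+ 2).

Definition edist (v w : 'rV[R]_2) : R := enorm (v - w).

Definition opnorm (L : 'M[R]_2) : R :=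
  sup [set enorm (v *m L) | v in [set v | enorm v = 1]].

Definition opdist (L M : 'M[R]_2) : R := opnorm (L - M).

Definition tdist (x y : torus R) : R :=
  inf [set enorm v | v in [set v | torus_proj v = x - y]].

(** * Differential calculus on the torus *)

(* [f (x + h) = f x + L h + o(h)], in the charts of the torus given by
   [torus_proj] and the translations. *)
Definition is_tderiv (V : normedModType R) (f : V -> torus R) (x : V)
    (L : V -> 'rV[R]_2) :=
  forall e : R, 0 < e ->
    \forall h \near (0 : V),
      tdist (f (x + h)) (f x + torus_proj (L h)) <= e * `|h|.

Definition has_jacobian (g : torus R -> torus R) (x : torus R) (L : 'M[R]_2) :=
  is_tderiv (fun v : 'rV[R]_2 => g (x + torus_proj v)) 0 (mulmxr L).

(* Vectors are rows: the differential is [v |-> v *m jac g x]. *)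
Definition jac (g : torus R -> torus R) (x : torus R) : 'M[R]_2 :=
  get [set L | has_jacobian g x L].

Definition locally_holder (X : topologicalType) (Y : Type)
    (dX : X -> X -> R) (dY : Y -> Y -> R) (alpha : R)
    (U : set X) (F : X -> Y) :=
  forall x, U x -> exists2 V, nbhs x V & exists C : R,
    forall y z, (U `&` V) y -> (U `&` V) z ->
      dY (F y) (F z) <= C * dX y z `^ alpha.

Definition C1alpha_on (alpha : R) (U : set (torus R))
    (f : torus R -> torus R) :=
  (forall x, U x -> has_jacobian f x (jac f x)) /\
  locally_holder tdist opdist alpha U (jac f).

Definition local_diffeo_C1alpha (alpha : R) (g : torus R -> torus R) :=
  forall x, exists2 U : set (torus R), open U /\ U x &
    [/\ open (g @` U), C1alpha_on alpha U g &
        exists2 h : torus R -> torus R,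
          {in U, cancel g h} & C1alpha_on alpha (g @` U) h].

Definition End1plus (g : torus R -> torus R) :=
  exists2 alpha : R, 0 < alpha & local_diffeo_C1alpha alpha g.

Definition topologically_transitive (g : torus R -> torus R) :=
  forall U V : set (torus R), open U -> open V -> U !=set0 -> V !=set0 ->
    exists n, iter n g @` U `&` V !=set0.

End torus.

(** * Measurable partitions and conditional measures *)

Section partitions.
Context {d : measure_display} {X : measurableType d} {R : realType}.

Definition preserves (f : X -> X) (mu : probability X R) :=
  forall A, measurable A -> mu (f @^-1` A) = mu A.

(* A partition is given by the map sending a point to its atom. *)
Definition is_partition (xi : X -> set X) :=
  (forall x, xi x x) /\ (forall x y, xi x y -> xi y = xi x).

(* Measurable in the sense of Rokhlin: up to a null set, the atoms are
   separated by countably many measurable unions of atoms. *)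
Definition measurable_partition (mu : probability X R) (xi : X -> set X) :=
  is_partition xi /\
  exists X0 (A : nat -> set X),
    [/\ measurable X0, mu X0 = 1%E, forall n, measurable (A n) &
        forall x y, X0 x -> X0 y -> (xi x y <-> forall n, A n x <-> A n y)].

Definition conditional_measures (mu : probability X R) (xi : X -> set X)
    (m : R.-pker X ~> X) :=
  [/\ forall B, measurable B -> mu B = (\int[mu]_x m x B)%E,
      {ae mu, forall x, (m x).-negligible (~` xi x)} &
      exists X0, [/\ measurable X0, mu X0 = 1%E &
        forall x y, X0 x -> X0 y -> xi x y ->
          forall B, measurable B -> m x B = m y B]].

(* Rokhlin's formula [H_mu(xi | eta) = - \int log mu^eta_x(xi(x)) d mu(x)]; by
   essential uniqueness of conditional measures the set below has at most one
   element. *)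
Definition conditional_entropy (mu : probability X R) (xi eta : X -> set X) :
    \bar R :=
  get [set h | exists2 m, conditional_measures mu eta m &
                 h = (\int[mu]_x - lne (m x (xi x)))%E].

Definition point_partition : X -> set X := fun x => [set x].

Definition preimage_partition (g : X -> X) (xi : X -> set X) : X -> set X :=
  fun x => g @^-1` xi (g x).

Definition folding_entropy (g : X -> X) (mu : probability X R) : \bar R :=
  conditional_entropy mu point_partition (preimage_partition g point_partition).

End partitions.

(** * Hyperbolic measures and inverse SRB measures *)

Section inverse_SRB.
Context {R : realType}.
Implicit Types (g : torus R -> torus R) (x : torus R).
Implicit Types (mu : probability (torus R) R).

Definition growth_plus g x : R^nat :=
  fun n => ln (opnorm (jac (iter n g) x)) / n%:R.

Definition growth_minus g x : R^nat :=
  fun n => ln (opnorm (invmx (jac (iter n g) x)))^-1 / n%:R.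

Definition chi_plus g x : R := limn (growth_plus g x).

Definition chi_minus g x : R := limn (growth_minus g x).

Definition hyperbolic g mu :=
  {ae mu, forall x, [/\ cvgn (growth_plus g x), cvgn (growth_minus g x),
                        chi_minus g x < 0 & 0 < chi_plus g x]}.

Definition oseledets_minus g x : set 'rV[R]_2 :=
  [set v | v = 0 \/
     (fun n => ln (enorm (v *m jac (iter n g) x)) / n%:R) @ \oo
       --> chi_minus g x].

(* Curves are parametrised by the open interval ]-1, 1[. *)
Definition curve_dom : set R := `]-1, 1[.

Definition curve (gamma : R -> torus R) : set (torus R) := gamma @` curve_dom.

Definition has_velocity (gamma : R -> torus R) (t : R) (v : 'rV[R]_2) :=
  is_tderiv (gamma : R^o -> torus R) t (fun h : R^o => h *: v).

Definition velocity (gamma : R -> torus R) (t : R) : 'rV[R]_2 :=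
  get [set v | has_velocity gamma t v].

Definition embedded_C1plus_curve (gamma : R -> torus R) :=
  [/\ forall t, curve_dom t -> has_velocity gamma t (velocity gamma t),
      forall t, curve_dom t -> velocity gamma t != 0,
      exists2 alpha : R, 0 < alpha &
        locally_holder (fun s t => `|s - t|) edist alpha curve_dom
          (velocity gamma) &
      exists2 h : torus R -> R,
        {in curve_dom, cancel gamma h} & {within curve gamma, continuous h}].

(* Riemannian length on the curve. *)
Definition Leb_curve (gamma : R -> torus R) : set (torus R) -> \bar R :=
  fun A => (\int[lebesgue_measure]_(t in curve_dom `&` gamma @^-1` A)
              (enorm (velocity gamma t))%:E)%E.

Definition local_stable_manifold g x (gamma : R -> torus R) :=
  [/\ embedded_C1plus_curve gamma,
      exists lambda eps C1 C2 : R,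
        [/\ 0 < lambda, 0 < eps < lambda / 200, 0 <= C1 <= 1, 1 <= C2 &
            forall y n, curve gamma y ->
              tdist (iter n g x) (iter n g y) <= C1 * expR (- (n%:R * eps)) /\
              tdist (iter n g x) (iter n g y) <= C2 * expR (- (n%:R * lambda))] &
      exists t0, [/\ curve_dom t0, gamma t0 = x &
        oseledets_minus g x = [set c *: velocity gamma t0 | c in [set: R]]]].

(* [Ws x] parametrises the local stable manifold chosen at [x]. *)
Definition subordinate g mu (Ws : torus R -> R -> torus R)
    (xi : torus R -> set (torus R)) :=
  {ae mu, forall x,
    [/\ local_stable_manifold g x (Ws x), xi x `<=` curve (Ws x) &
        exists U, [/\ open U, U x & U `&` curve (Ws x) `<=` xi x]]}.

Definition inverse_SRB g mu :=
  [/\ preserves g mu, hyperbolic g mu &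
      forall Ws xi (m : R.-pker torus R ~> torus R),
        measurable_partition mu xi -> subordinate g mu Ws xi ->
        conditional_measures mu xi m ->
        {ae mu, forall x, m x `<< Leb_curve (Ws x)}].

End inverse_SRB.

(** * The natural extension *)

(* Bi-infinite sequences with the product topology. Probabilities on the
   natural extension are encoded as probabilities on this space that give full
   mass to the closed subset [natural_extension g]. *)
Definition bisequence (R : realType) : Type := {ptws int -> torus R}.

HB.instance Definition _ (R : realType) :=
  Topological.copy (bisequence R) {ptws int -> torus R}.
HB.instance Definition _ (R : realType) :=
  Pointed.copy (bisequence R) (int -> torus R).
HB.instance Definition _ (R : realType) :=
  Measurable.copy (bisequence R) (g_sigma_algebraType (@open (bisequence R))).

Section natural_extension.
Context {R : realType}.
Implicit Types (g : torus R -> torus R) (x y : torus R).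
Implicit Types (mu : probability (torus R) R).
Implicit Types (muh : probability (bisequence R) R).

Definition natural_extension g : set (bisequence R) :=
  [set xh | forall n : int, g (xh n) = xh (n + 1)].

Definition seq_shift (xh : bisequence R) : bisequence R := fun n => xh (n + 1).

Definition seq_shift_inv (xh : bisequence R) : bisequence R :=
  fun n => xh (n - 1).

Definition pi0 (xh : bisequence R) : torus R := xh 0.

Definition is_lift g mu muh :=
  [/\ muh (natural_extension g) = 1%E, preserves seq_shift muh &
      forall A, measurable A -> muh (pi0 @^-1` A) = mu A].

Definition weakly_converges_on (L : set (bisequence R))
    (nu : nat -> set (bisequence R) -> \bar R) muh :=
  forall phi : bisequence R -> R, {within L, continuous phi} ->
    (fun n => \int[nu n]_(xh in L) (phi xh)%:E)%E @ \oo -->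
    (\int[muh]_(xh in L) (phi xh)%:E)%E.

Definition backward_empirical (xh : bisequence R) (n : nat) :
    set (bisequence R) -> \bar R :=
  mscale (n%:R^-1)%:nng (msum (fun k => \d_(iter k seq_shift_inv xh)) n).

Definition backward_basin g muh : set (bisequence R) :=
  [set xh | natural_extension g xh /\
     weakly_converges_on (natural_extension g) (backward_empirical xh) muh].

Definition fiber g x : set (bisequence R) :=
  [set xh | natural_extension g xh /\ pi0 xh = x].

Definition fiber_disintegration g mu muh
    (m : R.-pker torus R ~> bisequence R) :=
  (forall B, measurable B -> muh B = (\int[mu]_x m x B)%E) /\
  {ae mu, forall x, m x (fiber g x) = 1%E}.

(* An identification of the trees of preorbits of [x] and [y]: two preorbits
   share their first [n] steps iff their images do. *)
Definition fiber_identification g x y (h : bisequence R -> bisequence R) :=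
  set_bij (fiber g x) (fiber g y) h /\
  forall a b, fiber g x a -> fiber g x b -> forall n : nat,
    a (- n%:Z) = b (- n%:Z) <-> h a (- n%:Z) = h b (- n%:Z).

(* Two families of fibre measures, over [mu1] and [mu2], are the same if the
   points of the torus can be matched, by a coupling of [mu1] with [mu2], in
   such a way that the measures on matched fibres are identified.  Comparing
   them at one and the same point would be void: the invariant measures all
   have a common system of fibre measures, as distinct ergodic measures are
   mutually singular. *)
Definition same_disintegration g mu1 mu2
    (m1 m2 : R.-pker torus R ~> bisequence R) :=
  exists2 kappa : probability (torus R * torus R)%type R,
    forall A, measurable A ->
      kappa (A `*` setT) = mu1 A /\ kappa (setT `*` A) = mu2 A &
    {ae kappa, forall z, exists2 h, fiber_identification g z.1 z.2 h &
       forall B, measurable B -> m1 z.1 (fiber g z.1 `&` h @^-1` B) = m2 z.2 B}.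

Definition disintegrate_differently g mu1 mu2 muh1 muh2 :=
  exists m1 m2, [/\ fiber_disintegration g mu1 muh1 m1,
                    fiber_disintegration g mu2 muh2 m2 &
                    ~ same_disintegration g mu1 mu2 m1 m2].

End natural_extension.

(* Main.v *)
From HB Require Import structures.
From mathcomp Require Import all_boot all_order all_algebra ring_quotient.
From mathcomp Require Import all_classical all_reals all_analysis.
From mathcomp Require Import measurable_realfun.
From mathcomp Require Import ring lra zify.
Require Import Defs.
Set Implicit Arguments.
Unset Strict Implicit.
Unset Printing Implicit Defensive.
Import Order.TTheory GRing.Theory Num.Theory.
Import numFieldNormedType.Exports.
Local Open Scope classical_set_scope.
Local Open Scope ring_scope.

(** The map is [tmap], induced on the torus by the integer matrix [amx] with rows (1, 1) and (1, 4).
    Its determinant is 3 and its eigenvalues satisfy 0 < [ls] < 1 < 4 < [lu], so it is a hyperbolic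
    three-to-one local diffeomorphism with constant exponents. It carries a family of invariant
    measures [tprob], one for each [eps] in [0, 1/2]: Riesz products, formally with density the
    product over j >= 0 of 1 + eps cos(2 pi (A^j x)_0). They are stationary for the backward random
    walk that picks the preimage y with probability [tw y] = (1 + eps cos(2 pi y_0)) / 3; the three
    probabilities sum to 1 because the three angles differ by thirds of a turn. The two measures of
    the theorem are those for eps = 0, which is Lebesgue measure, and for eps = 1/2.

    Inverse SRB property: along a stable line the j-th factor varies by an amount of order ls^j, and
    these are summable, so moving along a stable line changes the Riesz product on the unstable
    lines by a bounded factor only ([dens_distortion], [nus_distortion]). Locally the measure is
    thus comparable with Lebesgue measure on stable leaves times a transverse measure ([mut_le]).
    For a partition subordinate to stable manifolds this bounds the conditional mass of a strip
    across the leaves by a constant times its width ([kernel_strip_le]), and absolute continuity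
    follows ([tmap_inverse_SRB]).

    Entropy and fibres: within its fibre a point has conditional mass [tw], so the folding entropy
    is the integral of - ln [tw]. It is ln 3 for eps = 0 and strictly smaller for eps = 1/2, by
    strict convexity of W ln W. The lift is the law of the full orbit of the backward walk, so its
    fibre measures give the three branches the probabilities [tw]. A measure-preserving
    identification of two preimage trees would match three equal probabilities with three that are
    not all equal.

    Basins: the iterates of the transfer operator [tL] of the walk converge uniformly to a constant
    on every character ([tcos_equidistributes]), so a character is, up to a small error, a constant
    plus h - [tL] h. Along a backward orbit y the increments h(y_(i+1)) - [tL] h(y_i) are martingale
    differences, and some choice of preimage does no worse than the mean for the sum of the squares
    of the accumulated increments. From any starting point this greedy choice yields a backward
    orbit equidistributed for all characters at once ([equidistributed_preorbit]); the
    Stone-Weierstrass theorem on the natural extension passes to continuous functions. For Lebesgue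
    measure, which has full support, such an orbit enters every nonempty open set, whence
    transitivity. *)

(** * The torus as a quotient of the plane, and the Euclidean norm *)

Section torus_basics.
Context {R : realType}.
Implicit Types (v w : 'rV[R]_2) (x y z : torus R).

Lemma fracB_itv (a : R) : 0 <= a - (Num.floor a)%:~R < 1.
Proof. by have := floor_itv a; rewrite intrD; lra. Qed.

Definition vec2 (a b : R) : 'rV[R]_2 := \row_i (if i == 0 then a else b).

Lemma vec2E0 a b : vec2 a b 0 0 = a. Proof. by rewrite mxE. Qed.
Lemma vec2E1 a b : vec2 a b 0 1 = b. Proof. by rewrite mxE. Qed.

Lemma row2P v w : v 0 0 = w 0 0 -> v 0 1 = w 0 1 -> v = w.
Proof.
move=> e0 e1; apply/rowP => i; case: (unliftP 0 i) => [j ->|-> //].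
by rewrite (ord1 j) (_ : lift _ _ = 1) //; exact: val_inj.
Qed.

Lemma vec2_eta v : v = vec2 (v 0 0) (v 0 1).
Proof. by apply: row2P; rewrite !mxE. Qed.

Lemma tprojB v w : torus_proj (v - w) = torus_proj v - torus_proj w.
Proof. exact: (@pi_is_zmod_morphism _ _ _ (Quotient.quot (@Z2 R))). Qed.

Lemma tproj0 : torus_proj 0 = 0 :> torus R.
Proof. by rewrite -(subrr 0) tprojB subrr. Qed.

Lemma tprojN v : torus_proj (- v) = - torus_proj v.
Proof. by rewrite -[- v]sub0r tprojB tproj0 sub0r. Qed.

Lemma tprojD v w : torus_proj (v + w) = torus_proj v + torus_proj w.
Proof. by rewrite -[w in LHS]opprK tprojB tprojN opprK. Qed.

Lemma tproj_repr x : torus_proj (repr x) = x.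
Proof. exact: reprK. Qed.

Lemma tproj_surj x : exists v, torus_proj v = x.
Proof. by exists (repr x); exact: tproj_repr. Qed.

Lemma in_Z2P v :
  reflect (exists a b : int, v = vec2 a%:~R b%:~R) (v \in @Z2 R).
Proof.
apply: (iffP forallP) => [vi|[a [b ->]] i].
  have /intrP[a ea] := vi 0; have /intrP[b eb] := vi 1.
  by exists a, b; apply: row2P; rewrite mxE.
by rewrite mxE; case: ifP.
Qed.

Lemma tproj_eqP v w : torus_proj v = torus_proj w <->
  exists a b : int, v = w + vec2 a%:~R b%:~R.
Proof.
have E : torus_proj v = torus_proj w <-> v - w \in @Z2 R.
  rewrite -[_ \in _](Quotient.equivE (@Z2 R)).
  by split => [h|/(eqquotP (Quotient.quot (@Z2 R)))//]; apply/(eqquotP (Quotient.quot (@Z2 R))).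
rewrite E; split=> [/in_Z2P[a [b e]]|[a [b ->]]].
  by exists a, b; rewrite -e addrC subrK.
by apply/in_Z2P; exists a, b; rewrite addrAC subrr add0r.
Qed.

Lemma tproj_int (a b : int) : torus_proj (vec2 a%:~R b%:~R : 'rV[R]_2) = 0.
Proof. by rewrite -tproj0; apply/tproj_eqP; exists a, b; rewrite add0r. Qed.

(* The Euclidean norm, compared with the sup norm carried by ['rV_2]. *)
Lemma enormE v : enorm v = Num.sqrt (v 0 0 ^+ 2 + v 0 1 ^+ 2).
Proof. by rewrite /enorm big_ord_recl big_ord1 (_ : lift _ _ = 1) //; exact: val_inj. Qed.

Lemma enorm_ge0 v : 0 <= enorm v.
Proof. exact: sqrtr_ge0. Qed.

Lemma enorm_sqr v : enorm v ^+ 2 = v 0 0 ^+ 2 + v 0 1 ^+ 2.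
Proof. by rewrite enormE sqr_sqrtr // addr_ge0 // sqr_ge0. Qed.

Lemma enorm0 : enorm (0 : 'rV[R]_2) = 0.
Proof. by rewrite enormE !mxE expr0n /= addr0 sqrtr0. Qed.

Lemma enormN v : enorm (- v) = enorm v.
Proof. by rewrite !enormE !mxE !sqrrN. Qed.

Lemma enormZ (c : R) v : enorm (c *: v) = `|c| * enorm v.
Proof.
by rewrite !enormE !mxE !exprMn -mulrDr sqrtrM ?sqr_ge0 // sqrtr_sqr.
Qed.

Lemma enorm_eq0 v : (enorm v == 0) = (v == 0).
Proof.
apply/idP/idP => [|/eqP ->]; last by rewrite enorm0.
rewrite -sqrf_eq0 enorm_sqr paddr_eq0 ?sqr_ge0 // !sqrf_eq0.
by move=> /andP[/eqP e0 /eqP e1]; apply/eqP/row2P; rewrite mxE.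
Qed.

Lemma enorm_coord v i : `|v 0 i| <= enorm v.
Proof.
rewrite -sqrtr_sqr; apply: ler_wsqrtr.
by rewrite (bigD1 i) //= lerDl sumr_ge0 // => k _; rewrite sqr_ge0.
Qed.

Lemma enorm_le_coord v (c : R) : `|v 0 0| <= c -> `|v 0 1| <= c -> enorm v <= 2 * c.
Proof.
move=> h0 h1; have c0 : 0 <= c := le_trans (normr_ge0 _) h0.
rewrite enormE -[leRHS]ger0_norm ?mulr_ge0 // -sqrtr_sqr ler_wsqrtr //.
rewrite -(real_normK (num_real (v 0 0))) -(real_normK (num_real (v 0 1))).
have : `|v 0 0| ^+ 2 <= c ^+ 2 by rewrite lerXn2r ?nnegrE.
have : `|v 0 1| ^+ 2 <= c ^+ 2 by rewrite lerXn2r ?nnegrE.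
rewrite exprMn; move: (sqr_ge0 c); lra.
Qed.

Lemma enormD v w : enorm (v + w) <= enorm v + enorm w.
Proof.
rewrite -(ler_pXn2r (n := 2)) // ?nnegrE ?addr_ge0 ?enorm_ge0 //.
rewrite sqrrD !enorm_sqr !mxE.
suff : v 0 0 * w 0 0 + v 0 1 * w 0 1 <= enorm v * enorm w by rewrite -mulr_natl; lra.
apply: (le_trans (ler_norm _)).
rewrite -(ler_pXn2r (n := 2)) // ?nnegrE ?mulr_ge0 ?enorm_ge0 //.
rewrite real_normK ?num_real // exprMn !enorm_sqr.
have := sqr_ge0 (v 0 0 * w 0 1 - v 0 1 * w 0 0); lra.
Qed.

Lemma mx_norm_le_enorm v : `|v| <= enorm v.
Proof.
by rewrite /Num.norm/= mx_normrE; apply/bigmax_leP; split=> [|[i j] _] /=;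
  rewrite ?enorm_ge0 // (ord1 i) enorm_coord.
Qed.

Lemma coord_le_mx_norm v i : `|v 0 i| <= `|v|.
Proof. by rewrite {2}/Num.norm/= mx_normrE; apply: (le_bigmax_cond _ (j := (0, i)) (fun k => `|v k.1 k.2|)). Qed.

Lemma enorm_le_mx_norm v : enorm v <= 2 * `|v|.
Proof. by apply: enorm_le_coord; exact: coord_le_mx_norm. Qed.

(* An integer vector with entries smaller than 1 vanishes. *)
Lemma tproj_inj_small v w : enorm v < 1/2 -> enorm w < 1/2 ->
  torus_proj v = torus_proj w -> v = w.
Proof.
move=> hv hw /tproj_eqP[a [b e]].
have small (c : int) (i : 'I_2) : v 0 i = w 0 i + c%:~R -> c = 0.
  move=> ei; have : `|c%:~R : R| < 1.
    rewrite (_ : c%:~R = v 0 i - w 0 i); last by rewrite ei addrAC subrr add0r.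
    apply: le_lt_trans (ler_normB _ _) _.
    by move: (enorm_coord v i) (enorm_coord w i); lra.
  by rewrite -intr_norm ltrz1; lia.
have a0 : a = 0 by apply: (small a 0); rewrite e !mxE.
have b0 : b = 0 by apply: (small b 1); rewrite e !mxE.
by apply: row2P; rewrite e a0 b0 !mxE /= addr0.
Qed.

End torus_basics.

(** * Topology and distance of the torus *)

Section torus_topology.
Context {R : realType}.
Implicit Types (v w : 'rV[R]_2) (x y z : torus R).

Lemma tproj_continuous : continuous (@torus_proj R).
Proof. exact: pi_continuous. Qed.

Lemma enorm_nbhs0 (U : set 'rV[R]_2) v :
  nbhs v U <-> exists2 d, 0 < d & forall h, enorm h < d -> U (v + h).
Proof.
split=> [/nbhs_ballP[d /= d0 dU]|[d d0 dU]].
  exists d => // h hd; apply: dU; rewrite -ball_normE /ball_ /=.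
  by rewrite opprD addNKr normrN (le_lt_trans (mx_norm_le_enorm h)).
apply/nbhs_ballP; exists (d / 2); first by rewrite /= divr_gt0.
move=> w; rewrite -ball_normE /ball_ /= distrC => hw.
rewrite -(subrK v w) addrC; apply: dU.
by apply: le_lt_trans (enorm_le_mx_norm _) _; rewrite mulrC -ltr_pdivlMr.
Qed.

(** The projection is continuous, and the translates by small vectors form open sets. Every later
    local statement is checked in this form, by adding the projection of a short vector. *)
Lemma nbhs_torusP x (U : set (torus R)) :
  nbhs x U <-> exists2 d, 0 < d & forall h, enorm h < d -> U (x + torus_proj h).
Proof.
split=> [xU|[d d0 dU]].
  have : nbhs (repr x) (torus_proj @^-1` U).
    by apply: tproj_continuous; rewrite tproj_repr.
  move=> /enorm_nbhs0[d d0 dU]; exists d => // h /dU /=.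
  by rewrite tprojD tproj_repr.
rewrite nbhsE /=; exists [set y | exists2 h, enorm h < d & y = x + torus_proj h].
  split; last by exists 0; rewrite ?enorm0 // tproj0 addr0.
  rewrite /open /= /quotient_open openE => w [h hd e].
  apply/enorm_nbhs0; exists (d - enorm h); first by rewrite subr_gt0.
  move=> k kd; exists (h + k).
    by apply: le_lt_trans (enormD _ _) _; rewrite -ltrBrDl.
  change (torus_proj w = x + torus_proj h) in e.
  by change (torus_proj (w + k) = x + torus_proj (h + k)); rewrite !tprojD e addrA.
by move=> y [h hd ->]; exact: dU.
Qed.

Lemma tproj_open (U : set 'rV[R]_2) : open U -> open (torus_proj @` U).
Proof.
move=> oU; rewrite openE => y [v Uv <-]; apply/nbhs_torusP.
have /enorm_nbhs0[d d0 dU] : nbhs v U by exact: open_nbhs_nbhs.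
by exists d => // h hd; exists (v + h); [exact: dU|rewrite tprojD].
Qed.

Lemma tcontinuousP (T : topologicalType) (f : torus R -> T) :
  continuous (f \o torus_proj) -> continuous f.
Proof. by move=> fc; apply/quotient_continuous. Qed.

(* Two points of the torus at distance less than [d] differ by the projection
   of a vector of norm less than [d]. *)
Lemma tdist_has_inf x y :
  has_inf [set enorm v | v in [set v | torus_proj v = x - y]].
Proof.
split; last by exists 0 => _ [v _ <-]; exact: enorm_ge0.
by exists (enorm (repr (x - y))); exists (repr (x - y)) => //=; exact: tproj_repr.
Qed.

Lemma tdist_le x y v : torus_proj v = x - y -> tdist x y <= enorm v.
Proof.
by move=> e; apply: ge_inf; [exact: (tdist_has_inf x y).2|exists v].
Qed.

Lemma tdist_ge0 x y : 0 <= tdist x y.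
Proof.
apply: lb_le_inf; first exact: (tdist_has_inf x y).1.
by move=> _ [v _ <-]; exact: enorm_ge0.
Qed.

Lemma tdist_ltP x y (d : R) :
  tdist x y < d -> exists2 v, enorm v < d & x = y + torus_proj v.
Proof.
move=> /(inf_lt (tdist_has_inf x y).1)[_ [v /= e <-] vd].
by exists v => //; rewrite e addrC subrK.
Qed.

Lemma tdist_proj_le v w : tdist (torus_proj v) (torus_proj w) <= enorm (v - w).
Proof. by apply: tdist_le; rewrite tprojB. Qed.

Lemma tdist_small x y v : enorm v < 1/2 -> x = y + torus_proj v ->
  tdist x y = enorm v.
Proof.
move=> hv ->; apply/eqP; rewrite eq_le tdist_le /=; last by rewrite addrAC subrr add0r.
rewrite leNgt; apply/negP => /[dup] lt /tdist_ltP[w hw /addrI e].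
by move: (hw); rewrite (tproj_inj_small hv (lt_trans hw hv) e) ltxx.
Qed.

Lemma torus_hausdorff : hausdorff_space (torus R).
Proof.
rewrite open_hausdorff => x y /eqP xy.
set v := repr (x - y); have [d [d0 dsep]] : exists d : R, 0 < d /\
    forall h, enorm h < d -> torus_proj h <> x - y.
  case: (pselect (exists2 h, enorm h < 1/2 & torus_proj h = x - y)) => [[h h2 e]|no].
    exists (enorm h); split=> [|k kh ek].
      rewrite lt_def enorm_ge0 andbT enorm_eq0; apply/eqP => h0.
      by apply: xy; apply: subr0_eq; rewrite -e h0 tproj0.
    suff kh' : k = h by move: kh; rewrite kh' ltxx.
    by apply: tproj_inj_small; rewrite ?ek ?e // (lt_trans kh).
  by exists (1/2); split=> // h h2 e; apply: no; exists h.
pose B z := (fun h => z + torus_proj h) @` [set h | enorm h < d / 2].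
have oB z : open (B z).
  rewrite openE => _ [h hd <-]; apply/nbhs_torusP; exists (d / 2 - enorm h).
    by rewrite subr_gt0.
  move=> k kd; exists (h + k); last by rewrite tprojD addrA.
  by apply: le_lt_trans (enormD _ _) _; rewrite -ltrBrDl.
exists (B x, B y); rewrite /= ?inE.
  by split; exists 0 => //=; rewrite ?enorm0 ?divr_gt0 // tproj0 addr0.
split=> //; apply/seteqP; split=> // z [[h hd <-] [k kd]] e.
apply: (dsep (k - h)).
  apply: le_lt_trans (enormD _ _) _; rewrite enormN; move: hd kd => /=; lra.
by rewrite tprojB; apply: (addrI y); rewrite addrA e addrK addrC subrK.
Qed.

Lemma torus_compact : compact [set: torus R].
Proof.
have -> : [set: torus R] = torus_proj @` [set v : 'rV[R]_2 | forall i, v 0 i \in `[0, 1]].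
  apply/seteqP; split=> // x _.
  have [v <-] := tproj_surj x.
  exists (vec2 (v 0 0 - (Num.floor (v 0 0))%:~R) (v 0 1 - (Num.floor (v 0 1))%:~R)).
    move=> i; rewrite mxE.
    by case: ifP => _; rewrite in_itv /=; case/andP: (fracB_itv (v 0 0)) => *; case/andP: (fracB_itv (v 0 1)) => *; apply/andP; split=> //; exact: ltW.
  apply/esym/tproj_eqP; exists (Num.floor (v 0 0)), (Num.floor (v 0 1)).
  by apply: row2P; rewrite !mxE /= subrK.
apply: continuous_compact; first by apply: continuous_subspaceT; exact: tproj_continuous.
exact: (@rV_compact R^o 2 (fun=> `[0, 1]%classic) (fun=> @segment_compact R 0 1)).
Qed.

End torus_topology.

(** * Measurability through countable bases *)

Section countable_bases.

Lemma preimage_open_measurable d (Z : measurableType d) (Y : topologicalType)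
    (I : countType) (b : I -> set Y) (f : Z -> Y) (U : set Y) :
  (forall V y, open V -> V y -> exists i, b i y /\ b i `<=` V) ->
  (forall i, measurable (f @^-1` b i)) -> open U -> measurable (f @^-1` U).
Proof.
move=> base mb oU.
pose c n := if unpickle n is Some i then
  (if `[< b i `<=` U >] then f @^-1` b i else set0) else set0.
have -> : f @^-1` U = \bigcup_n c n.
  apply/seteqP; split=> [z Uz|z [n _]].
    have [i [bi bU]] := base _ _ oU Uz.
    by exists (pickle i) => //; rewrite /c pickleK; case: asboolP.
  by rewrite /c; case: unpickle => // i; case: asboolP => // iU; exact: iU.
apply: bigcup_measurable => n _; rewrite /c.
by case: unpickle => // i; case: asboolP.
Qed.

Lemma prod_open_cylinder (I : choiceType) (T : topologicalType)
    (U : set {ptws I -> T}) (x : I -> T) : open U -> U x ->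
  exists2 l : seq (I * set T), (forall p, p \in l -> open p.2 /\ p.2 (x p.1)) &
    forall y : I -> T, (forall p, p \in l -> p.2 (y p.1)) -> U y.
Proof.
move=> oU Ux; have /= : nbhs (x : {ptws I -> T}) U by exact: open_nbhs_nbhs.
move=> [P [[Q QfinP <-] [V JV Vx]] QU].
have [L Lsub LV] := QfinP _ JV.
suff [l lL lV] : exists2 l : seq (I * set T),
    (forall p, p \in l -> open p.2 /\ p.2 (x p.1)) &
    forall y : I -> T, (forall p, p \in l -> p.2 (y p.1)) -> V y.
  by exists l => // y /lV Vy; apply: QU; exists V.
rewrite -LV in Vx *.
have {}Lsub : forall M, M \in finmap.enum_fset L -> exists p : I * set T, open p.2 /\ M = [set y | p.2 (y p.1)].
  by move=> M /Lsub /set_mem[i _ [W oW <-]]; exists (i, W).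
have {}Vx : forall M, M \in finmap.enum_fset L -> M x by exact: Vx.
suff [l lL lV] : exists2 l : seq (I * set T),
    (forall p, p \in l -> open p.2 /\ p.2 (x p.1)) &
    forall y : I -> T, (forall p, p \in l -> p.2 (y p.1)) ->
      forall M, M \in finmap.enum_fset L -> M y by exists l.
elim: (finmap.enum_fset L) Lsub Vx => [|M s IHs] Lsub Vx; first by exists [::].
have [p [op eM]] := Lsub _ (mem_head _ _).
have [|| l lL lV] := IHs.
- by move=> N Ns; apply: Lsub; rewrite in_cons Ns orbT.
- by move=> N Ns; apply: Vx; rewrite in_cons Ns orbT.
exists (p :: l) => [q|y yl N].
  rewrite in_cons => /predU1P[->|/lL//]; split=> //.
  by have := Vx _ (mem_head _ _); rewrite eM.
rewrite in_cons => /predU1P[->|Ns]; first by rewrite eM /=; apply: yl; exact: mem_head.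
by apply: lV => // q ql; apply: yl; rewrite in_cons ql orbT.
Qed.

End countable_bases.

Section borel_maps.
Context {R : realType}.

Lemma torus_open_measurable (U : set (torus R)) : open U -> measurable U.
Proof. exact: sub_sigma_algebra. Qed.

Lemma bisequence_open_measurable (U : set (bisequence R)) : open U -> measurable U.
Proof. exact: sub_sigma_algebra. Qed.

Lemma torus_measurable_fun d (Z : measurableType d) (f : Z -> torus R) :
  (forall U, open U -> measurable (f @^-1` U)) -> measurable_fun setT f.
Proof.
move=> fo; apply: (measurability (@open (torus R))) => // _ [U oU <-].
by rewrite setTI; exact: fo.
Qed.

Lemma rat_near (c e : R) : 0 < e -> exists q : rat, `|ratr q - c| < e.
Proof.
move=> e0; have ce : c - e < c + e by lra.
have [q] := rat_in_itvoo ce; rewrite in_itv /= => /andP[q1 q2].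
by exists q; rewrite ltr_norml; apply/andP; split; lra.
Qed.

Definition torus_base (i : rat * rat * nat) : set (torus R) :=
  torus_proj @` ball (vec2 (ratr i.1.1) (ratr i.1.2)) (i.2.+1%:R^-1 : R).

Lemma open_torus_base i : open (torus_base i).
Proof. by apply: tproj_open; exact: ball_open. Qed.

Lemma torus_baseP (V : set (torus R)) y : open V -> V y ->
  exists i, torus_base i y /\ torus_base i `<=` V.
Proof.
move=> oV Vy; have [v e] := tproj_surj y.
have : nbhs v (torus_proj @^-1` V).
  by apply: tproj_continuous; rewrite e; exact: open_nbhs_nbhs.
move=> /nbhs_ballP[d /= d0 dV].
have [n nd] : exists n : nat, n.+1%:R^-1 < d / 2 :> R.
  have [n] := @ltr_add_invr R 0 (d / 2) ltac:(by rewrite divr_gt0).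
  by rewrite add0r => ?; exists n.
have n0 : 0 < n.+1%:R^-1 :> R by rewrite invr_gt0.
have near c := rat_near c n0.
have [p hp] := near (v 0 0); have [q hq] := near (v 0 1).
have hb : ball (vec2 (ratr p) (ratr q)) (n.+1%:R^-1) v.
  rewrite -ball_normE /ball_ /=.
  rewrite /Num.norm/= mx_normrE; apply/bigmax_ltP; split=> // -[i j] _ /=.
  rewrite !mxE (ord1 i); case: (unliftP 0 j) => [k ->|->] //=.
  by rewrite (ord1 k) (_ : lift 0 0 = 1) //; exact: val_inj.
exists (p, q, n); split; first by exists v.
move=> _ [w hw <-]; apply: dV; apply: le_ball (ball_triangle (ball_sym hb) hw).
by rewrite [leRHS]splitr lerD // ltW.
Qed.

(** The Borel sets of the product are generated by coordinates because finite cylinders over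
    [torus_base] form a countable base. *)
Lemma bisequence_measurable_fun d (Z : measurableType d) (f : Z -> bisequence R) :
  (forall n, measurable_fun setT (fun z => f z n)) -> measurable_fun setT f.
Proof.
move=> mf; apply: (measurability (@open (bisequence R))) => // _ [U oU <-].
rewrite setTI.
pose b (l : seq (int * (rat * rat * nat))) : set (bisequence R) :=
  [set y | forall p, p \in l -> torus_base p.2 (y p.1)].
apply: (@preimage_open_measurable _ _ _ _ b) oU => [V y oV Vy|l].
  have [l lo lV] := prod_open_cylinder oV Vy.
  suff [l' l'y l'l] : exists2 l' : seq (int * (rat * rat * nat)), b l' y &
      b l' `<=` [set z | forall p, p \in l -> p.2 (z p.1)].
    by exists l'; split=> // z /l'l /lV.
  elim: l {lV} lo => [|p l IHl] lo; first by exists [::].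
  have [op py] := lo _ (mem_head _ _).
  have [q ql|l' l'y l'l] := IHl; first by apply: lo; rewrite in_cons ql orbT.
  have [i [iy iV]] := torus_baseP op py.
  exists ((p.1, i) :: l') => [q|z zl q].
    by rewrite in_cons => /predU1P[->//|]; exact: l'y.
  rewrite in_cons => /predU1P[->|].
    by apply: iV; apply: (zl (p.1, i)); exact: mem_head.
  by apply: l'l => q' q'l; apply: zl; rewrite in_cons q'l orbT.
elim: l => [|p l IHl]; first by rewrite (_ : _ @^-1` _ = setT) //; apply/seteqP; split.
rewrite (_ : _ @^-1` _ = (fun z => f z p.1) @^-1` torus_base p.2 `&` f @^-1` b l).
  apply: measurableI => //; rewrite -[_ @^-1` _]setTI; apply: mf => //.
  by apply: torus_open_measurable; exact: open_torus_base.
apply/seteqP; split=> z.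
  move=> h; split; first by apply: h; exact: mem_head.
  by move=> q ql; apply: h; rewrite in_cons ql orbT.
by move=> [h1 h2] q; rewrite in_cons => /predU1P[->|]//; exact: h2.
Qed.

Lemma bi_coord_continuous (n : int) : continuous (fun x : bisequence R => x n).
Proof. by move=> x; exact: (@proj_continuous int (fun=> torus R) n). Qed.

Lemma continuous_borel_torus (T : topologicalType) (f : T -> torus R) (U : set (torus R)) :
  continuous f -> open U -> open (f @^-1` U).
Proof. by move=> /continuousP; apply. Qed.

Lemma bi_coord_measurable (n : int) : measurable_fun setT (fun x : bisequence R => x n).
Proof.
apply: torus_measurable_fun => U oU; apply: bisequence_open_measurable.
by apply: continuous_borel_torus => //; exact: bi_coord_continuous.
Qed.

(* Opens of the plane are Borel for the product sigma-algebra. *)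
Lemma plane_open_measurable (U : set (measurableTypeR R * measurableTypeR R)) :
  open (U : set (R * R)) -> measurable U.
Proof.
pose b (i : (rat * rat) * (rat * rat)) : set (R * R) :=
  `]ratr i.1.1, ratr i.1.2[%classic `*` `]ratr i.2.1, ratr i.2.2[%classic.
move=> oU; apply: (@preimage_open_measurable _ _ (R * R)%type _ b id U) oU => [V y oV Vy|i].
  have : nbhs y V by exact: open_nbhs_nbhs.
  move=> [[A B] /= [/nbhs_ballP[e1 /= e10 e1A] /nbhs_ballP[e2 /= e20 e2B]] ABV].
  have near (c e : R) : 0 < e -> exists i : rat * rat, `]ratr i.1, ratr i.2[%classic c /\
     `]ratr i.1, ratr i.2[%classic `<=` ball c e.
    move=> e0.
    have cle : c - e < c by lra.
    have cge : c < c + e by lra.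
    have [p] := rat_in_itvoo cle; have [q] := rat_in_itvoo cge.
    rewrite !in_itv /= => /andP[q1 q2] /andP[p1 p2]; exists (p, q); split.
      by rewrite /= in_itv /= p2 q1.
    move=> z; rewrite /= in_itv /= => /andP[z1 z2].
    rewrite /ball /= ltr_norml; apply/andP; split; move: p1 p2 q1 q2 z1 z2; lra.
  have [i [i1 i2]] := near y.1 e1 e10; have [j [j1 j2]] := near y.2 e2 e20.
  exists (i, j); split=> // z [z1 z2]; apply: ABV; split=> /=.
    by apply: e1A; exact: i2.
  by apply: e2B; exact: j2.
by rewrite preimage_id; apply: measurableX; exact: measurable_itv.
Qed.

End borel_maps.

(* The eigenvalues of [amx]. *)
HB.lock Definition lams (R : realType) : R := (5 - Num.sqrt 13) / 2.
HB.lock Definition lamu (R : realType) : R := (5 + Num.sqrt 13) / 2.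

(** * The linear map and its eigenbasis *)

Section linear_map.
Context {R : realType}.
Local Notation ls := (lams R).
Local Notation lu := (lamu R).
Implicit Types (v w : 'rV[R]_2) (x y z : torus R).

Lemma sqrt13_itv : 18 / 5 < (Num.sqrt 13 : R) < 37 / 10.
Proof.
apply/andP; split.
- rewrite -(ltr_pXn2r (n := 2)) ?nnegrE ?sqrtr_ge0 ?divr_ge0 // sqr_sqrtr //; lra.
- rewrite -(ltr_pXn2r (n := 2)) ?nnegrE ?sqrtr_ge0 ?divr_ge0 // sqr_sqrtr //; lra.
Qed.

Lemma ls_add_lu : ls + lu = 5 :> R.
Proof. rewrite lams.unlock lamu.unlock; lra. Qed.

Lemma ls_mul_lu : ls * lu = 3 :> R.
Proof.
have : (Num.sqrt 13 : R) ^+ 2 = 13 by rewrite sqr_sqrtr.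
by rewrite lams.unlock lamu.unlock expr2; lra.
Qed.

Lemma ls_itv : 3/5 < (ls : R) < 7/10.
Proof. by have := sqrt13_itv; rewrite lams.unlock; lra. Qed.

Lemma lu_itv : 43/10 < (lu : R) < 22/5.
Proof. by have := sqrt13_itv; rewrite lamu.unlock; lra. Qed.

Lemma ls_gt0 : 0 < ls :> R. Proof. have := ls_itv; lra. Qed.
Lemma lu_gt0 : 0 < lu :> R. Proof. have := lu_itv; lra. Qed.
Lemma ls_lt1 : ls < 1 :> R. Proof. have := ls_itv; lra. Qed.
Lemma lu_gt1 : 1 < lu :> R. Proof. have := lu_itv; lra. Qed.
Lemma ls_neq0 : ls != 0 :> R. Proof. by rewrite gt_eqF // ls_gt0. Qed.
Lemma lu_neq0 : lu != 0 :> R. Proof. by rewrite gt_eqF // lu_gt0. Qed.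

(* The vector with coordinates [s], [u] in the eigenbasis (1, ls - 1),
   (1, lu - 1). *)
Definition svec (s u : R) : 'rV[R]_2 := vec2 (s + u) ((ls - 1) * s + (lu - 1) * u).

Definition scoord v : R := ((lu - 1) * v 0 0 - v 0 1) / (lu - ls).
Definition ucoord v : R := (v 0 1 - (ls - 1) * v 0 0) / (lu - ls).

Lemma lu_sub_ls_neq0 : lu - ls != 0 :> R.
Proof. by rewrite gt_eqF //; move: ls_itv lu_itv; lra. Qed.

Lemma svecK v : svec (scoord v) (ucoord v) = v.
Proof.
have := lu_sub_ls_neq0; rewrite /scoord /ucoord => h.
by apply: row2P; rewrite !mxE /=; field.
Qed.

Lemma scoord_svec s u : scoord (svec s u) = s.
Proof. by rewrite /scoord !mxE /=; field; exact: lu_sub_ls_neq0. Qed.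

Lemma ucoord_svec s u : ucoord (svec s u) = u.
Proof. by rewrite /ucoord !mxE /=; field; exact: lu_sub_ls_neq0. Qed.

Lemma svec_inj s u s' u' : svec s u = svec s' u' -> s = s' /\ u = u'.
Proof. by move=> e; rewrite -(scoord_svec s u) -{2}(ucoord_svec s u) e scoord_svec ucoord_svec. Qed.

Lemma svecD s u s' u' : svec s u + svec s' u' = svec (s + s') (u + u').
Proof. by apply: row2P; rewrite !mxE /=; ring. Qed.

Lemma svecN s u : - svec s u = svec (- s) (- u).
Proof. by apply: row2P; rewrite !mxE /=; ring. Qed.

Lemma svecZ c s u : c *: svec s u = svec (c * s) (c * u).
Proof. by apply: row2P; rewrite !mxE /=; ring. Qed.

Lemma svec0 : svec 0 0 = 0.
Proof. by apply: row2P; rewrite !mxE /=; ring. Qed.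

Lemma svecE v : exists s u, v = svec s u.
Proof. by exists (scoord v), (ucoord v); rewrite svecK. Qed.

(* The eigenvectors are orthogonal. *)
Lemma enorm_svec s u : enorm (svec s u) ^+ 2 =
  (1 + (ls - 1) ^+ 2) * s ^+ 2 + (1 + (lu - 1) ^+ 2) * u ^+ 2.
Proof.
rewrite enorm_sqr !mxE /=.
have h : lu = 5 - ls by move: ls_add_lu; lra.
have : ls * lu = 3 by exact: ls_mul_lu.
rewrite h => e.
apply/eqP; rewrite -subr_eq0; apply/eqP.
transitivity (2 * s * u * (5 - (ls * (5 - ls)) - 2 + ls * (5 - ls) * 2 - 6)); last by rewrite e; ring.
transitivity (2 * s * u * (1 + (ls - 1) * (5 - ls - 1))); first by ring.
by rewrite (_ : 1 + _ = ls * (5 - ls) - 3); [rewrite e; ring|ring].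
Qed.

Definition amx : 'M[R]_2 :=
  \matrix_(i, j) (if (i == 1) && (j == 1) then 4 else 1).
Definition bmx : 'M[R]_2 :=
  \matrix_(i, j) (if (i == 0) && (j == 0) then 4 / 3 else if i == j then 1 / 3 else - (1 / 3)).

Lemma mul_amx v : v *m amx = vec2 (v 0 0 + v 0 1) (v 0 0 + 4 * v 0 1).
Proof.
apply: row2P; rewrite !mxE /= big_ord_recl big_ord1 (_ : lift _ _ = 1) ?mxE /=;
  by [exact: val_inj|ring].
Qed.

Lemma mul_bmx v : v *m bmx =
  vec2 (4 / 3 * v 0 0 - 1 / 3 * v 0 1) (- (1 / 3) * v 0 0 + 1 / 3 * v 0 1).
Proof.
apply: row2P; rewrite !mxE /= big_ord_recl big_ord1 (_ : lift _ _ = 1) ?mxE /=;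
  by [exact: val_inj|ring].
Qed.

Lemma mulABK v : v *m amx *m bmx = v.
Proof. by rewrite mul_amx mul_bmx; apply: row2P; rewrite !mxE /=; field. Qed.

Lemma mulBAK v : v *m bmx *m amx = v.
Proof. by rewrite mul_bmx mul_amx; apply: row2P; rewrite !mxE /=; field. Qed.

Lemma row_mx_ext (L M : 'M[R]_2) : (forall v, v *m L = v *m M) -> L = M.
Proof. by move=> h; apply/row_matrixP => i; rewrite !rowE h. Qed.

Lemma amx_bmx : amx *m bmx = 1%:M.
Proof. by apply: row_mx_ext => v; rewrite mulmxA mulABK mulmx1. Qed.

Lemma bmx_amx : bmx *m amx = 1%:M.
Proof. by apply: row_mx_ext => v; rewrite mulmxA mulBAK mulmx1. Qed.

Lemma svec_amx s u : svec s u *m amx = svec (ls * s) (lu * u).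
Proof.
rewrite mul_amx; apply: row2P; rewrite !mxE /=; first by ring.
have es : ls * ls = 5 * ls - 3 by rewrite -ls_mul_lu -ls_add_lu; ring.
have eu : lu * lu = 5 * lu - 3 by rewrite -ls_mul_lu -ls_add_lu; ring.
transitivity ((ls * ls - ls) * s + (lu * lu - lu) * u); last by ring.
by rewrite es eu; ring.
Qed.

Lemma svec_bmx s u : svec s u *m bmx = svec (ls^-1 * s) (lu^-1 * u).
Proof.
have e : svec s u = svec (ls^-1 * s) (lu^-1 * u) *m amx.
  by rewrite svec_amx !mulrA !divff ?ls_neq0 ?lu_neq0 // !mul1r.
by rewrite e mulABK.
Qed.

Lemma svec_amxX n s u : svec s u *m amx ^+ n = svec (ls ^+ n * s) (lu ^+ n * u).
Proof.
elim: n s u => [|n IHn] s u; first by rewrite !expr0 mulmx1 !mul1r.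
by rewrite exprS -mulmxE mulmxA svec_amx IHn !exprSr !mulrA.
Qed.

(* A matrix diagonal in the eigenbasis. *)
Lemma opnorm_diag (L : 'M[R]_2) (p q : R) :
  (forall s u, svec s u *m L = svec (p * s) (q * u)) ->
  opnorm L = Num.max `|p| `|q|.
Proof.
move=> LE; set a := Num.max _ _.
have a0 : 0 <= a by rewrite le_max normr_ge0.
have c0 (l : R) : 0 <= 1 + (l - 1) ^+ 2 by rewrite addr_ge0 // sqr_ge0.
have ub v : enorm (v *m L) <= a * enorm v.
  have [s [u ->]] := svecE v; rewrite LE.
  rewrite -(ler_pXn2r (n := 2)) // ?nnegrE ?mulr_ge0 ?enorm_ge0 //.
  rewrite exprMn !enorm_svec mulrDr !exprMn.
  have hp : p ^+ 2 <= a ^+ 2 by rewrite -(real_normK (num_real p)) lerXn2r ?nnegrE // le_max lexx.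
  have hq : q ^+ 2 <= a ^+ 2 by rewrite -(real_normK (num_real q)) lerXn2r ?nnegrE // le_max lexx orbT.
  by rewrite lerD // mulrCA ler_wpM2r // mulr_ge0 ?c0 ?sqr_ge0.
have att s u : enorm (svec s u) != 0 -> enorm (svec (p * s) (q * u)) = a * enorm (svec s u) ->
    opnorm L = a.
  move=> n0 e; apply/eqP; rewrite eq_le; apply/andP; split.
    apply: sup_le_ub.
      exists (enorm ((enorm (svec s u))^-1 *: svec s u *m L)), ((enorm (svec s u))^-1 *: svec s u) => //=.
      by rewrite enormZ ger0_norm ?invr_ge0 ?enorm_ge0 // mulVf.
    by move=> _ [v /= v1 <-]; rewrite (le_trans (ub _)) // v1 mulr1.
  apply: ub_le_sup.
    by exists a => _ [v /= v1 <-]; rewrite (le_trans (ub _)) // v1 mulr1.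
  exists ((enorm (svec s u))^-1 *: svec s u) => /=.
    by rewrite enormZ ger0_norm ?invr_ge0 ?enorm_ge0 // mulVf.
  by rewrite -scalemxAl LE enormZ e ger0_norm ?invr_ge0 ?enorm_ge0 // mulrCA mulVf // mulr1.
have nz s u : svec s u != 0 -> enorm (svec s u) != 0 by rewrite enorm_eq0.
have [pq|/ltW qp] := leP `|p| `|q|.
  apply: (att 0 1).
    by apply: nz; apply/eqP; rewrite -svec0 => /svec_inj[_ /eqP]; rewrite oner_eq0.
  rewrite (_ : svec _ _ = q *: svec 0 1) ?enormZ; last by rewrite svecZ !mulr0.
  by congr (_ * _); rewrite /a; apply/esym/max_r.
apply: (att 1 0).
  by apply: nz; apply/eqP; rewrite -svec0 => /svec_inj[/eqP]; rewrite oner_eq0.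
rewrite (_ : svec _ _ = p *: svec 1 0) ?enormZ; last by rewrite svecZ !mulr0.
by congr (_ * _); rewrite /a; apply/esym/max_l.
Qed.

Lemma opdistxx (L : 'M[R]_2) : opdist L L = 0.
Proof.
rewrite /opdist subrr (@opnorm_diag 0 0 0) ?normr0 ?maxxx // => s u.
by rewrite mulmx0 !mul0r svec0.
Qed.

Lemma enorm_amx_le v : enorm (v *m amx) <= 5 * enorm v.
Proof.
have [s [u ->]] := svecE v; rewrite svec_amx.
rewrite -(ler_pXn2r (n := 2)) // ?nnegrE ?mulr_ge0 ?enorm_ge0 //.
rewrite exprMn !enorm_svec mulrDr !exprMn.
have c0 (l : R) : 0 <= 1 + (l - 1) ^+ 2 by rewrite addr_ge0 // sqr_ge0.
have le5 (l : R) : 0 < l -> l <= 5 -> l ^+ 2 <= 5 ^+ 2.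
  by move=> l0 l5; rewrite lerXn2r ?nnegrE // ltW.
rewrite lerD // mulrCA ler_wpM2r ?(mulr_ge0 (c0 _) (sqr_ge0 _)) // le5 ?ls_gt0 ?lu_gt0 //.
- by have := ls_itv; lra.
- by have := lu_itv; lra.
Qed.

Lemma enorm_bmx_le v : enorm (v *m bmx) <= 2 * enorm v.
Proof.
have [s [u ->]] := svecE v; rewrite svec_bmx.
rewrite -(ler_pXn2r (n := 2)) // ?nnegrE ?mulr_ge0 ?enorm_ge0 //.
rewrite exprMn !enorm_svec mulrDr !exprMn.
have c0 (l : R) : 0 <= 1 + (l - 1) ^+ 2 by rewrite addr_ge0 // sqr_ge0.
have inv2 (l : R) : 1 / 2 < l -> (l^-1) ^+ 2 <= 2 ^+ 2.
  move=> l2; have l0 : 0 < l by lra.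
  rewrite lerXn2r ?nnegrE ?invr_ge0 ?ltW // -[X in _ < X]invrK ltf_pV2 ?posrE ?invr_gt0 //.
  by move: l2; rewrite div1r.
by rewrite lerD // mulrCA ler_wpM2r ?(mulr_ge0 (c0 _) (sqr_ge0 _)) // inv2 //; move: ls_itv lu_itv; lra.
Qed.

Definition tmap x : torus R := torus_proj (repr x *m amx).

Lemma tmap_proj v : tmap (torus_proj v) = torus_proj (v *m amx).
Proof.
have /tproj_eqP[a [b e]] := tproj_repr (torus_proj v).
apply/tproj_eqP; exists (a + b), (a + 4 * b); rewrite e mulmxDl; congr (_ + _).
by rewrite mul_amx; apply: row2P; rewrite !mxE /= !intrD ?intrM.
Qed.

Lemma tmapD x y : tmap (x + y) = tmap x + tmap y.
Proof.
have [v <-] := tproj_surj x; have [w <-] := tproj_surj y.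
by rewrite -tprojD !tmap_proj mulmxDl tprojD.
Qed.

Lemma iter_tmap_proj n v : iter n tmap (torus_proj v) = torus_proj (v *m amx ^+ n).
Proof.
elim: n => [|n IHn]; first by rewrite expr0 mulmx1.
by rewrite iterS IHn tmap_proj exprSr -mulmxE mulmxA.
Qed.

Lemma iter_tmapD n x y : iter n tmap (x + y) = iter n tmap x + iter n tmap y.
Proof. by elim: n => // n IHn; rewrite !iterS IHn tmapD. Qed.

Lemma tmap_continuous : continuous tmap.
Proof.
move=> x U /nbhs_torusP[d d0 dU]; apply/nbhs_torusP; exists (d / 5) => [|h hd].
  by rewrite divr_gt0.
rewrite /= tmapD tmap_proj; apply: dU; apply: le_lt_trans (enorm_amx_le _) _; lra.
Qed.

End linear_map.
Arguments tmap {R} x.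

(** * Derivatives, local inverses and Lyapunov exponents *)

Section jacobians.
Context {R : realType}.
Local Notation ls := (lams R).
Local Notation lu := (lamu R).
Local Notation amx := (@amx R).
Local Notation bmx := (@bmx R).
Implicit Types (v w : 'rV[R]_2) (x y z : torus R) (L M : 'M[R]_2).

Lemma tdistxx x : tdist x x = 0.
Proof.
apply/eqP; rewrite eq_le tdist_ge0 andbT -(@enorm0 R).
by apply: tdist_le; rewrite tproj0 subrr.
Qed.

Lemma affine_has_jacobian (f : torus R -> torus R) x L (d : R) : 0 < d ->
  (forall h, enorm h < d -> f (x + torus_proj h) = f x + torus_proj (h *m L)) ->
  has_jacobian f x L.
Proof.
move=> d0 fL e e0; apply/(@enorm_nbhs0 R); exists d => // h hd.
by rewrite !add0r tproj0 addr0 fL // tdistxx mulr_ge0 // ltW.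
Qed.

Lemma mulmx_small L (e : R) : 0 < e ->
  exists2 d, 0 < d & forall h, enorm h < d -> enorm (h *m L) < e.
Proof.
move=> e0; pose K := 1 + \sum_i \sum_j `|L i j|.
have K0 : 0 < K by rewrite ltr_pwDl // sumr_ge0 // => i _; rewrite sumr_ge0.
have bd h i : `|(h *m L) 0 i| <= K * enorm h.
  rewrite mxE (le_trans (ler_norm_sum _ _ _)) //.
  apply: (@le_trans _ _ ((\sum_j `|L j i|) * enorm h)).
    rewrite mulr_suml ler_sum // => j _; rewrite normrM mulrC.
    by rewrite ler_wpM2l // enorm_coord.
  rewrite ler_wpM2r ?enorm_ge0 // ler_wpDl // ler_sum // => j _.
  by rewrite (bigD1 i) //= lerDl sumr_ge0.
exists (e / (2 * K)) => [|h]; first by rewrite divr_gt0 // mulr_gt0.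
rewrite ltr_pdivlMr ?mulr_gt0 // => hd.
apply: (le_lt_trans (enorm_le_coord (bd h 0) (bd h 1))).
by rewrite mulrA mulrC.
Qed.

(** [jac] is a choice, so computing it requires uniqueness. Two candidates send a short multiple t k
    of a vector to points of the torus that agree up to a small multiple of t; once the vectors have
    norm below 1/2, [tproj_inj_small] lifts the agreement to the plane, where dividing by t leaves
    an arbitrarily small bound. *)
Lemma has_jacobian_unique (f : torus R -> torus R) x L M :
  has_jacobian f x L -> has_jacobian f x M -> L = M.
Proof.
move=> fL fM; apply: row_mx_ext => k; apply: subr0_eq; rewrite -mulmxBr.
apply/eqP; rewrite -enorm_eq0 eq_le enorm_ge0 andbT.
apply/ler_addgt0Pr => e e0; rewrite add0r.
pose c := e / (4 * (1 + enorm k)).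
have k0 : 0 < 1 + enorm k by rewrite ltr_pwDl // enorm_ge0.
have c0 : 0 < c by rewrite divr_gt0 // mulr_gt0.
have /(@enorm_nbhs0 R)[d1 d10 fL1] := fL c c0.
have /(@enorm_nbhs0 R)[d2 d20 fM2] := fM c c0.
have [d3 d30 L3] := @mulmx_small L (1/8) ltac:(by rewrite divr_gt0).
have [d4 d40 M4] := @mulmx_small M (1/8) ltac:(by rewrite divr_gt0).
(* The last bound keeps the error [r] below 1/4 + 1/8; with the linear parts below 1/8, all vectors
   compared stay below 1/2. *)
pose q := Num.min (Num.min (Num.min d1 d2) (Num.min d3 d4)) (1 / (8 * c)).
have q0 : 0 < q by rewrite !lt_min d10 d20 d30 d40 divr_gt0 // mulr_gt0.
pose t := q / (2 * (1 + enorm k)).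
have t0 : 0 < t by rewrite divr_gt0 // mulr_gt0.
have tk : enorm (t *: k) < q.
  rewrite enormZ gtr0_norm // /t -mulrA gtr_pMr //.
  rewrite ltr_pdivrMl ?mulr_gt0 // mulr1; have := enorm_ge0 k; lra.
move: (tk); rewrite !lt_min => /andP[/andP[/andP[h1 h2] /andP[h3 h4]] h5].
have := fL1 _ h1; have := fM2 _ h2; rewrite !add0r tproj0 addr0.
set y := f _; set z := f _ => yM yL.
pose r := 2 * c * t * (1 + enorm k).
have r0 : 0 < r by rewrite /r mulr_gt0 // mulr_gt0 // mulr_gt0.
have nk : c * `|t *: k| < r.
  apply: (@le_lt_trans _ _ (c * (t * enorm k))).
    by rewrite ler_pM2l // (le_trans (mx_norm_le_enorm _)) // enormZ gtr0_norm.
  have ct : 0 < c * t by rewrite mulr_gt0.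
  have ctk : 0 <= c * t * enorm k by exact: mulr_ge0 (ltW ct) (enorm_ge0 k).
  by rewrite /r -subr_gt0 (_ : _ - _ = c * t + (c * t + c * t * enorm k)); [lra|ring].
have r4 : r < 1 / 4 + 1 / 8.
  have : t * (1 + enorm k) <= 1 / (8 * c) / 2.
    rewrite (_ : t * _ = q / 2); last by rewrite /t; field; rewrite gt_eqF.
    by rewrite ler_pM2r ?invr_gt0 // ge_min lexx orbT.
  move=> h; have c2 : 0 < 2 * c by rewrite mulr_gt0.
  move: h; rewrite -(ler_pM2l c2).
  have -> : 2 * c * (1 / (8 * c) / 2) = 1 / 8 by field; rewrite gt_eqF.
  by rewrite /r -!mulrA; lra.
have /tdist_ltP[w1 w1r e1] := le_lt_trans yL nk.
have /tdist_ltP[w2 w2r e2] := le_lt_trans yM nk.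
have {e1 e2} E : torus_proj (t *: k *m L + w1) = torus_proj (t *: k *m M + w2).
  by rewrite !tprojD; apply: (addrI z); rewrite !addrA -e1 -e2.
have {}E : t *: k *m L + w1 = t *: k *m M + w2.
  apply: tproj_inj_small E; apply: le_lt_trans (enormD _ _) _.
    by have := L3 _ h3; move: w1r r4; lra.
  by have := M4 _ h4; move: w2r r4; lra.
have D : t *: k *m (L - M) = w2 - w1.
  by rewrite mulmxBr -[X in X - _](addrK w1) E; apply: row2P; rewrite !mxE; ring.
have : t * enorm (k *m (L - M)) <= 2 * r.
  rewrite -[X in X * _]gtr0_norm // -enormZ scalemxAl D.
  by apply: le_trans (enormD _ _) _; rewrite enormN; lra.
rewrite /r (_ : 2 * _ = t * (4 * c * (1 + enorm k))); last by ring.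
rewrite ler_pM2l // => /le_trans; apply.
by rewrite /c (_ : 4 * _ * _ = e) //; field; rewrite gt_eqF.
Qed.

Lemma jacE (f : torus R -> torus R) x L : has_jacobian f x L -> jac f x = L.
Proof.
move=> fL; apply: (has_jacobian_unique _ fL).
have nemp : [set L | has_jacobian f x L] !=set0 by exists L.
exact: (getPex nemp).
Qed.

Lemma affine_C1alpha (U : set (torus R)) (f : torus R -> torus R) L : open U ->
  (forall x, U x -> exists2 d, 0 < d &
    forall h, enorm h < d -> f (x + torus_proj h) = f x + torus_proj (h *m L)) ->
  C1alpha_on (1 : R) U f.
Proof.
move=> oU fL; have fj x : U x -> has_jacobian f x L.
  by move=> /fL[d d0]; exact: affine_has_jacobian.
have jE x : U x -> jac f x = L by move=> /fj /jacE.
split=> [x Ux|x Ux]; first by rewrite jE //; exact: fj.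
exists setT; first exact: filterT.
by exists 0 => y z [Uy _] [Uz _]; rewrite !jE // opdistxx mul0r.
Qed.

Lemma iter_tmap_has_jacobian n x : has_jacobian (iter n tmap) x (amx ^+ n).
Proof.
apply: (@affine_has_jacobian _ _ _ 1) => // h _.
by rewrite iter_tmapD iter_tmap_proj.
Qed.

Lemma jac_iter_tmap n x : jac (iter n tmap) x = amx ^+ n.
Proof. by apply: jacE; exact: iter_tmap_has_jacobian. Qed.

Definition tball x (r : R) : set (torus R) :=
  [set x + torus_proj h | h in [set h | enorm h < r]].

Lemma open_tball x r : open (tball x r).
Proof.
rewrite openE => _ [h /= hr <-]; apply/nbhs_torusP; exists (r - enorm h).
  by rewrite subr_gt0.
move=> k kr; exists (h + k) => /=; last by rewrite tprojD addrA.
by apply: le_lt_trans (enormD _ _) _; rewrite -ltrBrDl.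
Qed.

Lemma tball_center x (r : R) : 0 < r -> tball x r x.
Proof. by move=> r0; exists 0; rewrite /= ?enorm0 // tproj0 addr0. Qed.

Lemma tmap_open (U : set (torus R)) : open U -> open (tmap @` U).
Proof.
rewrite !openE => oU _ [x Ux <-]; have /nbhs_torusP[d d0 dU] := oU _ Ux.
apply/nbhs_torusP; exists (d / 2) => [|h hd]; first by rewrite divr_gt0.
exists (x + torus_proj (h *m bmx)); last by rewrite tmapD tmap_proj mulBAK.
by apply: dU; apply: le_lt_trans (enorm_bmx_le _) _; lra.
Qed.

Definition tsmall z : 'rV[R]_2 := get [set v | enorm v < 1 / 2 /\ torus_proj v = z].

Lemma tsmall_proj v : enorm v < 1 / 2 -> tsmall (torus_proj v) = v.
Proof.
move=> hv; have nemp : [set w | enorm w < 1 / 2 /\ torus_proj w = torus_proj v] !=set0 by exists v.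
by have [h e] := getPex nemp; exact: tproj_inj_small e.
Qed.

(** The matrix stretches by at most 5, so a ball of radius 1/10 has its image within radius 1/2,
    where [tsmall] provides a local inverse. Both maps are locally affine, so their derivatives are
    constant and any Hölder exponent will do; 1 is taken. *)
Lemma tmap_End1plus : End1plus (@tmap R).
Proof.
exists 1 => // x; exists (tball x (1/10)).
  by split; [exact: open_tball|apply: tball_center; rewrite divr_gt0].
have oU := @open_tball x (1 / 10).
split; first exact: tmap_open.
  apply: (@affine_C1alpha _ _ amx) => // y _; exists 1 => // h _.
  by rewrite tmapD tmap_proj.
pose h y := x + torus_proj (tsmall (y - tmap x) *m bmx).
have hE w : enorm w < 1 / 2 -> h (tmap x + torus_proj w) = x + torus_proj (w *m bmx).
  by move=> w2; rewrite /h addrAC subrr add0r tsmall_proj.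
have sm v : enorm v < 1 / 10 -> enorm (v *m amx) < 1 / 2.
  by move=> v1; apply: le_lt_trans (enorm_amx_le _) _; lra.
exists h.
  move=> y; rewrite inE => -[v /= v1 <-].
  by rewrite tmapD tmap_proj hE ?mulABK // sm.
apply: (@affine_C1alpha _ _ bmx) => [|_ [y [v /= v1 <-] <-]]; first exact: tmap_open.
exists (1 / 2 - enorm (v *m amx)) => [|k kd]; first by rewrite subr_gt0 sm.
rewrite tmapD tmap_proj -addrA -tprojD !hE ?sm //.
  by rewrite mulmxDl tprojD addrA.
by apply: le_lt_trans (enormD _ _) _; rewrite -ltrBrDl.
Qed.

Lemma growth_plus_tmap x n : (0 < n)%N -> growth_plus tmap x n = ln lu.
Proof.
move=> n0; have [l0 u0] := (@ls_gt0 R, @lu_gt0 R).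
rewrite /growth_plus jac_iter_tmap (opnorm_diag (svec_amxX n)).
have lsu : ls ^+ n <= lu ^+ n.
  by apply: lerXn2r; rewrite ?nnegrE; move: (@ls_itv R) (@lu_itv R); lra.
rewrite (gtr0_norm (exprn_gt0 n l0)) (gtr0_norm (exprn_gt0 n u0)) (max_r lsu) lnXn // -(mulr_natl (ln lu)).
by rewrite mulrC mulKf // pnatr_eq0 -lt0n.
Qed.

Lemma svec_invmx_amxX n s u : svec s u *m invmx (amx ^+ n) = svec (ls ^- n * s) (lu ^- n * u).
Proof.
have E : bmx ^+ n *m amx ^+ n = 1%:M.
  elim: n => [|n IHn]; first by rewrite !expr0 mulmx1.
  by rewrite exprS exprSr !mulmxE -mulrA (mulrA (bmx ^+ n)) -!mulmxE IHn mul1mx bmx_amx.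
have -> : svec s u = svec (ls ^- n * s) (lu ^- n * u) *m amx ^+ n.
  by rewrite svec_amxX !mulrA !divff ?expf_neq0 ?ls_neq0 ?lu_neq0 // !mul1r.
have [_ un] := mulmx1_unit E.
by rewrite -mulmxA mulmxV // mulmx1.
Qed.

Lemma growth_minus_tmap x n : (0 < n)%N -> growth_minus tmap x n = ln ls.
Proof.
move=> n0; have [l0 u0] := (@ls_gt0 R, @lu_gt0 R).
rewrite /growth_minus jac_iter_tmap (opnorm_diag (svec_invmx_amxX n)).
have lsu : lu ^- n <= ls ^- n.
  rewrite lef_pV2 ?posrE ?exprn_gt0 //; apply: lerXn2r; rewrite ?nnegrE; move: (@ls_itv R) (@lu_itv R); lra.
rewrite !gtr0_norm ?invr_gt0 ?exprn_gt0 // (max_l lsu) invrK lnXn // -(mulr_natl (ln ls)).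
by rewrite mulrC mulKf // pnatr_eq0 -lt0n.
Qed.

Lemma tmap_hyperbolic mu : hyperbolic (@tmap R) mu.
Proof.
have [l0 u1] := (@ls_gt0 R, @lu_gt1 R).
apply: aeW => x.
have cp : growth_plus tmap x @ \oo --> ln lu.
  apply: cvg_near_cst; near=> n; apply: growth_plus_tmap; near: n; exact: nbhs_infty_gt.
have cm : growth_minus tmap x @ \oo --> ln ls.
  apply: cvg_near_cst; near=> n; apply: growth_minus_tmap; near: n; exact: nbhs_infty_gt.
split; [by apply/cvg_ex; exists (ln lu)|by apply/cvg_ex; exists (ln ls)| |].
- by rewrite /chi_minus (cvg_lim _ cm) // ln_lt0 // l0 ls_lt1.
- by rewrite /chi_plus (cvg_lim _ cp) // ln_gt0.
Unshelve. all: by end_near.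
Qed.

End jacobians.

(* [wt eps t] is three times the probability of choosing a preimage whose first
   coordinate is [t]. *)
Definition wt {R : realType} (eps t : R) : R := 1 + eps * cos (2 * pi * t).

(** * Sums of cosines over thirds of a turn *)

Section trigonometry.
Context {R : realType}.

Lemma derive_le_incr (f df : R -> R) (a b : R) : a <= b ->
  (forall x : R, is_derive x 1 f (df x)) -> (forall x, a <= x <= b -> 0 <= df x) ->
  f a <= f b.
Proof.
move=> ab fd df0.
have fc : {within `[a, b], continuous f}.
  apply: continuous_subspaceT => x.
  by apply: differentiable_continuous; apply/derivable1_diffP; exact: ex_derive.
have [c] := @MVT_segment R f df a b ab (fun x _ => fd x) fc.
rewrite in_itv /= => /df0 c0 e; rewrite -subr_ge0 e mulr_ge0 // subr_ge0 //.
Qed.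

(** Both t - cos t and t + cos t are nondecreasing. *)
Lemma cos_lip (x y : R) : `|cos x - cos y| <= `|x - y|.
Proof.
wlog xy : x y / x <= y.
  move=> h; have [/h//|/ltW /h] := leP x y.
  by rewrite distrC (distrC y).
have d1 (z : R) : is_derive z 1 (fun t : R => t - cos t) (1 + sin z).
  by apply: is_derive_eq; rewrite opprK.
have d2 (z : R) : is_derive z 1 (fun t : R => t + cos t) (1 - sin z) by apply: is_derive_eq.
have s1 z : `|sin z| <= 1 :> R by exact: sin_max.
have h1 : x - cos x <= y - cos y.
  by apply: derive_le_incr d1 _ => // z _; move: (s1 z); rewrite ler_norml; lra.
have h2 : x + cos x <= y + cos y.
  by apply: derive_le_incr d2 _ => // z _; move: (s1 z); rewrite ler_norml; lra.
by rewrite (ler0_norm (x := x - y)) ?ler_norml; [apply/andP; split; lra|lra].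
Qed.

Lemma cosD2pi_int (x : R) (k : int) : cos (x + 2 * pi * k%:~R) = cos x.
Proof.
have h n (y : R) : cos (y + 2 * pi * n%:R) = cos y.
  elim: n y => [|n IHn] y; first by rewrite mulr0 addr0.
  rewrite -(IHn y) -(cosD2pi (y + 2 * pi * n%:R)) -natr1.
  by congr cos; rewrite -mulr_natl; ring.
case: k => n; first exact: h.
rewrite -(h n.+1 (x + _)) NegzE mulrNz; congr cos; ring.
Qed.

(** This cancellation is what makes the three branch probabilities sum to 1. From cos 3d = 1 and sin
    3d = 0, cos d is a root of (c - 1)(2c + 1) other than 1, hence -1/2. *)
Lemma sum3_cos (x : R) : cos x + cos (x + 2 * pi / 3) + cos (x + 2 * (2 * pi / 3)) = 0.
Proof.
set d := 2 * pi / 3.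
have e3 : cos (3 * d) = 1.
  by rewrite (_ : 3 * d = 0 + 2 * pi * 1%:~R) ?cosD2pi_int ?cos0 // /d; field.
have s3 : sin (3 * d) = 0.
  have := cos2Dsin2 (3 * d); rewrite e3 expr1n => /eqP; rewrite -subr_eq0.
  by rewrite addrAC subrr add0r sqrf_eq0 => /eqP.
have E : (cos d - 1) * (2 * cos d + 1) = 0.
  have c2 : cos (2 * d) = 2 * cos d ^+ 2 - 1.
    by rewrite (_ : 2 * d = d + d) ?cosD -?expr2; [have := cos2Dsin2 d; lra|ring].
  have : cos (3 * d - d) = cos (2 * d) by congr cos; ring.
  by rewrite cosB e3 s3 c2; lra.
have c1 : cos d != 1.
  apply/eqP => cd.
  have pi0 : 0 < pi :> R := pi_gt0 R.
  have : cos d < cos 0.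
    by rewrite ltr_cos // ?in_itv /= /d; [|apply/andP; split|apply/andP; split]; lra.
  by rewrite cd cos0 ltxx.
have {E} c12 : cos d = - (1 / 2).
  move/eqP: E; rewrite mulf_eq0 subr_eq0 (negbTE c1) /= => /eqP; lra.
have c2 : cos (2 * d) = - (1 / 2).
  rewrite (_ : 2 * d = d + d); last by ring.
  rewrite cosD -!expr2; have := cos2Dsin2 d; rewrite c12; lra.
have s2 : sin (2 * d) = - sin d.
  rewrite (_ : 2 * d = 3 * d - d); last by ring.
  by rewrite sinB e3 s3; ring.
by rewrite !cosD c12 c2 s2; lra.
Qed.

(** Doubling the angles permutes the thirds of a turn. The positive value separates the two
    measures: the three cosines never vanish together, and it quantifies the entropy gap. *)
Lemma sum3_cos2 (x : R) :
  cos x ^+ 2 + cos (x + 2 * pi / 3) ^+ 2 + cos (x + 2 * (2 * pi / 3)) ^+ 2 = 3 / 2.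
Proof.
have dbl (y : R) : cos y ^+ 2 = (1 + cos (y + y)) / 2.
  by rewrite cosD -!expr2; have := cos2Dsin2 y; lra.
rewrite !dbl; have := sum3_cos (x + x).
rewrite (_ : cos (x + 2 * pi / 3 + _) = cos (x + x + 2 * (2 * pi / 3))); last first.
  by congr cos; ring.
rewrite (_ : cos (x + 2 * (2 * pi / 3) + _) = cos (x + x + 2 * pi / 3)); last first.
  by rewrite -(cosD2pi_int (x + x + 2 * pi / 3) 1); congr cos; field.
lra.
Qed.

End trigonometry.

(** * Explicit primitives of the finite Riesz products *)

Section primitive.
Context {R : realType} (eps : R).
Hypothesis eps_itv : 0 <= eps <= 1 / 2.
Local Notation ls := (lams R).
Local Notation lu := (lamu R).
Local Notation wt := (wt eps).

Lemma wt_itv t : 1 / 2 <= wt t <= 3 / 2.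
Proof.
have /andP[eps_ge0 eps_le] := eps_itv.
have : `|eps * cos (2 * pi * t)| <= 1 / 2.
  rewrite normrM ger0_norm // -[leRHS]mulr1 ler_pM //; exact: cos_max.
by rewrite ler_norml /wt; lra.
Qed.

Lemma wt_gt0 t : 0 < wt t.
Proof. by have := wt_itv t; lra. Qed.

Lemma wtD_int t (k : int) : wt (t + k%:~R) = wt t.
Proof. by rewrite /wt mulrDr cosD2pi_int. Qed.

Lemma wt_lip t t' : `|wt t - wt t'| <= 4 * `|t - t'|.
Proof.
have /andP[eps_ge0 eps_le] := eps_itv.
rewrite /wt (_ : _ - _ = eps * (cos (2 * pi * t) - cos (2 * pi * t'))); last by ring.
rewrite normrM ger0_norm //.
have h : `|cos (2 * pi * t) - cos (2 * pi * t')| <= 8 * `|t - t'|.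
  apply: le_trans (cos_lip _ _) _; rewrite -mulrBr normrM ler_wpM2r //.
  by rewrite ger0_norm ?mulr_ge0 ?pi_ge0 //; have := pihalf_02 R; lra.
have := ler_pM eps_ge0 (normr_ge0 _) eps_le h; lra.
Qed.

Lemma sum3_wt t : wt t + wt (t + 1 / 3) + wt (t + 2 / 3) = 3.
Proof.
rewrite /wt; have := sum3_cos (2 * pi * t).
rewrite (_ : 2 * pi * (t + 1 / 3) = 2 * pi * t + 2 * pi / 3); last by ring.
rewrite (_ : 2 * pi * (t + 2 / 3) = 2 * pi * t + 2 * (2 * pi / 3)); last by ring.
by move/(congr1 ( *%R eps)); rewrite mulr0; lra.
Qed.

(* The Riesz product along the unstable line through [s], in the coordinate
   [t] of that line. *)
Definition dens n (s t : R) : R := \prod_(j < n) wt (ls ^+ j * s + lu ^+ j * t).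

Lemma dens_gt0 n s t : 0 < dens n s t.
Proof. by apply: prodr_gt0 => j _; exact: wt_gt0. Qed.

Lemma densS n s t : dens n.+1 s t = wt (s + t) * dens n (ls * s) (lu * t).
Proof.
rewrite /dens big_ord_recl !expr0 !mul1r; congr (_ * _).
by apply: eq_bigr => j _; rewrite /= !mulrA -!exprSr.
Qed.

Definition freq n : R := 2 * pi * lu ^+ n.
Definition phas n s : R := 2 * pi * (ls ^+ n * s).

Lemma densSr n s t : dens n.+1 s t = dens n s t * (1 + eps * cos (freq n * t + phas n s)).
Proof.
rewrite /dens big_ord_recr /=; congr (_ * (1 + eps * cos _)).
by rewrite /freq /phas; ring.
Qed.

(* A primitive of [dens n s u * cos (th * u + ph)]. *)
Fixpoint gprim n (th ph s u : R) : R :=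
  if n is m.+1 then gprim m th ph s u + eps / 2 *
    (gprim m (th + freq m) (ph + phas m s) s u + gprim m (th - freq m) (ph - phas m s) s u)
  else sin (th * u + ph) / th.

(** A primitive of [dens n s], obtained by expanding its last factor. The explicit form exhibits
    each increment as a primitive of a fast oscillation, hence small. *)
Fixpoint fprim n (s u : R) : R :=
  if n is m.+1 then fprim m s u + eps * gprim m (freq m) (phas m s) s u else u.

Lemma freq_gt0 n : 0 < freq n.
Proof. by rewrite /freq !mulr_gt0 ?pi_gt0 ?exprn_gt0 // lu_gt0. Qed.

(** Expanding the product into single cosines shifts the frequency [th] by at most the sum of the
    [freq j]. The primitive of each cosine is at most the inverse of its frequency, and the
    coefficients have total mass at most (1 + eps)^n. *)
Lemma gprim_bound n th ph s u : \sum_(j < n) freq j < th ->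
  `|gprim n th ph s u| <= (1 + eps) ^+ n / (th - \sum_(j < n) freq j).
Proof.
have /andP[eps_ge0 eps_le] := eps_itv.
elim: n th ph => [|n IHn] th ph.
  rewrite !big_ord0 subr0 expr0 => th0 /=.
  rewrite normrM normfV (gtr0_norm th0) ler_pM2r ?invr_gt0 //; exact: sin_max.
rewrite !big_ord_recr /= => thS; have f0 := freq_gt0 n.
set S := \sum_(i < n) freq i in thS IHn *.
have D0 : 0 < th - (S + freq n) by rewrite subr_gt0.
have e1 : 0 <= (1 + eps) ^+ n by rewrite exprn_ge0 // addr_ge0.
have mono d : th - (S + freq n) <= d -> (1 + eps) ^+ n / d <= (1 + eps) ^+ n / (th - (S + freq n)).
  by move=> dD; rewrite ler_wpM2l // lef_pV2 ?posrE // (lt_le_trans D0).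
set B := (1 + eps) ^+ n / (th - (S + freq n)) in mono.
have b1 : `|gprim n th ph s u| <= B.
  by apply: le_trans (IHn _ _ _) (mono _ _); lra.
have b2 : `|gprim n (th + freq n) (ph + phas n s) s u| <= B.
  by apply: le_trans (IHn _ _ _) (mono _ _); lra.
have b3 : `|gprim n (th - freq n) (ph - phas n s) s u| <= B.
  by apply: le_trans (IHn _ _ _) (mono _ _); lra.
rewrite [leRHS](_ : _ = (1 + eps) * B); last by rewrite exprS /B mulrA.
apply: le_trans (ler_normD _ _) _; rewrite normrM (ger0_norm (x := eps / 2)) ?divr_ge0 //.
have : eps / 2 * `|gprim n (th + freq n) (ph + phas n s) s u + gprim n (th - freq n) (ph - phas n s) s u| <= eps / 2 * (B + B).
  rewrite ler_wpM2l ?divr_ge0 //; apply: le_trans (ler_normD _ _) _; lra.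
lra.
Qed.

(** Lacunarity: consecutive frequencies have ratio [lu] > 4. Hence no frequency in the expansion of
    the next factor falls below half of [freq n]. *)
Lemma sum_freq n : \sum_(j < n) freq j <= freq n / 2.
Proof.
elim: n => [|n IHn]; first by rewrite big_ord0 divr_ge0 // ltW ?freq_gt0.
rewrite big_ord_recr /=; have f0 := freq_gt0 n.
have -> : freq n.+1 = freq n * lu by rewrite /freq exprSr mulrA.
have l3 := @lu_itv R.
have : freq n * 4 <= freq n * lu by rewrite ler_wpM2l // ?ltW //; lra.
lra.
Qed.

(** The bound on [gprim] is at most ((1 + eps) / lu)^n, and (1 + eps) / lu < 1/2; the remaining
    factor is eps <= 1/2. So the primitives converge uniformly even though the densities need not
    converge. *)
Lemma fprimS_near n s u : `|fprim n.+1 s u - fprim n s u| <= (1 / 2) ^+ n.+1.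
Proof.
have /andP[eps_ge0 eps_le] := eps_itv.
rewrite /= addrAC subrr add0r normrM ger0_norm // exprS.
apply: ler_pM => //.
have f0 := freq_gt0 n; have sf := sum_freq n.
apply: le_trans (gprim_bound _ _ _ _) _; first by lra.
have l0 : 0 < lu ^+ n by rewrite exprn_gt0 // lu_gt0.
have fl : lu ^+ n <= freq n / 2.
  have -> : freq n / 2 = pi * lu ^+ n by rewrite /freq; field.
  by rewrite ler_peMl ?(ltW l0) //; have := pi_ge2 R; lra.
apply: (@le_trans _ _ ((1 + eps) ^+ n / lu ^+ n)).
  by rewrite ler_wpM2l ?exprn_ge0 ?addr_ge0 // lef_pV2 ?posrE //; lra.
rewrite -expr_div_n; apply: lerXn2r; rewrite ?nnegrE.
- by rewrite divr_ge0 // ?addr_ge0 // ltW // lu_gt0.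
- by rewrite divr_ge0.
- have /andP[l1 _] := @lu_itv R; have h : 1 + eps <= 1 / 2 * lu by lra.
  by rewrite ler_pdivrMr ?lu_gt0.
Qed.

Lemma gprim_derive n (th ph s u : R) : \sum_(j < n) freq j < th ->
  is_derive u 1 (gprim n th ph s) (dens n s u * cos (th * u + ph)).
Proof.
elim: n th ph => [|n IHn] th ph.
  rewrite big_ord0 => th0; rewrite /= /dens big_ord0 mul1r.
  have h : is_derive u 1 (fun t : R => th * t + ph) th.
    by apply: is_derive_eq; rewrite /GRing.scale /= mulr1 addr0 || idtac.
  have := @is_derive1_comp R sin (fun t : R => th * t + ph) u _ _ (is_derive_sin _) h.
  rewrite (_ : (fun t => sin (th * t + ph) / th) = (th^-1 *: (sin \o (fun t => th * t + ph)))); last first.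
    by apply/funext => t; rewrite /GRing.scale /= mulrC.
  move=> h'; apply: is_derive_eq; rewrite /GRing.scale /= mulrCA mulVf ?mulr1 //.
  by rewrite gt_eqF.
rewrite big_ord_recr /= => thS; have f0 := freq_gt0 n.
have h1 := IHn th ph ltac:(lra).
have h2 := IHn (th + freq n) (ph + phas n s) ltac:(lra).
have h3 := IHn (th - freq n) (ph - phas n s) ltac:(lra).
have := is_deriveD h1 (is_deriveZ (eps / 2) (is_deriveD h2 h3)).
move=> h; apply: (is_derive_eq h); rewrite /GRing.scale /= densSr.
have -> : (th + freq n) * u + (ph + phas n s) = (th * u + ph) + (freq n * u + phas n s) by ring.
have -> : (th - freq n) * u + (ph - phas n s) = (th * u + ph) - (freq n * u + phas n s) by ring.
move: (th * u + ph) (freq n * u + phas n s) => X Y.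
by rewrite cosD cosB; field.
Qed.

Lemma fprim_derive n (s u : R) : is_derive u 1 (fprim n s) (dens n s u).
Proof.
elim: n => [|n IHn]; first by rewrite /dens big_ord0; exact: is_derive_id.
have h : is_derive u 1 (gprim n (freq n) (phas n s) s) (dens n s u * cos (freq n * u + phas n s)).
  by apply: gprim_derive; have := sum_freq n; have := freq_gt0 n; lra.
have := is_deriveD IHn (is_deriveZ eps h).
move=> h'; apply: (is_derive_eq h'); rewrite /GRing.scale /= densSr; ring.
Qed.

(** The difference of the two sides has nonnegative derivative. Inequalities between densities are
    carried to the limit measure through primitives in this way. *)
Lemma fprim_cmp n m s s' (c k k' a b : R) : a <= b ->
  (forall t, a <= t <= b -> k * dens n s (t + c) <= k' * dens m s' t) ->
  k * (fprim n s (b + c) - fprim n s (a + c)) <= k' * (fprim m s' b - fprim m s' a).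
Proof.
move=> ab h.
suff : k' * fprim m s' a - k * fprim n s (a + c) <= k' * fprim m s' b - k * fprim n s (b + c) by lra.
have dF (x : R) : is_derive x 1 (fun t => k' * fprim m s' t - k * fprim n s (t + c))
   (k' * dens m s' x - k * dens n s (x + c)).
  have h1 := is_deriveZ k' (fprim_derive m s' x).
  have h2 : is_derive x 1 (fun t : R => t + c) 1 by apply: is_derive_eq; rewrite addr0.
  have h3 := is_deriveZ k (@is_derive1_comp R (fprim n s) (fun t : R => t + c) x _ _ (fprim_derive n s (x + c)) h2).
  by apply: (is_derive_eq (is_deriveB h1 h3)); rewrite /GRing.scale /= mulr1.
apply: (derive_le_incr ab dF) => x xab; rewrite subr_ge0; exact: h.
Qed.

Lemma fprim_scale n m s s' (c k k' a b : R) : 0 < c -> a <= b ->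
  (forall t, a <= t <= b -> k * dens n s t <= k' * dens m s' (c * t)) ->
  k * (fprim n s b - fprim n s a) <= k' * (c^-1 * (fprim m s' (c * b) - fprim m s' (c * a))).
Proof.
move=> c0 ab h.
suff : k' * (c^-1 * fprim m s' (c * a)) - k * fprim n s a <= k' * (c^-1 * fprim m s' (c * b)) - k * fprim n s b by lra.
have dF (x : R) : is_derive x 1 (fun t => k' * (c^-1 * fprim m s' (c * t)) - k * fprim n s t)
   (k' * dens m s' (c * x) - k * dens n s x).
  have h1 := is_deriveZ k (fprim_derive n s x).
  have h2 : is_derive x 1 (fun t : R => c * t) c.
    by apply: is_derive_eq; rewrite /GRing.scale /= mulr1.
  have h3 := is_deriveZ k' (is_deriveZ c^-1 (@is_derive1_comp R (fprim m s') (fun t : R => c * t) x _ _ (fprim_derive m s' (c * x)) h2)).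
  apply: (is_derive_eq (is_deriveB h3 h1)); rewrite /GRing.scale /=.
  by rewrite (mulrC _ c) mulKf // gt_eqF.
apply: (derive_le_incr ab dF) => x xab; rewrite subr_ge0; exact: h.
Qed.

Lemma fprim_scale' n m s s' (c k k' a b : R) : 0 < c -> a <= b ->
  (forall t, a <= t <= b -> k' * dens m s' (c * t) <= k * dens n s t) ->
  k' * (c^-1 * (fprim m s' (c * b) - fprim m s' (c * a))) <= k * (fprim n s b - fprim n s a).
Proof.
move=> c0 ab h; rewrite -lerN2 -!mulNr; apply: fprim_scale => // t tab.
by rewrite !mulNr lerN2; exact: h.
Qed.

(* The sequence [fprim n s u - 2^-n] is nondecreasing. *)
Definition flim (s u : R) : R := sup [set fprim n s u - (1 / 2) ^+ n | n in [set: nat]].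

Lemma half_expS n : (1 / 2 : R) ^+ n = (1 / 2) ^+ n.+1 + (1 / 2) ^+ n.+1.
Proof. by rewrite exprS; lra. Qed.

Lemma fprim_near n m s u : `|fprim (n + m) s u - fprim n s u| <= (1 / 2) ^+ n - (1 / 2) ^+ (n + m).
Proof.
elim: m => [|m IHm]; first by rewrite addn0 !subrr normr0.
rewrite addnS; have := fprimS_near (n + m) s u; have := half_expS (n + m).
move: IHm; rewrite !ler_norml; lra.
Qed.

Lemma flim_near n s u : `|flim s u - fprim n s u| <= (1 / 2) ^+ n.
Proof.
have p2 k : 0 <= (1 / 2 : R) ^+ k by rewrite exprn_ge0 // divr_ge0.
have ub k : fprim k s u - (1 / 2) ^+ k <= fprim n s u + (1 / 2) ^+ n.
  have [nk|kn] := leqP n k.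
    have := fprim_near n (k - n) s u; rewrite subnKC // ler_norml.
    by have := p2 k; have := p2 n; lra.
  have := fprim_near k (n - k) s u; rewrite subnKC ?(ltnW kn) // ler_norml.
  by have := p2 k; have := p2 n; lra.
have le1 : flim s u <= fprim n s u + (1 / 2) ^+ n.
  by apply: sup_le_ub; [exists (fprim 0 s u - (1 / 2) ^+ 0), 0%N|move=> _ [k _ <-]; exact: ub].
have le2 : fprim n s u - (1 / 2) ^+ n <= flim s u.
  by apply: ub_le_sup; [exists (fprim n s u + (1 / 2) ^+ n) => _ [k _ <-]; exact: ub|exists n].
by rewrite ler_norml; apply/andP; split; lra.
Qed.

Lemma le_half_exp (x y c : R) : 0 <= c -> (forall n, x <= y + c * (1 / 2) ^+ n) -> x <= y.
Proof.
move=> c0 h; apply/ler_addgt0Pr => e e0.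
have ec : 0 < e / (c + 1) by rewrite divr_gt0 // ltr_wpDl.
have [n _ hn] := near_infty_natSinv_expn_lt (PosNum ec).
have /= {}hn := hn n (leqnn _).
apply: le_trans (h n) _; rewrite lerD2l expr_div_n expr1n.
have l1 : c * (1 / 2 ^+ n) <= c * (e / (c + 1)) by apply: ler_wpM2l => //; exact: ltW.
apply: le_trans l1 _; rewrite mulrA ler_pdivrMr ?ltr_wpDl //; lra.
Qed.

End primitive.

(** * Image measures, densities and uniqueness on intervals *)

Section measure_tools.

Definition mk_measure d (T : measurableType d) (R : realType) (mu : set T -> \bar R)
  (mu0 : mu set0 = 0%E) (mu_ge0 : forall A, (0 <= mu A)%E)
  (mu_sa : semi_sigma_additive mu) : measure T R :=
  HB.pack mu (isMeasure.Build d T R mu mu0 mu_ge0 mu_sa).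

Definition image_measure d1 d2 (T1 : measurableType d1) (T2 : measurableType d2)
    (R : realType) (m : measure T1 R) (f : T1 -> T2) (mf : measurable_fun setT f) :
    measure T2 R.
Proof.
refine (@mk_measure _ _ _ (pushforward m f) _ _ _).
- by rewrite /pushforward preimage_set0 measure0.
- by move=> A; exact: measure_ge0.
- move=> F mF tF mUF; rewrite /pushforward preimage_bigcup.
  apply: measure_semi_sigma_additive.
  + by move=> n; rewrite -[X in measurable X]setTI; exact: mf.
  + apply/trivIsetP => /= i j _ _ ij; rewrite -preimage_setI.
    by move/trivIsetP : tF => /(_ _ _ _ _ ij) ->//; rewrite preimage_set0.
  + by rewrite -preimage_bigcup -[X in measurable X]setTI; exact: mf.
Defined.

Definition density_measure d (T : measurableType d) (R : realType) (m : measure T R)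
    (f : T -> \bar R) (mf : measurable_fun [set: T] f) (f0 : forall x, (0 <= f x)%E) :
    measure T R.
Proof.
refine (@mk_measure _ _ _ (fun A => \int[m]_(x in A) f x)%E _ _ _).
- by rewrite integral_set0.
- by move=> A; apply: integral_ge0 => x _.
- exact: semi_sigma_additive_nng_induced.
Defined.

Lemma measure_ocitv_unique (R : realType) (m1 m2 : measure (measurableTypeR R) R) :
  (forall a b : R, a < b -> m1 `]a, b]%classic = m2 `]a, b]%classic) ->
  (forall a b : R, (m1 `]a, b]%classic < +oo)%E) ->
  forall A, measurable A -> m1 A = m2 A.
Proof.
move=> m12 m1oo; pose g n : set (measurableTypeR R) := `](- n%:R), n%:R]%classic.
have gT : \bigcup_k g k = setT.
  apply/seteqP; split=> // x _; exists (Num.bound `|x|) => //; rewrite /g /= in_itv /=.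
  by have := archi_boundP (normr_ge0 x); rewrite ltr_norml => /andP[-> /ltW ->].
have mG : @measurable _ (measurableTypeR R) = <<s @ocitv R >> by [].
have Gg n : ocitv (g n) by exact: is_ocitv.
have H := @measure_unique _ R (measurableTypeR R) (@ocitv R) g mG (@ocitvI R) Gg gT m1 m2.
move=> A mA; apply: H => // [B|k]; last exact: m1oo.
by move=> /ocitvP[->|[[a b] /= ab ->]]; [rewrite !measure0|exact: m12].
Qed.

End measure_tools.

(** * The distribution function of the limiting Riesz product *)

Section limit_primitive.
Context {R : realType} (eps : R).
Hypothesis eps_itv : 0 <= eps <= 1 / 2.
Local Notation ls := (lams R).
Local Notation lu := (lamu R).
Local Notation wt := (wt eps).
Local Notation flim := (flim eps).
Local Notation fprim := (fprim eps).
Local Notation dens := (dens eps).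

Lemma flim_diff_near n s x y :
  `|(flim s x - flim s y) - (fprim n s x - fprim n s y)| <= 2 * (1 / 2) ^+ n.
Proof.
have := flim_near eps_itv n s x; have := flim_near eps_itv n s y.
rewrite !ler_norml; lra.
Qed.

Lemma flim_cmp s s' (c k k' a b : R) : a <= b ->
  (forall n t, a <= t <= b -> k * dens n s (t + c) <= k' * dens n s' t) ->
  k * (flim s (b + c) - flim s (a + c)) <= k' * (flim s' b - flim s' a).
Proof.
move=> ab h; apply: (@le_half_exp _ _ _ (2 * `|k| + 2 * `|k'|)).
  by rewrite addr_ge0 // mulr_ge0.
move=> n; have cmp := fprim_cmp ab (h n).
have near (q s0 x y : R) : `|q * (flim s0 x - flim s0 y) - q * (fprim n s0 x - fprim n s0 y)|
    <= 2 * `|q| * (1 / 2) ^+ n.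
  by rewrite -mulrBr normrM (mulrC 2) -mulrA ler_wpM2l // flim_diff_near.
have := near k s (b + c) (a + c); have := near k' s' b a.
rewrite !ler_norml; lra.
Qed.

Lemma flim_incr s a b : a <= b -> flim s a <= flim s b.
Proof.
move=> ab; have := @flim_cmp s s 0 0 1 a b ab; rewrite mul0r mul1r subr_ge0.
by apply=> n t _; rewrite mul0r mul1r ltW // dens_gt0.
Qed.

(** Self-similarity from [densS]: the first factor is squeezed between [m] and [M], and the rest is
    the Riesz product on the image line, stretched by [lu]. The exact form with a varying weight is
    [nus_scale]. *)
Lemma flim_scale s (m M a b : R) : a <= b ->
  (forall t, a <= t <= b -> m <= wt (s + t) <= M) ->
  m * (lu^-1 * (flim (ls * s) (lu * b) - flim (ls * s) (lu * a))) <= flim s b - flim s a /\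
  flim s b - flim s a <= M * (lu^-1 * (flim (ls * s) (lu * b) - flim (ls * s) (lu * a))).
Proof.
move=> ab h; have l0 := @lu_gt0 R; have l1 := @lu_gt1 R.
have near n (q x y : R) : `|q * (lu^-1 * (flim (ls * s) x - flim (ls * s) y)) -
    q * (lu^-1 * (fprim n (ls * s) x - fprim n (ls * s) y))| <= 2 * `|q| * (1 / 2) ^+ n.
  rewrite -!mulrBr normrM (mulrC 2) -mulrA ler_wpM2l //.
  rewrite normrM -[leRHS]mul1r ler_pM // ?flim_diff_near //.
  by rewrite ger0_norm ?invr_ge0 ?(ltW l0) // invf_le1 // ltW.
have hd n t : a <= t <= b -> m * dens n (ls * s) (lu * t) <= 1 * dens n.+1 s t /\
    1 * dens n.+1 s t <= M * dens n (ls * s) (lu * t).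
  move=> /h /andP[h1 h2]; rewrite mul1r densS.
  by have d0 := dens_gt0 eps_itv n (ls * s) (lu * t); rewrite !ler_wpM2r // ltW.
split; apply: (@le_half_exp _ _ _ (2 * `|m| + 2 * `|M| + 2)); rewrite ?addr_ge0 ?mulr_ge0 // => n.
  have := fprim_scale' l0 ab (fun t tab => (hd n t tab).1); rewrite mul1r.
  have := near n m (lu * b) (lu * a); have := flim_diff_near n.+1 s b a.
  have M0 : 0 <= `|M| * (1 / 2) ^+ n by rewrite mulr_ge0 // exprn_ge0 // divr_ge0.
  rewrite !ler_norml exprS; lra.
have := fprim_scale l0 ab (fun t tab => (hd n t tab).2); rewrite mul1r.
have := near n M (lu * b) (lu * a); have := flim_diff_near n.+1 s b a.
have M0 : 0 <= `|m| * (1 / 2) ^+ n by rewrite mulr_ge0 // exprn_ge0 // divr_ge0.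
rewrite !ler_norml exprS; lra.
Qed.

Lemma dens0 s t : dens 0 s t = 1.
Proof. exact: big_ord0. Qed.

(** The matrix is integral, so the first coordinate of A^j v is an integer, and each factor is
    1-periodic. *)
Lemma dens_translate n s t (a b : int) :
  let v : 'rV[R]_2 := vec2 a%:~R b%:~R in
  dens n (s + scoord v) (t + ucoord v) = dens n s t.
Proof.
move=> v; apply: eq_bigr => j _.
have [c ec] : exists c : int, ls ^+ j * scoord v + lu ^+ j * ucoord v = c%:~R.
  have [p [q e]] : exists p q : int, v *m amx ^+ j = vec2 p%:~R q%:~R.
    elim: (nat_of_ord j) => [|i [p [q e]]]; first by exists a, b; rewrite expr0 mulmx1.
    exists (p + q), (p + 4 * q); rewrite exprSr -mulmxE mulmxA e mul_amx.
    by apply: row2P; rewrite !mxE /= !intrD ?intrM.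
  exists p; have := svec_amxX j (scoord v) (ucoord v); rewrite svecK e.
  by move/(congr1 (fun w : 'rV[R]_2 => w 0 0)); rewrite !mxE.
rewrite -[RHS](wtD_int eps _ c) -ec.
by rewrite (_ : _ + (_ + _) = ls ^+ j * (s + scoord v) + lu ^+ j * (t + ucoord v)) //; ring.
Qed.

Lemma flim_translate s x y (a b : int) :
  let v : 'rV[R]_2 := vec2 a%:~R b%:~R in
  flim (s + scoord v) (y + ucoord v) - flim (s + scoord v) (x + ucoord v) =
  flim s y - flim s x.
Proof.
move=> v; wlog xy : x y / x <= y.
  move=> h; have [/h//|/ltW /h e] := leP x y.
  by rewrite -(opprB (flim _ (x + _))) e opprB.
apply/eqP; rewrite eq_le; apply/andP; split.
  rewrite -[leLHS]mul1r -[leRHS]mul1r; apply: flim_cmp => // n t _.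
  by rewrite /= dens_translate.
rewrite -[leRHS]mul1r -[leLHS]mul1r -lerN2 -!mulNr; apply: flim_cmp => // n t _.
by rewrite /= dens_translate.
Qed.

(* Bounded distortion along the stable direction. *)
Definition distortion (d : R) : R := expR (8 / (1 - ls) * d).

(** [wt] is 4-Lipschitz and at least 1/2, so the j-th factor changes by a ratio at most exp(8 ls^j
    |s - s'|); the exponents sum to a geometric series with total 8 / (1 - ls) |s - s'|. *)
Lemma dens_distortion n s s' t : dens n s t <= distortion `|s - s'| * dens n s' t.
Proof.
have l1 : 0 < 1 - ls by rewrite subr_gt0 ls_lt1.
elim: n s s' t => [|n IHn] s s' t.
  rewrite !dens0 mulr1 /distortion -[leLHS]expR0 ler_expR.
  by rewrite mulr_ge0 // divr_ge0 // ltW.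
rewrite !densS; have := IHn (ls * s) (ls * s') (lu * t).
have w1 : wt (s + t) <= expR (8 * `|s - s'|) * wt (s' + t).
  have h1 := wt_lip eps_itv (s + t) (s' + t).
  have h2 := wt_itv eps_itv (s' + t).
  have e1 := expR_ge1Dx (8 * `|s - s'|).
  have d0 : 0 <= `|s - s'| by [].
  apply: (@le_trans _ _ ((1 + 8 * `|s - s'|) * wt (s' + t))); last first.
    by rewrite ler_wpM2r //; lra.
  have e : s + t - (s' + t) = s - s' by ring.
  rewrite e in h1.
  have : `|s - s'| * (1 / 2) <= `|s - s'| * wt (s' + t) by rewrite ler_wpM2l //; lra.
  move: h1; rewrite ler_norml; lra.
move=> w2.
have -> : distortion `|s - s'| = expR (8 * `|s - s'|) * distortion `|ls * s - ls * s'|.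
  rewrite /distortion -mulrBr normrM (ger0_norm (ltW (@ls_gt0 R))) -expRD.
  by congr expR; field; rewrite gt_eqF.
rewrite mulrACA; apply: ler_pM => //; apply: ltW.
  exact: wt_gt0.
exact: dens_gt0.
Qed.

Lemma flim_distortion s s' a b : a <= b ->
  flim s b - flim s a <= distortion `|s - s'| * (flim s' b - flim s' a).
Proof.
move=> ab; rewrite -[leLHS]mul1r -{1}(addr0 a) -{1}(addr0 b).
by apply: flim_cmp => // n t _; rewrite mul1r addr0 dens_distortion.
Qed.

Lemma flim_sub_id s u : `|flim s u - u| <= 1.
Proof. exact: (flim_near eps_itv 0 s u). Qed.

Lemma fprim_continuous n s : continuous (fprim n s).
Proof.
move=> x; apply: differentiable_continuous; apply/derivable1_diffP.
by have := fprim_derive eps n s x => h; exact: ex_derive.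
Qed.

Lemma flim_continuous s : continuous (flim s : R -> R).
Proof.
move=> x; apply/cvgrPdist_lt => e e0.
have e3 : 0 < e / 3 by rewrite divr_gt0.
have [n _ /(_ _ (leqnn _)) /= hn] := near_infty_natSinv_expn_lt (PosNum e3).
have hn' : (1 / 2 : R) ^+ n < e / 3 by rewrite expr_div_n expr1n.
have /cvgrPdist_lt/(_ _ e3) := @fprim_continuous n s x.
apply: filterS => y hy.
have := flim_near eps_itv n s x; have := flim_near eps_itv n s y.
move: hy; rewrite !ltr_norml !ler_norml; lra.
Qed.

(** The quantile function of [flim z.1]: it carries Lebesgue measure to the measure with that
    distribution function. It takes a pair because joint measurability in the line and the level is
    needed. *)
Definition quant (z : R * R) : R := inf [set u | z.2 <= flim z.1 u].

Lemma quant_le s p b : (quant (s, p) <= b) = (p <= flim s b).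
Proof.
have lb : has_lbound [set u | p <= flim s u].
  by exists (p - 1) => u /= pu; have := flim_sub_id s u; rewrite ler_norml; lra.
apply/idP/idP => [qb|pb]; last by apply: ge_inf.
rewrite leNgt; apply/negP => bp.
have [d /= d0 hd] : \forall y \near b, flim s y < p.
  have /cvgrPdist_lt/(_ (p - flim s b)) := @flim_continuous s b.
  rewrite subr_gt0 => /(_ bp); apply: filterS => y; rewrite ltr_norml; lra.
have hb : flim s (b + d / 2) < p.
  by apply: hd; rewrite /= opprD addNKr normrN gtr0_norm ?divr_gt0 // ltr_pdivrMr //; lra.
have : b + d / 2 <= quant (s, p).
  apply: lb_le_inf.
    by exists (p + 1) => /=; have := flim_sub_id s (p + 1); rewrite ler_norml; lra.
  move=> u /= pu; rewrite leNgt; apply/negP => /ltW /(flim_incr s); lra.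
by lra.
Qed.

Lemma gprim_measurable n th (ph : R -> R) u : measurable_fun setT ph ->
  measurable_fun setT (fun s => gprim eps n th (ph s) s u).
Proof.
have msin : measurable_fun setT (@sin R).
  by apply: continuous_measurable_fun; exact: continuous_sin.
elim: n th ph => [|n IHn] th ph mph /=.
  apply: measurable_funM => //; apply: measurableT_comp => //.
  exact: measurable_funD.
have mp : measurable_fun setT (phas n : R -> R).
  by apply: measurable_funM => //; apply: measurable_funM.
apply: measurable_funD; first exact: IHn.
apply: measurable_funM => //; apply: measurable_funD; apply: IHn.
  exact: measurable_funD.
exact: measurable_funB.
Qed.

Lemma flim_measurable u : measurable_fun setT (fun s => flim s u).
Proof.
apply: (@measurable_fun_cvg _ _ _ _ (fun n s => fprim n s u)).
  elim=> [|n IHn] /=; first exact: measurable_cst.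
  apply: measurable_funD => //; apply: measurable_funM => //; apply: gprim_measurable.
  by apply: measurable_funM => //; apply: measurable_funM.
move=> s _; apply/cvgrPdist_lt => e e0.
have [n _ hn] := near_infty_natSinv_expn_lt (PosNum e0).
exists n => // m /= nm; apply: le_lt_trans (flim_near eps_itv m s u) _.
by rewrite expr_div_n expr1n; exact: hn.
Qed.

End limit_primitive.

(** * Lebesgue measure under affine maps *)

Section lebesgue_affine.
Context {R : realType}.
Local Notation leb := (@lebesgue_measure R).
Implicit Types (A : set (measurableTypeR R)).

Lemma affine_measurable (c d : R) :
  measurable_fun setT ((fun x => c * x + d) : measurableTypeR R -> measurableTypeR R).
Proof. by apply: measurable_funD => //; apply: measurable_funM. Qed.

Lemma lebesgue_measure_oc (a b : R) : a <= b -> leb `]a, b]%classic = (b - a)%:E.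
Proof.
move=> ab; rewrite lebesgue_measure_itv /= lte_fin; case: ltP => [//|ba].
by rewrite (le_anti _ : a = b) ?subrr // ab ba.
Qed.

Lemma lebesgue_affine (c d : R) (c0 : 0 < c) A : measurable A ->
  leb ((fun x => c * x + d) @^-1` A) = (c^-1%:E * leb A)%E.
Proof.
move=> mA; have ci0 : 0 <= c^-1 by rewrite invr_ge0 ltW.
apply: (@measure_ocitv_unique R (image_measure leb (affine_measurable c d))
  (mscale (NngNum ci0) leb)) mA => [a b ab|a b] /=; rewrite /pushforward.
  rewrite (_ : _ @^-1` _ = `](a - d) / c, (b - d) / c]%classic); last first.
    apply/seteqP; split=> x /=; rewrite !in_itv /=.
      by rewrite ltr_pdivrMr // ler_pdivlMr // ltrBlDr lerBrDr (mulrC x).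
    by rewrite ltr_pdivrMr // ler_pdivlMr // ltrBlDr lerBrDr (mulrC x).
  rewrite /mscale /= !lebesgue_measure_oc ?(ltW ab) //.
    by rewrite -EFinM; congr EFin; field; rewrite gt_eqF.
  by rewrite ler_pM2r ?invr_gt0 // lerD2r ltW.
rewrite (_ : _ @^-1` _ = `](a - d) / c, (b - d) / c]%classic); last first.
  apply/seteqP; split=> x /=; rewrite !in_itv /=.
    by rewrite ltr_pdivrMr // ler_pdivlMr // ltrBlDr lerBrDr (mulrC x).
  by rewrite ltr_pdivrMr // ler_pdivlMr // ltrBlDr lerBrDr (mulrC x).
by rewrite lebesgue_measure_itv; case: ifP; rewrite ?ltry.
Qed.

Lemma integral_affine (c d : R) (c0 : 0 < c) (f : measurableTypeR R -> \bar R) :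
  measurable_fun [set: measurableTypeR R] f -> (forall x, 0 <= f x)%E ->
  (\int[leb]_x f (c * x + d)%R = c^-1%:E * \int[leb]_x f x)%E.
Proof.
move=> mf f0; have ci0 : 0 <= c^-1 by rewrite invr_ge0 ltW.
have -> : (\int[leb]_x f (c * x + d)%R =
    \int[image_measure leb (affine_measurable c d)]_x f x)%E.
  by rewrite (ge0_integral_pushforward (affine_measurable c d)).
rewrite (@eq_measure_integral _ _ _ _ (mscale (NngNum ci0) leb)) => [|A mA _].
  by rewrite ge0_integral_mscale.
exact: lebesgue_affine.
Qed.

End lebesgue_affine.

(** * The Riesz measures on unstable lines *)

Section unstable_measures.
Context {R : realType} (eps : R).
Hypothesis eps_itv : 0 <= eps <= 1 / 2.
Local Notation ls := (lams R).
Local Notation lu := (lamu R).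
Local Notation wt := (wt eps).
Local Notation flim := (flim eps).
Local Notation quant := (quant eps).
Local Notation mR := (measurableTypeR R).
Local Notation RR := (measurableTypeR R * measurableTypeR R)%type.
Local Notation leb := (@lebesgue_measure R).

Lemma quant_oc s (a b : R) :
  (fun p => quant (s, p)) @^-1` `]a, b]%classic = `]flim s a, flim s b]%classic.
Proof.
by apply/seteqP; split=> p /=; rewrite !in_itv /= !ltNge !(quant_le eps_itv).
Qed.

Lemma hypograph_measurable (f : mR -> R) : measurable_fun setT f ->
  measurable [set z : RR | z.2 <= f z.1].
Proof.
move=> mf; rewrite (_ : [set z | _] = setT `&` (fun z : RR => f z.1 - z.2) @^-1` `[0, +oo[%classic).
  have h : measurable_fun setT (fun z : RR => f z.1 - z.2).
    by apply: measurable_funB => //; apply: measurableT_comp.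
  by apply: h => //; exact: measurable_itv.
by apply/seteqP; split=> z /=; rewrite in_itv /= andbT subr_ge0 => // -[].
Qed.

Lemma quant_measurable : measurable_fun setT (quant : RR -> mR).
Proof.
apply: (measurability (@ocitv R)) => // _ [_ [[a b] _ <-] <-].
rewrite setTI (_ : _ @^-1` _ = [set z : RR | z.2 <= flim z.1 b] `\` [set z : RR | z.2 <= flim z.1 a]).
  by apply: measurableD; [apply: (@hypograph_measurable (flim^~ b))|apply: (@hypograph_measurable (flim^~ a))]; exact: flim_measurable.
apply/seteqP; split=> -[s p] /=; rewrite in_itv /= ltNge !quant_le //.
  by move=> /andP[/negP].
by move=> [-> /negP ->].
Qed.

Lemma quantr_measurable s : measurable_fun setT ((fun p => quant (s, p)) : mR -> mR).
Proof.
apply: (@measurableT_comp _ _ _ _ _ _ quant _ (fun p : mR => (s, p))).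
  exact: quant_measurable.
exact: measurable_fun_pair.
Qed.

(* The Riesz product on the unstable line through [s], with distribution
   function [flim s]. *)
Definition nus s : measure mR R := image_measure leb (quantr_measurable s).

Lemma nus_oc s a b : a <= b -> nus s `]a, b]%classic = (flim s b - flim s a)%:E.
Proof.
by move=> ab; rewrite /nus /= /pushforward quant_oc lebesgue_measure_oc // flim_incr.
Qed.

Lemma nus_oc_lty s a b : (nus s `]a, b]%classic < +oo)%E.
Proof.
have [ab|ba] := leP a b; first by rewrite nus_oc // ltry.
by rewrite set_itv_ge ?measure0 // bnd_simp -leNgt ltW.
Qed.

Lemma nus_translate s (a b : int) (E : set mR) : measurable E ->
  let v : 'rV[R]_2 := vec2 a%:~R b%:~R in
  nus (s + scoord v) ((fun y => y - ucoord v) @^-1` E) = nus s E.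
Proof.
move=> mE v.
have mt : measurable_fun setT ((fun y => y - ucoord v) : mR -> mR) by exact: measurable_funB.
have pre (x y : R) : (fun y => y - ucoord v) @^-1` `]x, y]%classic = `]x + ucoord v, y + ucoord v]%classic.
  by apply/seteqP; split=> z /=; rewrite !in_itv /= ltrBrDr lerBlDr.
apply: (@measure_ocitv_unique R (image_measure (nus (s + scoord v)) mt) (nus s)) mE => [x y xy|x y] /=.
  rewrite [LHS]/pushforward pre.
  by rewrite [LHS]nus_oc ?[RHS]nus_oc ?flim_translate ?lerD2r ?(ltW xy).
by rewrite /pushforward pre; exact: nus_oc_lty.
Qed.

(** By [flim_distortion] the function K [flim s'] - [flim s] is nondecreasing; its
    Lebesgue-Stieltjes measure is exactly what must be added to [nus s] to get K times [nus s']. *)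
Lemma nus_distortion s s' (E : set mR) : measurable E ->
  (nus s E <= (distortion `|s - s'|)%:E * nus s' E)%E.
Proof.
move=> mE; set K := distortion _; have K0 : 0 <= K by exact: expR_ge0.
pose f u := K * flim s' u - flim s u.
have fc : continuous (f : R -> R).
  move=> x; apply: cvgB; last exact: flim_continuous.
  by apply: cvgM; [exact: cvg_cst|exact: flim_continuous].
have nd : nondecreasing f.
  move=> x y xy; have := flim_distortion eps_itv s s' xy; rewrite -/K /f; lra.
have rc : right_continuous f by exact: right_continuousW.
pose F : cumulative R R := HB.pack f (isCumulative.Build R _ R f nd rc).
have addE A : measure_add (nus s) (lebesgue_stieltjes_measure F) A =
    (nus s A + lebesgue_stieltjes_measure F A)%E by exact: measure_addE.
have := @measure_ocitv_unique R (measure_add (nus s) (lebesgue_stieltjes_measure F))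
  (mscale (NngNum K0) (nus s')).
move=> /(_ _ _ E mE) H; rewrite -[leRHS]H.
- apply: (@le_trans _ _ (nus s E + lebesgue_stieltjes_measure F E)%E).
    by rewrite leeDl.
  by rewrite le_eqVlt; apply/orP; left; apply/eqP; exact: (esym (addE E)).
- move=> a b ab; apply: (eq_trans (addE _)).
  have scE : mscale (NngNum K0) (nus s') `]a, b]%classic = (K%:E * nus s' `]a, b]%classic)%E by [].
  apply: (eq_trans _ (esym scE)); rewrite !nus_oc ?(ltW ab) //.
  rewrite /lebesgue_stieltjes_measure /measure_extension measurable_mu_extE /=; last exact: is_ocitv.
  by rewrite wlength_itv_bnd ?(ltW ab) // -EFinD -EFinM; congr EFin; rewrite /= /f; ring.
- move=> a b.
  apply: (@le_lt_trans _ _ (nus s `]a, b]%classic + lebesgue_stieltjes_measure F `]a, b]%classic)%E).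
    by rewrite le_eqVlt; apply/orP; left; apply/eqP; exact: addE.
  rewrite lte_add_pinfty ?nus_oc_lty //.
  rewrite /lebesgue_stieltjes_measure /measure_extension measurable_mu_extE /=; last exact: is_ocitv.
  by rewrite wlength_itv; case: ifP => //; rewrite ltry.
Qed.

End unstable_measures.

(** * Self-similarity of the unstable measures *)

Section plane_measure.
Context {R : realType} (eps : R).
Hypothesis eps_itv : 0 <= eps <= 1 / 2.
Local Notation ls := (lams R).
Local Notation lu := (lamu R).
Local Notation wt := (wt eps).
Local Notation flim := (flim eps).
Local Notation quant := (quant eps).
Local Notation nus := (nus eps_itv).
Local Notation mR := (measurableTypeR R).
Local Notation RR := (measurableTypeR R * measurableTypeR R)%type.
Local Notation leb := (@lebesgue_measure R).

(** Bisecting an interval halves b - a while the increments of [G] add up, so every round of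
    bisection halves the bound on [D]. *)
Lemma additive_small (D : R -> R -> R) (G : R -> R) (C : R) :
  (forall a b c, a <= b -> b <= c -> D a c = D a b + D b c) ->
  (forall a b, a <= b -> `|D a b| <= C * (b - a) * (G b - G a)) ->
  forall a b, a <= b -> D a b = 0.
Proof.
move=> Dadd Dsm.
have bd n a b : a <= b -> `|D a b| <= C * (b - a) * (G b - G a) * (1 / 2) ^+ n.
  elim: n a b => [|n IHn] a b ab; first by rewrite expr0 mulr1; exact: Dsm.
  pose c := (a + b) / 2.
  have ac : a <= c by rewrite /c; lra.
  have cb : c <= b by rewrite /c; lra.
  rewrite (Dadd _ _ _ ac cb); apply: le_trans (ler_normD _ _) _.
  have := IHn _ _ ac; have := IHn _ _ cb.
  have -> : b - c = (b - a) * (1 / 2) by rewrite /c; field.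
  have -> : c - a = (b - a) * (1 / 2) by rewrite /c; field.
  move=> h1 h2; apply: le_trans (lerD h2 h1) _.
  by rewrite exprS le_eqVlt; apply/orP; left; apply/eqP; ring.
move=> a b ab; apply/eqP; rewrite -normr_le0.
apply: (@le_half_exp _ _ _ `|C * (b - a) * (G b - G a)|) => // n; rewrite add0r.
apply: le_trans (bd n _ _ ab) _.
by rewrite ler_wpM2r ?ler_norm // exprn_ge0 // divr_ge0.
Qed.

Lemma wt_measurable (f : mR -> R) : measurable_fun setT f ->
  measurable_fun [set: mR] (fun y => (wt (f y))%:E).
Proof.
move=> mf; apply/measurable_EFinP; apply: measurable_funD => //; apply: measurable_funM => //.
apply: measurableT_comp; first by apply: continuous_measurable_fun; exact: continuous_cos.
exact: measurable_funM.
Qed.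

Let div_measurable : measurable_fun setT ((fun y => lu^-1 * y + 0) : mR -> mR).
Proof. exact: affine_measurable. Qed.

Let lui_ge0 : 0 <= lu^-1 :> R.
Proof. by rewrite invr_ge0 ltW // lu_gt0. Qed.

Let wt_ge0 (t : R) : (0 <= (wt t)%:E)%E.
Proof. by rewrite lee_fin ltW // wt_gt0. Qed.

(** On []a, b]] both sides lie between the extreme values of [wt] times the increment of [G]. Since
    [wt] oscillates by at most 8 (b - a) there, [additive_small] shows that the two sides coincide
    on intervals, hence as measures. *)
Lemma nus_scale s (E : set mR) : measurable E ->
  nus s E = (lu^-1%:E * \int[nus (ls * s)]_(y in (fun y => (lu^-1 * y)%R) @^-1` E)
     (wt (s + lu^-1 * y))%:E)%E.
Proof.
move=> mE; have l0 := @lu_gt0 R.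
pose m' := mscale (NngNum lui_ge0) (image_measure (nus (ls * s)) div_measurable).
have mw : measurable_fun [set: mR] (fun y => (wt (s + y))%:E).
  by apply: wt_measurable; exact: measurable_funD.
pose G u := lu^-1 * flim (ls * s) (lu * u).
have m'E a b : a <= b -> m' `]a, b]%classic = (G b - G a)%:E.
  move=> ab.
  have -> : m' `]a, b]%classic = (lu^-1%:E * nus (ls * s) ((fun y => (lu^-1 * y + 0)%R) @^-1` `]a, b]%classic))%E by [].
  rewrite [X in nus _ X](_ : _ = `]lu * a, lu * b]%classic); last first.
    by apply/seteqP; split=> y /=; rewrite !in_itv /= addr0 (mulrC lu^-1) ltr_pdivlMr // ler_pdivrMr // !(mulrC lu).
  rewrite nus_oc; last by rewrite ler_pM2l.
  by rewrite -EFinM mulrBr.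
pose J a b := (\int[m']_(y in `]a, b]) (wt (s + y))%:E)%E.
have Jbd a b m M : a <= b -> (forall t, a <= t <= b -> m <= wt (s + t) <= M) -> 0 <= m ->
    ((m * (G b - G a))%:E <= J a b)%E /\ (J a b <= (M * (G b - G a))%:E)%E.
  move=> ab h m0; have M0 : 0 <= M.
    by have := h a; rewrite lexx ab => /(_ isT); lra.
  have h' t : `]a, b]%classic t -> m <= wt (s + t) <= M.
    by rewrite /= in_itv /= => /andP[/ltW ? ?]; apply: h; apply/andP; split.
  rewrite !EFinM -!m'E // -!(integral_cst m') //.
  split; apply: ge0_le_integral => //.
  - exact: measurable_funTS.
  - by move=> t /h' /andP[]; rewrite lee_fin.
  - exact: measurable_funTS.
  - by move=> t /h' /andP[]; rewrite lee_fin.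
have Jfin a b : a <= b -> J a b \is a fin_num.
  move=> ab; have [] := Jbd a b (1/2) (3/2) ab (fun t _ => wt_itv eps_itv _) ltac:(lra).
  by move=> j1 j2; rewrite ge0_fin_numE ?(le_lt_trans j2) ?ltry //; apply: integral_ge0.
have Jadd a b c : a <= b -> b <= c -> J a c = (J a b + J b c)%E.
  move=> ab bc; rewrite /J -ge0_integral_setU //.
  - by rewrite (_ : _ `|` _ = `]a, c]%classic) // -itv_bndbnd_setU // bnd_simp.
  - exact: measurable_funTS.
  - rewrite disj_set2E; apply/eqP/seteqP; split=> // y [] /=.
    by rewrite !in_itv /= => /andP[_ h1] /andP[h2 _]; move: h1 h2; lra.
pose D a b := (flim s b - flim s a) - fine (J a b).
have D0 : forall a b, a <= b -> D a b = 0.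
  apply: (@additive_small D G 8) => [a b c ab bc|a b ab].
    by rewrite /D (Jadd _ _ _ ab bc) fineD ?Jfin //; ring.
  (* The maximum with 0 keeps the lower bound nonnegative, as [Jbd] requires. *)
  have hb t : a <= t <= b -> Num.max 0 (wt (s + a) - 4 * (b - a)) <= wt (s + t) <= wt (s + a) + 4 * (b - a).
    move=> tab; have := wt_lip eps_itv (s + t) (s + a); have := wt_gt0 eps_itv (s + t).
    rewrite (_ : s + t - (s + a) = t - a); last by ring.
    rewrite (ger0_norm (x := t - a)); last by lra.
    by rewrite ler_norml ge_max; lra.
  have [f1 f2] := flim_scale eps_itv ab hb.
  have [j1 j2] := Jbd a b _ _ ab hb ltac:(by rewrite le_max lexx).
  rewrite -(fineK (Jfin _ _ ab)) !lee_fin in j1 j2.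
  have G0 : 0 <= G b - G a by rewrite subr_ge0 ler_wpM2l // flim_incr // ler_pM2l.
  have mx : wt (s + a) - 4 * (b - a) <= Num.max 0 (wt (s + a) - 4 * (b - a)) by rewrite le_max lexx orbT.
  have := ler_wpM2r G0 mx.
  have e1 : lu^-1 * (flim (ls * s) (lu * b) - flim (ls * s) (lu * a)) = G b - G a by rewrite /G; ring.
  rewrite e1 in f1 f2 => h.
  rewrite /D ler_norml; apply/andP; split; lra.
rewrite (@measure_ocitv_unique R (nus s) (density_measure m' mw (fun y => wt_ge0 (s + y))) _ _ E mE).
- transitivity (\int[m']_(y in E) (wt (s + y))%:E)%E; first by [].
  rewrite /m' ge0_integral_mscale //; last exact: measurable_funTS.
  congr (lu^-1%:E * _)%E.
  apply: (eq_trans (ge0_integral_pushforward div_measurable (nus (ls * s)) mE _ _)).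
  - exact: measurable_funTS.
  - by [].
  have eqf : (fun y : mR => lu^-1 * y + 0) = (fun y => lu^-1 * y).
    by apply/funext => y; rewrite addr0.
  by rewrite eqf.
- move=> a b ab; rewrite nus_oc ?(ltW ab) //.
  have /= -> : density_measure m' mw (fun y => wt_ge0 (s + y)) `]a, b]%classic = J a b by [].
  by rewrite -(fineK (Jfin _ _ (ltW ab))); congr EFin; have := D0 _ _ (ltW ab); rewrite /D; lra.
- by move=> a b; exact: nus_oc_lty.
Qed.

End plane_measure.

(** * The invariant measure on the plane and its local product structure *)

Section plane_measure_theory.
Context {R : realType} (eps : R).
Hypothesis eps_itv : 0 <= eps <= 1 / 2.
Local Notation ls := (lams R).
Local Notation lu := (lamu R).
Local Notation wt := (wt eps).
Local Notation flim := (flim eps).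
Local Notation quant := (quant eps).
Local Notation nus := (nus eps_itv).
Local Notation mR := (measurableTypeR R).
Local Notation RR := (measurableTypeR R * measurableTypeR R)%type.
Local Notation leb := (@lebesgue_measure R).

(** Planar Lebesgue measure is carried by [qmap] to the measure with [nus s] on the line over each
    [s], and by [qmap0 s0] to the product of Lebesgue measure with [nus s0]. *)
Definition qmap (z : RR) : RR := (z.1, quant z).
Definition qmap0 (s0 : R) (z : RR) : RR := (z.1, quant (s0, z.2)).

Lemma qmap_measurable : measurable_fun setT qmap.
Proof. by apply: measurable_fun_pair => //; exact: quant_measurable. Qed.

Lemma qmap0_measurable s0 : measurable_fun setT (qmap0 s0).
Proof.
apply: measurable_fun_pair => //.
by apply: (measurableT_comp (quantr_measurable eps_itv s0)).
Qed.

(* In coordinates of the eigenbasis, the lift to the plane of (a multiple of)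
   the Riesz product; and its comparison with a product measure. *)
Definition mut : measure RR R := image_measure (leb \x leb)%E qmap_measurable.
Definition mut0 s0 : measure RR R := image_measure (leb \x leb)%E (qmap0_measurable s0).

Lemma mutE B : mut B = (\int[leb]_s nus s (xsection B s))%E.
Proof. by []. Qed.

Lemma mut0E s0 B : mut0 s0 B = (\int[leb]_s nus s0 (xsection B s))%E.
Proof. by []. Qed.

Lemma mut_integral (f : RR -> \bar R) : measurable_fun [set: RR] f ->
  (forall z, 0 <= f z)%E ->
  (\int[mut]_z f z = \int[leb]_s \int[nus s]_y f (s, y))%E.
Proof.
move=> mf f0.
have mfq : measurable_fun [set: RR] (f \o qmap) by apply: measurableT_comp => //; exact: qmap_measurable.
apply: (eq_trans (ge0_integral_pushforward qmap_measurable _ measurableT mf _)) => //.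
have fq0 z : (0 <= (f \o qmap) z)%E by exact: f0.
transitivity (\int[leb \x leb]_x (f \o qmap) x)%E; first by [].
rewrite (@fubini_tonelli1 _ _ _ _ _ leb leb (f \o qmap) mfq fq0).
apply: eq_integral => s _; rewrite /fubini_F.
have mfs : measurable_fun [set: mR] (fun y => f (s, y)).
  by apply: measurableT_comp => //; exact: measurable_fun_pair.
apply/esym; apply: (eq_trans (ge0_integral_pushforward (quantr_measurable eps_itv s) _ measurableT mfs _)) => //.
Qed.

Lemma inner_measurable (f : RR -> \bar R) : measurable_fun [set: RR] f ->
  (forall z, 0 <= f z)%E ->
  measurable_fun [set: mR] (fun s => \int[nus s]_y f (s, y))%E.
Proof.
move=> mf f0.
have mfq : measurable_fun [set: RR] (f \o qmap) by apply: measurableT_comp => //; exact: qmap_measurable.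
have fq0 z : (0 <= (f \o qmap) z)%E by exact: f0.
have := @measurable_fun_fubini_tonelli_F _ _ _ _ _ leb (f \o qmap) mfq fq0.
congr (measurable_fun _ _); apply/funext => s; rewrite /fubini_F.
have mfs : measurable_fun [set: mR] (fun y => f (s, y)).
  by apply: measurableT_comp => //; exact: measurable_fun_pair.
apply/esym; apply: (eq_trans (ge0_integral_pushforward (quantr_measurable eps_itv s) _ measurableT mfs _)) => //.
Qed.

Lemma nus_xsection_measurable B : measurable B ->
  measurable_fun [set: mR] (fun s => nus s (xsection B s)).
Proof.
move=> mB; have mqB : measurable (qmap @^-1` B).
  by rewrite -[X in measurable X]setTI; exact: qmap_measurable.
by have := measurable_fun_xsection leb mqB; congr (measurable_fun _ _).
Qed.

Lemma mut_translate (a b : int) B : measurable B ->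
  let v : 'rV[R]_2 := vec2 a%:~R b%:~R in
  mut ((fun z => (z.1 - scoord v, z.2 - ucoord v)) @^-1` B) = mut B.
Proof.
move=> mB v; rewrite !mutE.
have -> : (\int[leb]_s nus s (xsection B s))%E =
    (\int[leb]_s nus (1 * s + - scoord v) (xsection B (1 * s + - scoord v)%R))%E.
  rewrite (@integral_affine _ 1 (- scoord v) _ (fun s => nus s (xsection B s))) ?invr1 ?mul1e //.
  exact: nus_xsection_measurable.
apply: eq_integral => s _; rewrite mul1r.
have mX : measurable (xsection B (s - scoord v)) by exact: measurable_xsection.
rewrite -(nus_translate eps_itv (s - scoord v) a b mX) /= -/v subrK.
by congr (nus _ _); apply/seteqP; split=> y; rewrite /xsection /= !inE.
Qed.

Let ls_gt0 := @ls_gt0 R.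
Let lu_gt0 := @lu_gt0 R.

Definition zdiv (z : RR) : RR := (ls^-1 * z.1, lu^-1 * z.2).

Lemma zdiv_measurable : measurable_fun setT zdiv.
Proof.
by apply: measurable_fun_pair; apply: measurable_funM => //.
Qed.

Lemma plane_wt_measurable (f : RR -> R) : measurable_fun setT f ->
  measurable_fun [set: RR] (fun z => (wt (f z))%:E).
Proof.
move=> mf; apply/measurable_EFinP; apply: measurable_funD => //; apply: measurable_funM => //.
apply: measurableT_comp; first by apply: continuous_measurable_fun; exact: continuous_cos.
exact: measurable_funM.
Qed.

(** Combine [nus_scale] on each unstable line with the substitution s -> ls s across the lines; the
    factor is 1 / (ls lu) = 1/3. On the torus this becomes stationarity. *)
Lemma mut_scale B : measurable B ->
  (mut B = (1 / 3)%:E * \int[mut]_(z in zdiv @^-1` B) (wt ((zdiv z).1 + (zdiv z).2))%:E)%E.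
Proof.
move=> mB.
have mD : measurable (zdiv @^-1` B).
  by rewrite -[X in measurable X]setTI; exact: zdiv_measurable.
have w0 t : (0 <= (wt t)%:E)%E by rewrite lee_fin ltW // wt_gt0.
have mw : measurable_fun [set: RR] (fun z => (wt ((zdiv z).1 + (zdiv z).2))%:E).
  by apply: plane_wt_measurable; apply: measurable_funD;
    apply: measurableT_comp => //; exact: zdiv_measurable.
pose f : RR -> \bar R := (fun z => (wt ((zdiv z).1 + (zdiv z).2))%:E) \_ (zdiv @^-1` B).
have mf : measurable_fun setT f by apply/(measurable_restrictT _ mD); exact: measurable_funTS.
have f0 z : (0 <= f z)%E by rewrite /f /patch; case: ifP.
rewrite integral_mkcond -/f mut_integral //.
pose h s := (\int[nus s]_y f (s, y))%E.
have mh : measurable_fun setT h by exact: inner_measurable.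
have h0 s : (0 <= h s)%E by apply: integral_ge0.
have := integral_affine 0 ls_gt0 mh h0 => /(congr1 (fun e => ((lu^-1)%:E * e)%E)).
rewrite muleA -EFinM -invfM (mulrC lu) ls_mul_lu div1r => <-.
have mh' : measurable_fun [set: mR] (fun s => h (ls * s + 0)).
  by apply: (measurableT_comp mh); exact: affine_measurable.
have lui0 : (0 <= lu^-1%:E)%E by rewrite lee_fin invr_ge0 ltW.
rewrite mutE -(ge0_integralZl leb measurableT mh' (fun s _ => h0 _) lui0).
apply: eq_integral => s _; rewrite addr0 nus_scale; last exact: measurable_xsection.
congr (_ * _)%E; rewrite integral_mkcond; apply: eq_integral => y _.
rewrite /f /patch /zdiv /= mulKf ?ls_neq0 //.
suff -> : (y \in (fun y => lu^-1 * y) @^-1` xsection B s) = ((ls * s, y) \in zdiv @^-1` B) by [].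
by apply/idP/idP; rewrite !inE /zdiv /xsection /= inE mulKf ?ls_neq0.
Qed.

(** [nus_distortion] on each line, integrated over [s]. Absolute continuity along stable leaves
    rests on this comparison with a genuine product. *)
Lemma mut_le (s0 d : R) (B : set RR) : measurable B -> 0 <= d -> (forall z, B z -> `|z.1 - s0| <= d) ->
  (mut B <= (distortion d)%:E * mut0 s0 B)%E /\
  (mut0 s0 B <= (distortion d)%:E * mut B)%E.
Proof.
move=> mB d0 Bd.
have dist x : `|x| <= d -> distortion `|x| <= distortion d :> R.
  move=> xd; rewrite /distortion ler_expR ler_wpM2l // divr_ge0 // subr_ge0 ltW //.
  exact: ls_lt1.
have K0 : 0 <= distortion d :> R by exact: expR_ge0.
have m1 := nus_xsection_measurable mB.
have m2 : measurable_fun [set: mR] (fun s => nus s0 (xsection B s)).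
  have mqB : measurable (qmap0 s0 @^-1` B).
    by rewrite -[X in measurable X]setTI; exact: qmap0_measurable.
  by have := measurable_fun_xsection leb mqB; congr (measurable_fun _ _).
have emp s : ~ `|s - s0| <= d -> xsection B s = set0.
  move=> sd; apply/seteqP; split=> // y; rewrite /xsection /= inE => /Bd; exact: sd.
have KE : (0 <= (distortion d : R)%:E)%E by rewrite lee_fin.
rewrite mutE mut0E.
have p1 (s : mR) : setT s -> (0 <= nus s (xsection B s))%E by move=> _; exact: measure_ge0.
have p2 (s : mR) : setT s -> (0 <= nus s0 (xsection B s))%E by move=> _; exact: measure_ge0.
have M1 : measurable_fun [set: mR] (fun x => (distortion d)%:E * nus x (xsection B x))%E.
  exact: (measurable_funeM (distortion d)%:E m1).
have M2 : measurable_fun [set: mR] (fun x => (distortion d)%:E * nus s0 (xsection B x))%E.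
  exact: (measurable_funeM (distortion d)%:E m2).
have e1 := ge0_integralZl leb measurableT m1 p1 KE.
have e2 := ge0_integralZl leb measurableT m2 p2 KE.
split.
- apply: (@le_trans _ _ (\int[leb]_x ((distortion d)%:E * nus s0 (xsection B x)))%E).
    refine (@ge0_le_integral _ _ _ leb setT measurableT _ _ p1 m1 M2 _) => s _.
    have [sd|/negP sd] := boolP (`|s - s0| <= d); last first.
      by rewrite emp // !measure0 mule0.
    apply: le_trans (nus_distortion eps_itv s s0 (measurable_xsection s mB)) _.
    by apply: lee_wpmul2r; [exact: measure_ge0|rewrite lee_fin dist].
  by rewrite le_eqVlt; apply/orP; left; apply/eqP; exact: e2.
- apply: (@le_trans _ _ (\int[leb]_x ((distortion d)%:E * nus x (xsection B x)))%E).
    refine (@ge0_le_integral _ _ _ leb setT measurableT _ _ p2 m2 M1 _) => s _.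
    have [sd|/negP sd] := boolP (`|s - s0| <= d); last first.
      by rewrite emp // !measure0 mule0.
    apply: le_trans (nus_distortion eps_itv s0 s (measurable_xsection s mB)) _.
    by apply: lee_wpmul2r; [exact: measure_ge0|rewrite lee_fin distrC dist].
  by rewrite le_eqVlt; apply/orP; left; apply/eqP; exact: e1.
Qed.

Lemma mut0_rect s0 (I E : set mR) : measurable I -> measurable E ->
  mut0 s0 (I `*` E) = (leb I * nus s0 E)%E.
Proof.
move=> mI mE; rewrite /mut0 /= /pushforward.
have -> : qmap0 s0 @^-1` (I `*` E) = I `*` ((fun p => quant (s0, p)) @^-1` E).
  by apply/seteqP; split=> z.
rewrite product_measure1E // -[X in measurable X]setTI.
exact: quantr_measurable.
Qed.

Lemma mut0_null s0 (X : set RR) : measurable X -> (forall u, leb (ysection X u) = 0%E) ->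
  mut0 s0 X = 0%E.
Proof.
move=> mX X0; have mqX : measurable (qmap0 s0 @^-1` X).
  by rewrite -[X in measurable X]setTI; exact: qmap0_measurable.
transitivity ((leb \x^ leb) (qmap0 s0 @^-1` X))%E.
  apply: (@product_measure_unique _ _ _ _ R leb leb (leb \x^ leb)%E) mqX => A1 A2 mA1 mA2.
  exact: (product_measure2E leb leb mA1 mA2).
rewrite /product_measure2 integral0_eq // => p _ /=.
by rewrite -(X0 (quant (s0, p))); congr leb.
Qed.

Definition square (M : R) : set RR := `](- M), M]%classic `*` `](- M), M]%classic.

Lemma mut_bounded (M : R) : 0 <= M -> (mut (square M) < +oo)%E.
Proof.
move=> M0; set B := square M.
have mB : measurable B by apply: measurableX; exact: measurable_itv.
have [] := @mut_le 0 M B mB M0.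
  by move=> z [] /=; rewrite in_itv /= subr0 ler_norml => /andP[/ltW -> ->].
move=> h _; apply: le_lt_trans h _; rewrite mut0_rect //.
rewrite lebesgue_measure_oc ?nus_oc; last 2 first.
- by lra.
- by lra.
by rewrite -!EFinM ltry.
Qed.

Lemma mutT : mut setT = +oo%E.
Proof.
have h : leb [set: mR] = +oo%E by rewrite -set_itvNyy lebesgue_measure_itv.
transitivity ((leb \x leb) ([set: mR] `*` [set: mR]))%E; first by rewrite setXTT.
transitivity (leb [set: mR] * leb [set: mR])%E; last by rewrite h mulyy.
exact: product_measure1E.
Qed.

End plane_measure_theory.

Section lebesgue_case.
Context {R : realType}.

Lemma flim_eps0 (s u : R) : flim 0 s u = u.
Proof.
have F n : fprim 0 n s u = u by elim: n => //= n ->; rewrite mul0r addr0.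
have h : 0 <= (0 : R) <= 1 / 2 by rewrite lexx /= divr_ge0.
apply/eqP; rewrite -subr_eq0 -normr_le0.
apply: (@le_half_exp _ _ _ 1) => // n; rewrite add0r mul1r.
by have := flim_near h n s u; rewrite F.
Qed.

End lebesgue_case.

Section mk_probability.
Context d (T : measurableType d) (R : realType).
Variables (m : measure T R) (m1 : m setT = 1%E).

Definition measure_fun : set T -> \bar R := m.
HB.instance Definition _ := Measure.on measure_fun.
HB.instance Definition _ := Measure_isProbability.Build d T R measure_fun m1.
Definition mk_probability : probability T R := [the probability T R of measure_fun].

End mk_probability.

(** * From the plane to the torus: fundamental domain and lattice translates *)

Section torus_charts.
Context {R : realType}.
Local Notation ls := (lams R).
Local Notation lu := (lamu R).
Local Notation mR := (measurableTypeR R).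
Local Notation RR := (measurableTypeR R * measurableTypeR R)%type.
Implicit Types (x y : torus R) (z : RR) (v : 'rV[R]_2).

Definition pvec z : 'rV[R]_2 := svec z.1 z.2.
Definition pproj z : torus R := torus_proj (pvec z).

Lemma pvec_inj : injective pvec.
Proof. by move=> [s u] [s' u'] /svec_inj /= [-> ->]. Qed.

Definition vcoord v : RR := (scoord v, ucoord v).

Lemma vcoordK v : pvec (vcoord v) = v. Proof. exact: svecK. Qed.

Lemma pvecK z : vcoord (pvec z) = z.
Proof. by apply: pvec_inj; rewrite vcoordK. Qed.

Lemma enorm_pvec_lt z (d : R) : 0 < d -> `|z.1| < d -> `|z.2| < d -> enorm (pvec z) < 12 * d.
Proof.
move=> d0 h1 h2.
have l1 := @ls_itv R; have l2 := @lu_itv R.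
have b : forall i, `|pvec z 0 i| <= 5 * d.
  have n1 : `|(ls - 1) * z.1| <= d.
    rewrite normrM -[leRHS]mul1r; apply: ler_pM => //; last exact: ltW.
    by rewrite ler_norml; lra.
  have n2 : `|(lu - 1) * z.2| <= 4 * d.
    rewrite normrM; apply: ler_pM => //; last exact: ltW.
    by rewrite ler_norml; lra.
  move=> i; rewrite mxE; case: ifP => _; apply: le_trans (ler_normD _ _) _; lra.
by apply: le_lt_trans (enorm_le_coord (b 0) (b 1)) _; lra.
Qed.

Lemma affine_plane_measurable (x0 : torus R) (L : 'M[R]_2) :
  measurable_fun setT (fun z => x0 + torus_proj (pvec z *m L)).
Proof.
apply: torus_measurable_fun => U oU; apply: plane_open_measurable.
rewrite openE => z /= Uz.
have /nbhs_torusP[d d0 dU] : nbhs (x0 + torus_proj (pvec z *m L)) U by exact: open_nbhs_nbhs.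
have [e e0 eL] := mulmx_small L d0.
have e12 : 0 < e / 12 by rewrite divr_gt0.
exists (ball z.1 (e / 12), ball z.2 (e / 12)); first by split; exact: nbhsx_ballx.
move=> [s u] [] /=; rewrite /ball /= => hs hu.
have -> : pvec (s, u) = pvec z + pvec (s - z.1, u - z.2).
  by rewrite /pvec svecD /= !subrKC || (rewrite /pvec svecD /=; congr svec; ring).
rewrite mulmxDl tprojD addrA; apply: dU; apply: eL.
rewrite (_ : e = 12 * (e / 12)); last by field.
by apply: enorm_pvec_lt => //=; rewrite distrC.
Qed.

Lemma pproj_measurable : measurable_fun setT pproj.
Proof.
have := affine_plane_measurable 0 1%:M; congr (measurable_fun _ _).
by apply/funext => z; rewrite add0r mulmx1.
Qed.

Lemma torus_continuous_measurable (f : torus R -> R) : continuous f ->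
  measurable_fun setT (f : torus R -> mR).
Proof.
move=> /continuousP fc; apply: (measurability _ (RGenOpens.measurableE R)) => _ [_ [a [b ->]] <-].
by rewrite setTI; apply: torus_open_measurable; apply: fc; exact: itv_open.
Qed.

(* The representative of a point of the torus in [0, 1[^2. *)
Definition tfrac (i : 'I_2) x : R := repr x 0 i - (Num.floor (repr x 0 i))%:~R.

Lemma tfrac_itv i x : 0 <= tfrac i x < 1. Proof. exact: fracB_itv. Qed.

Lemma tfrac_proj i v : tfrac i (torus_proj v) = v 0 i - (Num.floor (v 0 i))%:~R.
Proof.
have /tproj_eqP[a [b e]] := tproj_repr (torus_proj v).
have [k ek] : exists k : int, repr (torus_proj v) 0 i = v 0 i + k%:~R.
  by rewrite e !mxE; case: ifP => _; [exists a|exists b].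
rewrite /tfrac ek (_ : Num.floor (v 0 i + k%:~R) = Num.floor (v 0 i) + k); last first.
  by apply: floor_def; have := floor_itv (v 0 i); rewrite !intrD; lra.
by rewrite intrD; ring.
Qed.

Lemma tfrac_measurable i : measurable_fun setT (tfrac i : torus R -> mR).
Proof.
apply: (measurability _ (RGenOInfty.measurableE R)) => _ [_ [c ->] <-].
rewrite setTI; have [c0|c0] := ltP c 0.
  rewrite (_ : _ @^-1` _ = setT) //; apply/seteqP; split=> // x _ /=.
  by rewrite in_itv /= andbT; have := tfrac_itv i x; lra.
suff oA : open [set x : torus R | c < tfrac i x].
  rewrite (_ : _ @^-1` _ = [set x : torus R | c < tfrac i x]); first exact: torus_open_measurable.
  by apply/seteqP; split=> x /=; rewrite in_itv /= andbT.
rewrite openE => x /= cx.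
apply/nbhs_torusP; exists (Num.min (tfrac i x - c) (1 - tfrac i x)).
  by have := tfrac_itv i x; move: cx; rewrite lt_min => h1 h2; apply/andP; split; lra.
move=> h; rewrite lt_min => /andP[h1 h2] /=.
have ch := enorm_coord h i; move: ch; rewrite ler_norml => ch.
rewrite -{1}(tproj_repr x) -tprojD tfrac_proj mxE.
have -> : Num.floor (repr x 0 i + h 0 i) = Num.floor (repr x 0 i).
  by apply: floor_def; rewrite intrD; move: h1 h2 cx; rewrite /tfrac; lra.
by move: h1 h2; rewrite /tfrac; lra.
Qed.

(** A Borel section of [pproj] with values in the unit square, in eigenbasis coordinates; its range
    is [fdom]. *)
Definition loc x : RR := vcoord (vec2 (tfrac 0 x) (tfrac 1 x)).

Lemma pproj_loc x : pproj (loc x) = x.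
Proof.
rewrite /pproj vcoordK -[RHS]tproj_repr; apply/esym/tproj_eqP.
exists (Num.floor (repr x 0 0)), (Num.floor (repr x 0 1)).
by apply: row2P; rewrite !mxE /= /tfrac subrK.
Qed.

Lemma loc_measurable : measurable_fun setT loc.
Proof.
have m0 := tfrac_measurable 0; have m1 := tfrac_measurable 1.
apply: measurable_fun_pair; rewrite /scoord /ucoord.
  apply: measurable_funM => //; rewrite (_ : (fun x => _) = (fun x => (lu - 1) * tfrac 0 x - tfrac 1 x)).
    by apply: measurable_funB => //; exact: measurable_funM.
  by apply/funext => x; rewrite !mxE.
apply: measurable_funM => //; rewrite (_ : (fun x => _) = (fun x => tfrac 1 x - (ls - 1) * tfrac 0 x)).
  by apply: measurable_funB => //; exact: measurable_funM.
by apply/funext => x; rewrite !mxE.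
Qed.

Definition fdom : set RR := [set z | loc (pproj z) = z].

Lemma fdom_loc x : fdom (loc x).
Proof. by rewrite /fdom /= pproj_loc. Qed.

Lemma fdomP z : fdom z <-> forall i, 0 <= pvec z 0 i < 1.
Proof.
split=> [<- i|h].
  by rewrite vcoordK mxE; case: ifP => _; exact: tfrac_itv.
have fl i : Num.floor (pvec z 0 i) = 0 by apply: floor_def; rewrite add0r; exact: h.
rewrite /fdom /= /loc !tfrac_proj !fl !subr0 -[RHS]pvecK; congr vcoord.
by apply: row2P; rewrite !mxE.
Qed.

Lemma fdom_inj z z' : fdom z -> fdom z' -> pproj z = pproj z' -> z = z'.
Proof.
move=> e e' h; transitivity (loc (pproj z)); first exact: esym e.
by rewrite h; exact: e'.
Qed.

Lemma fdom_measurable : measurable fdom.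
Proof.
have mz : measurable_fun setT (fun z => loc (pproj z)).
  by apply: measurableT_comp; [exact: loc_measurable|exact: pproj_measurable].
have m1 : measurable_fun setT (fun z => (loc (pproj z)).1 - z.1).
  by apply: measurable_funB => //; apply: measurableT_comp.
have m2 : measurable_fun setT (fun z => (loc (pproj z)).2 - z.2).
  by apply: measurable_funB => //; apply: measurableT_comp.
rewrite (_ : fdom = (setT `&` (fun z => (loc (pproj z)).1 - z.1) @^-1` [set 0]) `&`
                    (setT `&` (fun z => (loc (pproj z)).2 - z.2) @^-1` [set 0])).
  by apply: measurableI; [apply: m1|apply: m2] => //; exact: measurable_set1.
apply/seteqP; split=> [z /= <-|z /= [[_ /eqP e1] [_ /eqP e2]]].
  by rewrite pproj_loc !subrr.
move: e1 e2; rewrite !subr_eq0 => /eqP e1 /eqP e2.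
by rewrite /fdom /= /loc /vcoord e1 e2 -surjective_pairing.
Qed.

Lemma fdom_square : fdom `<=` square 3.
Proof.
move=> z /fdomP h; have h0 := h 0; have h1 := h 1.
have l1 := @ls_itv R; have l2 := @lu_itv R.
rewrite -[z]pvecK /square; split; rewrite /= in_itv /= /scoord /ucoord;
  rewrite ltr_pdivlMr ?ler_pdivrMr; try lra.
- have : 0 <= (lu - 1) * pvec z 0 0 <= (lu - 1) * 1.
    by rewrite mulr_ge0 ?ler_wpM2l //; lra.
  lra.
- have : (1 - ls) * 0 <= (1 - ls) * pvec z 0 0 <= (1 - ls) * 1.
    by rewrite !ler_wpM2l //; lra.
  lra.
Qed.

Lemma square_measurable (M : R) : measurable (square M).
Proof. by apply: measurableX; exact: measurable_itv. Qed.

Definition ptrans (k : int * int) z : RR :=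
  (z.1 - scoord (vec2 k.1%:~R k.2%:~R), z.2 - ucoord (vec2 k.1%:~R k.2%:~R)).

Lemma pvec_ptrans k z : pvec (ptrans k z) = pvec z - vec2 k.1%:~R k.2%:~R.
Proof. by rewrite -[in RHS](vcoordK (vec2 _ _)) /pvec svecN svecD. Qed.

Lemma pproj_ptrans k z : pproj (ptrans k z) = pproj z.
Proof. by rewrite /pproj pvec_ptrans tprojB tproj_int subr0. Qed.

Lemma ptrans_ex z z' : pproj z = pproj z' -> exists k, z = ptrans k z'.
Proof.
move=> /tproj_eqP[a [b e]]; exists (- a, - b); apply: pvec_inj.
by rewrite pvec_ptrans e; apply: row2P; rewrite !mxE /= !mulrNz opprK.
Qed.

Lemma ptrans_inj k k' z : ptrans k z = ptrans k' z -> k = k'.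
Proof.
move/(congr1 pvec); rewrite !pvec_ptrans => /addrI/oppr_inj e.
case: k k' e => [a b] [a' b'] /= /rowP e.
have := e 0; have := e 1; rewrite !mxE /= => /intr_inj -> /intr_inj -> //.
Qed.

Lemma ptrans_measurable k : measurable_fun setT (ptrans k).
Proof. by apply: measurable_fun_pair; apply: measurable_funB. Qed.

(* Lattice translates of [X] cut along the fundamental domain. *)
Definition sat (X : set RR) : set RR := [set z | fdom z /\ exists2 z', X z' & pproj z' = pproj z].

Definition piece (X : set RR) (n : nat) : set RR :=
  if pickle_inv n is Some k then X `&` ptrans k @^-1` fdom else set0.
Definition piece' (X : set RR) (n : nat) : set RR :=
  if pickle_inv n is Some k then ptrans (- k.1, - k.2) @^-1` X `&` fdom else set0.

Lemma ptransK k z : ptrans (- k.1, - k.2) (ptrans k z) = z.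
Proof.
apply: pvec_inj; rewrite !pvec_ptrans; apply: row2P; rewrite !mxE /= !mulrNz; ring.
Qed.

Lemma ptransNK k z : ptrans k (ptrans (- k.1, - k.2) z) = z.
Proof.
apply: pvec_inj; rewrite !pvec_ptrans; apply: row2P; rewrite !mxE /= !mulrNz; ring.
Qed.

Lemma preim_measurable d1 d2 (T1 : measurableType d1) (T2 : measurableType d2) (f : T1 -> T2)
  (B : set T2) : measurable_fun setT f -> measurable B -> measurable (f @^-1` B).
Proof. by move=> mf mB; rewrite -[X in measurable X]setTI; exact: mf. Qed.

Lemma piece_measurable X n : measurable X -> measurable (piece X n).
Proof.
move=> mX; rewrite /piece; case: pickle_inv => // k; apply: measurableI => //.
exact: preim_measurable (ptrans_measurable k) fdom_measurable.
Qed.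

Lemma piece'_measurable X n : measurable X -> measurable (piece' X n).
Proof.
move=> mX; rewrite /piece'; case: pickle_inv => // k; apply: measurableI => //.
  exact: preim_measurable (ptrans_measurable _) mX.
exact: fdom_measurable.
Qed.

Lemma bigcup_piece X : \bigcup_n piece X n = X.
Proof.
apply/seteqP; split=> [z [n _]|z Xz].
  by rewrite /piece; case: pickle_inv => // k [].
have [k ek] := ptrans_ex (pproj_loc (pproj z)).
exists (pickle k); first exact: I.
rewrite /piece (pickleK_inv k); split; first exact: Xz.
by rewrite /preimage /mkset -ek; exact: fdom_loc.
Qed.

Lemma bigcup_piece' X : \bigcup_n piece' X n = sat X.
Proof.
apply/seteqP; split=> [z [n _]|z [fz [z' Xz' e]]].
  rewrite /piece'; case: pickle_inv => // k [Xz fz]; split=> //.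
  by exists (ptrans (- k.1, - k.2) z) => //; exact: pproj_ptrans.
have [k ek] := ptrans_ex e; exists (pickle (- k.1, - k.2)); first exact: I.
rewrite /piece' (pickleK_inv (- k.1, - k.2)); split; last exact: fz.
by rewrite /preimage /mkset !opprK -surjective_pairing -ek.
Qed.

Lemma sat_measurable X : measurable X -> measurable (sat X).
Proof.
move=> mX; rewrite -bigcup_piece'; apply: bigcup_measurable => n _.
exact: piece'_measurable.
Qed.

Lemma pickle_inv_eq n (k : int * int) : pickle_inv n = Some k -> pickle k = n.
Proof. by move=> e; have := @pickle_invK (int * int)%type n; rewrite e. Qed.

Lemma trivIset_piece X : trivIset setT (piece X).
Proof.
apply/trivIsetP => n m _ _ /eqP nm; apply/seteqP; split=> // z [].
rewrite /piece; case en : (pickle_inv n) => [k|//]; case em : (pickle_inv m) => [k'|//].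
move=> [_ /= f1] [_ /= f2]; apply: nm.
have e : ptrans k z = ptrans k' z by apply: fdom_inj => //; rewrite !pproj_ptrans.
by rewrite -(pickle_inv_eq en) -(pickle_inv_eq em) (ptrans_inj e).
Qed.

Lemma trivIset_piece' X : (forall z z', X z -> X z' -> pproj z = pproj z' -> z = z') ->
  trivIset setT (piece' X).
Proof.
move=> Xinj; apply/trivIsetP => n m _ _ /eqP nm; apply/seteqP; split=> // z [].
rewrite /piece'; case en : (pickle_inv n) => [k|//]; case em : (pickle_inv m) => [k'|//].
move=> [/= f1 _] [/= f2 _]; apply: nm.
have /ptrans_inj[e1 e2] : ptrans (- k.1, - k.2) z = ptrans (- k'.1, - k'.2) z.
  by apply: Xinj => //; rewrite !pproj_ptrans.
rewrite -(pickle_inv_eq en) -(pickle_inv_eq em); congr pickle.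
by rewrite [k]surjective_pairing [k']surjective_pairing (oppr_inj e1) (oppr_inj e2).
Qed.

Section invariant_measure.
Variables (eps : R) (eps_itv : 0 <= eps <= 1 / 2).
Local Notation mut := (mut eps_itv).

Lemma mut_ptrans k (B : set RR) : measurable B -> mut (ptrans k @^-1` B) = mut B.
Proof. exact: mut_translate. Qed.

(* If the torus projection is injective on [X], moving the pieces of [X] back to
   the fundamental domain preserves the measure. *)
Lemma mut_sat (X : set RR) : measurable X ->
  (forall z z', X z -> X z' -> pproj z = pproj z' -> z = z') ->
  mut X = mut (sat X).
Proof.
move=> mX Xinj.
have mp n : measurable (piece X n) by exact: piece_measurable.
have mp' n : measurable (piece' X n) by exact: piece'_measurable.
have e1 := measure_bigcup mut setT (piece X) (fun n _ => mp n) (@trivIset_piece X).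
have e2 := measure_bigcup mut setT (piece' X) (fun n _ => mp' n) (@trivIset_piece' X Xinj).
rewrite bigcup_piece in e1; rewrite bigcup_piece' in e2.
apply: (eq_trans e1); apply: (eq_trans _ (esym e2)).
apply: eq_eseriesr => n _; rewrite /piece /piece'; case: pickle_inv => [k|]; last by rewrite !measure0.
rewrite -[RHS](@mut_ptrans k); last first.
  exact: measurableI (preim_measurable (ptrans_measurable _) mX) fdom_measurable.
by congr (mut _); apply/seteqP; split=> z [/= h1 h2]; split=> //=; move: h1; rewrite ptransK.
Qed.

Lemma mut_fdom_lty : (mut fdom < +oo)%E.
Proof.
have M3 : (0 : R) <= 3 by [].
apply: le_lt_trans (mut_bounded eps_itv M3).
apply: le_measure; rewrite ?inE; [exact: fdom_measurable|exact: square_measurable|exact: fdom_square].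
Qed.

(** Otherwise all lattice translates of the fundamental domain would be null, whereas the plane has
    infinite measure. *)
Lemma mut_fdom_gt0 : (0 < mut fdom)%E.
Proof.
rewrite lt_def measure_ge0 andbT; apply/eqP => f0.
have : mut setT = 0%E.
  apply/eqP; rewrite -measure_le0 -(bigcup_piece setT).
  have mp n : measurable (piece setT n) by exact: piece_measurable.
  apply: (@le_trans _ _ (\sum_(n <oo) mut (piece setT n))%E).
    apply: measure_sigma_subadditive => //; exact: bigcup_measurable.
  rewrite eseries0 // => n _ _; rewrite /piece; case: pickle_inv => [k|]; last exact: measure0.
  by rewrite setTI mut_ptrans ?f0 //; exact: fdom_measurable.
by rewrite mutT.
Qed.

Definition tnorm : R := (fine (mut fdom))^-1.

Lemma tnorm_gt0 : 0 < tnorm.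
Proof.
by rewrite invr_gt0 fine_gt0 // mut_fdom_lty mut_fdom_gt0.
Qed.

Let tnorm_ge0 : 0 <= tnorm. Proof. exact: ltW tnorm_gt0. Qed.

Definition tmeas : measure (torus R) R :=
  mscale (NngNum tnorm_ge0) (image_measure (mrestr mut fdom_measurable) pproj_measurable).

Lemma tmeasE (B : set (torus R)) : tmeas B = (tnorm%:E * mut (pproj @^-1` B `&` fdom))%E.
Proof. by []. Qed.

Lemma tmeasT : tmeas setT = 1%E.
Proof.
rewrite tmeasE preimage_setT setTI -(fineK (x := mut fdom)); last first.
  by rewrite ge0_fin_numE ?mut_fdom_lty.
by rewrite -EFinM mulVf // gt_eqF // fine_gt0 // mut_fdom_lty mut_fdom_gt0.
Qed.

Definition tprob : probability (torus R) R :=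
  mk_probability tmeasT.

Lemma tprobE B : tprob B = (tnorm%:E * mut (pproj @^-1` B `&` fdom))%E.
Proof. by []. Qed.

(** Invariance of [mut] under the lattice lets any set on which the projection is injective replace
    the fundamental domain. *)
Lemma tprob_chart (X : set RR) (D : set (torus R)) : measurable X -> measurable D ->
  (forall z z', X z -> X z' -> pproj z = pproj z' -> z = z') -> D `<=` pproj @` X ->
  tprob D = (tnorm%:E * mut (pproj @^-1` D `&` X))%E.
Proof.
move=> mX mD Xinj DX; rewrite tprobE.
have mPD : measurable (pproj @^-1` D) by exact: preim_measurable pproj_measurable mD.
congr (_ * _)%E; rewrite [RHS]mut_sat; last 2 first.
- exact: measurableI.
- by move=> z z' [_ ?] [_ ?]; exact: Xinj.
congr (mut _); apply/seteqP; split=> z.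
  move=> [/= Dz fz]; split=> //; have [z' Xz' e] := DX _ Dz.
  by exists z' => //; split=> //=; rewrite e.
by move=> [fz [z' [/= Dz' _] e]]; split=> //=; rewrite -e.
Qed.

End invariant_measure.

End torus_charts.

Section measure_integrals.
Context d (T : measurableType d) (R : realType).

Lemma integral_mrestr (m : measure T R) (D E : set T) (mD : measurable D) (f : T -> \bar R) :
  measurable E -> measurable_fun setT f -> (forall x, 0 <= f x)%E ->
  (\int[mrestr m mD]_(x in E) f x = \int[m]_(x in E `&` D) f x)%E.
Proof.
move=> mE mf f0; have mDc : measurable (~` D) by exact: measurableC.
have mED : measurable (E `&` D) by exact: measurableI.
have mfr (A : set T) : measurable_fun A f by exact: measurable_funS mf.
have f0r (A : set T) x : A x -> (0 <= f x)%E by move=> _; exact: f0.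
have mE' : forall A, measurable A -> A `<=` E `&` D ->
    m A = measure_add (mrestr m mD) (mrestr m mDc) A.
  move=> A mA _; rewrite measure_addE /mrestr -{1}(setIT A) -(setUv D) setIUr measureU //;
    [exact: measurableI|exact: measurableI|].
  by rewrite setIACA setICr setI0.
rewrite (eq_measure_integral (measure_add (mrestr m mD) (mrestr m mDc))) //.
rewrite (ge0_integral_measure_add _ _ mED (f0r _) (mfr _)).
have n1 : mrestr m mDc D = 0%E by rewrite /mrestr setICr measure0.
have n2 : mrestr m mD (~` D) = 0%E by rewrite /mrestr setICl measure0.
rewrite [X in (_ + X)%E](_ : _ = 0%E) ?adde0; last first.
  rewrite (ge0_negligible_integral mD mED (mfr _) (f0r _) n1).
  by rewrite setDE -setIA setICr setI0 integral_set0.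
by rewrite (ge0_negligible_integral mDc mE (mfr _) (f0r _) n2) setDE setCK.
Qed.

End measure_integrals.

(** * Inverse branches, weights and stationarity *)

Section stationarity.
Context {R : realType}.
Local Notation ls := (lams R).
Local Notation lu := (lamu R).
Local Notation mR := (measurableTypeR R).
Local Notation RR := (measurableTypeR R * measurableTypeR R)%type.
Implicit Types (x y : torus R) (z : RR) (v : 'rV[R]_2) (j : 'I_3).

Lemma torus_eq_measurable d (T : measurableType d) (f g : T -> torus R) :
  measurable_fun setT f -> measurable_fun setT g -> measurable [set t | f t = g t].
Proof.
move=> mf mg.
have ml (i : (RR -> mR)) (mi : measurable_fun setT i) :
    measurable_fun setT (fun t => i (loc (f t)) - i (loc (g t))).
  by apply: measurable_funB; apply: measurableT_comp => //; apply: measurableT_comp => //; exact: loc_measurable.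
rewrite (_ : [set t | f t = g t] =
    (setT `&` (fun t => (loc (f t)).1 - (loc (g t)).1) @^-1` [set 0]) `&`
    (setT `&` (fun t => (loc (f t)).2 - (loc (g t)).2) @^-1` [set 0])).
  by apply: measurableI; [apply: (ml fst)|apply: (ml snd)] => //; exact: measurable_set1.
apply/seteqP; split=> [t /= ->|t /= [[_ /eqP e1] [_ /eqP e2]]]; first by rewrite !subrr.
move: e1 e2; rewrite !subr_eq0 => /eqP e1 /eqP e2.
by rewrite -[f t]pproj_loc -[g t]pproj_loc /loc /vcoord e1 e2.
Qed.

(** Representatives of the kernel of [tmap], a group of order 3. *)
Definition qv j : 'rV[R]_2 := vec2 (j%:R / 3) (2 * j%:R / 3).

(* The three preimages of [x]. *)
Definition tsec j x : torus R := torus_proj (pvec (loc x) *m bmx + qv j).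

Lemma tmap_qv j : tmap (torus_proj (qv j)) = 0.
Proof.
rewrite tmap_proj mul_amx !mxE /=.
have -> : vec2 (j%:R / 3 + 2 * j%:R / 3) (j%:R / 3 + 4 * (2 * j%:R / 3)) =
    vec2 (j%:Z%:~R : R) ((3 * j)%N%:Z%:~R).
  by apply: row2P; rewrite !mxE /= -!pmulrn ?natrM; field.
exact: tproj_int.
Qed.

Lemma tmap_tsec j x : tmap (tsec j x) = x.
Proof. rewrite /tsec tprojD tmapD tmap_qv addr0 tmap_proj mulBAK; exact: pproj_loc. Qed.

Lemma tsec_measurable j : measurable_fun setT (tsec j).
Proof.
have := measurableT_comp (affine_plane_measurable (torus_proj (qv j)) bmx) loc_measurable.
by congr (measurable_fun _ _); apply/funext => x; rewrite /= /tsec addrC tprojD.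
Qed.

Lemma tmap_fiber x y : tmap x = tmap y -> exists j, x = y + torus_proj (qv j).
Proof.
rewrite -(tproj_repr x) -(tproj_repr y) !tmap_proj => /tproj_eqP[a [b e]].
have {}e : repr x = repr y + vec2 a%:~R b%:~R *m bmx.
  by rewrite -[LHS]mulABK e mulmxDl mulABK.
(* The class of a - b modulo 3 decides which kernel element separates the two points. *)
have [k [j0 [jlt ek]]] : exists k : int, exists j : nat, (j < 3)%N /\ a - b = 3 * k + j%:Z.
  exists (divz (a - b) 3), (absz (modz (a - b) 3)).
  have p3 : (0 < 3 :> int) by [].
  have h1 := modz_ge0 (a - b) (lt0r_neq0 p3); have h2 := ltz_pmod (a - b) p3.
  by split; [lia|rewrite gez0_abs // mulrC -divz_eq].
exists (Ordinal jlt); rewrite e tprojD; congr (_ + _).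
apply/tproj_eqP; exists (k + a), (- k - j0%:Z).
have {}ek : a%:~R - b%:~R = 3 * k%:~R + j0%:R :> R.
  by rewrite -(intrD _ a (- b)) -intrB ek intrD intrM -pmulrn || rewrite -intrB ek intrD intrM.
rewrite mul_bmx !mxE /=; apply: row2P; rewrite !mxE /= ?intrB ?intrD ?intrN -?pmulrn; lra.
Qed.

Lemma tsecE j x : tsec j x = tsec 0 x + torus_proj (qv j).
Proof.
rewrite /tsec !tprojD -addrA; congr (_ + _).
rewrite (_ : qv 0 = 0) ?tproj0 ?add0r //.
by apply: row2P; rewrite !mxE /= ?mulr0 ?mul0r.
Qed.

Lemma tsec_tmap y : exists j, tsec j (tmap y) = y.
Proof.
have [j e] : exists j, y = tsec 0 (tmap y) + torus_proj (qv j).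
  by apply: tmap_fiber; rewrite tmap_tsec.
by exists j; rewrite tsecE.
Qed.

Lemma tsec_inj j j' x : tsec j x = tsec j' x -> j = j'.
Proof.
rewrite tsecE (tsecE j') => /addrI /tproj_eqP[a [b /rowP/(_ 0)]].
rewrite !mxE /= => e; apply/ord_inj.
have {}e : (Posz j)%:~R = (Posz j' + 3 * a)%:~R :> R by rewrite intrD intrM -!pmulrn; lra.
by move: e => /intr_inj; have := ltn_ord j; have := ltn_ord j'; lia.
Qed.

Section weights.
Variables (eps : R) (eps_itv : 0 <= eps <= 1 / 2).
Local Notation mut := (mut eps_itv).
Local Notation tprob := (tprob eps_itv).

Definition tw y : R := wt eps (tfrac 0 y) / 3.

Lemma tw_proj v : tw (torus_proj v) = wt eps (v 0 0) / 3.
Proof. by rewrite /tw tfrac_proj -[in LHS]mulrNz wtD_int. Qed.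

Lemma tw_itv y : 1 / 6 <= tw y <= 1 / 2.
Proof. by have := wt_itv eps_itv (tfrac 0 y); rewrite /tw; lra. Qed.

Lemma tw_gt0 y : 0 < tw y.
Proof. by have := tw_itv y; lra. Qed.

Lemma tw_measurable : measurable_fun setT (tw : torus R -> mR).
Proof.
have m1 : measurable_fun [set: torus R] (wt eps \o tfrac 0).
  apply: measurableT_comp (tfrac_measurable 0).
  apply: measurable_funD => //; apply: measurable_funM => //.
  apply: measurableT_comp; first by apply: continuous_measurable_fun; exact: continuous_cos.
  exact: measurable_funM.
exact: measurable_funM m1 (measurable_cst _).
Qed.

Lemma tw_tsec j x : tw (tsec j x) = wt eps ((pvec (loc x) *m bmx) 0 0 + j%:R / 3) / 3.
Proof. by rewrite /tsec tw_proj !mxE. Qed.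

Lemma sum_tw x : \sum_j tw (tsec j x) = 1.
Proof.
rewrite !big_ord_recl big_ord0 !tw_tsec /= mul0r addr0.
by have := sum3_wt eps ((pvec (loc x) *m bmx) 0 0); rewrite /bump /=; lra.
Qed.

(** The part of the image of the fundamental domain under the linear map on which the inverse branch
    is [tsec j]. That image has three times the area and is cut into three charts, each covering the
    torus once. *)
Definition tchart j : set RR := [set z | fdom (zdiv z) /\ pproj (zdiv z) = tsec j (pproj z)].

Lemma pproj_zdiv z : tmap (pproj (zdiv z)) = pproj z.
Proof. by rewrite /pproj tmap_proj /pvec svec_amx /= !mulrA !divff ?ls_neq0 ?lu_neq0 // !mul1r. Qed.

Lemma tchart_measurable j : measurable (tchart j).
Proof.
apply: measurableI; first exact: preim_measurable zdiv_measurable fdom_measurable.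
apply: torus_eq_measurable.
  by apply: measurableT_comp; [exact: pproj_measurable|exact: zdiv_measurable].
by apply: measurableT_comp; [exact: tsec_measurable|exact: pproj_measurable].
Qed.

Lemma zdiv_inj : injective (@zdiv R).
Proof.
move=> [a b] [a' b'] [/mulfI e1 /mulfI e2].
by rewrite e1 ?e2 // invr_neq0 ?ls_neq0 ?lu_neq0.
Qed.

Lemma tchart_inj j z z' : tchart j z -> tchart j z' -> pproj z = pproj z' -> z = z'.
Proof. by move=> [f1 e1] [f2 e2] e; apply/zdiv_inj/fdom_inj => //; rewrite e1 e2 e. Qed.

Lemma tchart_surj j x : (pproj @` tchart j) x.
Proof.
pose a := loc (tsec j x); pose z : RR := (ls * a.1, lu * a.2).
have ez : zdiv z = a.
  by rewrite /zdiv /z /= !mulKf ?ls_neq0 ?lu_neq0 //; case: (a).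
have pz : pproj z = x by rewrite -pproj_zdiv ez /a pproj_loc tmap_tsec.
by exists z => //; split; rewrite ez; [exact: fdom_loc|rewrite pproj_loc pz].
Qed.

Lemma integral_tprob_chart j (E : set (torus R)) (f : torus R -> \bar R) :
  measurable E -> measurable_fun setT f -> (forall x, 0 <= f x)%E ->
  (\int[tprob]_(x in E) f x =
   (tnorm eps_itv)%:E * \int[mut]_(z in pproj @^-1` E `&` tchart j) f (pproj z))%E.
Proof.
move=> mE mf f0; have n0 := ltW (tnorm_gt0 eps_itv).
pose m1 := image_measure (mrestr mut (tchart_measurable j)) pproj_measurable.
have mfE : measurable_fun E f by exact: measurable_funS mf.
have f0E x : E x -> (0 <= f x)%E by move=> _.
rewrite (eq_measure_integral (mscale (NngNum n0) m1)); last first.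
  move=> A mA _; apply: (eq_trans (@tprob_chart _ _ eps_itv (tchart j) A _ mA _ _)) => //.
  - exact: tchart_measurable.
  - exact: tchart_inj.
  - by move=> x _; exact: tchart_surj.
rewrite (@ge0_integral_mscale _ _ _ m1 _ mE (NngNum n0) _ mfE f0E); congr (_ * _)%E.
apply: (eq_trans (ge0_integral_pushforward pproj_measurable (mrestr mut (tchart_measurable j)) mE mfE _)).
  by move=> x _.
apply: integral_mrestr => //; first exact: preim_measurable pproj_measurable mE.
  by apply: measurableT_comp => //; exact: pproj_measurable.
by move=> z; exact: f0.
Qed.

(** [mut_scale] writes the mass of [B] as a weighted integral over the image of the fundamental
    domain. Cutting this image into the three [tchart j] and reading each piece as an integral over
    the torus gives the three terms. *)
Lemma tprob_stationary (B : set (torus R)) : measurable B ->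
  tprob B = \sum_(j < 3) (\int[tprob]_(x in tsec j @^-1` B) (tw (tsec j x))%:E)%E.
Proof.
move=> mB; set B' := pproj @^-1` B `&` fdom.
have mB' : measurable B' by exact: measurableI (preim_measurable pproj_measurable mB) fdom_measurable.
pose h z := (tw (pproj (zdiv z)))%:E.
have mh : measurable_fun setT h.
  apply/measurable_EFinP; apply: (measurableT_comp tw_measurable).
  by apply: measurableT_comp; [exact: pproj_measurable|exact: zdiv_measurable].
have h0 z : (0 <= h z)%E by rewrite lee_fin ltW // tw_gt0.
pose F j := zdiv @^-1` B' `&` tchart j.
have mz : measurable (zdiv @^-1` B') by exact: preim_measurable zdiv_measurable mB'.
have mF j : measurable (F j) by apply: measurableI mz (tchart_measurable j).
have tF : trivIset [set: 'I_3] F.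
  apply/trivIsetP => i j _ _ /eqP ij; apply/seteqP; split=> // z [[_ [_ e1]] [_ [_ e2]]].
  by apply: ij; apply: (@tsec_inj _ _ (pproj z)); rewrite -e1 -e2.
have UF : zdiv @^-1` B' = \big[setU/set0]_(j < 3) F j.
  rewrite -bigcup_seq; apply/seteqP; split=> [z Bz|z [j _ []] //].
  have [j e] := tsec_tmap (pproj (zdiv z)); exists j; first by rewrite /= mem_index_enum.
  split=> //; split; first by case: Bz.
  by rewrite -e pproj_zdiv.
rewrite tprobE mut_scale //.
rewrite (_ : ((1 / 3)%:E * _)%E = (\sum_(j < 3) \int[mut]_(z in F j) h z)%E); last first.
  apply: (@eq_trans _ _ (density_measure mut mh h0 (zdiv @^-1` B'))); last first.
    by rewrite UF; exact: (@measure_bigsetU_ord _ _ _ (density_measure mut mh h0) 3 xpredT).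
  apply: (@eq_trans _ _ (\int[mut]_(z in zdiv @^-1` B') ((1 / 3)%:E * (wt eps ((zdiv z).1 + (zdiv z).2))%:E)))%E.
    apply/esym; apply: (@ge0_integralZl_EFin _ _ _ mut _ mz) => //.
    - by move=> z _; rewrite lee_fin ltW // wt_gt0.
    - apply: (measurable_funS measurableT) => //; apply: plane_wt_measurable.
      by apply: measurable_funD; apply: measurableT_comp => //; exact: zdiv_measurable.
  apply: eq_integral => z _; rewrite /h /pproj tw_proj -EFinM /pvec /svec mxE.
  by congr EFin; rewrite mulrC mul1r.
rewrite ge0_sume_distrr; last by move=> j _; apply: integral_ge0 => z _.
apply: eq_bigr => j _; rewrite (@integral_tprob_chart j); last 3 first.
- exact: preim_measurable (tsec_measurable j) mB.
- apply/measurable_EFinP; apply: (measurableT_comp tw_measurable); exact: tsec_measurable.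
- by move=> x; rewrite lee_fin ltW // tw_gt0.
congr (_ * _)%E; rewrite (_ : _ `&` tchart j = F j).
  by apply: eq_integral => z /set_mem[_ [_ e]]; rewrite /h e.
apply/seteqP; split=> z [] /=; last by move=> [/= ? ?] [? e]; split; rewrite -?e.
by move=> h1 [h2 e]; split; split=> //=; rewrite /= e.
Qed.

Lemma tmap_measurable : measurable_fun setT (@tmap R).
Proof.
apply: torus_measurable_fun => U oU; apply: torus_open_measurable.
by move/continuousP: (@tmap_continuous R); exact.
Qed.

Lemma tmap_preserves : preserves (@tmap R) tprob.
Proof.
move=> B mB; have mtB : measurable (tmap @^-1` B) by exact: preim_measurable tmap_measurable mB.
rewrite tprob_stationary //.
have mw j : measurable_fun B (fun x => (tw (tsec j x))%:E).
  apply: (measurable_funS measurableT) => //.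
  by apply/measurable_EFinP; apply: (measurableT_comp tw_measurable); exact: tsec_measurable.
have e j : tsec j @^-1` (@tmap R @^-1` B) = B.
  by apply/seteqP; split=> x /=; rewrite tmap_tsec.
under eq_bigr do rewrite e.
rewrite -ge0_integral_sum //; last by move=> j x _; rewrite lee_fin ltW // tw_gt0.
under eq_integral do rewrite sumEFin sum_tw.
by rewrite integral_cst // mul1e.
Qed.

End weights.
End stationarity.

#[global] Opaque tprob.

(** * Kernels as laws of a function of a uniform variable *)

Section law_kernels.
Context {R : realType}.
Local Notation mR := (measurableTypeR R).

Definition unit_itv : set mR := `[0, 1[%classic.

Lemma unit_itv_measurable : measurable unit_itv. Proof. exact: measurable_itv. Qed.

Lemma lam01T : mrestr (@lebesgue_measure R) unit_itv_measurable setT = 1%E.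
Proof. by rewrite /mrestr setTI lebesgue_measure_itv /= lte_fin ltr01 oppr0 adde0. Qed.

Definition lam01 : probability mR R := mk_probability lam01T.

Context d1 d2 (X : measurableType d1) (Y : measurableType d2).
Variables (F : X * mR -> Y) (mF : measurable_fun setT F).

(* The law of [F (x, u)] for [u] uniformly distributed in [0, 1[. *)
Definition law_ker (x : X) : {measure set Y -> \bar R} :=
  image_measure lam01 (measurableT_comp mF (pair1_measurable x)).

Lemma law_kerE x B : law_ker x B = lam01 ((fun u => F (x, u)) @^-1` B).
Proof. by []. Qed.

Lemma law_ker_measurable B : measurable B -> measurable_fun setT (law_ker ^~ B).
Proof.
move=> mB; have mFB : measurable (F @^-1` B) by exact: preim_measurable mF mB.
have := measurable_fun_xsection lam01 mFB; congr (measurable_fun _ _).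
by apply/funext => x /=; rewrite xsectionE.
Qed.

HB.instance Definition _ := isKernel.Build _ _ X Y R law_ker law_ker_measurable.

Lemma law_kerT x : law_ker x setT = 1%E.
Proof. by rewrite law_kerE preimage_setT probability_setT. Qed.

HB.instance Definition _ := Kernel_isProbability.Build _ _ X Y R law_ker law_kerT.

Definition law_kernel : R.-pker X ~> Y := law_ker.

Lemma law_kernel_integral (mu : probability X R) B : measurable B ->
  (mu \x lam01)%E (F @^-1` B) = (\int[mu]_x law_kernel x B)%E.
Proof.
by move=> mB; apply: eq_integral => x _ /=; rewrite xsectionE.
Qed.

End law_kernels.

(** * One step of the backward random walk *)

Section step.
Context {R : realType}.
Local Notation mR := (measurableTypeR R).
Local Notation leb := (@lebesgue_measure R).
Local Notation lam01 := (@lam01 R).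
Variables (eps : R) (eps_itv : 0 <= eps <= 1 / 2).
Local Notation tprob := (tprob eps_itv).
Local Notation tw := (tw eps).
Implicit Types (x : torus R) (p : (torus R * mR)%type).

Definition cumw x (j : 'I_3) : R := \sum_(i < 3) (i < j)%N%:R * tw (tsec i x).

(* The preimage of [x] numbered [j] is chosen for [u] in an interval of length
   [tw (tsec j x)], which is then rescaled to [0, 1[. *)
Definition step_to (j : 'I_3) p : (torus R * mR)%type :=
  (tsec j p.1, (p.2 - cumw p.1 j) / tw (tsec j p.1)).

Definition stepT p : (torus R * mR)%type :=
  if p.2 < cumw p.1 1 then step_to 0 p
  else if p.2 < cumw p.1 2 then step_to 1 p else step_to 2 p.

Lemma tw_tsec_measurable j : measurable_fun setT (fun x => tw (tsec j x) : mR).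
Proof. by apply: (measurableT_comp (tw_measurable eps)); exact: tsec_measurable. Qed.

Lemma cumw_measurable j : measurable_fun setT (fun x => cumw x j : mR).
Proof.
by apply: measurable_sum => i; apply: measurable_funM => //; exact: tw_tsec_measurable.
Qed.

Lemma step_to_measurable j : measurable_fun setT (step_to j).
Proof.
apply: measurable_fun_pair; first by apply: (measurableT_comp (tsec_measurable j)).
apply: measurable_funM.
  apply: measurable_funB; first exact: measurable_snd.
  by apply: (measurableT_comp (cumw_measurable j)).
under eq_fun do rewrite -(powR_inv1 (ltW (tw_gt0 eps_itv _))).
by apply: (measurableT_comp (measurable_powR _)); apply: (measurableT_comp (tw_tsec_measurable j)).
Qed.

Lemma stepT_measurable : measurable_fun setT stepT.
Proof.
have ml j : measurable_fun setT (fun p => p.2 < cumw p.1 j).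
  apply: measurable_fun_ltr; first exact: measurable_snd.
  by apply: (measurableT_comp (cumw_measurable j)).
apply: measurable_fun_ifT => //; first exact: step_to_measurable.
by apply: measurable_fun_ifT => //; exact: step_to_measurable.
Qed.

Lemma tmap_stepT p : tmap (stepT p).1 = p.1.
Proof. by rewrite /stepT; case: ltP => _; [|case: ltP => _]; rewrite tmap_tsec. Qed.

Lemma cumwE x : [/\ cumw x 0 = 0, cumw x 1 = tw (tsec 0 x) &
  cumw x 2 = tw (tsec 0 x) + tw (tsec 1 x)].
Proof.
rewrite /cumw !big_ord_recl !big_ord0 /= !mul0r !mul1r !addr0; split=> //;
  by congr (_ + tw (tsec _ x)); apply/ord_inj.
Qed.

Lemma ord3P (j : 'I_3) : [\/ j = 0, j = 1 | j = 2].
Proof. by case: j => [[|[|[|//]]] ?]; [apply: Or31|apply: Or32|apply: Or33]; apply/ord_inj. Qed.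

Lemma sum_tw3 x : tw (tsec 0 x) + tw (tsec 1 x) + tw (tsec 2 x) = 1.
Proof.
rewrite -(sum_tw eps x) !big_ord_recl big_ord0 addr0 addrA.
by congr (_ + tw (tsec _ x) + tw (tsec _ x)); apply/ord_inj.
Qed.

Lemma cumw_unit x j : 0 <= cumw x j /\ cumw x j + tw (tsec j x) <= 1.
Proof.
have [c0 c1 c2] := cumwE x; have s1 := sum_tw3 x.
have p0 := tw_gt0 eps_itv (tsec 0 x); have p1 := tw_gt0 eps_itv (tsec 1 x).
have p2 := tw_gt0 eps_itv (tsec 2 x).
by have [->|->|->] := ord3P j; rewrite ?c0 ?c1 ?c2; split; lra.
Qed.

Lemma stepT_unit x u : unit_itv u ->
  exists j, stepT (x, u) = step_to j (x, u) /\
  forall i, 0 <= u - cumw x i < tw (tsec i x) <-> i = j.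
Proof.
rewrite /unit_itv /= in_itv /= => /andP[u0 u1].
have [c0 c1 c2] := cumwE x; have s1 := sum_tw3 x.
have p0 := tw_gt0 eps_itv (tsec 0 x); have p1 := tw_gt0 eps_itv (tsec 1 x).
have p2 := tw_gt0 eps_itv (tsec 2 x).
rewrite /stepT /=; case: ltP => h1; [exists 0|case: ltP => h2; [exists 1|exists 2]].
all: split=> // i; split=> [|->]; last by rewrite ?c0 ?c1 ?c2; lra.
all: by have [->|->|->] := ord3P i; rewrite ?c0 ?c1 ?c2 => // ?; exfalso; lra.
Qed.

(** Each branch owns a subinterval of [0, 1[ of length [tw], which is mapped affinely onto [0, 1[.
    So, given the branch, the new second coordinate is again uniform, and one uniform variable can
    drive all later choices. *)
Lemma stepT_preimage_law x (C : set (torus R * mR)) : measurable C ->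
  lam01 ((fun u => stepT (x, u)) @^-1` C) =
  (\sum_(j < 3) (tw (tsec j x))%:E * lam01 ((fun t => (tsec j x, t)) @^-1` C))%E.
Proof.
move=> mC.
pose F (j : 'I_3) : set mR := (fun u => (tw (tsec j x))^-1 * u + - ((tw (tsec j x))^-1 * cumw x j)) @^-1`
  ((fun t => (tsec j x, t)) @^-1` C `&` unit_itv).
have mFj (j : 'I_3) : measurable ((fun t => (tsec j x, t)) @^-1` C `&` unit_itv).
  apply: measurableI unit_itv_measurable.
  by have := preim_measurable (@pair1_measurable _ _ (torus R) mR (tsec j x)) mC.
have mF j : measurable (F j) by exact: preim_measurable (affine_measurable _ _) (mFj j).
have FE j u : F j u <-> C (step_to j (x, u)) /\ 0 <= u - cumw x j < tw (tsec j x).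
  have w0 := tw_gt0 eps_itv (tsec j x).
  rewrite /F /= -mulrBr mulrC /step_to /unit_itv /= in_itv /= pmulr_lge0 ?invr_gt0 //.
  by rewrite ltr_pdivrMr // mul1r.
have UF : (fun u => stepT (x, u)) @^-1` C `&` unit_itv = \big[setU/set0]_(j < 3) F j.
  rewrite -bigcup_seq; apply/seteqP; split=> [u [Cu u01]|u [j _ /FE[Cu h]]].
    have [j [e /(_ j)[_ /(_ erefl) h]]] := stepT_unit x u01; exists j; first by rewrite /= mem_index_enum.
    by apply/FE; split=> //; rewrite -e.
  have u01 : unit_itv u by rewrite /unit_itv /= in_itv /=; have := cumw_unit x j; lra.
  split=> //=; have [i [e iu]] := stepT_unit x u01.
  by rewrite e -(iu j).1.
have tF : trivIset [set: 'I_3] F.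
  apply/trivIsetP => i j _ _ /eqP ij; apply/seteqP; split=> // u [Fi Fj].
  have u01 : unit_itv u by have : (\big[setU/set0]_(j < 3) F j) u;
    [rewrite -bigcup_seq; exists i => //=; rewrite mem_index_enum|rewrite -UF => -[]].
  have [k [_ ku]] := stepT_unit x u01; apply: ij.
  by move: Fi Fj => /FE[_ /ku ->] /FE[_ /ku ->].
rewrite [LHS]/= /measure_fun /= /mrestr UF (@measure_bigsetU_ord _ _ _ leb 3 xpredT) //.
apply: eq_bigr => j _; have wi : 0 < (tw (tsec j x))^-1 by rewrite invr_gt0 tw_gt0.
by have := lebesgue_affine (- ((tw (tsec j x))^-1 * cumw x j)) wi (mFj j); rewrite invrK; exact.
Qed.

(** The branch law and the fresh uniform coordinate factor, and the sum over branches is [tprob A]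
    by stationarity. *)
Lemma stepT_rect (A : set (torus R)) (E : set mR) : measurable A -> measurable E ->
  (tprob \x lam01)%E (stepT @^-1` (A `*` E)) = (tprob A * lam01 E)%E.
Proof.
move=> mA mE; have mAE : measurable (A `*` E) by exact: measurableX.
apply: (eq_trans (law_kernel_integral stepT_measurable tprob mAE)).
apply: (eq_trans _ (congr1 (fun r => r * lam01 E)%E (esym (tprob_stationary eps_itv mA)))).
transitivity (\sum_(j < 3) \int[tprob]_(x in tsec j @^-1` A) ((tw (tsec j x))%:E * lam01 E))%E.
  rewrite -(fineK (fin_num_measure lam01 _ mE)); set e := fine _.
  pose g (j : 'I_3) x := ((tw (tsec j x))%:E * e%:E)%E.
  have mg j : measurable_fun setT (g j).
    by apply: emeasurable_funM => //; apply/measurable_EFinP; exact: tw_tsec_measurable.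
  have e0 : 0 <= e by rewrite fine_ge0.
  have mtA j : measurable (tsec j @^-1` A) by exact: preim_measurable (tsec_measurable j) mA.
  transitivity (\int[tprob]_x (\sum_(j < 3) (g j \_ (tsec j @^-1` A)) x))%E.
    apply: eq_integral => x _; rewrite /law_kernel law_kerE stepT_preimage_law //.
    apply: eq_bigr => j _; rewrite /patch /g; have [/set_mem xA|/negP xA] := boolP (x \in _).
      by congr (_ * _)%E; rewrite /e fineK ?fin_num_measure //; congr (lam01 _); apply/seteqP; split=> t //= [].
    rewrite (_ : _ @^-1` _ = set0) ?measure0 ?mule0 //.
    by apply/seteqP; split=> t //= [h _]; apply: xA; rewrite inE.
  have mgr j : measurable_fun setT (g j \_ (tsec j @^-1` A)).
    by apply/(measurable_restrictT _ (mtA j)); exact: measurable_funS (mg j).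
  have gr0 j x : setT x -> (0 <= (g j \_ (tsec j @^-1` A)) x)%E.
    by rewrite /patch; case: ifP => _ // _; rewrite mule_ge0 ?lee_fin // ltW // tw_gt0.
  apply: (eq_trans (ge0_integral_sum tprob measurableT mgr gr0 (index_enum 'I_3))).
  by apply: eq_bigr => j _; apply/esym; exact: integral_mkcond.
rewrite ge0_sume_distrl; last by move=> j _; apply: integral_ge0 => x _; rewrite lee_fin ltW // tw_gt0.
apply: eq_bigr => j _; rewrite -(fineK (fin_num_measure lam01 _ mE)).
have mtA : measurable (tsec j @^-1` A) by exact: preim_measurable (tsec_measurable j) mA.
have e0 : (0 <= (fine (lam01 E))%:E)%E by rewrite lee_fin fine_ge0.
have mw : measurable_fun (tsec j @^-1` A) (fun x => (tw (tsec j x))%:E).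
  by apply/measurable_EFinP; apply: (measurable_funS measurableT) => //; exact: tw_tsec_measurable.
apply: (@ge0_integralZr _ _ _ tprob _ mtA _ mw _ _ e0).
by move=> x _; rewrite lee_fin ltW // tw_gt0.
Qed.

Lemma stepT_preserves (C : set (torus R * mR)) : measurable C ->
  (tprob \x lam01)%E (stepT @^-1` C) = (tprob \x lam01)%E C.
Proof.
move=> mC; apply: esym.
exact: (@product_measure_unique _ _ _ _ R tprob lam01
  (image_measure (tprob \x lam01)%E stepT_measurable) stepT_rect C mC).
Qed.

Definition tker : R.-pker torus R ~> torus R :=
  law_kernel (measurableT_comp measurable_fst stepT_measurable).

Lemma tkerE x B : measurable B ->
  tker x B = (\sum_(j < 3) (tw (tsec j x))%:E * (\1_B (tsec j x))%:E)%E.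
Proof.
move=> mB; rewrite /tker /law_kernel law_kerE.
rewrite (_ : _ @^-1` B = (fun u => stepT (x, u)) @^-1` (B `*` setT)); last first.
  by apply/seteqP; split=> u //= -[].
rewrite stepT_preimage_law; last exact: measurableX.
apply: eq_bigr => j _; congr (_ * _)%E; rewrite indicE.
have [/set_mem xB|/negP xB] := boolP (_ \in _).
  by rewrite -(probability_setT lam01); congr (lam01 _); apply/seteqP; split.
rewrite (_ : _ @^-1` _ = set0) ?measure0 //.
by apply/seteqP; split=> t //= [h]; case: xB; rewrite inE.
Qed.

Lemma tker_integral x (f : torus R -> \bar R) : measurable_fun setT f ->
  (forall y, 0 <= f y)%E ->
  (\int[tker x]_y f y = \sum_(j < 3) (tw (tsec j x))%:E * f (tsec j x))%E.
Proof.
move=> mf f0; have w0 j : 0 <= tw (tsec j x) by rewrite ltW // tw_gt0.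
have f0T y : setT y -> (0 <= f y)%E by move=> _.
pose m (n : nat) : measure (torus R) R :=
  mscale (NngNum (w0 (inord n))) (dirac (tsec (inord n) x)).
rewrite (eq_measure_integral (msum m 3)); last first.
  move=> B mB _; rewrite tkerE // /msum /=; apply: eq_bigr => j _.
  by rewrite /m /mscale /= inord_val.
rewrite ge0_integral_measure_sum //; apply: eq_bigr => j _.
rewrite [LHS](ge0_integral_mscale _ measurableT) //.
by rewrite integral_dirac // diracT mul1e /= inord_val.
Qed.

Lemma tprob_integral (f : torus R -> \bar R) : measurable_fun setT f ->
  (forall y, 0 <= f y)%E ->
  (\int[tprob]_x f x = \int[tprob]_x \sum_(j < 3) (tw (tsec j x))%:E * f (tsec j x))%E.
Proof.
move=> mf f0; have f0T y : setT y -> (0 <= f y)%E by move=> _.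
have mS : measurable_fun setT (fst \o stepT) by exact: measurableT_comp measurable_fst stepT_measurable.
have mfS : measurable_fun setT (f \o (fst \o stepT)) by exact: measurableT_comp mf mS.
rewrite (eq_measure_integral (image_measure (tprob \x lam01)%E mS)); last first.
  move=> B mB _; have mBT : measurable (B `*` [set: mR]) by exact: measurableX.
  have -> : image_measure (tprob \x lam01)%E mS B = (tprob \x lam01)%E (stepT @^-1` (B `*` setT)).
    by congr ((tprob \x lam01)%E _); apply/seteqP; split=> [p Bp|p []].
  by rewrite stepT_rect // probability_setT mule1.
apply: (eq_trans (ge0_integral_pushforward mS (tprob \x lam01)%E measurableT mf _)) => //.
rewrite preimage_setT.
apply: (eq_trans (fubini_tonelli1 _ _ _)) => //.
  by move=> p; exact: f0.
apply: eq_integral => x _; rewrite -tker_integral //.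
apply/esym; apply: (eq_trans (ge0_integral_pushforward _ _ _ _ _)) => //.
by apply: measurableT_comp mS _.
Qed.

End step.

(** * The lift to the natural extension *)

Section lift.
Context {R : realType}.
Local Notation mR := (measurableTypeR R).

Lemma ae_ex d (T : measurableType d) (mu : probability T R) (P : T -> Prop) :
  {ae mu, forall x, P x} -> exists x, P x.
Proof.
move=> [N [mN N0 PN]]; apply/not_existsP => nP.
have : (mu N = 1)%E.
  by rewrite -(probability_setT mu); congr (mu _); apply/seteqP; split=> // x _; apply: PN; exact: nP.
by rewrite N0 => /esym/eqP; rewrite onee_eq0.
Qed.

Lemma torus_measurable1 (x : torus R) : measurable [set x].
Proof.
have := torus_eq_measurable (@measurable_id _ (torus R) setT) (@measurable_cst _ _ (torus R) (torus R) setT x).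
by congr (measurable _).
Qed.

Variables (eps : R) (eps_itv : 0 <= eps <= 1 / 2).
Local Notation tprob := (tprob eps_itv).
Local Notation tw := (tw eps).
Local Notation stepT := (stepT eps).
Implicit Types (x : torus R) (p : (torus R * mR)%type).

(** The full orbit through [p.1] whose past is the backward walk driven by [p.2]. It conjugates
    [stepT] to the inverse shift, so the image of the invariant product measure is shift-invariant:
    it is the lift, and fixing [p.1] gives its fibre measures. *)
Definition theta p : bisequence R := fun n =>
  match n with Posz k => iter k tmap p.1 | Negz k => (iter k.+1 stepT p).1 end.

Lemma iter_stepT_measurable n : measurable_fun setT (iter n stepT).
Proof.
elim: n => [|n IHn]; first exact: measurable_id.
by apply: (measurableT_comp (stepT_measurable eps_itv)).
Qed.

Lemma iter_tmap_measurable n : measurable_fun setT (iter n (@tmap R)).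
Proof.
elim: n => [|n IHn]; first exact: measurable_id.
by apply: (measurableT_comp (@tmap_measurable R)).
Qed.

Lemma theta_measurable : measurable_fun setT theta.
Proof.
apply: bisequence_measurable_fun => -[k|k].
  by apply: (measurableT_comp (iter_tmap_measurable k)); exact: measurable_fst.
by apply: (measurableT_comp measurable_fst); exact: iter_stepT_measurable.
Qed.

Lemma theta_stepT p : theta (stepT p) = seq_shift_inv (theta p).
Proof.
apply/funext => -[[|k]|k]; rewrite /seq_shift_inv.
- by [].
- have -> : Posz k.+1 - 1 = Posz k by lia.
  by rewrite /theta iterSr tmap_stepT.
- have -> : Negz k - 1 = Negz k.+1 by lia.
  by rewrite /theta -iterSr.
Qed.

Lemma theta_natural p : natural_extension tmap (theta p).
Proof.
move=> [k|[|k]].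
- by have -> : Posz k + 1 = Posz k.+1 by lia.
- by rewrite /theta /= tmap_stepT.
- have -> : Negz k.+1 + 1 = Negz k by lia.
  by rewrite /theta [in LHS]iterS tmap_stepT.
Qed.

Lemma theta_shift p : seq_shift (theta (stepT p)) = theta p.
Proof. by rewrite theta_stepT; apply/funext => n; rewrite /seq_shift /seq_shift_inv addrK. Qed.

Lemma thetaT : image_measure (tprob \x lam01)%E theta_measurable setT = 1%E.
Proof.
transitivity ((tprob \x lam01)%E (setT `*` setT)); first by rewrite setXTT.
rewrite product_measure1E //.
by apply: (eq_trans (congr2 mule (probability_setT tprob) (probability_setT lam01))); rewrite mule1.
Qed.

Definition tlift : probability (bisequence R) R := mk_probability thetaT.

Lemma tliftE B : tlift B = (tprob \x lam01)%E (theta @^-1` B).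
Proof. by []. Qed.

Lemma seq_shift_measurable : measurable_fun setT (@seq_shift R).
Proof. by apply: bisequence_measurable_fun => n; exact: bi_coord_measurable. Qed.

Lemma tlift_is_lift : is_lift tmap tprob tlift.
Proof.
split.
- transitivity (tlift setT); last exact: thetaT.
  by rewrite !tliftE; congr ((tprob \x lam01)%E _); apply/seteqP; split=> // p _; exact: theta_natural.
- move=> A mA; rewrite !tliftE -(stepT_preserves eps_itv).
    by congr ((tprob \x lam01)%E _); apply/seteqP; split=> p; rewrite /preimage /= theta_shift.
  apply: (preim_measurable theta_measurable); exact: preim_measurable seq_shift_measurable mA.
- move=> A mA; rewrite tliftE (_ : _ @^-1` _ = A `*` setT); last first.
    by apply/seteqP; split=> [p Ap|p []].
  rewrite product_measure1E //.
  by apply: (eq_trans (congr1 (mule _) (probability_setT lam01))); rewrite mule1.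
Qed.

Definition fker : R.-pker torus R ~> bisequence R := law_kernel theta_measurable.

Lemma fkerE x B : fker x B = lam01 ((fun u => theta (x, u)) @^-1` B).
Proof. by []. Qed.

Lemma fker_disintegration : fiber_disintegration tmap tprob tlift fker.
Proof.
split=> [B mB|]; first exact: law_kernel_integral.
apply/aeW => x; rewrite fkerE -(probability_setT lam01); congr (lam01 _).
by apply/seteqP; split=> // u _; split=> //; exact: theta_natural.
Qed.

Lemma tker_tsec j x : tker eps_itv x [set tsec j x] = (tw (tsec j x))%:E.
Proof.
rewrite tkerE; last exact: torus_measurable1.
rewrite (bigD1 j) //= big1 ?adde0 => [|i ij].
  by rewrite indicE in_set1 eqxx mule1.
rewrite indicE in_set1 (_ : (_ == _) = false) ?mule0 //.
by apply/eqP => /tsec_inj e; move/eqP: ij.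
Qed.

Lemma fker_branch j x : fker x [set b | b (-1) = tsec j x] = (tw (tsec j x))%:E.
Proof. by rewrite -tker_tsec. Qed.

Lemma fiber_branch x b : fiber tmap x b -> exists j, b (-1) = tsec j x.
Proof.
move=> [nb bx]; have [j e] := tsec_tmap (b (-1)); exists j.
by rewrite -e nb addNr -bx.
Qed.

Lemma fiber_branch_ex j x : exists2 b, fiber tmap x b & b (-1) = tsec j x.
Proof.
pose b : bisequence R := seq_shift (theta (tsec j x, 0)).
have nb := theta_natural (tsec j x, 0).
exists b; last by rewrite /b /seq_shift addNr.
split; first by move=> n; exact: nb.
by rewrite /pi0 /b /seq_shift add0r /= tmap_tsec.
Qed.

End lift.

(** * The two lifts disintegrate differently *)

Section different_fibers.
Context {R : realType}.

Lemma eps0_itv : 0 <= (0 : R) <= 1 / 2. Proof. by rewrite lexx divr_ge0. Qed.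

Lemma epsh_itv : 0 <= (1 / 2 : R) <= 1 / 2. Proof. by rewrite lexx divr_ge0. Qed.

Lemma tw_eps0 (y : torus R) : tw 0 y = 1 / 3.
Proof. by rewrite /tw /wt mul0r addr0. Qed.

Lemma tw_epsh_tsec (x : torus R) : exists t : R, forall j : 'I_3,
  tw (1 / 2) (tsec j x) = 1 / 3 + cos (t + j%:R * (2 * pi / 3)) / 6.
Proof.
exists (2 * pi * (pvec (loc x) *m bmx) 0 0) => j; rewrite tw_tsec /wt.
rewrite (_ : 2 * pi * (_ + j%:R / 3) =
  2 * pi * (pvec (loc x) *m bmx) 0 0 + j%:R * (2 * pi / 3)); last by field.
by field.
Qed.

(** An identification of fibres respects the first preimage, so it sends each of the three branches
    over x onto a branch over y. If it preserved the measures, the weights over y for eps = 1/2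
    would all be 1/3; then three cosines would vanish, against [sum3_cos2]. One matched pair (x, y)
    of the coupling is enough. *)
Lemma lift_disintegrate_differently :
  disintegrate_differently tmap (tprob eps0_itv) (tprob epsh_itv)
    (tlift eps0_itv) (tlift epsh_itv).
Proof.
exists (fker eps0_itv), (fker epsh_itv); split; [exact: fker_disintegration..|].
move=> [kappa _ /ae_ex[[x y] [h [[hf hinj hsurj] hid] hm]]].
suff e j : tw (1 / 2) (tsec j y) = 1 / 3.
  have [t te] := tw_epsh_tsec y; have c0 (j : 'I_3) : cos (t + j%:R * (2 * pi / 3)) = 0.
    by have := e j; rewrite te; lra.
  have := sum3_cos2 t; have := c0 0; have := c0 1; have := c0 2.
  by rewrite mul0r addr0 mul1r => -> -> ->; rewrite expr0n /=; lra.
apply: EFin_inj; rewrite -(fker_branch epsh_itv).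
have [b fb bj] := fiber_branch_ex eps0_itv j y; have [a fa hab] := hsurj _ fb.
have [i ai] := fiber_branch fa.
rewrite -[fker _ y]/(fker epsh_itv (x, y).2) -hm; last first.
  exact: preim_measurable (bi_coord_measurable _) (torus_measurable1 _).
rewrite -(tw_eps0 (tsec i x)) -(fker_branch eps0_itv) !fkerE; congr (lam01 _).
apply/seteqP; split=> u /=.
  move=> [fu hu]; rewrite -ai; apply/(hid _ _ fu fa 1%N); rewrite hab -[RHS]/(b (-1)) bj.
  exact: hu.
move=> ui; have fu : fiber tmap x (theta 0 (x, u)).
  by split=> //; exact: (theta_natural eps0_itv).
split=> //; rewrite -bj -hab.
by apply: (hid _ _ fu fa 1%N).1; rewrite [LHS]ui ai.
Qed.

End different_fibers.

(** * Conditional measures and their essential uniqueness *)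

Section probability_kernel_bounds.
Context d1 d2 (X : measurableType d1) (Y : measurableType d2) (R : realType).

Lemma pker_le1 (m : R.-pker X ~> Y) x A : measurable A -> (m x A <= 1)%E.
Proof. by move=> mA; rewrite -(prob_kernel (s := m) x); apply: le_measure; rewrite ?inE. Qed.

Lemma pker_fin_num (m : R.-pker X ~> Y) x A : measurable A -> m x A \is a fin_num.
Proof.
by move=> mA; rewrite ge0_fin_numE //; exact: le_lt_trans (pker_le1 m x mA) (ltry _).
Qed.

End probability_kernel_bounds.

Section conditional_measures_theory.
Context d (X : measurableType d) (R : realType).
Variables (mu : probability X R) (xi : X -> set X).
Hypothesis part_xi : is_partition xi.
Implicit Types (m : R.-pker X ~> X).

Lemma probability_compl0 (X0 : set X) : measurable X0 -> mu X0 = 1%E -> mu (~` X0) = 0%E.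
Proof. by move=> mX0 X01; rewrite probability_setC // X01 subee. Qed.

Lemma probability_setI1 (Y Z : set X) : measurable Y -> measurable Z ->
  mu Y = 1%E -> mu Z = 1%E -> mu (Y `&` Z) = 1%E.
Proof.
move=> mY mZ Y1 Z1; have ZY0 : mu (Z `\` Y) = 0%E.
  apply: (subset_measure0 (measurableD mZ mY) (measurableC mY)); first by move=> x [].
  exact: probability_compl0.
apply: (eq_trans (esym _) Z1); apply: (eq_trans (measureDI mu mZ mY)).
by apply: (eq_trans (congr1 (fun r => r + _)%E ZY0)); rewrite add0e setIC.
Qed.

Lemma full_set_kernel m (X0 : set X) : (forall B, measurable B -> mu B = (\int[mu]_x m x B)%E) ->
  measurable X0 -> mu X0 = 1%E -> {ae mu, forall x, X0 x /\ m x (~` X0) = 0%E}.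
Proof.
move=> mum mX0 X01; have mC := measurableC mX0.
have C0 := probability_compl0 mX0 X01.
apply: filterS2 (_ : {ae mu, forall x, X0 x}) (_ : {ae mu, forall x, m x (~` X0) = 0%E}).
- by move=> x x0 h; split.
- by exists (~` X0); split=> // x h /h.
have := (@ae_eq_integral_abs _ _ _ mu setT measurableT (fun x => m x (~` X0)) _).1 _.
have -> : (\int[mu]_x `|m x (~` X0)| = 0)%E.
  by rewrite -C0 mum //; apply: eq_integral => x _; rewrite gee0_abs.
move=> /(_ (measurable_kernel m _ mC) erefl); apply: filterS => x; exact.
Qed.

(** For almost every [x] the measure [m x] lives on the atom of [x] inside [X0], where [C] contains
    either everything or nothing. So intersecting [P] with [C] changes nothing when [x] is in [C]
    and leaves mass 0 otherwise. *)
Lemma conditional_localize m (X0 C P : set X) : conditional_measures mu xi m ->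
  measurable X0 -> mu X0 = 1%E -> measurable C -> measurable P ->
  (forall x y, X0 x -> X0 y -> xi x y -> C x -> C y) ->
  (\int[mu]_(x in C) m x P = mu (P `&` C))%E.
Proof.
move=> [mum mxi _] mX0 X01 mC mP Cinv; have [xix xixy] := part_xi.
have mPC : measurable (P `&` C) by exact: measurableI.
rewrite (mum _ mPC) integral_mkcond; apply: ae_eq_integral => //.
- by apply/(measurable_restrictT _ mC); apply: (measurable_funS measurableT) => //; exact: measurable_kernel.
- exact: measurable_kernel.
have := full_set_kernel mum mX0 X01; apply: filterS2 mxi => x [N [mN N0 xiN]] [X0x X0m] _.
have m0 A : measurable A -> A `<=` ~` (X0 `&` xi x) -> m x A = 0%E.
  move=> mA AX; apply: (subset_measure0 mA (measurableU _ _ (measurableC mX0) mN)).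
    move=> y /AX h; have [Xy|] := pselect (X0 y); last by left.
    by right; apply: xiN => /= xy; apply: h.
  by apply: null_set_setU => //; exact: measurableC.
rewrite /patch; case: ifPn => [/set_mem Cx|/negP Cx].
  rewrite (measureDI (m x) mP mC) [X in (X + _)%E]m0 ?add0e //; first exact: measurableD.
  by move=> y [_ nCy] [X0y xy]; apply: nCy; exact: Cinv Cx.
rewrite m0 // => y [_ Cy] [X0y xy]; apply: Cx; rewrite inE.
by apply: (Cinv y) => //; rewrite (xixy _ _ xy).
Qed.

(** The set where the inequality fails is a union of atoms on a full set, so both kernels integrate
    over it to the same value, and it must be null. *)
Lemma conditional_le m m' (P : set X) : conditional_measures mu xi m ->
  conditional_measures mu xi m' -> measurable P ->
  {ae mu, forall x, m x P <= m' x P}%E.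
Proof.
move=> cm cm' mP; have [_ _ [X0 [mX0 X01 X0m]]] := cm; have [_ _ [X1 [mX1 X11 X1m]]] := cm'.
have mk := measurable_kernel m _ mP; have mk' := measurable_kernel m' _ mP.
pose C := [set x | (m' x P < m x P)%E].
have mC : measurable C.
  by have := measurable_lte measurableT mk' mk; rewrite setTI.
have X011 := probability_setI1 mX0 mX1 X01 X11.
have Cinv x y : (X0 `&` X1) x -> (X0 `&` X1) y -> xi x y -> C x -> C y.
  by move=> [x0 x1] [y0 y1] xy; rewrite /C /= (X0m x y) // (X1m x y).
have e := conditional_localize cm (measurableI _ _ mX0 mX1) X011 mC mP Cinv.
have e' := conditional_localize cm' (measurableI _ _ mX0 mX1) X011 mC mP Cinv.
have fm x : m x P \is a fin_num by exact: pker_fin_num.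
have fm' x : m' x P \is a fin_num by exact: pker_fin_num.
have mkC : measurable_fun C (fun x => m x P) by exact: measurable_funS mk.
have mkC' : measurable_fun C (fun x => m' x P) by exact: measurable_funS mk'.
have d0 : (\int[mu]_(x in C) `|m x P - m' x P| = 0)%E.
  transitivity (\int[mu]_(x in C) (m x P - m' x P))%E.
    apply: eq_integral => x /set_mem /ltW Cx; rewrite gee0_abs // sube_ge0 //.
    by rewrite fm'.
  have bd (k : R.-pker X ~> X) : measurable_fun C (fun x => k x P) -> mu.-integrable C (fun x => k x P).
    move=> mkk; apply/integrableP; split=> //; apply: (@le_lt_trans _ _ (\int[mu]_(x in C) 1)%E).
      apply: ge0_le_integral => //; first exact: measurableT_comp.
      by move=> x _; rewrite gee0_abs // pker_le1.
    by rewrite integral_cst // mul1e; apply: le_lt_trans (probability_le1 _ mC) (ltry _).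
  apply: (eq_trans (integralB mC (bd m mkC) (bd m' mkC'))).
  by rewrite e e' subee // fin_num_measure //; exact: measurableI.
have mB : measurable_fun C (fun x => m x P - m' x P)%E by exact: emeasurable_funB.
have := (ae_eq_integral_abs mu mC mB).1 d0; apply: filterS => x h.
rewrite leNgt; apply/negP => Cx; have := h Cx => /eqP.
by rewrite sube_eq ?add0e /= => [/eqP k|//|//]; move: Cx; rewrite k ltxx.
Qed.

End conditional_measures_theory.

(** * The folding entropy as an integral *)

Section folding.
Context {R : realType}.
Local Notation mR := (measurableTypeR R).
Local Notation fibers := (preimage_partition (@tmap R) point_partition).

Lemma fibers_partition : is_partition fibers.
Proof. by split=> // x y; rewrite /preimage_partition /point_partition /= => ->. Qed.

Lemma fibersP (x y : torus R) : fibers x y <-> tmap y = tmap x.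
Proof. by []. Qed.

Lemma measurable_kernel_diag (m : R.-pker torus R ~> torus R) :
  measurable_fun setT (fun x => m x [set x]).
Proof.
pose D : set (torus R * torus R) := [set p | p.1 = p.2].
have mD : measurable D by apply: torus_eq_measurable.
have := measurable_fun_xsection_finite_kernel m (mem_set mD).
congr (measurable_fun _ _); apply/funext => x; congr (m x _).
by apply/seteqP; split=> y; rewrite xsectionE => e; exact: esym e.
Qed.

Lemma measurable_fun_lne d (T : measurableType d) (f : T -> \bar R) :
  measurable_fun setT f -> (forall x, f x \is a fin_num) ->
  measurable_fun setT (fun x => lne (f x)).
Proof.
move=> mf ff; have mfi : measurable_fun setT (fun x => fine (f x)).
  by apply/measurable_EFinP; congr (measurable_fun _ _): mf; apply/funext => x /=; rewrite fineK.
rewrite (_ : (fun x => _) = fun x => if fine (f x) <= 0 then -oo%E else (ln (fine (f x)))%:E).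
  apply: measurable_fun_ifT => //; first exact: measurable_fun_ler.
  by apply/measurable_EFinP; exact: measurableT_comp (@measurable_ln R) mfi.
by apply/funext => x; rewrite -[in LHS](fineK (ff x)).
Qed.

Variables (eps : R) (eps_itv : 0 <= eps <= 1 / 2).
Local Notation tprob := (tprob eps_itv).
Local Notation tw := (tw eps).
Local Notation stepT := (stepT eps).
Local Notation tker := (tker eps_itv).

Definition pull_tmap (p : (torus R * mR)%type) := (tmap p.1, p.2).

Lemma pull_tmap_measurable : measurable_fun setT pull_tmap.
Proof.
apply: measurable_fun_pair; last exact: measurable_snd.
exact: measurableT_comp (@tmap_measurable R) measurable_fst.
Qed.

(** Resampling within a fibre: move to [tmap x], then draw one of its preimages with the weights. *)
Definition fold_ker : R.-pker torus R ~> torus R :=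
  law_kernel (measurableT_comp measurable_fst
    (measurableT_comp (stepT_measurable eps_itv) pull_tmap_measurable)).

Lemma fold_kerE x B : fold_ker x B = tker (tmap x) B.
Proof. by []. Qed.

Lemma fold_ker_null x : (fold_ker x).-negligible (~` fibers x).
Proof.
exists (~` fibers x); split=> //.
  apply: measurableC; apply: (preim_measurable (@tmap_measurable R)); exact: torus_measurable1.
rewrite fold_kerE -(measure0 lam01); congr (lam01 _); apply/seteqP; split=> // u /=.
by apply; apply/fibersP; rewrite tmap_stepT.
Qed.

Lemma fold_ker_conditional : conditional_measures tprob fibers fold_ker.
Proof.
split.
- move=> B mB; transitivity (\int[tprob]_x tker x B)%E.
    rewrite -law_kernel_integral // (_ : _ @^-1` B = stepT @^-1` (B `*` setT)); last first.
      by apply/seteqP; split=> [p Bp|p []].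
    rewrite stepT_rect //.
    by apply/esym; apply: (eq_trans (congr1 (mule _) (probability_setT lam01))); rewrite mule1.
  apply: (eq_trans (eq_measure_integral (image_measure tprob (@tmap_measurable R)) _)).
    by move=> A mA _; apply/esym; exact: tmap_preserves.
  apply: (eq_trans (ge0_integral_pushforward (@tmap_measurable R) tprob measurableT _ _)) => //.
  exact: measurable_kernel.
- by apply/aeW => x; exact: fold_ker_null.
- exists setT; split; [exact: measurableT|exact: probability_setT|].
  move=> x y _ _ /fibersP e B mB.
  apply: (eq_trans (fold_kerE x B)); apply: (eq_trans _ (esym (fold_kerE y B))).
  by move: e; move: (tmap x) (tmap y) => a b ->.
Qed.

(** The range [P j] of each inverse branch meets every fibre in one point, so the masses of points
    are masses of three fixed events, to which the uniqueness of conditional measures applies. *)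
Lemma fold_ker_point (m : R.-pker torus R ~> torus R) : conditional_measures tprob fibers m ->
  {ae tprob, forall x, m x [set x] = (tw x)%:E}.
Proof.
move=> cm; have cf := fold_ker_conditional; have [_ mx _] := cm.
pose P (j : 'I_3) : set (torus R) := [set y | tsec j (tmap y) = y].
have mP j : measurable (P j).
  apply: torus_eq_measurable; last exact: measurable_id.
  exact: measurableT_comp (tsec_measurable j) (@tmap_measurable R).
have eP j : {ae tprob, forall x, m x (P j) = fold_ker x (P j)}.
  apply: filterS2 (conditional_le fibers_partition cm cf (mP j))
    (conditional_le fibers_partition cf cm (mP j)) => x h1 h2.
  by apply/eqP; rewrite eq_le h1 h2.
have atom (k : R.-pker torus R ~> torus R) x j : k x (P j) = k x [set tsec j (tmap x)] \/
    ~ (k x).-negligible (~` fibers x).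
  have [[N [mN N0 xN]]|] := pselect ((k x).-negligible (~` fibers x)); last by right.
  left; rewrite (measureDI (k x) (mP j) (torus_measurable1 (tsec j (tmap x)))).
  rewrite [X in (X + _)%E](_ : _ = 0%E) ?add0e.
    by congr (k x _); apply/seteqP; split=> [y []|y /= ->] //; rewrite /P /= tmap_tsec.
  apply: (subset_measure0 (measurableD (mP j) (torus_measurable1 _)) mN) N0 => y [Py nyx].
  by apply: xN => /fibersP e; apply: nyx; rewrite /= -e Py.
apply: filterS3 mx (eP 0) (filterI (eP 1) (eP 2)) => x xm e0 [e1 e2]; have [j jx] := tsec_tmap x.
have [e|//] := atom m x j; rewrite jx in e; apply: (eq_trans (esym e)).
have -> : m x (P j) = fold_ker x (P j) by have [->|->|->] := ord3P j.
have [e'|/(_ (fold_ker_null x))//] := atom fold_ker x j.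
by rewrite e' fold_kerE tker_tsec jx.
Qed.

Lemma folding_entropyE :
  folding_entropy (@tmap R) tprob = (\int[tprob]_x (- ln (tw x))%:E)%E.
Proof.
have E m : conditional_measures tprob fibers m ->
    (\int[tprob]_x - lne (m x (point_partition x)) = \int[tprob]_x (- ln (tw x))%:E)%E.
  move=> cm; apply: ae_eq_integral => //.
  - apply: measurableT_comp => //; apply: measurable_fun_lne; first exact: measurable_kernel_diag.
    by move=> x; apply: pker_fin_num; exact: torus_measurable1.
  - apply/measurable_EFinP; apply: measurableT_comp => //.
    exact: measurableT_comp (@measurable_ln R) (tw_measurable eps).
  - apply: filterS (fold_ker_point cm) => x e _; rewrite /point_partition e lne_EFin //.
    exact: tw_gt0.
apply: get_unique; first by exists fold_ker; [exact: fold_ker_conditional|rewrite E //; exact: fold_ker_conditional].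
by move=> _ [m cm ->]; exact: E.
Qed.

(** Stationarity turns the integrand into the Shannon entropy of the three branch weights, which can
    be bounded pointwise. *)
Lemma integral_ln_tw : (\int[tprob]_x (- ln (tw x))%:E =
  \int[tprob]_x (\sum_(j < 3) tw (tsec j x) * (- ln (tw (tsec j x))))%:E)%E.
Proof.
rewrite tprob_integral.
- by apply: eq_integral => x _; rewrite -sumEFin.
- apply/measurable_EFinP; apply: measurableT_comp => //.
  exact: measurableT_comp (@measurable_ln R) (tw_measurable eps).
- move=> y; rewrite lee_fin oppr_ge0 ln_le0 //; have := tw_itv eps_itv y; lra.
Qed.

End folding.

(** * A quantitative gap between the entropies *)

Section entropies_differ.
Context {R : realType}.

(** With r = sqrt W, ln W = 2 ln r >= 2 (1 - 1/r) gives W ln W >= W - 1 + (r - 1)^2; and (W - 1)^2 =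
    (r - 1)^2 (r + 1)^2 <= 9 (r - 1)^2. *)
Lemma xlnx_ge (W : R) : 1 / 2 <= W <= 3 / 2 -> W - 1 + (W - 1) ^+ 2 / 9 <= W * ln W.
Proof.
move=> /andP[h1 h2]; set r := Num.sqrt W.
have W0 : 0 < W by lra.
have r0 : 0 < r by rewrite sqrtr_gt0.
have rW : r ^+ 2 = W by rewrite sqr_sqrtr // ltW.
have r32 : r < 3 / 2 by rewrite -(ltr_pXn2r (_ : 0 < 2)%N) ?nnegrE ?ltW // ?rW; lra.
have l1 : 1 - r^-1 <= ln r.
  have := @le_ln1Dx R (r^-1 - 1); rewrite addrCA subrr addr0 lnV ?posrE //.
  have : 0 < r^-1 by rewrite invr_gt0.
  by move=> ri h; have := h _; lra.
have lW : ln W = ln r *+ 2 by rewrite -lnXn // rW.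
have l2 : 2 * (W - r) <= W * ln W.
  have h := ler_wpM2l (ltW W0) l1.
  have e : W * r^-1 = r by rewrite -{1}rW expr2 mulfK // gt_eqF.
  by move: h; rewrite mulrBr mulr1 e lW mulr2n; lra.
have h : (W - 1) ^+ 2 <= 9 * (r - 1) ^+ 2.
  rewrite -{1}rW (_ : r ^+ 2 - 1 = (r - 1) * (r + 1)); last by ring.
  rewrite exprMn mulrC; apply: ler_wpM2r; first exact: sqr_ge0.
  by rewrite (_ : 9 = 3 ^+ 2); [rewrite ler_pXn2r ?nnegrE //; lra|ring].
have e : (r - 1) ^+ 2 = W - 2 * r + 1 by rewrite -rW; ring.
by move: h; rewrite e; lra.
Qed.

Lemma folding_entropies_differ :
  folding_entropy tmap (tprob (@eps0_itv R)) <> folding_entropy tmap (tprob (@epsh_itv R)).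
Proof.
rewrite !folding_entropyE.
have h0 : (\int[tprob (@eps0_itv R)]_x (- ln (tw 0 x))%:E = (ln 3)%:E)%E.
  under eq_integral do rewrite tw_eps0.
  rewrite div1r lnV ?posrE // opprK integral_cst //.
  by apply: (eq_trans (congr1 (mule _) (probability_setT _))); rewrite mule1.
move=> e0; have {e0} e := eq_trans (eq_trans (esym h0) e0) (integral_ln_tw _).
(* Three times each weight is 1 + c/2 with c a cosine, so [xlnx_ge] makes each term lose c^2 / 108
   besides a linear term. The linear terms cancel, the squares sum to 3/2, and (3/2) / 108 =
   1/72. *)
have ub (x : torus R) : 0 <= \sum_(j < 3) tw (1 / 2) (tsec j x) * (- ln (tw (1 / 2) (tsec j x))) <= ln 3 - 1 / 72.
  have wi j := tw_itv (@epsh_itv R) (tsec j x).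
  apply/andP; split.
    apply: sumr_ge0 => j _; apply: mulr_ge0; first by have := wi j; lra.
    by rewrite oppr_ge0 ln_le0 //; have := wi j; lra.
  have [t te] := tw_epsh_tsec x; have s1 := sum_tw3 (1 / 2) x.
  pose c (j : 'I_3) := cos (t + j%:R * (2 * pi / 3)).
  have b (j : 'I_3) : tw (1 / 2) (tsec j x) * (- ln (tw (1 / 2) (tsec j x))) <=
      tw (1 / 2) (tsec j x) * ln 3 - c j / 6 - c j ^+ 2 / 108.
    have W0 : 0 < 3 * tw (1 / 2) (tsec j x) by have := wi j; lra.
    have := @xlnx_ge (3 * tw (1 / 2) (tsec j x)).
    rewrite lnM ?posrE //; last by have := wi j; lra.
    rewrite (_ : 3 * tw (1 / 2) (tsec j x) - 1 = c j / 2); last by rewrite te /c; field.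
    by move=> h; have := h _; have := wi j; rewrite expr_div_n; lra.
  have c0 : c 0 = cos t by rewrite /c mul0r addr0.
  have c1 : c 1 = cos (t + 2 * pi / 3) by rewrite /c mul1r.
  have c2 : c 2 = cos (t + 2 * (2 * pi / 3)) by [].
  have := b 0; have := b 1; have := b 2; rewrite c0 c1 c2.
  have := sum3_cos2 t; have := sum3_cos t.
  have l : (tw (1 / 2) (tsec 0 x) + tw (1 / 2) (tsec 1 x) + tw (1 / 2) (tsec 2 x)) * ln 3 = ln 3.
    by rewrite s1 mul1r.
  rewrite !big_ord_recl big_ord0 addr0.
  have -> : lift ord0 ord0 = 1 :> 'I_3 by apply/ord_inj.
  have -> : lift ord0 (lift ord0 ord0) = 2 :> 'I_3 by apply/ord_inj.
  rewrite -[ord0]/(0 : 'I_3); lra.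
have pT := probability_setT (tprob (@epsh_itv R)).
have : ((ln 3)%:E <= (ln 3 - 1 / 72)%:E :> \bar R)%E; last by rewrite lee_fin; lra.
rewrite [X in (X <= _)%E]e; apply: (@le_trans _ _ (\int[tprob (@epsh_itv R)]_x (ln 3 - 1 / 72)%:E)%E).
  apply: ge0_le_integral => //.
  - by move=> x _; rewrite lee_fin; have /andP[] := ub x.
  - apply/measurable_EFinP; apply: measurable_sum => j; apply: measurable_funM.
      exact: tw_tsec_measurable.
    apply: measurableT_comp => //; apply: measurableT_comp (@measurable_ln R) _.
    exact: tw_tsec_measurable.
  - by move=> x _; rewrite lee_fin; have /andP[] := ub x.
rewrite integral_cst //.
by apply: (eq_ind_r (fun r => _ * r <= _)%E _ pT); rewrite mule1.
Qed.

End entropies_differ.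

(** * Characters and the transfer operator *)

Section fourier.
Context {R : realType}.
Implicit Types (x y : torus R) (k : int * int) (n : int).

Lemma cosM_sum (a b : R) : cos a * cos b = (cos (a + b) + cos (a - b)) / 2.
Proof. by rewrite cosD cosB; field. Qed.

(** The sum over a fibre of a wave whose phase advances by [m] thirds of a turn. For integral [m] it
    depends on [m] modulo 3 only and vanishes unless 3 divides [m]. *)
Definition cos3 (X m : R) : R :=
  cos X + cos (X + m * (2 * pi / 3)) + cos (X + 2 * m * (2 * pi / 3)).

Lemma cos3_shift (X r : R) (q : int) : cos3 X (3 * q%:~R + r) = cos3 X r.
Proof.
rewrite /cos3; congr (_ + _ + _).
  rewrite -(cosD2pi_int (X + r * _) q); congr cos; by field.
rewrite -(cosD2pi_int (X + 2 * r * _) (q + q)); congr cos; rewrite intrD; by field.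
Qed.

Lemma cos3_0 (X : R) : cos3 X 0 = 3 * cos X.
Proof. by rewrite /cos3 !mulr0 !mul0r !addr0; ring. Qed.

Lemma cos3_1 (X : R) : cos3 X 1 = 0.
Proof. by rewrite /cos3 mul1r mulr1 -(sum3_cos X). Qed.

Lemma cos3_2 (X : R) : cos3 X 2 = 0.
Proof.
rewrite -[RHS](sum3_cos X) /cos3 -addrA -[RHS]addrA; congr (_ + _); rewrite addrC; congr (_ + _).
rewrite -(cosD2pi_int (X + 2 * pi / 3) 1); congr cos; by field.
Qed.

Lemma cos3_N1 (X : R) : cos3 X (-1) = 0.
Proof.
rewrite -(cos3_2 X) -(cos3_shift X 2 (-1)); congr (cos3 _ _).
by rewrite mulrNz /=; ring.
Qed.

Definition tphase k x : R := 2 * pi * (k.1%:~R * tfrac 0 x + k.2%:~R * tfrac 1 x).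

(** Real characters; the quarter turns [n] bring in the sines, so that products are again
    combinations of such functions. *)
Definition tcos k n x : R := cos (tphase k x + n%:~R * (pi / 2)).

Lemma tcos_proj k n (v : 'rV[R]_2) : tcos k n (torus_proj v) =
  cos (2 * pi * (k.1%:~R * v 0 0 + k.2%:~R * v 0 1) + n%:~R * (pi / 2)).
Proof.
rewrite /tcos /tphase !tfrac_proj; set a := Num.floor _; set b := Num.floor _.
rewrite -[RHS](cosD2pi_int _ (- (k.1 * a) - k.2 * b)); congr cos.
by rewrite !(intrB, intrN, intrM, mulrNz, rmorphN, rmorphM); ring.
Qed.

Lemma tcosM k n k' n' x : tcos k n x * tcos k' n' x =
  (tcos (k.1 + k'.1, k.2 + k'.2) (n + n') x + tcos (k.1 - k'.1, k.2 - k'.2) (n - n') x) / 2.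
Proof.
rewrite /tcos cosM_sum /tphase !intrD !(mulrNz, rmorphN).
by congr ((cos _ + cos _) / 2); ring.
Qed.

Lemma tcos_tmap k n x : tcos k n (tmap x) = tcos (k.1 + k.2, k.1 + 4 * k.2) n x.
Proof.
rewrite -(tproj_repr x) tmap_proj !tcos_proj mul_amx !mxE /= !intrD intrM.
by congr cos; ring.
Qed.

Lemma tcos00 x : tcos (0, 0) 0 x = 1.
Proof. by rewrite /tcos /tphase /= !mul0r !addr0 mulr0 cos0. Qed.

Lemma tcos0_const n x y : tcos (0, 0) n x = tcos (0, 0) n y.
Proof. by rewrite /tcos /tphase /= !mul0r. Qed.

Lemma tcos_le1 k n x : `|tcos k n x| <= 1.
Proof. exact: cos_max. Qed.

Lemma tcos_continuous k n : continuous (tcos k n : torus R -> R).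
Proof.
move=> x U /nbhs_ballP[e /= e0 eU].
pose C : R := 2 * pi * (`|k.1%:~R| + `|k.2%:~R|) + 1.
have p0 : 0 <= 2 * pi :> R by rewrite mulr_ge0 // pi_ge0.
have C0 : 0 < C.
  by rewrite /C; have : 0 <= 2 * pi * (`|k.1%:~R| + `|k.2%:~R|) :> R; [rewrite mulr_ge0 // addr_ge0|lra].
apply/nbhs_torusP; exists (e / C); first exact: divr_gt0.
move=> h he; apply: eU; rewrite /ball /=.
have [v vx] : exists v, x = torus_proj v by exists (repr x); rewrite tproj_repr.
rewrite {}vx -tprojD !tcos_proj !mxE.
apply: le_lt_trans (cos_lip _ _) _.
rewrite (_ : _ - _ = - (2 * pi * (k.1%:~R * h 0 0 + k.2%:~R * h 0 1))); last by ring.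
rewrite normrN normrM (ger0_norm p0).
have h0 := enorm_coord h 0; have h1 := enorm_coord h 1.
have -> : e = C * (e / C) by field; rewrite gt_eqF.
apply: (@le_lt_trans _ _ (2 * pi * ((`|k.1%:~R| + `|k.2%:~R|) * (e / C)))).
  apply: ler_wpM2l => //; apply: le_trans (ler_normD _ _) _; rewrite !normrM mulrDl.
  by apply: lerD; apply: ler_wpM2l => //; apply: ltW; apply: le_lt_trans he.
by rewrite mulrA ltr_pM2r ?divr_gt0 // /C; lra.
Qed.

Lemma tcos_separates x y : (forall k n, tcos k n x = tcos k n y) -> x = y.
Proof.
move=> h.
have sep (a b : R) : 0 <= a < 1 -> 0 <= b < 1 -> cos (2 * pi * a) = cos (2 * pi * b) ->
    sin (2 * pi * a) = sin (2 * pi * b) -> a = b.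
  wlog ab : a b / b <= a.
    move=> W ha hb hc hs; have [ba|/ltW ab] := leP b a; first exact: W.
    by apply/esym; apply: W.
  move=> ha hb hc hs.
  have p0 := pi_gt0 R.
  have c1 : cos (2 * pi * (a - b)) = 1.
    by rewrite mulrBr cosB hc hs -!expr2 cos2Dsin2.
  pose z := 2 * pi * (a - b).
  have z0 : 0 <= z by rewrite mulr_ge0 // ?subr_ge0 // mulr_ge0 // ltW.
  have z2 : z < 2 * pi by rewrite /z -[ltRHS]mulr1 ltr_pM2l ?mulr_gt0 //; lra.
  have cz : cos z = 1 := c1.
  have zz : z = 0.
    have [zp|/ltW pz] := leP z pi.
      apply: cos_inj; rewrite ?in_itv /= ?z0 ?zp ?lexx ?ltW //; by rewrite cz cos0.
    exfalso; have : 2 * pi - z = 0.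
      apply: cos_inj; rewrite ?in_itv /= ?lexx ?(ltW p0) //; first by apply/andP; split; lra.
      rewrite cos0; apply: (eq_trans _ cz); rewrite -(cosN z) -(cosD2pi_int (- z) 1); congr cos; ring.
    lra.
  by move/eqP: zz; rewrite /z mulf_eq0 gt_eqF ?mulr_gt0 //= subr_eq0 => /eqP.
have hs n k : cos (tphase k x + n%:~R * (pi / 2)) = cos (tphase k y + n%:~R * (pi / 2)) by exact: h.
have hk k : cos (tphase k x) = cos (tphase k y) /\ sin (tphase k x) = sin (tphase k y).
  split; first by have := hs 0 k; rewrite mul0r !addr0.
  have := hs (-1) k; rewrite !mulN1r.
  have e (t : R) : cos (t + - (pi / 2)) = sin t by rewrite cosB cos_pihalf sin_pihalf mulr0 mulr1 add0r.
  by rewrite !e.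
have [c1 s1] := hk (1, 0); have [c2 s2] := hk (0, 1).
move: c1 s1 c2 s2; rewrite /tphase /= !mul0r !mul1r !addr0 !add0r => c1 s1 c2 s2.
rewrite -(pproj_loc x) -(pproj_loc y) /loc.
by rewrite (sep _ _ (tfrac_itv 0 x) (tfrac_itv 0 y) c1 s1) (sep _ _ (tfrac_itv 1 x) (tfrac_itv 1 y) c2 s2).
Qed.

(** Completing the square gives (2a + 3b)^2 = 13 b^2, impossible for b nonzero by parity of the
    exponent of 13. The matrix multiplies this form on frequencies by 3, so it measures how often a
    frequency can be divided by the matrix. *)
Lemma form_anisotropic k : k.1 * k.1 + 3 * k.1 * k.2 - k.2 * k.2 = 0 -> k = (0, 0).
Proof.
case: k => a b /= h.
have [b0|b0] := eqVneq b 0.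
  move: h; rewrite b0 !mulr0 addr0 subr0 => /eqP; rewrite mulf_eq0 orbb => /eqP -> //.
have e : ((2 * a + 3 * b) ^+ 2 = 13 * b ^+ 2)%R by rewrite !expr2; lia.
have {}e : (absz (2 * a + 3 * b)%R ^ 2 = 13 * absz b ^ 2)%N.
  by rewrite -!abszX e abszM.
have := congr1 (logn 13) e; rewrite lognX lognM ?expn_gt0 ?absz_gt0 ?b0 // lognX.
by rewrite (_ : logn 13 13 = 1%N) //; lia.
Qed.

Section transfer.
Variables (eps : R) (eps_itv : 0 <= eps <= 1 / 2).
Local Notation tw := (tw eps).
Local Notation tprob := (tprob eps_itv).
Implicit Types (f : torus R -> R).

Definition tL f x : R := \sum_(j < 3) tw (tsec j x) * f (tsec j x).

Lemma tL_near f (c e : R) : (forall x, `|f x - c| <= e) -> forall x, `|tL f x - c| <= e.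
Proof.
move=> h x; have s1 := sum_tw eps x.
have -> : tL f x - c = \sum_(j < 3) tw (tsec j x) * (f (tsec j x) - c).
  by rewrite -{1}(mulr1 c) -s1 mulr_sumr -sumrB; apply: eq_bigr => j _; rewrite mulrBr (mulrC c).
apply: le_trans (ler_norm_sum _ _ _) _; rewrite -[leRHS]mulr1 -s1 mulr_sumr.
apply: ler_sum => j _; rewrite normrM mulrC (ger0_norm (ltW (tw_gt0 eps_itv _))).
by apply: ler_wpM2r => //; exact: ltW (tw_gt0 eps_itv _).
Qed.

Lemma tL_scale f (c : R) : tL (fun x => c * f x) = (fun x => c * tL f x).
Proof. by apply/funext => x; rewrite /tL mulr_sumr; apply: eq_bigr => j _; rewrite mulrCA. Qed.

Lemma iter_tL_scale N f (c : R) : iter N tL (fun x => c * f x) = (fun x => c * iter N tL f x).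
Proof. by elim: N => // N IH; rewrite !iterS IH tL_scale. Qed.

(** The weight splits the character into the frequency [k] and, with coefficient eps / 2, the
    frequencies [k] plus or minus (1, 0). Averaging over the fibre keeps only a frequency whose
    coordinates are congruent modulo 3, and exactly one of the three is such; it becomes its
    preimage under the action of the matrix on frequencies. *)
Lemma tL_tcos k n :
  (exists2 q, k.1 - k.2 = 3 * q & tL (tcos k n) = tcos (k.1 + q, - q) n) \/
  (exists k', tL (tcos k n) = (fun x => eps / 2 * tcos k' n x)).
Proof.
pose t x : R := (4 * tfrac 0 x - tfrac 1 x) / 3.
pose s x : R := (tfrac 1 x - tfrac 0 x) / 3.
pose P (l1 l2 : int) x : R := 2 * pi * (l1%:~R * t x + l2%:~R * s x) + n%:~R * (pi / 2).
have E x : tL (tcos k n) x = (1 / 3) * (cos3 (P k.1 k.2 x) (k.1 + 2 * k.2)%:~R +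
    eps / 2 * (cos3 (P (k.1 + 1) k.2 x) (k.1 + 2 * k.2 + 1)%:~R +
               cos3 (P (k.1 - 1) k.2 x) (k.1 + 2 * k.2 - 1)%:~R)).
  pose d : R := 2 * pi / 3.
  have T (j : 'I_3) : tw (tsec j x) * tcos k n (tsec j x) =
      (1 / 3) * (cos (P k.1 k.2 x + j%:R * (k.1 + 2 * k.2)%:~R * d) + eps / 2 *
      (cos (P (k.1 + 1) k.2 x + j%:R * (k.1 + 2 * k.2 + 1)%:~R * d) +
       cos (P (k.1 - 1) k.2 x + j%:R * (k.1 + 2 * k.2 - 1)%:~R * d))).
    have vE : pvec (loc x) *m bmx = vec2 (t x) (s x).
      rewrite /loc /pvec svecK mul_bmx; apply: row2P; rewrite !mxE /= /t /s; lra.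
    rewrite tw_tsec /tsec tcos_proj vE !mxE /= /wt.
    set X := 2 * pi * (_ + _) + _; set Y := 2 * pi * _.
    have -> : P k.1 k.2 x + j%:R * (k.1 + 2 * k.2)%:~R * d = X.
      by rewrite /X /P /d intrD intrM; field.
    have -> : P (k.1 + 1) k.2 x + j%:R * (k.1 + 2 * k.2 + 1)%:~R * d = Y + X.
      by rewrite /X /Y /P /d !intrD intrM; field.
    have -> : P (k.1 - 1) k.2 x + j%:R * (k.1 + 2 * k.2 - 1)%:~R * d = - (Y - X).
      by rewrite /X /Y /P /d !intrD intrM !(mulrNz, rmorphN); field.
    rewrite cosN; have := cosM_sum Y X => e.
    have -> : cos (Y + X) + cos (Y - X) = 2 * (cos Y * cos X) by rewrite e; field.
    by field.
  rewrite /tL !big_ord_recl big_ord0 addr0 !T /cos3 /=.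
  rewrite !mul0r !addr0 !mul1r; rewrite -/d; ring.
have R3 (m : int) : exists q, [\/ m = 3 * q, m = 3 * q + 1 | m = 3 * q - 1].
  exists (divz (m + 1) 3); have := divz_eq (m + 1) 3.
  have := modz_ge0 (m + 1) (isT : (3 : int) != 0); have := ltz_pmod (m + 1) (isT : (0 : int) < 3).
  set r := modz _ _ => r1 r2 e.
  have [er|[er|er]] : r = 0 \/ r = 1 \/ r = 2 by lia.
  - by apply: Or33; lia.
  - by apply: Or31; lia.
  - by apply: Or32; lia.
have PE (l1 l2 q : int) : l1 - l2 = 3 * q -> (fun x => cos (P l1 l2 x)) = tcos (l1 + q, - q) n.
  move=> e; apply/funext => x; rewrite /P /tcos /tphase /=; congr (cos (_ * _ + _)).
  have -> : l2 = l1 - 3 * q by lia.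
  by rewrite /t /s !intrD !(mulrNz, rmorphN) intrM; field.
have sh (X : R) (m q r : int) : m = 3 * q + r -> cos3 X m%:~R = cos3 X r%:~R.
  by move=> ->; rewrite intrD intrM -(cos3_shift X r%:~R q).
have [q [e|e|e]] := R3 (k.1 - k.2).
- left; exists q => //; rewrite -(PE k.1 k.2 q) //; apply/funext => x; rewrite E.
  rewrite (sh _ (k.1 + 2 * k.2) (k.2 + q) 0); last lia.
  rewrite (sh _ (k.1 + 2 * k.2 + 1) (k.2 + q) 1); last lia.
  rewrite (sh _ (k.1 + 2 * k.2 - 1) (k.2 + q) (-1)); last lia.
  by rewrite cos3_0 cos3_1 cos3_N1; field.
- right; exists (k.1 - 1 + q, - q); rewrite -(PE (k.1 - 1) k.2 q); last lia.
  apply/funext => x; rewrite E.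
  rewrite (sh _ (k.1 + 2 * k.2) (k.2 + q) 1); last lia.
  rewrite (sh _ (k.1 + 2 * k.2 + 1) (k.2 + q) 2); last lia.
  rewrite (sh _ (k.1 + 2 * k.2 - 1) (k.2 + q) 0); last lia.
  by rewrite cos3_0 cos3_1 cos3_2; field.
- right; exists (k.1 + 1 + q, - q); rewrite -(PE (k.1 + 1) k.2 q); last lia.
  apply/funext => x; rewrite E.
  rewrite (sh _ (k.1 + 2 * k.2) (k.2 + q) (-1)); last lia.
  rewrite (sh _ (k.1 + 2 * k.2 + 1) (k.2 + q) 0); last lia.
  rewrite (sh _ (k.1 + 2 * k.2 - 1) (k.2 + q - 1) 1); last lia.
  by rewrite cos3_0 cos3_1 cos3_N1; field.
Qed.

(** Each application of [tL] either gains a factor eps / 2 <= 1/2 or divides the form of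
    [form_anisotropic] by 3. The second cannot go on for ever unless k = 0, where the function is
    constant. Hence an outer induction on the number of factors gained and an inner one on the
    absolute value of the form. *)
Lemma tcos_equidistributes p k n : exists N c, forall x,
  `|iter N tL (tcos k n) x - c| <= (1 / 2) ^+ p.
Proof.
have /andP[eps_ge0 eps_le] := eps_itv.
elim: p k => [|p IHp] k.
  by exists 0%N, 0 => x; rewrite subr0 expr0; exact: tcos_le1.
pose Q k := absz (k.1 * k.1 + 3 * k.1 * k.2 - k.2 * k.2 : int).
move: {2}(Q k) (leqnn (Q k)) => m; elim: m k => [|m IHm] k kQ.
  have -> : k = (0, 0) by apply: form_anisotropic; apply/eqP; rewrite -absz_eq0 -leqn0.
  by exists 0%N, (tcos (0, 0) n 0) => x; rewrite /= (tcos0_const _ _ 0) subrr normr0 exprn_ge0 // divr_ge0.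
have [[q kq e]|[k' e]] := tL_tcos k n.
  have [k0|k0] := eqVneq k (0, 0).
    by rewrite k0; exists 0%N, (tcos (0, 0) n 0) => x;
      rewrite /= (tcos0_const _ _ 0) subrr normr0 exprn_ge0 // divr_ge0.
  have [|N [c h]] := IHm (k.1 + q, - q).
    have Q0 : (k.1 * k.1 + 3 * k.1 * k.2 - k.2 * k.2) != 0.
      by apply: contra k0 => /eqP/form_anisotropic ->.
    move: kQ Q0; rewrite /Q /=; have -> : k.2 = k.1 - 3 * q by lia.
    have -> : k.1 * k.1 + 3 * k.1 * (k.1 - 3 * q) - (k.1 - 3 * q) * (k.1 - 3 * q) =
       3 * ((k.1 + q) * (k.1 + q) + 3 * (k.1 + q) * - q - - q * - q) by ring.
    by set w := _ - _ * _; lia.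
  by exists N.+1, c => x; rewrite iterSr e.
have [N [c h]] := IHp k'; exists N.+1, (eps / 2 * c) => x.
rewrite iterSr e iter_tL_scale -mulrBr normrM exprS.
apply: ler_pM => //; rewrite ger0_norm; lra.
Qed.

Lemma tL_measurable f : measurable_fun setT (f : torus R -> measurableTypeR R) ->
  measurable_fun setT (tL f : torus R -> measurableTypeR R).
Proof.
move=> mf; apply: measurable_sum => j; apply: measurable_funM; first exact: tw_tsec_measurable.
by apply: (measurableT_comp mf); exact: tsec_measurable.
Qed.

Lemma bounded_integrable d (T : measurableType d) (mu : probability T R) (g : T -> R) (M : R) :
  measurable_fun setT (g : T -> measurableTypeR R) -> (forall t, `|g t| <= M) ->
  mu.-integrable setT (fun t => (g t)%:E).
Proof.
move=> mg gM; apply/integrableP; split; first exact/measurable_EFinP.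
apply: (@le_lt_trans _ _ (\int[mu]_x M%:E)%E).
  apply: ge0_le_integral => //.
  - by apply: measurableT_comp => //; exact/measurable_EFinP.
  - by move=> x _; rewrite lee_fin; exact: le_trans (gM x).
rewrite integral_cst //.
by apply: (eq_ind_r (fun r => M%:E * r < +oo)%E _ (probability_setT mu)); rewrite mule1 ltry.
Qed.

Definition tint f : R := fine (\int[tprob]_x (f x)%:E)%E.

Lemma integral_near d (T : measurableType d) (mu : probability T R) (g : T -> R) (c e : R) :
  measurable_fun setT (g : T -> measurableTypeR R) -> (forall t, `|g t - c| <= e) ->
  `|fine (\int[mu]_t (g t)%:E)%E - c| <= e.
Proof.
move=> mg gc.
have gM t : `|g t| <= `|c| + e.
  by rewrite -(subrK c (g t)) addrC; apply: le_trans (ler_normD _ _) _; rewrite lerD2l.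
have ig := bounded_integrable mu mg gM.
have cst (r : R) : (\int[mu]_t r%:E)%E = r%:E.
  rewrite integral_cst //.
  by apply: (eq_ind_r (fun q => _ * q = _)%E _ (probability_setT mu)); rewrite mule1.
have icst (r : R) : mu.-integrable setT (fun t : T => r%:E).
  by apply: (@bounded_integrable _ _ mu (fun=> r) `|r|).
have ef : (\int[mu]_t (g t)%:E)%E \is a fin_num by exact: integrable_fin_num ig.
have h1 : ((c - e)%:E <= \int[mu]_t (g t)%:E)%E.
  rewrite -(cst (c - e)); apply: le_integral => // t _.
  by rewrite lee_fin; have := gc t; rewrite ler_norml; lra.
have h2 : (\int[mu]_t (g t)%:E <= (c + e)%:E)%E.
  rewrite -(cst (c + e)); apply: le_integral => // t _.
  by rewrite lee_fin; have := gc t; rewrite ler_norml; lra.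
by move: h1 h2; rewrite -(fineK ef) !lee_fin ler_norml; lra.
Qed.

(** Stationarity is available for nonnegative functions, so it is applied to f + M. *)
Lemma tint_tL f (M : R) : measurable_fun setT (f : torus R -> measurableTypeR R) ->
  (forall x, `|f x| <= M) -> tint (tL f) = tint f.
Proof.
move=> mf fM.
have fM0 x : `|f x - 0| <= M by rewrite subr0.
have LM x : `|tL f x| <= M by rewrite -[tL f x]subr0; exact: tL_near fM0 x.
have cst : (\int[tprob]_x M%:E)%E = M%:E.
  rewrite integral_cst //.
  by apply: (eq_ind_r (fun q => _ * q = _)%E _ (probability_setT tprob)); rewrite mule1.
have icst : (tprob).-integrable setT (fun x : torus R => M%:E).
  by apply: (@bounded_integrable _ _ tprob (fun=> M) `|M|).
have add g : measurable_fun setT (g : torus R -> measurableTypeR R) -> (forall x, `|g x| <= M) ->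
    (\int[tprob]_x (g x + M)%:E = (tint g + M)%:E)%E.
  move=> mg gM; have ig := bounded_integrable tprob mg gM.
  under eq_integral do rewrite EFinD.
  apply: (eq_trans (integralD measurableT ig icst)); rewrite EFinD cst /tint fineK //.
  exact: integrable_fin_num ig.
apply/eqP; rewrite -(inj_eq (addIr M)); apply/eqP/EFin_inj.
rewrite -!add //; last exact: tL_measurable.
rewrite [RHS]tprob_integral; last 2 first.
- by apply/measurable_EFinP; exact: measurable_funD.
- by move=> y; rewrite lee_fin; have := fM y; rewrite ler_norml; lra.
apply: eq_integral => x _.
have -> : tL f x + M = \sum_(j < 3) tw (tsec j x) * (f (tsec j x) + M).
  rewrite -{1}(mulr1 M) -(sum_tw eps x) mulr_sumr -big_split /=.
  by apply: eq_bigr => j _; ring.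
by rewrite -sumEFin; apply: eq_bigr => j _; rewrite EFinM.
Qed.

Lemma iter_tL_bounded f (M : R) N : measurable_fun setT (f : torus R -> measurableTypeR R) ->
  (forall x, `|f x| <= M) ->
  [/\ measurable_fun setT (iter N tL f : torus R -> measurableTypeR R),
      forall x, `|iter N tL f x| <= M & tint (iter N tL f) = tint f].
Proof.
move=> mf fM; elim: N => // N [m1 m2 m3]; split.
- exact: tL_measurable.
- have h x : `|iter N tL f x - 0| <= M by rewrite subr0.
  by move=> x; rewrite -[iter _ _ _ _]subr0; exact: tL_near h x.
- by rewrite -m3; exact: tint_tL m1 m2.
Qed.

Lemma tcos_measurable k n : measurable_fun setT (tcos k n : torus R -> measurableTypeR R).
Proof. exact: torus_continuous_measurable (@tcos_continuous k n). Qed.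

Lemma tcos_limit k n (e : R) : 0 < e -> exists N, forall x,
  `|iter N tL (tcos k n) x - tint (tcos k n)| <= e.
Proof.
(* The factor 2: both the iterate and its integral lie within (1/2)^p of the constant [c]. *)
move=> e0; have [p pe] : exists p, 2 * (1 / 2) ^+ p <= e.
  have [p hp] : exists p : nat, (1 / 2 : R) ^+ p < e / 2.
    have e2 : 0 < e / 2 by rewrite divr_gt0.
    have h1 : `|1 / 2 : R| < 1 by rewrite ger0_norm; lra.
    have /cvgrPdist_lt/(_ _ e2)[p _ /(_ p (leqnn p))] := cvg_expr h1.
    by rewrite sub0r normrN ger0_norm ?exprn_ge0 ?divr_ge0 //; exists p.
  by exists p; lra.
have [N [c h]] := tcos_equidistributes p k n; exists N => x.
have [m1 m2 m3] := iter_tL_bounded N (tcos_measurable k n) (tcos_le1 k n).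
have := integral_near tprob m1 h; rewrite -/(tint _) m3.
have := h x; rewrite !ler_norml; lra.
Qed.

End transfer.
End fourier.

(** * The Stone-Weierstrass theorem on a compact subset *)

Section stone_weierstrass.
Context {T : topologicalType} {R : realType}.
Variable K : set T.
Hypothesis cK : compact K.

(** Finite subcovers in filter form: if no finite list works, the points of [K] missed by finite
    lists generate a proper filter, and a cluster point contradicts the local choice there. *)
Lemma compact_finite_choice (I : eqType) (P : I -> T -> Prop) :
  (forall b, K b -> exists i, exists2 U, nbhs b U & forall x, U x -> K x -> P i x) ->
  exists s : seq I, forall x, K x -> exists2 i, i \in s & P i x.
Proof.
move=> locP; apply: contrapT => /forallNP noP.
pose F (S : set T) := exists s : seq I, forall x, K x -> (forall i, i \in s -> ~ P i x) -> S x.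
have FF : ProperFilter F.
  apply: Build_ProperFilter => [[s hs]|].
    apply: (noP s) => x Kx; apply: contrapT => h; apply: (hs x Kx) => i si Pi.
    by apply: h; exists i.
  split.
  - by exists [::].
  - move=> S S' [s hs] [s' hs']; exists (s ++ s') => x Kx h; split.
      by apply: hs => // i si; apply: h; rewrite mem_cat si.
    by apply: hs' => // i si; apply: h; rewrite mem_cat si orbT.
  - by move=> S S' SS' [s hs]; exists s => x Kx h; apply/SS'/hs.
have FK : F K by exists [::].
have [b [Kb clb]] := cK FF FK.
have [i [U nU UP]] := locP b Kb.
have FS : F [set y | K y /\ ~ P i y].
  by exists [:: i] => x Kx h; split=> //; apply: h; rewrite mem_head.
by have [y [[Ky nPy] Uy]] := clb _ _ FS nU; apply: nPy; exact: UP.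
Qed.

Variable A : set (T -> R).
Hypothesis A_continuous : forall f, A f -> continuous f.
Hypothesis A_cst : forall c : R, A (fun=> c).
Hypothesis A_add : forall f g, A f -> A g -> A (fun x => f x + g x).
Hypothesis A_mul : forall f g, A f -> A g -> A (fun x => f x * g x).
Hypothesis A_separates : forall a b, K a -> K b -> a != b -> exists2 f, A f & f a != f b.

Definition approx (g : T -> R) := forall e, 0 < e ->
  exists2 f, A f & forall x, K x -> `|g x - f x| <= e.

Lemma approx_incl f : A f -> approx f.
Proof. by move=> Af e e0; exists f => // x _; rewrite subrr normr0 ltW. Qed.

Lemma compact_bounded_fun (f : T -> R) : continuous f -> exists2 M, 0 < M & forall x, K x -> `|f x| <= M.
Proof.
move=> cf; have [s hs] : exists s : seq nat, forall x, K x -> exists2 i, i \in s & `|f x| <= i%:R.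
  apply: compact_finite_choice => b Kb.
  exists (Num.bound (`|f b| + 1)), [set x | `|f x - f b| < 1].
    by have := cf b => /cvgrPdist_lt/(_ _ ltr01); apply: filterS => x /=; rewrite distrC.
  move=> x /= h _; have := archi_boundP (addr_ge0 (normr_ge0 (f b)) ler01).
  by have := ler_normD (f x - f b) (f b); rewrite subrK; lra.
exists (\sum_(i <- s) i%:R + 1); first by rewrite ltr_wpDl // sumr_ge0.
move=> x Kx; have [i si h] := hs x Kx; apply: le_trans h _.
have si' : 0 <= \sum_(j <- rem i s) (j%:R : R) by apply: sumr_ge0.
by rewrite (big_rem i) //=; lra.
Qed.

(* The increasing Newton-type iteration [p + (t^2 - p^2) / 2] converges to [|t|]
   uniformly for [|t| <= 1]. *)
Fixpoint absp n (t : R) : R :=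
  if n is n'.+1 then absp n' t + (t * t + -1 * (absp n' t * absp n' t)) * 2^-1 else 0.

Lemma absp_itv n t : `|t| <= 1 -> 0 <= absp n t <= `|t|.
Proof.
move=> t1; elim: n => [|n IH] /=; first by rewrite lexx normr_ge0.
have tt : t * t = `|t| * `|t| by rewrite -normrM ger0_norm // -expr2 sqr_ge0.
rewrite tt; move: IH; set p := absp n t; set q := `|t| in t1 *; move=> /andP[p0 pq].
have e : q - (p + (q * q + -1 * (p * p)) * 2^-1) = (q - p) * (1 - (q + p) / 2) by field.
have : 0 <= (q - p) * (1 - (q + p) / 2) by apply: mulr_ge0; lra.
have : 0 <= (q - p) * ((q + p) / 2) by apply: mulr_ge0; lra.
by rewrite -e; nra.
Qed.

Lemma absp_err n t d : `|t| <= 1 -> 0 <= d -> d <= `|t| -> `|t| - absp n t <= (1 - d / 2) ^+ n.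
Proof.
move=> t1 d0 dt; elim: n => [|n IH] /=; first by rewrite subr0 expr0.
have tt : t * t = `|t| * `|t| by rewrite -normrM ger0_norm // -expr2 sqr_ge0.
have /andP[p0 pq] := absp_itv n t1; rewrite tt; move: IH p0 pq.
set p := absp n t; set q := `|t| in t1 dt *; move=> IH p0 pq.
rewrite (_ : q - _ = (q - p) * (1 - (q + p) / 2)); last by field.
rewrite exprSr; apply: ler_pM => //; lra.
Qed.

Lemma approx_abs f : A f -> approx (fun x => `|f x|).
Proof.
move=> Af e e0; have [M M0 fM] := compact_bounded_fun (A_continuous Af).
pose d := Num.min (e / M) 1; have d0 : 0 < d by rewrite lt_min ltr01 divr_gt0.
have d1 : d <= 1 by rewrite ge_min lexx orbT.
have [n hn] : exists n : nat, (1 - d / 2) ^+ n < d.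
  have h1 : `|1 - d / 2| < 1 by rewrite ger0_norm; lra.
  have /cvgrPdist_lt/(_ _ d0)[n _ /(_ n (leqnn n))] := cvg_expr h1.
  move=> h; exists n; move: h; rewrite sub0r normrN ger0_norm //; apply: exprn_ge0; lra.
have Aabs m : A (fun x => absp m (M^-1 * f x)).
  have Ag : A (fun x => M^-1 * f x) by exact: A_mul.
  elim: m => [|m IH] /=; first exact: A_cst.
  apply: (A_add IH); apply: A_mul; last exact: A_cst.
  by apply: A_add; [exact: A_mul|apply: A_mul; [exact: A_cst|exact: A_mul]].
exists (fun x => M * absp n (M^-1 * f x)); first exact: A_mul.
move=> x Kx; set t := M^-1 * f x.
have t1 : `|t| <= 1.
  by rewrite /t normrM ger0_norm ?invr_ge0 ?(ltW M0) // mulrC ler_pdivrMr // mul1r fM.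
have -> : `|f x| = M * `|t|.
  by rewrite /t normrM (ger0_norm (x := M^-1)) ?invr_ge0 ?(ltW M0) // mulrA divff ?mul1r // gt_eqF.
rewrite -mulrBr normrM (ger0_norm (ltW M0)) -ler_pdivlMl // mulrC.
have /andP[p0 pq] := absp_itv n t1; rewrite ger0_norm ?subr_ge0 //.
have de : d <= e / M by rewrite ge_min lexx.
have [td|dt] := leP `|t| d; first by lra.
have := absp_err n t1 (ltW d0) (ltW dt); lra.
Qed.

Lemma approx_max f g : approx f -> approx g -> approx (fun x => Num.max (f x) (g x)).
Proof.
move=> af ag e e0; have e4 : 0 < e / 4 by rewrite divr_gt0.
have [f' Af' ff'] := af _ e4; have [g' Ag' gg'] := ag _ e4.
have Ad : A (fun x => f' x + -1 * g' x) by apply: A_add => //; apply: A_mul.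
have [h Ah hh] := approx_abs Ad e4.
exists (fun x => (f' x + g' x + h x) * 2^-1).
  by apply: A_mul => //; apply: A_add => //; exact: A_add.
move=> x Kx; have := ff' x Kx; have := gg' x Kx; have := hh x Kx.
rewrite !ler_norml; case: (ler0P (f' x + -1 * g' x)); case: (leP (f x) (g x)); lra.
Qed.

Lemma approxN f : approx f -> approx (fun x => - f x).
Proof.
move=> af e e0; have [g Ag h] := af e e0; exists (fun x => -1 * g x); first exact: A_mul.
by move=> x Kx; rewrite mulN1r -opprD normrN h.
Qed.

Lemma approx_min f g : approx f -> approx g -> approx (fun x => Num.min (f x) (g x)).
Proof.
move=> af ag; have := approxN (approx_max (approxN af) (approxN ag)).
by congr approx; apply/funext => x; rewrite oppr_max !opprK.
Qed.

(** The lattice argument. Interpolants agree with [phi] at two points; for fixed [a], the maximum of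
    finitely many of them stays above [phi] - e/2 and equals [phi] at [a]; the minimum of finitely
    many such maxima also stays below [phi] + e/2. Maxima and minima are approximable by
    [approx_abs]. *)
Theorem stone_weierstrass (phi : T -> R) : {within K, continuous phi} -> approx phi.
Proof.
move=> /subspace_continuousP cphi e e0.
have near_phi (g : T -> R) (r : R) b : continuous g -> K b -> 0 < r ->
    exists2 U, nbhs b U & forall x, U x -> K x -> `|(g x - phi x) - (g b - phi b)| < r.
  move=> cg Kb r0; have r2 : 0 < r / 2 by rewrite divr_gt0.
  have /cvgrPdist_lt/(_ _ r2) h1 := cphi b Kb.
  have /cvgrPdist_lt/(_ _ r2) h2 := cg b.
  exists ([set x | K x -> `|phi b - phi x| < r / 2] `&` [set x | `|g b - g x| < r / 2]).
    exact: filterI.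
  by move=> x [hx1 hx2] /hx1; move: hx2; rewrite /= !ltr_norml; lra.
have interp a b : K a -> K b -> exists2 f, A f & f a = phi a /\ f b = phi b.
  move=> Ka Kb; have [<-|ab] := eqVneq a b; first by exists (fun=> phi a).
  have [h Ah hab] := A_separates Ka Kb ab.
  exists (fun x => phi a + (phi b - phi a) / (h b - h a) * (h x + - h a)).
    by apply: (A_add (A_cst (phi a))); apply: (A_mul (A_cst _)); exact: A_add.
  have hba : h b - h a != 0 by rewrite subr_eq0 eq_sym.
  by split; [rewrite subrr mulr0 addr0|rewrite divfK // subrKC].
have above a : K a -> exists g, [/\ continuous g, approx g, g a = phi a &
    forall x, K x -> phi x - e / 2 < g x].
  move=> Ka.
  have /choice[f fP] b : exists f, K b -> [/\ A f, f a = phi a & f b = phi b].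
    by have [Kb|] := pselect (K b); [have [f Af [h1 h2]] := interp a b Ka Kb; exists f|exists 0].
  have [s hs] : exists s : seq T, forall x, K x -> exists2 b, b \in s & K b /\ phi x - e / 2 < f b x.
    apply: compact_finite_choice => b Kb; have [Af fa fb] := fP b Kb.
    have e2 : 0 < e / 2 by rewrite divr_gt0.
    have [U nU UP] := near_phi _ _ b (A_continuous Af) Kb e2; exists b, U => // x Ux Kx; split=> //.
    by have := UP x Ux Kx; rewrite fb subrr subr0 ltr_norml; lra.
  have [fa' _] : exists2 f, A f & f a = phi a by have [f' A1 [h1 _]] := interp a a Ka Ka; exists f'.
  suff [g [cg ag ga gs]] : exists g, [/\ continuous g, approx g, g a = phi a &
      forall b x, b \in s -> K b -> f b x <= g x].
    exists g; split=> // x Kx; have [b bs [Kb]] := hs x Kx.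
    by move=> h; apply: lt_le_trans h (gs b x bs Kb).
  elim: s {hs} => [|b s [g [cg ag ga gs]]].
    have [f' A1 [h1 _]] := interp a a Ka Ka; exists f'; split=> //.
      exact: A_continuous.
    exact: approx_incl.
  have [Kb|nKb] := pselect (K b); last first.
    exists g; split=> // b' x; rewrite in_cons => /predU1P[->//|]; exact: gs.
  have [Af h1 h2] := fP b Kb.
  exists (fun x => Num.max (f b x) (g x)); split.
  - by move=> x; apply: continuous_max; [exact: A_continuous|exact: cg].
  - by apply: approx_max => //; exact: approx_incl.
  - by rewrite h1 ga maxxx.
  - move=> b' x; rewrite in_cons le_max => /predU1P[->|b's] Kb'; first by rewrite lexx.
    by rewrite (gs b') ?orbT.
have /choice[g gP] a : exists g, K a -> [/\ continuous g, approx g, g a = phi a &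
    forall x, K x -> phi x - e / 2 < g x].
  by have [Ka|] := pselect (K a); [have [g ?] := above a Ka; exists g|exists 0].
have [s hs] : exists s : seq T, forall x, K x -> exists2 a, a \in s & K a /\ g a x < phi x + e / 2.
  apply: compact_finite_choice => a Ka; have [cg ag ga gs] := gP a Ka.
  have e2 : 0 < e / 2 by rewrite divr_gt0.
  have [U nU UP] := near_phi _ _ a cg Ka e2; exists a, U => // x Ux Kx; split=> //.
  by have := UP x Ux Kx; rewrite ga subrr subr0 ltr_norml; lra.
suff [G [aG Ge Gs]] : exists G, [/\ approx G, forall x, K x -> phi x - e / 2 < G x &
    forall a x, a \in s -> K a -> G x <= g a x].
  have e2 : 0 < e / 2 by rewrite divr_gt0.
  have [f Af Gf] := aG _ e2; exists f => // x Kx.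
  have [a sa [Ka ha]] := hs x Kx; have := Gs a x sa Ka; have := Ge x Kx; have := Gf x Kx.
  by rewrite !ler_norml; lra.
elim: s {hs} => [|a s [G [aG Ge Gs]]].
  have [[a Ka]|noK] := pselect (exists a, K a).
    by have [_ ag _ gs] := gP a Ka; exists (g a); split.
  by exists (fun=> 0); split=> // [|x Kx]; [apply: approx_incl|exfalso; apply: noK; exists x].
have [Ka|nKa] := pselect (K a); last first.
  exists G; split=> // a' x; rewrite in_cons => /predU1P[->//|]; exact: Gs.
have [cg ag ga gs] := gP a Ka.
exists (fun x => Num.min (g a x) (G x)); split; first exact: approx_min.
  by move=> x Kx; rewrite lt_min gs //= Ge.
move=> a' x; rewrite in_cons ge_min => /predU1P[->|a's] Ka'; first by rewrite lexx.
by rewrite (Gs a') ?orbT.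
Qed.

End stone_weierstrass.

(** * Greedy construction of equidistributed backward orbits *)

Section greedy.
Context {R : realType}.
Variables (eps : R) (eps_itv : 0 <= eps <= 1 / 2).
Local Notation tw := (tw eps).
Local Notation tL := (tL eps).
Local Notation tint := (tint eps_itv).
Implicit Types (x : torus R) (f : torus R -> R).

Section greedy_choice.
Variable h : nat -> torus R -> R.
Hypothesis h_bound : forall l x, `|h l x| <= (1 / 2) ^+ l.+1 / l.+1%:R.

(** The martingale difference of [h l] along the backward walk. *)
Definition mdiff l j x : R := h l (tsec j x) - tL (h l) x.

Lemma mdiff_mean l x : \sum_(j < 3) tw (tsec j x) * mdiff l j x = 0.
Proof.
under eq_bigr do rewrite mulrBr; rewrite sumrB -mulr_suml sum_tw mul1r.
by rewrite subrr.
Qed.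

Lemma mdiff_bound l j x : `|mdiff l j x| <= (1 / 2) ^+ l / l.+1%:R.
Proof.
have hb x' : `|h l x' - 0| <= (1 / 2) ^+ l.+1 / l.+1%:R by rewrite subr0.
have := tL_near eps_itv hb x; rewrite subr0 => h1.
have -> : (1 / 2 : R) ^+ l / l.+1%:R = (1 / 2) ^+ l.+1 / l.+1%:R + (1 / 2) ^+ l.+1 / l.+1%:R.
  by rewrite -mulrDl -half_expS.
by apply: le_trans (ler_normB _ _) _; apply: lerD.
Qed.

Lemma mdiff_sqr l j x : mdiff l j x ^+ 2 <= (1 / 2) ^+ l.
Proof.
have p0 : 0 <= (1 / 2 : R) ^+ l by rewrite exprn_ge0 // divr_ge0.
have p1 : (1 / 2 : R) ^+ l <= 1 by rewrite exprn_ile1 //; lra.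
have b : `|mdiff l j x| <= (1 / 2) ^+ l.
  apply: le_trans (mdiff_bound l j x) _; rewrite ler_pdivrMr ?ltr0Sn // ler_peMr //.
  by rewrite ler1n.
rewrite -real_normK ?num_real //.
rewrite expr2 -[leRHS]mulr1; apply: ler_pM => //; exact: le_trans b p1.
Qed.

Lemma sum_half n : \sum_(l < n) (1 / 2 : R) ^+ l <= 2 - 2 * (1 / 2) ^+ n.
Proof.
elim: n => [|n IH]; first by rewrite big_ord0 expr0; lra.
by rewrite big_ord_recr /= exprS; lra.
Qed.

(* The mean over the three preimages of the increment of [\sum_l S l ^ 2] is the
   sum of the mean squares, as the [mdiff l] have mean zero. *)
Lemma greedy_step n x (S : nat -> R) : exists j : 'I_3,
  \sum_(l < n) (S l + mdiff l j x) ^+ 2 <= \sum_(l < n) S l ^+ 2 + 2.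
Proof.
apply: contrapT => /forallNP nj.
have nj' j : \sum_(l < n) S l ^+ 2 + 2 < \sum_(l < n) (S l + mdiff l j x) ^+ 2.
  by have /negP := nj j; rewrite -ltNge.
have s1 := sum_tw eps x.
have lt : \sum_(j < 3) tw (tsec j x) * (\sum_(l < n) S l ^+ 2 + 2) <
    \sum_(j < 3) tw (tsec j x) * \sum_(l < n) (S l + mdiff l j x) ^+ 2.
  by apply: ltr_sum; [apply/hasP; exists ord0; rewrite ?mem_index_enum|move=> j _; rewrite ltr_pM2l ?tw_gt0].
move: lt; rewrite -mulr_suml s1 mul1r ltNge => /negP; apply.
under eq_bigr do rewrite mulr_sumr; rewrite exchange_big /=.
apply: (@le_trans _ _ (\sum_(l < n) (S l ^+ 2 + (1 / 2) ^+ l))); last first.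
  rewrite big_split /= lerD2l; apply: le_trans (sum_half n) _.
  by have : 0 <= (1 / 2 : R) ^+ n; [rewrite exprn_ge0 // divr_ge0|lra].
apply: ler_sum => l _.
have -> : \sum_(j < 3) tw (tsec j x) * (S l + mdiff l j x) ^+ 2 =
    S l ^+ 2 + \sum_(j < 3) tw (tsec j x) * mdiff l j x ^+ 2.
  transitivity (\sum_(j < 3) (tw (tsec j x) * S l ^+ 2 + 2 * S l * (tw (tsec j x) * mdiff l j x) +
      tw (tsec j x) * mdiff l j x ^+ 2)); first by apply: eq_bigr => j _; ring.
  by rewrite !big_split /= -mulr_suml s1 mul1r -mulr_sumr mdiff_mean mulr0 addr0.
rewrite lerD2l; apply: (@le_trans _ _ (\sum_(j < 3) tw (tsec j x) * (1 / 2) ^+ l)); last first.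
  by rewrite -mulr_suml s1 mul1r.
apply: ler_sum => j _.
by apply: ler_wpM2l; [exact: ltW (tw_gt0 eps_itv _)|exact: mdiff_sqr].
Qed.

(** At time n only the functions of index below n are watched. A step adds at most 2 to their sum of
    squares by [greedy_step], and the function of index n then enters with square at most 1: its n +
    1 increments are each at most 1 / (n + 1), the purpose of the denominator in [h_bound]. Hence 3
    per step. *)
Lemma greedy_preorbit x0 : exists2 y : nat -> torus R,
  y 0%N = x0 /\ (forall n, tmap (y n.+1) = y n) &
  forall l n, (l < n)%N -> (\sum_(i < n) (h l (y i.+1) - tL (h l) (y i))) ^+ 2 <= 3 * n%:R.
Proof.
have /choice[J JP] (p : nat * torus R * (nat -> R)) : exists j : 'I_3,
    \sum_(l < p.1.1) (p.2 l + mdiff l j p.1.2) ^+ 2 <= \sum_(l < p.1.1) p.2 l ^+ 2 + 2.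
  exact: greedy_step.
pose fix st n : torus R * (nat -> R) := if n is n'.+1 then
    let s := st n' in let j := J (n', s.1, s.2) in
    (tsec j s.1, fun l => s.2 l + mdiff l j s.1)
  else (x0, fun=> 0).
have S_E l n : (st n).2 l = \sum_(i < n) (h l (st i.+1).1 - tL (h l) (st i).1).
  by elim: n => [|n IH]; rewrite ?big_ord0 // big_ord_recr /= -IH.
have S_b l n : `|(st n).2 l| <= n%:R * ((1 / 2) ^+ l / l.+1%:R).
  elim: n => [|n IH]; first by rewrite /= normr0 mul0r.
  have -> : n.+1%:R * ((1 / 2 : R) ^+ l / l.+1%:R) =
      n%:R * ((1 / 2) ^+ l / l.+1%:R) + (1 / 2) ^+ l / l.+1%:R by rewrite -natr1; ring.
  by apply: le_trans (ler_normD _ _) _; apply: lerD => //; exact: mdiff_bound.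
have Phi n : \sum_(l < n) (st n).2 l ^+ 2 <= 3 * n%:R.
  elim: n => [|n IH]; first by rewrite big_ord0 mulr0.
  rewrite big_ord_recr /=; have -> : (n.+1%:R : R) = n%:R + 1 by rewrite natr1.
  have := JP (n, (st n).1, (st n).2); rewrite /= => h1.
  have h2 : ((st n.+1).2 n) ^+ 2 <= 1.
    have b := S_b n n.+1.
    have b1 : `|(st n.+1).2 n| <= 1.
      apply: le_trans b _; rewrite mulrCA divff ?pnatr_eq0 // mulr1.
      by rewrite exprn_ile1 //; lra.
    by rewrite -real_normK ?num_real // exprn_ile1.
  move: h2 h1 IH; rewrite /=; lra.
exists (fun n => (st n).1); first by split=> // n; rewrite /= tmap_tsec.
move=> l n ln; rewrite -S_E; apply: le_trans (Phi n).
by rewrite (bigD1 (Ordinal ln)) //= lerDl; apply: sumr_ge0 => i _; exact: sqr_ge0.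
Qed.

End greedy_choice.

Definition equidistributed (y : nat -> torus R) f (c : R) :=
  forall e, 0 < e -> exists n0, forall n, (n0 <= n)%N ->
    `|\sum_(i < n) f (y i) - n%:R * c| <= e * n%:R.

(** A solution h of h - [tL] h = f up to the error [iter N tL f], which is nearly constant for large
    [N]. *)
Definition cobound f N : torus R -> R := fun x => \sum_(m < N) iter m tL f x.

Lemma coboundE f N x : f x - iter N tL f x = cobound f N x - tL (cobound f N) x.
Proof.
have -> : tL (cobound f N) x = \sum_(m < N) iter m.+1 tL f x.
  transitivity (\sum_(j < 3) \sum_(m < N) tw (tsec j x) * iter m tL f (tsec j x)).
    by apply: eq_bigr => j _; rewrite /cobound mulr_sumr.
  by rewrite exchange_big.
elim: N => [|N IH]; first by rewrite /cobound !big_ord0 !subrr.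
by rewrite /cobound in IH *; rewrite !big_ord_recr /=; move: IH; lra.
Qed.

Lemma iter_tL_le1 k n m x : `|iter m tL (tcos k n) x| <= 1.
Proof. by have [_ h _] := iter_tL_bounded eps_itv m (@tcos_measurable R k n) (tcos_le1 k n). Qed.

Lemma cobound_bound k n N x : `|cobound (tcos k n) N x| <= N%:R.
Proof.
apply: le_trans (ler_norm_sum _ _ _) _.
apply: le_trans (_ : _ <= \sum_(m < N) (1 : R)) _; first by apply: ler_sum => m _; exact: iter_tL_le1.
by rewrite sumr_const card_ord.
Qed.

(** With h = [cobound f N], f(y_i) minus the mean splits into a uniformly small error, the
    martingale difference h(y_(i+1)) - [tL] h(y_i), and the telescoping h(y_i) - h(y_(i+1)). Sums of
    the second are of order sqrt m along the greedy orbit. All characters and all precisions 1 / (p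
    + 1) are enumerated into a single sequence [h]. *)
Lemma equidistributed_preorbit x0 : exists2 y : nat -> torus R,
  y 0%N = x0 /\ (forall n, tmap (y n.+1) = y n) &
  forall k n, equidistributed y (tcos k n) (tint (tcos k n)).
Proof.
have inv0 p : 0 < (p.+1%:R : R)^-1 by rewrite invr_gt0.
have /choice[NN NP] (q : int * int * int * nat) : exists N, forall x,
    `|iter N tL (tcos q.1.1 q.1.2) x - tint (tcos q.1.1 q.1.2)| <= q.2.+1%:R^-1.
  exact: tcos_limit.
pose hh (q : int * int * int * nat) := cobound (tcos q.1.1 q.1.2) (NN q).
(* Scaling to meet [h_bound], as [hh q] is bounded by [NN q]. Undoing it later only enlarges the
   constant in front of sqrt m. *)
pose c (l : nat) (q : int * int * int * nat) : R := (1 / 2) ^+ l.+1 / l.+1%:R / (NN q).+1%:R.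
have c0 l q : 0 < c l q by rewrite /c !divr_gt0 // exprn_gt0.
pose h (l : nat) (x : torus R) : R :=
  if @unpickle (int * int * int * nat)%type l is Some q then c l q * hh q x else 0.
have hb l x : `|h l x| <= (1 / 2) ^+ l.+1 / l.+1%:R.
  rewrite /h; case: unpickle => [q|]; last by rewrite normr0 divr_ge0 // exprn_ge0 // divr_ge0.
  rewrite normrM (ger0_norm (ltW (c0 l q))).
  apply: (@le_trans _ _ (c l q * (NN q).+1%:R)).
    apply: ler_wpM2l; first exact: ltW.
    by apply: le_trans (cobound_bound _ _ _ _) _; rewrite ler_nat.
  by rewrite /c divfK // pnatr_eq0.
have [y [y0 ty] yh] := greedy_preorbit hb x0; exists y => // k n e e0.
have [p pe] : exists p : nat, p.+1%:R^-1 < e / 2 :> R.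
  have e2 : 0 < e / 2 by rewrite divr_gt0.
  exists (Num.bound (e / 2)^-1); rewrite invf_plt ?posrE //.
  apply: lt_le_trans (archi_boundP _) _; first by rewrite invr_ge0 ltW.
  by rewrite ler_nat.
pose q := (k, n, p); pose l := pickle q; pose N := NN q.
have hl x : h l x = c l q * hh q x by rewrite /h /l pickleK.
have tLhl x : tL (h l) x = c l q * tL (hh q) x.
  by rewrite (_ : h l = fun x => c l q * hh q x) ?tL_scale //; apply/funext => z; exact: hl.
pose C : R := c l q.
have C0 : 0 < C by exact: c0.
pose B : R := 2 * N%:R.
have key m : (l < m)%N -> `|\sum_(i < m) tcos k n (y i) - m%:R * tint (tcos k n)| <=
    m%:R * p.+1%:R^-1 + C^-1 * Num.sqrt (3 * m%:R) + B.
  move=> lm.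
  have -> : \sum_(i < m) tcos k n (y i) - m%:R * tint (tcos k n) =
      \sum_(i < m) (iter N tL (tcos k n) (y i) - tint (tcos k n)) +
      C^-1 * \sum_(i < m) (h l (y i.+1) - tL (h l) (y i)) + (hh q (y 0%N) - hh q (y m)).
    have -> : C^-1 * \sum_(i < m) (h l (y i.+1) - tL (h l) (y i)) =
        \sum_(i < m) (hh q (y i.+1) - tL (hh q) (y i)).
      rewrite mulr_sumr; apply: eq_bigr => i _; rewrite hl tLhl -/C -mulrBr mulrA mulVf ?mul1r //.
      by rewrite gt_eqF.
    have tel : hh q (y 0%N) - hh q (y m) = \sum_(i < m) (hh q (y i) - hh q (y i.+1)).
      elim: (m) => [|m' IH]; first by rewrite big_ord0 subrr.
      by rewrite big_ord_recr /= -IH; ring.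
    rewrite tel -big_split -big_split /= mulr_natl -(card_ord m) -sumr_const card_ord -sumrB.
    by apply: eq_bigr => i _; have := coboundE (tcos k n) N (y i); rewrite -/(hh q); lra.
  apply: le_trans (ler_normD _ _) _; apply: lerD.
    apply: le_trans (ler_normD _ _) _; apply: lerD.
      apply: le_trans (ler_norm_sum _ _ _) _.
      have -> : m%:R * (p.+1%:R : R)^-1 = \sum_(i < m) p.+1%:R^-1.
        by rewrite sumr_const card_ord mulr_natl.
      by apply: ler_sum => i _; exact: NP q (y i).
    rewrite normrM ger0_norm ?invr_ge0 ?(ltW C0) //; apply: ler_wpM2l; first by rewrite invr_ge0 ltW.
    rewrite -(ler_pXn2r (_ : 0 < 2)%N) ?nnegrE ?sqrtr_ge0 // real_normK ?num_real //.
    by rewrite sqr_sqrtr ?mulr_ge0 //; exact: yh.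
  apply: le_trans (ler_normB _ _) _; rewrite /B mulrDl (mul1r N%:R).
  by apply: lerD; exact: cobound_bound.
have [m1 m1P] : exists m1 : nat, forall m, (m1 <= m)%N ->
    C^-1 * Num.sqrt (3 * m%:R) + B <= e / 2 * m%:R.
  pose D := e / 4.
  have D0 : 0 < D by rewrite divr_gt0.
  exists (Num.bound (3 * (C * D)^-1 ^+ 2 + B / D)) => m hm.
  have h3 : 0 <= 3 * (C * D)^-1 ^+ 2 by rewrite mulr_ge0 ?sqr_ge0.
  have h4 : 0 <= B / D by rewrite divr_ge0 ?(ltW D0) // mulr_ge0.
  have mb : 3 * (C * D)^-1 ^+ 2 + B / D <= m%:R.
    apply: le_trans (_ : _ <= (Num.bound (3 * (C * D)^-1 ^+ 2 + B / D))%:R) _; last by rewrite ler_nat.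
    by apply/ltW/archi_boundP; exact: addr_ge0.
  have b1 : B <= D * m%:R by rewrite mulrC -ler_pdivrMr //; lra.
  have b2 : C^-1 * Num.sqrt (3 * m%:R) <= D * m%:R.
    rewrite ler_pdivrMl // -(ler_pXn2r (_ : 0 < 2)%N) ?nnegrE ?sqrtr_ge0 //; last first.
      by rewrite !mulr_ge0 // ltW.
    rewrite sqr_sqrtr ?mulr_ge0 //.
    have CD0 : 0 < (C * D) ^+ 2 by rewrite exprn_gt0 // mulr_gt0.
    have : (C * D) ^+ 2 * (3 * (C * D)^-1 ^+ 2) <= (C * D) ^+ 2 * m%:R.
      by apply: ler_wpM2l; [exact: ltW|lra].
    rewrite exprVn mulrCA divff ?gt_eqF // mulr1 => h5.
    have -> : (C * (D * m%:R)) ^+ 2 = ((C * D) ^+ 2 * m%:R) * m%:R by ring.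
    by apply: ler_wpM2r.
  have -> : e / 2 = D + D by rewrite /D; field.
  by rewrite (mulrDl D D); apply: lerD.
exists (maxn l.+1 m1) => m; rewrite geq_max => /andP[lm hm].
apply: le_trans (key m lm) _.
have := m1P m hm.
have : m%:R * p.+1%:R^-1 <= m%:R * (e / 2) :> R by apply: ler_wpM2l => //; exact: ltW.
rewrite (_ : e * m%:R = m%:R * (e / 2) + e / 2 * m%:R); last by field.
by move=> h1 h2; rewrite -addrA; exact: lerD.
Qed.

End greedy.

(** * Trigonometric polynomials *)

Section trigonometric_polynomials.
Context {R : realType}.
Implicit Types (f g : torus R -> R).

Inductive trigpoly : (torus R -> R) -> Prop :=
| trigpoly_cos k n : trigpoly (tcos k n)
| trigpolyD f g : trigpoly f -> trigpoly g -> trigpoly (fun x => f x + g x)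
| trigpolyZ c f : trigpoly f -> trigpoly (fun x => c * f x).

Lemma trigpolyM f g : trigpoly f -> trigpoly g -> trigpoly (fun x => f x * g x).
Proof.
move=> tf tg; elim: tf => [k n|f1 f2 _ h1 _ h2|c f1 _ h1]; last 2 first.
- rewrite (_ : (fun x => _) = (fun x => f1 x * g x + f2 x * g x)); first exact: trigpolyD.
  by apply/funext => x; rewrite mulrDl.
- rewrite (_ : (fun x => _) = (fun x => c * (f1 x * g x))); first exact: trigpolyZ.
  by apply/funext => x; rewrite mulrA.
elim: tg => [k' n'|f1 f2 _ h1 _ h2|c f1 _ h1].
- rewrite (_ : (fun x => _) = (fun x => 2^-1 * (tcos (k.1 + k'.1, k.2 + k'.2) (n + n') x +
      tcos (k.1 - k'.1, k.2 - k'.2) (n - n') x))).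
    by apply: trigpolyZ; apply: trigpolyD; exact: trigpoly_cos.
  by apply/funext => x; rewrite tcosM mulrC.
- rewrite (_ : (fun x => _) = (fun x => tcos k n x * f1 x + tcos k n x * f2 x)); first exact: trigpolyD.
  by apply/funext => x; rewrite mulrDr.
- rewrite (_ : (fun x => _) = (fun x => c * (tcos k n x * f1 x))); first exact: trigpolyZ.
  by apply/funext => x; rewrite mulrCA.
Qed.

Lemma trigpoly_cst (c : R) : trigpoly (fun=> c).
Proof.
rewrite (_ : (fun=> c) = (fun x => c * tcos (0, 0) 0 x)).
  by apply: trigpolyZ; exact: trigpoly_cos.
by apply/funext => x; rewrite tcos00 mulr1.
Qed.

Lemma trigpoly_tmap f : trigpoly f -> trigpoly (fun x => f (tmap x)).
Proof.
elim=> [k n|f1 f2 _ h1 _ h2|c f1 _ h1]; [|exact: trigpolyD|exact: trigpolyZ].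
rewrite (_ : (fun x => _) = tcos (k.1 + k.2, k.1 + 4 * k.2) n); first exact: trigpoly_cos.
by apply/funext => x; exact: tcos_tmap.
Qed.

Lemma trigpoly_continuous f : trigpoly f -> continuous f.
Proof.
elim=> [k n|f1 f2 _ h1 _ h2|c f1 _ h1]; first exact: tcos_continuous.
  by move=> x; apply: continuousD; [exact: h1|exact: h2].
by move=> x; apply: continuousM; [exact: cst_continuous|exact: h1].
Qed.

Lemma trigpoly_bounded f : trigpoly f -> exists M : R, forall x, `|f x| <= M.
Proof.
elim=> [k n|f1 f2 _ [M1 h1] _ [M2 h2]|c f1 _ [M h1]]; first by exists 1; exact: tcos_le1.
  by exists (M1 + M2) => x; apply: le_trans (ler_normD _ _) _; exact: lerD.
by exists (`|c| * M) => x; rewrite normrM; exact: ler_wpM2l.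
Qed.

Lemma trigpoly_measurable f : trigpoly f -> measurable_fun setT (f : torus R -> measurableTypeR R).
Proof. by move=> tf; apply: torus_continuous_measurable; exact: trigpoly_continuous. Qed.

Section equidistribution.
Variables (eps : R) (eps_itv : 0 <= eps <= 1 / 2).
Local Notation tint := (tint eps_itv).
Local Notation tprob := (tprob eps_itv).
Implicit Types (y : nat -> torus R).

Lemma trigpoly_integrable f : trigpoly f -> (tprob).-integrable setT (EFin \o f).
Proof.
move=> tf; have [M fM] := trigpoly_bounded tf.
have := @bounded_integrable R _ (torus R) tprob f M (trigpoly_measurable tf) fM.
exact.
Qed.

Lemma equidistributed_trigpoly y f : (forall k n, equidistributed y (tcos k n) (tint (tcos k n))) ->
  trigpoly f -> equidistributed y f (tint f).
Proof.
move=> yP; elim=> [//|f1 f2 t1 h1 t2 h2|c f1 t1 h1] e e0.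
  have e2 : 0 < e / 2 by rewrite divr_gt0.
  have [n1 H1] := h1 _ e2; have [n2 H2] := h2 _ e2.
  exists (maxn n1 n2) => n; rewrite geq_max => /andP[/H1 b1 /H2 b2].
  have -> : tint (fun x => f1 x + f2 x) = tint f1 + tint f2.
    exact: (RintegralD measurableT (trigpoly_integrable t1) (trigpoly_integrable t2)).
  have -> : \sum_(i < n) (f1 (y i) + f2 (y i)) - n%:R * (tint f1 + tint f2) =
      (\sum_(i < n) f1 (y i) - n%:R * tint f1) + (\sum_(i < n) f2 (y i) - n%:R * tint f2).
    by rewrite big_split /=; ring.
  by apply: le_trans (ler_normD _ _) _; lra.
have ec : 0 < e / (`|c| + 1) by rewrite divr_gt0 // ltr_wpDl.
have [n1 H1] := h1 _ ec; exists n1 => n /H1 b.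
have -> : tint (fun x => c * f1 x) = c * tint f1.
  exact: (RintegralZl c measurableT (trigpoly_integrable t1)).
rewrite -mulr_sumr mulrCA -mulrBr normrM.
apply: (@le_trans _ _ ((`|c| + 1) * (e / (`|c| + 1) * n%:R))).
  by apply: ler_pM => //; rewrite lerDl.
by rewrite mulrA mulrCA divff ?mulr1 // gt_eqF // ltr_wpDl.
Qed.

Lemma equidistributed_shift y f (c M : R) m : (forall x, `|f x| <= M) -> equidistributed y f c ->
  equidistributed (fun i => y (i + m)%N) f c.
Proof.
move=> fM; elim: m => [|m IH] h.
  by rewrite (_ : (fun i => _) = y) //; apply/funext => i; rewrite addn0.
move=> e e0; have e2 : 0 < e / 2 by rewrite divr_gt0.
have [n1 H1] := IH h _ e2.
have M0 : 0 <= M by exact: le_trans (fM (y 0%N)).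
exists (maxn n1 (Num.bound (4 * M / e))) => n; rewrite geq_max => /andP[/H1 b1 b2].
have -> : \sum_(i < n) f (y (i + m.+1)%N) =
    \sum_(i < n) f (y (i + m)%N) + (f (y (n + m)%N) - f (y m)).
  elim: (n) => [|n' IHn]; first by rewrite !big_ord0 add0r add0n subrr.
  by rewrite !big_ord_recr /= IHn addnS addSn; ring.
have b3 : 4 * M <= e * n%:R.
  rewrite (mulrC e) -ler_pdivrMr //; apply: le_trans (_ : _ <= (Num.bound (4 * M / e))%:R) _.
    by apply/ltW/archi_boundP; rewrite divr_ge0 ?(ltW e0) // mulr_ge0.
  by rewrite ler_nat.
have := fM (y (n + m)%N); have := fM (y m); move: b1.
by rewrite !ler_norml; lra.
Qed.

End equidistribution.
End trigonometric_polynomials.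

(** * Compactness and density on the natural extension *)

Section natural_extension_topology.
Context {R : realType}.
Local Notation NE := (natural_extension (@tmap R)).
Implicit Types (xh : bisequence R) (F : bisequence R -> R).

Definition past f (m : nat) xh : R := f (xh (- m%:Z)).

Lemma past_continuous f m : trigpoly f -> continuous (past f m).
Proof.
move=> tf xh; apply: continuous_comp; first exact: bi_coord_continuous.
exact: trigpoly_continuous.
Qed.

Lemma bi_tcos_continuous k n (i : int) : continuous (fun xh : bisequence R => tcos k n (xh i)).
Proof.
move=> xh; apply: continuous_comp; first exact: bi_coord_continuous.
exact: tcos_continuous.
Qed.

(** Characters separate points, so the orbit relations become equations between continuous real
    functions. *)
Lemma natural_extension_closed : closed NE.
Proof.
pose E (q : int * (int * int) * int) : set (bisequence R) :=
  (fun xh => tcos (q.1.2.1 + q.1.2.2, q.1.2.1 + 4 * q.1.2.2) q.2 (xh q.1.1) -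
             tcos q.1.2 q.2 (xh (q.1.1 + 1))) @^-1` [set 0].
rewrite (_ : NE = \bigcap_q E q).
  apply: closed_bigI => q _; apply: preimage_closed; last exact: closed_eq.
  have cE : continuous (fun xh : bisequence R =>
      tcos (q.1.2.1 + q.1.2.2, q.1.2.1 + 4 * q.1.2.2) q.2 (xh q.1.1) -
      tcos q.1.2 q.2 (xh (q.1.1 + 1))).
    move=> xh; exact: (@continuousB R R^o (bisequence R) _ _ xh
      (@bi_tcos_continuous _ _ _ xh) (@bi_tcos_continuous _ _ _ xh)).
  by move=> xh _; exact: cE.
apply/seteqP; split=> [xh hx q _|xh hx n].
  by rewrite /E /= -tcos_tmap hx subrr.
apply: tcos_separates => k m; rewrite tcos_tmap.
by have /eqP := hx (n, k, m) I; rewrite subr_eq0 => /eqP.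
Qed.

Lemma natural_extension_compact : compact NE.
Proof.
apply: subclosed_compact natural_extension_closed _ (@subsetT _ _).
have := @tychonoff int (fun=> torus R) (fun=> setT) (fun=> torus_compact).
by congr compact; apply/seteqP; split.
Qed.

Lemma natural_extension_measurable : measurable NE.
Proof.
rewrite -(setCK NE); apply: measurableC; apply: bisequence_open_measurable.
exact: closed_openC natural_extension_closed.
Qed.

(* On the natural extension these functions form an algebra, as an earlier
   coordinate determines the later ones. *)
Definition past_algebra : set (bisequence R -> R) := [set F | continuous F /\
  exists m f, trigpoly f /\ forall xh, NE xh -> F xh = past f m xh].

Lemma past_raise f m p : trigpoly f -> exists2 f', trigpoly f' &
  forall xh, NE xh -> past f m xh = past f' (m + p) xh.
Proof.
move=> tf; elim: p => [|p [f' tf' h]]; first by exists f => //; rewrite addn0.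
exists (fun x => f' (tmap x)); first exact: trigpoly_tmap.
move=> xh hx; rewrite h // /past; congr (f' _).
by rewrite hx; congr (xh _); lia.
Qed.

Lemma past_common F G : past_algebra F -> past_algebra G -> exists m f g,
  [/\ trigpoly f, trigpoly g, forall xh, NE xh -> F xh = past f m xh &
   forall xh, NE xh -> G xh = past g m xh].
Proof.
move=> [_ [m [f [tf hf]]]] [_ [p [g [tg hg]]]].
have [f' tf' hf'] := past_raise m p tf; have [g' tg' hg'] := past_raise p m tg.
exists (m + p)%N, f', g'; split=> // xh hx; first by rewrite hf // hf'.
by rewrite hg // hg' // addnC.
Qed.

(** The past separates the points of the natural extension, since coordinate 0 determines the
    future. *)
Lemma past_approx phi : {within NE, continuous phi} -> approx NE past_algebra phi.
Proof.
apply: stone_weierstrass.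
- exact: natural_extension_compact.
- by move=> F [].
- move=> c; split; first exact: cst_continuous.
  by exists 0%N, (fun=> c); split=> //; exact: trigpoly_cst.
- move=> F G aF aG; split.
    by move=> x; apply: continuousD; [case: aF => h _; exact: h|case: aG => h _; exact: h].
  have [m [f [g [tf tg hf hg]]]] := past_common aF aG.
  exists m, (fun x => f x + g x); split; first exact: trigpolyD.
  by move=> xh hx; rewrite hf // hg.
- move=> F G aF aG; split.
    by move=> x; apply: continuousM; [case: aF => h _; exact: h|case: aG => h _; exact: h].
  have [m [f [g [tf tg hf hg]]]] := past_common aF aG.
  exists m, (fun x => f x * g x); split; first exact: trigpolyM.
  by move=> xh hx; rewrite hf // hg.
- move=> a b ha hb; apply: contraNP => /forall2NP noF.
  have eqm m : a (- m%:Z) = b (- m%:Z).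
    apply: tcos_separates => k n; have [nF|/negP] := noF (past (tcos k n) m).
      exfalso; apply: nF; split; first by apply: past_continuous; exact: trigpoly_cos.
      by exists m, (tcos k n); split=> //; exact: trigpoly_cos.
    by rewrite negbK => /eqP.
  apply/eqP/funext => -[k|k]; last by have := eqm k.+1; rewrite NegzE.
  elim: k => [|k IH]; first by have := eqm 0%N; rewrite oppr0.
  have -> : Posz k.+1 = Posz k + 1 by lia.
  by rewrite -ha -hb IH.
Qed.

End natural_extension_topology.

(** * Backward empirical measures and full basins *)

Section empirical_integrals.
Context {R : realType}.
Implicit Types (xh : bisequence R) (phi : bisequence R -> R).

Lemma integral_empirical (L : set (bisequence R)) phi xh n : measurable L ->
  measurable_fun L (phi : bisequence R -> measurableTypeR R) ->
  (forall k, L (iter k seq_shift_inv xh)) ->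
  (\int[backward_empirical xh n]_(x in L) (phi x)%:E)%E =
  (n%:R^-1 * \sum_(k < n) phi (iter k seq_shift_inv xh))%:E.
Proof.
move=> mL mphi Lxh.
have pos (p : bisequence R -> \bar R) : measurable_fun L p -> (forall x, 0 <= p x)%E ->
    (\int[backward_empirical xh n]_(x in L) p x =
     n%:R^-1%:E * \sum_(k < n) p (iter k seq_shift_inv xh))%E.
  move=> mp p0; have p0L x : L x -> (0 <= p x)%E by move=> _.
  rewrite /backward_empirical.
  apply: (eq_trans (ge0_integral_mscale _ mL _ mp p0L)); congr (_ * _)%E.
  apply: (eq_trans (ge0_integral_measure_sum _ mL p0L mp n)); apply: eq_bigr => k _.
  by rewrite (integral_dirac _ mL mp) diracE mem_set ?mul1e.
have mphiE : measurable_fun L (fun x => (phi x)%:E) by exact/measurable_EFinP.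
rewrite integralE pos //; last exact: measurable_funepos.
rewrite pos //; last exact: measurable_funeneg.
have -> : (\sum_(k < n) (fun x => (phi x)%:E)^\+ (iter k seq_shift_inv xh))%E =
    (\sum_(k < n) Num.max (phi (iter k seq_shift_inv xh)) 0)%:E.
  by rewrite -sumEFin; apply: eq_bigr => k _; rewrite funeposE -EFin_max.
have -> : (\sum_(k < n) (fun x => (phi x)%:E)^\- (iter k seq_shift_inv xh))%E =
    (\sum_(k < n) Num.max (- phi (iter k seq_shift_inv xh)) 0)%:E.
  by rewrite -sumEFin; apply: eq_bigr => k _; rewrite funenegE -EFinN -EFin_max.
rewrite -!EFinM -EFinB -mulrBr -sumrB; congr (_ * _)%:E; apply: eq_bigr => k _.
by case: (leP (phi _) 0) => h; case: leP => h'; lra.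
Qed.

End empirical_integrals.

Section backward_orbits.
Context {R : realType}.
Local Notation NE := (natural_extension (@tmap R)).

Definition orbit_of (y : nat -> torus R) : bisequence R := fun n =>
  match n with Posz k => iter k tmap (y 0%N) | Negz k => y k.+1 end.

Lemma orbit_of_past (y : nat -> torus R) (m : nat) : orbit_of y (- m%:Z) = y m.
Proof. by case: m => [|m]; [rewrite oppr0|rewrite -NegzE]. Qed.

Lemma iter_shift_inv (k : nat) (xh : bisequence R) (n : int) : iter k seq_shift_inv xh n = xh (n - k%:Z).
Proof.
elim: k n => [|k IH] n; first by rewrite subr0.
by rewrite iterS /seq_shift_inv IH; congr (xh _); lia.
Qed.

Lemma orbit_of_natural (y : nat -> torus R) : (forall n, tmap (y n.+1) = y n) -> NE (orbit_of y).
Proof.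
move=> ty [k|[|k]].
- by have -> : Posz k + 1 = Posz k.+1 by lia.
- exact: ty.
- have -> : Negz k.+1 + 1 = Negz k by lia.
  exact: ty.
Qed.

Lemma natural_iter_shift_inv (k : nat) (xh : bisequence R) : NE xh -> NE (iter k seq_shift_inv xh).
Proof. by move=> hx n; rewrite !iter_shift_inv hx; congr (xh _); lia. Qed.

End backward_orbits.

Section basin.
Context {R : realType}.
Variables (eps : R) (eps_itv : 0 <= eps <= 1 / 2).
Local Notation tprob := (tprob eps_itv).
Local Notation tlift := (tlift eps_itv).
Local Notation tint := (tint eps_itv).
Local Notation NE := (natural_extension (@tmap R)).
Implicit Types (f : torus R -> R) (phi : bisequence R -> R) (y : nat -> torus R).

Lemma tlift_past m B : measurable B -> tlift [set xh | B (xh (- m%:Z))] = tprob B.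
Proof.
move=> mB; have [h1 h2 h3] := tlift_is_lift eps_itv; elim: m => [|m IH].
  by rewrite -h3.
rewrite -IH; rewrite -[LHS]h2; last first.
  by have := preim_measurable (@bi_coord_measurable R (- (m.+1)%:Z)) mB.
congr (tlift _); apply/seteqP; split=> xh /=; rewrite /seq_shift;
  by have -> : - (m.+1)%:Z + 1 = - m%:Z by lia.
Qed.

Lemma tlift_past_integral f m : trigpoly f ->
  (\int[tlift]_xh (past f m xh)%:E = \int[tprob]_x (f x)%:E)%E.
Proof.
move=> tf; have [M fM] := trigpoly_bounded tf.
have mc := @bi_coord_measurable R (- m%:Z).
have mf : measurable_fun setT (fun x => (f x)%:E) by apply/measurable_EFinP; exact: trigpoly_measurable.
apply/esym; apply: (eq_trans (eq_measure_integral (image_measure tlift mc) _)).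
  by move=> B mB _; apply/esym; exact: tlift_past.
apply: (eq_trans (integral_pushforward mc mf _ measurableT)) => //.
have mp : measurable_fun setT (past f m : bisequence R -> measurableTypeR R).
  exact: measurableT_comp (trigpoly_measurable tf) mc.
by have := @bounded_integrable R _ _ tlift _ M mp (fun xh => fM _).
Qed.

Lemma past_measurable f m : trigpoly f ->
  measurable_fun setT (past f m : bisequence R -> measurableTypeR R).
Proof.
by move=> tf; exact: measurableT_comp (trigpoly_measurable tf) (@bi_coord_measurable R (- m%:Z)).
Qed.

(** A test function is continuous on the natural extension only; there it is a uniform limit of
    functions of one past coordinate, which yields measurability and boundedness. *)
Lemma within_measurable phi : {within NE, continuous phi} ->
  measurable_fun setT ((phi \_ NE) : bisequence R -> measurableTypeR R) /\
  exists M : R, forall xh, `|(phi \_ NE) xh| <= M.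
Proof.
move=> cphi; have mNE := @natural_extension_measurable R.
have ap (n : nat) : exists F, (exists m f, trigpoly f /\ F = past f m) /\
    forall xh, NE xh -> `|phi xh - F xh| <= n.+1%:R^-1.
  have n0 : 0 < (n.+1%:R : R)^-1 by rewrite invr_gt0.
  have [F [_ [m [f [tf Ff]]]] h] := past_approx cphi n0.
  exists (past f m); split; first by exists m, f.
  by move=> xh hx; rewrite -Ff // h.
split; last first.
  have [F [[m [f [tf ->]]] h]] := ap 0%N; have [M fM] := trigpoly_bounded tf.
  exists (M + 1) => xh; rewrite /patch; case: ifPn => [/set_mem hx|_]; last first.
    by rewrite normr0 addr_ge0 //; exact: le_trans (fM 0).
  have := h xh hx; have := fM (xh (- m%:Z)); rewrite /past invr1 !ler_norml; lra.
have /choice[F FP] := ap.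
have mF n : measurable_fun NE (F n : bisequence R -> measurableTypeR R).
  have [[m [f [tf ->]]] _] := FP n; apply: (measurable_funS measurableT) => //.
  exact: past_measurable.
apply/(measurable_restrictT _ mNE); apply: measurable_fun_cvg mF _ => xh hx.
apply/cvgrPdist_le => e e0; near=> n.
have [_ /(_ xh hx) h] := FP n; apply: le_trans h _.
near: n; exists (Num.bound e^-1) => // n /= hn.
rewrite invf_ple ?posrE //; apply: le_trans (_ : _ <= (Num.bound e^-1)%:R) _.
  by apply/ltW/archi_boundP; rewrite invr_ge0 ltW.
by rewrite ler_nat; apply: leq_trans hn _.
Unshelve. all: by end_near. Qed.

Lemma lift_weak_limit phi (e : R) : {within NE, continuous phi} -> 0 < e ->
  exists m f, [/\ trigpoly f, forall xh, NE xh -> `|phi xh - past f m xh| <= e &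
   `|fine (\int[tlift]_(xh in NE) (phi xh)%:E)%E - tint f| <= e].
Proof.
move=> cphi e0; have mNE := @natural_extension_measurable R.
have [F [_ [m [f [tf Ff]]]] h] := past_approx cphi e0.
have {}h xh : NE xh -> `|phi xh - past f m xh| <= e by move=> hx; rewrite -Ff // h.
exists m, f; split=> //.
have [mg [M gM]] := within_measurable cphi; set g := phi \_ NE in mg gM.
have [M' fM'] := trigpoly_bounded tf.
pose G : bisequence R -> R := past f m \_ NE.
have mG : measurable_fun setT (G : bisequence R -> measurableTypeR R).
  by apply/(measurable_restrictT _ mNE); apply: (measurable_funS measurableT) => //; exact: past_measurable.
have GM xh : `|G xh| <= M'.
  rewrite /G /patch; case: ifP => _; first exact: fM'.
  by rewrite normr0; exact: le_trans (fM' 0).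
have patchE (k : bisequence R -> R) : (\int[tlift]_(xh in NE) (k xh)%:E = \int[tlift]_xh ((k \_ NE) xh)%:E)%E.
  rewrite integral_mkcond; apply: eq_integral => xh _; rewrite /patch.
  by case: ifP.
have NE0 : tlift (~` NE) = 0%E.
  apply: probability_compl0 => //; by have [] := tlift_is_lift eps_itv.
have iG : fine (\int[tlift]_xh (G xh)%:E)%E = tint f.
  rewrite -patchE; apply: (eq_trans _ (congr1 fine (tlift_past_integral m tf))); congr fine.
  have ip := @bounded_integrable R _ _ tlift _ M' (past_measurable m tf) (fun xh => fM' _).
  rewrite [RHS](negligible_integral (measurableC mNE) measurableT ip NE0).
  by rewrite setTD setCK.
rewrite patchE -iG -/g.
have := @integral_near R _ _ tlift (fun xh => g xh - G xh) 0 e.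
have ig := @bounded_integrable R _ _ tlift g M mg gM.
have iGi := @bounded_integrable R _ _ tlift G M' mG GM.
have -> : fine (\int[tlift]_xh (g xh - G xh)%:E)%E =
    fine (\int[tlift]_xh (g xh)%:E)%E - fine (\int[tlift]_xh (G xh)%:E)%E.
  exact: (RintegralB measurableT ig iGi).
rewrite subr0; apply; first exact: measurable_funB.
move=> xh; rewrite subr0 /g /G /patch; case: ifPn => [/set_mem /h //|_].
by rewrite subrr normr0 ltW.
Qed.

(** Replacing [phi] by a trigonometric polynomial in coordinate -m turns its backward averages into
    averages along [y] shifted by m, and its integral over the lift into one over the torus. *)
Lemma orbit_in_basin y : (forall n, tmap (y n.+1) = y n) ->
  (forall k n, equidistributed y (tcos k n) (tint (tcos k n))) ->
  backward_basin tmap tlift (orbit_of y).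
Proof.
move=> ty yP; have hy := orbit_of_natural ty; split=> // phi cphi.
have mNE := @natural_extension_measurable R.
have [mg [M gM]] := within_measurable cphi.
have mphi : measurable_fun NE (phi : bisequence R -> measurableTypeR R).
  by move/(measurable_restrictT _ mNE): mg.
have LE k : NE (iter k seq_shift_inv (orbit_of y)) by exact: natural_iter_shift_inv.
rewrite (_ : (fun n => _) = (fun n => (n%:R^-1 * \sum_(k < n)
    phi (iter k seq_shift_inv (orbit_of y)))%:E)); last first.
  by apply/funext => n; exact: integral_empirical.
have fI : (\int[tlift]_(xh in NE) (phi xh)%:E)%E \is a fin_num.
  have -> : (\int[tlift]_(xh in NE) (phi xh)%:E = \int[tlift]_xh ((phi \_ NE) xh)%:E)%E.
    by rewrite integral_mkcond; apply: eq_integral => xh _; rewrite /patch; case: ifP.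
  exact: integrable_fin_num (bounded_integrable tlift mg gM).
rewrite -(fineK fI); apply: cvg_EFin; first by near=> n.
apply/cvgrPdist_le => e e0; have e3 : 0 < e / 3 by rewrite divr_gt0.
have [m [f [tf phif If]]] := lift_weak_limit cphi e3.
have [Mf fMf] := trigpoly_bounded tf.
have [n0 n0P] := equidistributed_shift m fMf (equidistributed_trigpoly yP tf) e3.
near=> n.
have n1 : (0 < n)%N by near: n; exists 1%N.
have nn0 : (n0 <= n)%N by near: n; exists n0.
have n1R : 0 < n%:R :> R by rewrite ltr0n.
have b1 : `|\sum_(k < n) phi (iter k seq_shift_inv (orbit_of y)) - \sum_(k < n) f (y (k + m)%N)| <= n%:R * (e / 3).
  rewrite -sumrB; apply: le_trans (ler_norm_sum _ _ _) _.
  have -> : n%:R * (e / 3) = \sum_(k < n) (e / 3) by rewrite sumr_const card_ord mulr_natl.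
  apply: ler_sum => k _; have := phif _ (LE k); rewrite /past iter_shift_inv.
  have -> : - m%:Z - k%:Z = - (k + m)%N%:Z by rewrite PoszD opprD addrC.
  by rewrite orbit_of_past.
have b2 := n0P n nn0.
have h : `|n%:R * fine (\int[tlift]_(xh in NE) (phi xh)%:E)%E -
    \sum_(k < n) phi (iter k seq_shift_inv (orbit_of y))| <= n%:R * e.
  have b3 : `|n%:R * fine (\int[tlift]_(xh in NE) (phi xh)%:E)%E - n%:R * tint f| <= n%:R * (e / 3).
    by rewrite -mulrBr normrM normr_nat ler_wpM2l.
  by move: b1 b2 b3; rewrite !ler_norml; lra.
rewrite -(ler_pM2l n1R); apply: le_trans h.
rewrite -{1}(ger0_norm (ltW n1R)) -normrM mulrBr mulrA divff ?gt_eqF // mul1r.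
by [].
Unshelve. all: by end_near. Qed.

Lemma basin_full : @pi0 R @` backward_basin tmap tlift = [set: torus R].
Proof.
apply/seteqP; split=> // x _; have [y [y0 ty] yP] := equidistributed_preorbit eps_itv x.
exists (orbit_of y); first exact: orbit_in_basin.
by rewrite /pi0 /= y0.
Qed.

End basin.

(** * Full support of Lebesgue measure and transitivity *)

Section transitive.
Context {R : realType}.
Local Notation mR := (measurableTypeR R).
Local Notation RR := (measurableTypeR R * measurableTypeR R)%type.
Implicit Types (x u : torus R).

Lemma tdist_shift x u h : tdist (x + torus_proj h) u <= tdist x u + enorm h.
Proof.
rewrite -lerBlDr; apply: lb_le_inf; first exact: (tdist_has_inf x u).1.
move=> _ [v /= ve <-]; rewrite lerBlDr; apply: le_trans (enormD _ _).
by apply: tdist_le; rewrite tprojD ve addrAC.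
Qed.

Lemma tdist_continuous u : continuous (fun x : torus R => tdist x u : R^o).
Proof.
move=> x U /nbhs_ballP[e /= e0 eU]; apply/nbhs_torusP; exists e => // h he; apply: eU.
rewrite /ball /= ltr_norml.
have h1 := tdist_shift x u h.
have := tdist_shift (x + torus_proj h) u (- h); rewrite tprojN addrK enormN => h2.
by apply/andP; split; lra.
Qed.

Definition rbox (c : RR) (r : R) : set RR :=
  `](c.1 - r), (c.1 + r)]%classic `*` `](c.2 - r), (c.2 + r)]%classic.

Lemma rbox_measurable c r : measurable (rbox c r).
Proof. by apply: measurableX; exact: measurable_itv. Qed.

Lemma rboxP c r z : 0 < r -> rbox c r z -> enorm (pvec z - pvec c) < 24 * r.
Proof.
move=> r0 [/=]; rewrite !in_itv /= => h1 h2.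
have -> : pvec z - pvec c = pvec (z.1 - c.1, z.2 - c.2) by rewrite /pvec svecN svecD.
rewrite (_ : 24 * r = 12 * (2 * r)); last by ring.
by apply: enorm_pvec_lt; [lra|rewrite /= ltr_norml; lra|rewrite /= ltr_norml; lra].
Qed.

Lemma rbox_inj c r z z' : 0 < r -> 24 * r <= 1 / 2 -> rbox c r z -> rbox c r z' ->
  pproj z = pproj z' -> z = z'.
Proof.
move=> r0 r1 /(rboxP r0) h /(rboxP r0) h' e; apply: pvec_inj; apply: (addIr (- pvec c)).
apply: tproj_inj_small; [lra..|].
by rewrite !tprojB; congr (_ - _).
Qed.

(** For eps = 0 the function [flim] is the identity, so a small box has positive product measure,
    and [mut_le] transfers this to [mut]. *)
Lemma tprob0_ball u (d : R) : 0 < d ->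
  (0 < tprob (@eps0_itv R) [set x | (tdist x u < d)%R])%E.
Proof.
move=> d0; set B := [set x | _].
have mB : measurable B.
  apply: torus_open_measurable.
  have := (@continuousP _ _ (fun x : torus R => tdist x u : R^o)).1 (@tdist_continuous u) _ (@open_lt R d).
  by [].
(* Points of the box are within 24 r of its centre: at most [d] to stay in the ball, at most 1/2 for
   injectivity of the projection. *)
pose c := vcoord (repr u); pose r := Num.min (d / 24) (1 / 48).
have r0 : 0 < r by rewrite lt_min !divr_gt0.
have r1 : 24 * r <= d by rewrite -ler_pdivlMl // mulrC ge_min lexx.
have r2 : 24 * r <= 1 / 2 by have : r <= 1 / 48 by [rewrite ge_min lexx orbT]; lra.
pose Z := rbox c r; have mZ : measurable Z by exact: rbox_measurable.
rewrite tprobE; apply: mule_gt0; first by rewrite lte_fin tnorm_gt0.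
apply: (@lt_le_trans _ _ (mut (@eps0_itv R) Z)); last first.
  rewrite mut_sat //; last by move=> z z' h h'; exact: rbox_inj h h'.
  apply: le_measure; rewrite ?inE.
  - exact: sat_measurable.
  - exact: measurableI (preim_measurable pproj_measurable mB) fdom_measurable.
  - move=> z [fz [z' /(rboxP r0) Zz' e]]; split=> //; rewrite /B /= -e.
    rewrite -(tproj_repr u) -(vcoordK (repr u)).
    by apply: le_lt_trans (tdist_proj_le _ _) _; exact: lt_le_trans Zz' r1.
have Zd z : Z z -> `|z.1 - c.1| <= r by move=> [/=]; rewrite in_itv /= ler_norml => h _; lra.
have [_ h] := mut_le (@eps0_itv R) mZ (ltW r0) Zd.
have m0 : (0 < mut0 (@eps0_itv R) c.1 Z)%E.
  rewrite mut0_rect; [|exact: measurable_itv..].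
  rewrite lebesgue_measure_oc; last lra.
  rewrite nus_oc; last lra.
  by rewrite -EFinM lte_fin !flim_eps0 mulr_gt0 //; lra.
rewrite lt_def measure_ge0 andbT; apply/eqP => Z0.
by move: h; rewrite Z0 mule0 leNgt m0.
Qed.

(** Take a backward orbit of a point of [V] equidistributed for Lebesgue measure. If it missed [U],
    a bump function supported in [U] would average to 0 along it while having positive integral. *)
Lemma tmap_transitive : topologically_transitive (@tmap R).
Proof.
move=> U V oU _ [u Uu] [v Vv].
have /nbhs_torusP[d d0 dU] : nbhs u U by exact: open_nbhs_nbhs.
have [y [y0 ty] yP] := equidistributed_preorbit (@eps0_itv R) v.
suff [k Uk] : exists k, U (y k).
  exists k; exists v; split=> //; exists (y k) => //.
  by rewrite -y0; elim: k {Uk} => //= k IH; rewrite -iterS iterSr ty.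
apply: contrapT => /forallNP noU.
pose bump x : R := Num.max (d - tdist x u) 0.
have bump0 x : 0 <= bump x by rewrite le_max lexx orbT.
have bumpy k : bump (y k) = 0.
  apply/max_idPr; rewrite subr_le0 leNgt; apply/negP => /tdist_ltP[h hd e].
  by apply: (noU k); rewrite e; exact: dU.
pose phi (xh : bisequence R) : R := bump (pi0 xh).
have cphi : continuous phi.
  move=> xh; apply: (@continuous_comp _ _ _ (@pi0 R) bump); first exact: bi_coord_continuous.
  apply: (@continuous_max _ _ (fun x => d - tdist x u) (fun=> 0)); last exact: cst_continuous.
  apply: (@continuousB R R^o); [exact: cst_continuous|exact: tdist_continuous].
have NEm := @natural_extension_measurable R.
have [_ [hy bas]] : True /\ backward_basin tmap (tlift (@eps0_itv R)) (orbit_of y).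
  by split=> //; exact: orbit_in_basin.
have := bas phi (continuous_subspaceT cphi).
have mphi : measurable_fun setT (phi : bisequence R -> mR).
  apply: (measurableT_comp _ (@bi_coord_measurable R 0)).
  apply: torus_continuous_measurable => x.
  apply: (@continuous_max _ _ (fun x => d - tdist x u) (fun=> 0)); last exact: cst_continuous.
  apply: (@continuousB R R^o); [exact: cst_continuous|exact: tdist_continuous].
rewrite (_ : (fun n => _) = fun=> 0%E); last first.
  apply/funext => n; rewrite integral_empirical //.
  - rewrite big1 ?mulr0 // => k _; rewrite /phi /pi0 iter_shift_inv sub0r orbit_of_past.
    exact: bumpy.
  - exact: measurable_funS mphi.
  - by move=> k; exact: natural_iter_shift_inv.
move=> lim0.
have I0 : (\int[tlift (@eps0_itv R)]_(xh in natural_extension tmap) (phi xh)%:E = 0)%E.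
  exact: (cvg_unique (@ereal_hausdorff R) lim0 (cvg_cst _)).
have d2 : 0 < d / 2 by rewrite divr_gt0.
pose B : set (torus R) := [set x | tdist x u < d / 2].
have mB : measurable B.
  apply: torus_open_measurable.
  exact: ((@continuousP _ _ (fun x : torus R => tdist x u : R^o)).1 (@tdist_continuous u) _ (@open_lt R (d / 2))).
have mB' : measurable (@pi0 R @^-1` B).
  by have := preim_measurable (@bi_coord_measurable R 0) mB.
have [l1 l2 l3] := tlift_is_lift (@eps0_itv R).
have : (0 < tlift (@eps0_itv R) (natural_extension tmap `&` @pi0 R @^-1` B))%E.
  have := tprob0_ball u d2; rewrite -(l3 _ mB) (measureDI _ mB' NEm).
  rewrite [X in (X + _)%E](_ : _ = 0%E) ?add0e 1?setIC //.
  apply: (subset_measure0 (measurableD mB' NEm) (measurableC NEm)); first by move=> z [].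
  exact: probability_compl0.
rewrite ltNge => /negP; apply; rewrite -(@lee_pmul2l _ (d / 2)%:E) ?lte_fin // mule0 -I0.
rewrite -integral_cst; last exact: measurableI.
apply: (@le_trans _ _ (\int[tlift (@eps0_itv R)]_(xh in natural_extension tmap `&` @pi0 R @^-1` B) (phi xh)%:E)%E).
  apply: ge0_le_integral => //.
  - exact: measurableI.
  - by move=> xh _; rewrite lee_fin ltW.
  - by apply/measurable_EFinP; exact: measurable_funS mphi.
  - move=> xh [_ Bx]; have {}Bx : tdist (pi0 xh) u < d / 2 := Bx.
    by rewrite lee_fin /phi /bump le_max; apply/orP; left; lra.
apply: ge0_subset_integral => //.
- exact: measurableI.
- by apply/measurable_EFinP; exact: measurable_funS mphi.
- by move=> xh _; rewrite lee_fin bump0.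
Qed.

End transitive.

(** * Null sets of the line and Lipschitz images *)

Section negligible_sets.
Context {R : realType}.
Local Notation mR := (measurableTypeR R).
Local Notation leb := (@lebesgue_measure R).

Lemma negligible_small d (T : measurableType d) (mu : measure T R) (X : set T) :
  (forall e : R, 0 < e -> exists F, [/\ measurable F, X `<=` F & (mu F <= e%:E)%E]) ->
  mu.-negligible X.
Proof.
move=> small; have n0 (n : nat) : 0 < (n.+1%:R : R)^-1 by rewrite invr_gt0.
have /choice[F FP] (n : nat) := small _ (n0 n).
have mF : measurable (\bigcap_n F n) by apply: bigcapT_measurable => n; have [] := FP n.
exists (\bigcap_n F n); split=> //; last by move=> x Xx n _; have [_ h _] := FP n; exact: h.
have le n : (mu (\bigcap_n F n) <= (n.+1%:R^-1)%:E)%E.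
  have [mFn _ h] := FP n; apply: le_trans h; apply: le_measure; rewrite ?inE //.
  by move=> x /(_ n I).
have fin : mu (\bigcap_n F n) \is a fin_num.
  by rewrite ge0_fin_numE //; exact: le_lt_trans (le 0%N) (ltry _).
apply/eqP; rewrite eq_le measure_ge0 andbT -(fineK fin) lee_fin leNgt; apply/negP => c0.
have := le (Num.bound (fine (mu (\bigcap_n F n)))^-1); rewrite -(fineK fin) lee_fin leNgt => /negP; apply.
rewrite invf_plt ?posrE //; apply: lt_le_trans (archi_boundP _) _; first by rewrite invr_ge0 ltW.
by rewrite ler_nat.
Qed.

Lemma negligible_cover (X : set mR) (e : R) : leb.-negligible X -> 0 < e ->
  exists F : nat -> R * R, [/\ forall k, (F k).1 <= (F k).2,
    X `<=` \bigcup_k `](F k).1, (F k).2]%classic &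
    (\sum_(k <oo) ((F k).2 - (F k).1)%:E <= e%:E)%E].
Proof.
move=> /negligible_outer_measure X0 e0.
have : ((wlength idfun)^*%mu X < e%:E)%E by rewrite X0 lte_fin.
move=> /ereal_inf_lt[_ [A [mA XA] <-] lt].
have /choice[F FP] (k : nat) : exists p : R * R, p.1 <= p.2 /\ A k = `]p.1, p.2]%classic.
  have /ocitvP[->|[p /ltW pp ->]] := mA k; last by exists p.
  by exists (0, 0); rewrite /= lexx set_itv_ge // bnd_simp ltxx.
exists F; split.
- by move=> k; have [] := FP k.
- by move=> x /XA[k _]; have [_ ->] := FP k => h; exists k.
apply: le_trans (ltW lt); rewrite le_eqVlt; apply/orP; left; apply/eqP.
by apply: eq_eseriesr => k _; have [le ->] := FP k; rewrite wlength_itv_bnd.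
Qed.

Lemma nneseries_term_le (u : nat -> R) (e : R) : (forall k, 0 <= u k) ->
  (\sum_(k <oo) (u k)%:E <= e%:E)%E -> forall k, u k <= e.
Proof.
move=> u0 ue k; rewrite -lee_fin; apply: le_trans ue.
apply: le_trans (nneseries_lim_ge k.+1 _); last by move=> *; rewrite lee_fin.
by rewrite big_nat_recr //= leeDr // sume_ge0 // => i _; rewrite lee_fin.
Qed.

(* Countably many intervals cover the points at which [f] is Lipschitz with a
   given constant and at a given scale, and [f] maps each to a set of comparable
   diameter. *)
Lemma lipschitz_image_negligible (X : set mR) (f : R -> R) : leb.-negligible X ->
  (forall t, X t -> exists L d : R, 0 < d /\
     forall t', X t' -> `|t' - t| < d -> `|f t' - f t| <= L * `|t' - t|) ->
  leb.-negligible (f @` X : set mR).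
Proof.
move=> X0 lip.
pose Y (n : nat) : set R := [set t | X t /\ forall t', X t' -> `|t' - t| < n.+1%:R^-1 ->
  `|f t' - f t| <= n.+1%:R * `|t' - t|].
have XY : X `<=` \bigcup_n Y n.
  move=> t Xt; have [L [d [d0 h]]] := lip t Xt.
  pose n := (Num.bound `|L| + Num.bound d^-1)%N.
  have nL : L <= n.+1%:R.
    apply: le_trans (ler_norm L) _; apply: le_trans (ltW (archi_boundP (normr_ge0 L))) _.
    by rewrite ler_nat /n; apply: leqW; exact: leq_addr.
  have nd : n.+1%:R^-1 <= d.
    rewrite invf_ple ?posrE //; apply: le_trans (ltW (archi_boundP _)) _; first by rewrite invr_ge0 ltW.
    by rewrite ler_nat /n; apply: leqW; exact: leq_addl.
  exists n => //; split=> // t' Xt' tt'; apply: le_trans (h t' Xt' (lt_le_trans tt' nd)) _.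
  exact: ler_wpM2r.
apply: (@negligibleS _ _ _ leb (\bigcup_n (f @` Y n))).
  by move=> _ [t Xt <-]; have [n _ Yt] := XY t Xt; exists n => //; exists t.
apply: negligible_bigcup => n; apply: negligible_small => e e0.
pose c : R := n.+1%:R; have c1 : 1 <= c by rewrite ler1n.
have c0 : 0 < c by lra.
(* The first bound pays for the dilation by 2c; the second makes every covering interval shorter
   than the scale 1 / (n + 1) of the Lipschitz condition. *)
pose e' := Num.min (e / (2 * c)) (c^-1 / 2).
have e'0 : 0 < e' by rewrite lt_min !divr_gt0 // ?mulr_gt0 // invr_gt0.
have [F [Fle XF Fe]] := negligible_cover X0 e'0.
pose l k := (F k).2 - (F k).1.
have l0 k : 0 <= l k by rewrite subr_ge0.
have le' k : l k <= e' by exact: (nneseries_term_le l0 Fe).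
have /choice[tt ttP] (k : nat) : exists t, (exists2 t', Y n t' & `](F k).1, (F k).2]%classic t') ->
    Y n t /\ `](F k).1, (F k).2]%classic t.
  have [[t Yt Ft]|no] := pselect (exists2 t', Y n t' & `](F k).1, (F k).2]%classic t'); first by exists t.
  by exists 0.
pose H0 k : set mR := `[(f (tt k) - c * l k), (f (tt k) + c * l k)]%classic.
have mH0 k : measurable (H0 k) by exact: measurable_itv.
exists (\bigcup_k H0 k); split; first exact: bigcup_measurable.
  move=> _ [t Yt <-]; have [Xt _] := Yt; have [k _ Ft] := XF t Xt; exists k => //.
  have [|[Xs Ys] Fs] := ttP k; first by exists t.
  have lt : `|t - tt k| <= l k.
    move: Ft Fs; rewrite /= !in_itv /= => /andP[h1 h2] /andP[h3 h4].
    by rewrite ler_norml /l; lra.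
  have := Ys t Xt.
  have ci : c^-1 / 2 < c^-1 by rewrite ltr_pdivrMr // ltr_pMr ?invr_gt0 // ltr1n.
  have le2 : e' <= c^-1 / 2 by rewrite ge_min lexx orbT.
  move=> /(_ (le_lt_trans (le_trans lt (le_trans (le' k) le2)) ci)) h.
  have := le_trans h (ler_wpM2l (ltW c0) lt).
  by rewrite /H0 /= in_itv /= ler_norml; lra.
apply: le_trans (measure_sigma_subadditive leb mH0 (bigcup_measurable (fun k _ => mH0 k)) (@subset_refl _ _)) _.
apply: (@le_trans _ _ (\sum_(k <oo) ((2 * c)%:E * (l k)%:E))%E).
  apply: lee_nneseries => [k _ _|k _]; first exact: measure_ge0.
  have e1 := lebesgue_measure_itv `[(f (tt k) - c * l k), (f (tt k) + c * l k)].
  apply: (eq_ind_r (fun r => r <= _)%E _ e1); rewrite /= lte_fin.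
  have cl : 0 <= c * l k by rewrite mulr_ge0 // ltW.
  by case: ltP => _; rewrite -?EFinB -?EFinM lee_fin; lra.
rewrite nneseriesZl; last by move=> k _; rewrite lee_fin.
apply: (@le_trans _ _ ((2 * c)%:E * e'%:E)%E).
  by apply: lee_wpmul2l Fe; rewrite lee_fin mulr_ge0 // ltW.
have : e' <= e / (2 * c) by rewrite ge_min lexx.
by rewrite -EFinM lee_fin ler_pdivlMr ?mulr_gt0 // mulrC.
Qed.

End negligible_sets.

(** * Local stable manifolds lie in stable leaves *)

Section leaf_geometry.
Context {R : realType}.
Local Notation mR := (measurableTypeR R).
Local Notation RR := (measurableTypeR R * measurableTypeR R)%type.
Local Notation ls := (lams R).
Local Notation lu := (lamu R).
Implicit Types (x : torus R) (gamma : R -> torus R) (v h : 'rV[R]_2).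

Definition leaf x (s : R) : torus R := x + torus_proj (svec s 0).

Lemma coord_le_enorm v : `|scoord v| <= 4 * enorm v /\ `|ucoord v| <= 4 * enorm v.
Proof.
have l1 := @ls_itv R; have l2 := @lu_itv R.
have d0 : 0 < lu - ls by lra.
have h0 := enorm_coord v 0; have h1 := enorm_coord v 1; have e0 := enorm_ge0 v.
have n0 : `|(lu - 1) * v 0 0| <= 4 * enorm v.
  by rewrite normrM; apply: ler_pM => //; rewrite ler_norml; lra.
have n1 : `|(ls - 1) * v 0 0| <= 1 * enorm v.
  by rewrite normrM; apply: ler_pM => //; rewrite ler_norml; lra.
have k : 5 * enorm v <= 4 * enorm v * (lu - ls).
  by rewrite mulrAC ler_wpM2r //; lra.
by split; rewrite normrM normfV (gtr0_norm d0) ler_pdivrMr //; apply: le_trans (ler_normB _ _) _; lra.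
Qed.

Lemma enorm_svec0 (s : R) : `|s| <= enorm (svec s 0) /\ enorm (svec s 0) <= 2 * `|s|.
Proof.
have l1 := @ls_itv R; split.
  by have := enorm_coord (svec s 0) 0; rewrite mxE /= addr0.
apply: (@enorm_le_coord _ _ `|s|); rewrite mxE /= ?mulr0 addr0 //.
by rewrite normrM ler_piMl // ler_norml; lra.
Qed.

Lemma has_velocity_near gamma t v (e : R) : has_velocity gamma t v -> 0 < e ->
  exists2 d : R, 0 < d & forall r, `|r| < d ->
    exists2 k, gamma (t + r) = gamma t + torus_proj (r *: v + k) & enorm k <= e * `|r|.
Proof.
move=> hv e0; have e2 : 0 < e / 2 by rewrite divr_gt0.
have /nbhs_ballP[d /= d0 dP] := hv _ e2; exists d => // r rd.
have [->|r0] := eqVneq r 0.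
  by exists 0; rewrite ?addr0 ?scale0r ?addr0 ?tproj0 ?addr0 ?enorm0 ?mulr_ge0 // ltW.
have rp : 0 < `|r| by rewrite normr_gt0.
have := dP r; rewrite /ball /= sub0r normrN => /(_ rd) h.
have lt : tdist (gamma (t + r)) (gamma t + torus_proj (r *: v)) < e * `|r|.
  by apply: le_lt_trans h _; rewrite ltr_pM2r // ltr_pdivrMr // ltr_pMr // ltr1n.
have [k kn ->] := tdist_ltP lt; exists k; last exact: ltW.
by rewrite tprojD addrA.
Qed.

Lemma embedded_continuity gamma t v : has_velocity gamma t v ->
  exists L d : R, [/\ 0 < L, 0 < d & forall r, `|r| < d -> exists2 k,
    gamma (t + r) = gamma t + torus_proj k & enorm k <= L * `|r|].
Proof.
move=> hv; have [d d0 dP] := has_velocity_near hv ltr01.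
exists (enorm v + 1), d; split=> //; first by rewrite ltr_wpDl // enorm_ge0.
move=> r rd; have [k gk kr] := dP r rd; exists (r *: v + k) => //.
by apply: le_trans (enormD _ _) _; rewrite enormZ; lra.
Qed.

(** The unstable coordinate is multiplied by [lu] at each step. *)
Lemma bounded_orbit_ucoord (k : 'rV[R]_2) (M : R) :
  (forall n, enorm (k *m amx ^+ n) <= M) -> ucoord k = 0.
Proof.
move=> kM; apply/eqP; rewrite -normr_le0 leNgt; apply/negP => u0.
have l2 := @lu_itv R.
have b n : lu ^+ n * `|ucoord k| <= 4 * M.
  have [_ h] := coord_le_enorm (k *m amx ^+ n).
  move: h; rewrite -{1}(svecK k) svec_amxX ucoord_svec normrM (ger0_norm (x := lu ^+ n)); last first.
    by rewrite exprn_ge0 // ltW // lu_gt0.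
  by move=> h; apply: le_trans h _; have := kM n; lra.
have g n : 1 + n%:R <= lu ^+ n.
  elim: n => [|n IH]; first by rewrite addr0 expr0.
  have : lu * (1 + n%:R) <= lu * lu ^+ n by rewrite ler_pM2l // lu_gt0.
  have n0 : 0 <= n%:R :> R by [].
  have : 1 + n.+1%:R <= lu * (1 + n%:R) by rewrite -natr1; nra.
  by rewrite exprS; lra.
pose n := Num.bound (4 * M / `|ucoord k|).
have M0 : 0 <= M by exact: le_trans (enorm_ge0 _) (kM 0%N).
have := archi_boundP (divr_ge0 (mulr_ge0 (ler0n R 4) M0) (normr_ge0 (ucoord k))).
rewrite -/n ltr_pdivrMr // => h.
have := b n; have : (1 + n%:R) * `|ucoord k| <= lu ^+ n * `|ucoord k| by rewrite ler_wpM2r.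
by lra.
Qed.

(* Points of a local stable manifold close to its centre lie on the stable
   leaf: their displacement stays bounded under the linear map. *)
Lemma stable_manifold_leaf x gamma : local_stable_manifold tmap x gamma ->
  exists t0 (d : R) sigma, [/\ curve_dom t0, gamma t0 = x, 0 < d,
    (forall r, `|r| < d -> curve_dom (t0 + r) /\ gamma (t0 + r) = leaf x (sigma r)) &
    (forall r, `|r| < d -> `|sigma r| < 1 / 16)].
Proof.
move=> [[gv gn _ _] [lambda [ep [C1 [C2 [l0 _ _ C21 gC]]]]] [t0 [dt0 gt0 _]]].
have [L [d [L0 d0 dP]]] := embedded_continuity (gv _ dt0).
have [N NP] : exists N : nat, forall n, (N <= n)%N -> C2 * expR (- (n%:R * lambda)) < 1 / 20.
  exists (Num.bound (20 * C2 / lambda)) => n hn.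
  have C0 : 0 < C2 by lra.
  have h : 20 * C2 < 1 + n%:R * lambda.
    have : 20 * C2 / lambda <= n%:R.
      apply: le_trans (ltW (archi_boundP _)) _; first by rewrite divr_ge0 ?mulr_ge0 // ltW.
      by rewrite ler_nat.
    by rewrite ler_pdivrMr //; lra.
  have e1 : 20 * C2 < expR (n%:R * lambda) by apply: lt_le_trans h (expR_ge1Dx _).
  by rewrite expRN ltr_pdivrMr ?expR_gt0 //; lra.
have iterA n v : enorm (v *m amx ^+ n) <= 5 ^+ n * enorm v.
  elim: n v => [|n IH] v; first by rewrite expr0 mulmx1 mul1r.
  rewrite exprS mulmxA; apply: le_trans (IH _) _; rewrite exprSr -mulrA.
  by apply: ler_wpM2l (enorm_amx_le v); rewrite exprn_ge0.
pose d1 := Num.min d (Num.min (1 - `|t0|) (1 / 20 / (5 ^+ N * L))).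
have t01 : 0 < 1 - `|t0|.
  by move: dt0; rewrite /curve_dom /= in_itv /= subr_gt0 ltr_norml.
have L5 : 0 < 5 ^+ N * L by rewrite mulr_gt0 // exprn_gt0.
have d10 : 0 < d1 by rewrite !lt_min d0 t01 !divr_gt0.
have main r : `|r| < d1 -> curve_dom (t0 + r) /\ exists s : R,
    gamma (t0 + r) = leaf x s /\ `|s| < 1 / 16.
  rewrite !lt_min => /andP[rd /andP[rt rL]].
  have dr : curve_dom (t0 + r).
    have : `|t0 + r| < 1 by apply: le_lt_trans (ler_normD _ _) _; lra.
    by rewrite /curve_dom /= in_itv /= ltr_norml.
  split=> //; have [k gk kL] := dP r rd; rewrite gt0 in gk.
  have k5 : 5 ^+ N * enorm k < 1 / 20.
    have p5 : 0 <= (5 : R) ^+ N by rewrite exprn_ge0.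
    apply: le_lt_trans (ler_wpM2l p5 kL) _.
    by rewrite mulrA mulrC -ltr_pdivlMr.
  have small n : enorm (k *m amx ^+ n) < 1 / 20.
    have [nN|/ltnW] := leqP n N.
      apply: le_lt_trans (iterA n k) _; apply: le_lt_trans k5.
      by apply: ler_wpM2r; [exact: enorm_ge0|rewrite ler_eXn2l // ltr1n].
    (* After time [N] the points stay within 1/20 on the torus. A displacement below 1/20 grows to
       at most 1/4 in one step, so it is still the unique short representative of the torus
       displacement and is below 1/20 again. *)
    move=> Nn; rewrite -(subnKC Nn); elim: (n - N)%N => [|p IH].
      by rewrite addn0; apply: le_lt_trans (iterA N k) k5.
    rewrite addnS exprSr mulmxA.
    have [_ hC] := gC _ (N + p.+1)%N (ex_intro2 _ _ (t0 + r) dr erefl).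
    have /tdist_ltP[w wn we] : tdist (iter (N + p.+1) tmap (gamma (t0 + r))) (iter (N + p.+1) tmap x) < 1 / 20.
      have sym (a b : torus R) e : tdist a b < e -> tdist b a < e.
        move=> /tdist_ltP[w wn ->]; apply: le_lt_trans wn; rewrite -enormN.
        by apply: tdist_le; rewrite tprojN opprD addNKr || (rewrite tprojN; rewrite opprD addrA subrr add0r).
      by apply: sym; apply: le_lt_trans hC _; apply: NP; rewrite leq_addr.
    move: we; rewrite gk iter_tmapD iter_tmap_proj => /addrI.
    rewrite addnS exprSr mulmxA => /tproj_inj_small-> //; last lra.
    by apply: le_lt_trans (enorm_amx_le _) _; lra.
  have uk : ucoord k = 0 by apply: (@bounded_orbit_ucoord _ (1 / 20)) => n; exact: ltW.
  exists (scoord k); split; first by rewrite gk /leaf -{1}(svecK k) uk.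
  have k0 := small 0%N; rewrite expr0 mulmx1 in k0.
  have [h _] := enorm_svec0 (scoord k); apply: le_lt_trans h _.
  by rewrite -uk svecK; lra.
have /choice[sigma sP] (r : R) : exists s : R, `|r| < d1 ->
    gamma (t0 + r) = leaf x s /\ `|s| < 1 / 16.
  have [/main[_ [s sP]]|_] := ltP `|r| d1; first by exists s.
  by exists 0.
exists t0, d1, sigma; split=> // r rd; have [dr _] := main r rd; have [h1 h2] := sP r rd => //.
Qed.

Lemma leaf_inj x (s s' : R) : `|s| < 1 / 8 -> `|s'| < 1 / 8 -> leaf x s = leaf x s' -> s = s'.
Proof.
move=> h h' /addrI /tproj_inj_small e.
have [_ b] := enorm_svec0 s; have [_ b'] := enorm_svec0 s'.
by have /svec_inj[] : svec s 0 = svec s' 0 by apply: e; lra.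
Qed.

Lemma leaf_step x (s s' : R) k : `|s| < 1 / 16 -> `|s'| < 1 / 16 -> enorm k < 1 / 2 ->
  leaf x s' = leaf x s + torus_proj k -> svec (s' - s) 0 = k.
Proof.
move=> h h' kn; rewrite /leaf -addrA => /addrI; rewrite -tprojD => /(congr1 (fun y => y - torus_proj (svec s 0))).
rewrite -!tprojB addrAC subrr add0r svecN svecD oppr0 addr0 => /tproj_inj_small; apply=> //.
have [_ b] := enorm_svec0 (s' - s); apply: le_lt_trans b _.
by have := ler_normB s' s; lra.
Qed.

(* The stable manifold through [x] covers a segment of the stable leaf, by the
   intermediate value theorem. *)
Lemma stable_manifold_segment x gamma (U : set (torus R)) : local_stable_manifold tmap x gamma ->
  open U -> U x -> exists2 d : R, 0 < d & forall s, `|s| < d -> (U `&` curve gamma) (leaf x s).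
Proof.
move=> sm oU Ux; have [[gv gn _ _] _ _] := sm.
have [t0 [d [sigma [dt0 gt0 d0 gs s16]]]] := stable_manifold_leaf sm.
have gsr r : `|r| < d -> gamma (t0 + r) = leaf x (sigma r) by move=> /gs[].
have /nbhs_torusP[e e0 eU] : nbhs x U by exact: open_nbhs_nbhs.
have r0d : `|0 : R| < d by rewrite normr0.
have s0 : sigma 0 = 0.
  apply: (@leaf_inj x); rewrite ?normr0 ?divr_gt0 //; first by have := s16 0 r0d; lra.
  by rewrite -gsr // addr0 gt0 /leaf svec0 tproj0 addr0.
have cs r : `|r| < d -> {for r, continuous sigma}.
  move=> rd; have [dr _] := gs r rd.
  have [L [d2 [L0 d20 LP]]] := embedded_continuity (gv _ dr).
  apply/cvgrPdist_lt => e2 e20; near=> r'.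
  have rr : `|r' - r| < Num.min (Num.min d2 (d - `|r|)) (Num.min (e2 / L) (1 / 2 / L)).
    near: r'; apply/nbhs_ballP; exists (Num.min (Num.min d2 (d - `|r|)) (Num.min (e2 / L) (1 / 2 / L))).
      by rewrite /= !lt_min d20 subr_gt0 rd !divr_gt0.
    by move=> r'; rewrite /ball /= distrC.
  move: rr; rewrite !lt_min => /andP[/andP[h1 h2] /andP[h3 h4]].
  have rd' : `|r'| < d by have := ler_normD (r' - r) r; rewrite subrK; lra.
  have [k gk kL] := LP _ h1.
  have kL' c : `|r' - r| < c / L -> enorm k < c.
    by move=> h; apply: le_lt_trans kL _; rewrite mulrC -ltr_pdivlMr.
  have ek : svec (sigma r' - sigma r) 0 = k.
    apply: (@leaf_step x); [exact: s16|exact: s16|exact: kL'|].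
    rewrite -(gsr _ rd) -gk -(gsr _ rd'); congr gamma; ring.
  rewrite distrC; have [h _] := enorm_svec0 (sigma r' - sigma r).
  by apply: le_lt_trans h _; rewrite ek; exact: kL'.
pose v := velocity gamma t0.
have hv : has_velocity gamma t0 v by exact: gv.
have v0 : v != 0 by exact: gn.
have near_v e3 : 0 < e3 -> e3 <= 1 -> exists2 d3, 0 < d3 & forall r, `|r| < d3 ->
    `|r| < d /\ enorm (svec (sigma r) 0 - r *: v) <= e3 * `|r|.
  move=> e30 e31; have [d3 d30 dP] := has_velocity_near hv e30.
  have ve := enorm_ge0 v.
  have c0 : 0 < 1 / 2 / (enorm v + 1) by rewrite !divr_gt0 // ltr_wpDl.
  exists (Num.min (Num.min d d3) (1 / 2 / (enorm v + 1))); first by rewrite !lt_min d0 d30.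
  move=> r; rewrite !lt_min => /andP[/andP[rd r3] rc]; split=> //.
  have [k gk kr] := dP r r3.
  suff -> : svec (sigma r) 0 = r *: v + k by rewrite addrAC subrr add0r.
  rewrite -[sigma r]subr0 -{1}s0; apply: (@leaf_step x); [exact: s16|exact: s16| |].
    apply: le_lt_trans (enormD _ _) _; rewrite enormZ.
    move: rc; rewrite ltr_pdivlMr; last by rewrite ltr_wpDl.
    have : e3 * `|r| <= `|r| by rewrite ler_piMl.
    lra.
  by rewrite -(gsr _ rd) -(gsr _ r0d) addr0.
(* The displacements along the curve are stable vectors, so their derivative is one. *)
have uv : ucoord v = 0.
  apply/eqP; rewrite -normr_le0; apply/ler_addgt0Pr => e3 e30; rewrite add0r.
  pose e4 := Num.min (e3 / 4) 1; have e40 : 0 < e4 by rewrite lt_min ltr01 divr_gt0.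
  have e41 : e4 <= 1 by rewrite ge_min lexx orbT.
  have [d3 d30 dP] := near_v _ e40 e41.
  have [|_ h] := dP (d3 / 2).
    by rewrite ger0_norm ?divr_ge0 ?(ltW d30) // ltr_pdivrMr // ltr_pMr // ltr1n.
  have [_ hu] := coord_le_enorm (svec (sigma (d3 / 2)) 0 - (d3 / 2) *: v).
  have d3p : 0 < d3 / 2 by rewrite divr_gt0.
  have ue : ucoord (svec (sigma (d3 / 2)) 0 - (d3 / 2) *: v) = - (d3 / 2 * ucoord v).
    by rewrite -[in LHS](svecK v) svecZ svecN svecD ucoord_svec add0r.
  move: hu; rewrite ue normrN normrM (gtr0_norm d3p) => hu.
  have e43 : e4 <= e3 / 4 by rewrite ge_min lexx.
  move: h; rewrite (gtr0_norm d3p) => h.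
  rewrite -(ler_pM2l d3p); apply: le_trans hu _.
  have : e4 * (d3 / 2) <= e3 / 4 * (d3 / 2) by rewrite ler_wpM2r // ltW.
  by lra.
pose c := scoord v.
have vE : v = svec c 0 by rewrite -uv svecK.
have c0 : 0 < `|c|.
  rewrite normr_gt0; apply: contra v0 => /eqP c0; by rewrite vE c0 svec0.
have e30 : 0 < Num.min (`|c| / 2) 1 by rewrite lt_min ltr01 divr_gt0.
have [d3 d30 dP] := near_v _ e30 (ltac:(by rewrite ge_min lexx orbT)).
have near_s r : `|r| < d3 -> `|r| < d /\ `|sigma r - r * c| <= `|c| / 2 * `|r|.
  move=> /dP[rd h]; split=> //; have [b _] := enorm_svec0 (sigma r - r * c).
  apply: le_trans b _; move: h; rewrite vE svecZ svecN svecD mulr0 oppr0 addr0 => h.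
  by apply: le_trans h _; apply: ler_wpM2r => //; rewrite ge_min lexx.
have ne : 0 < e / 2 by rewrite divr_gt0.
pose r1 := Num.min (d3 / 2) (e / 8 / (`|c| + 1)).
have c1 : 0 < `|c| + 1 by rewrite ltr_wpDl.
have r10 : 0 < r1 by rewrite lt_min !divr_gt0.
have r13 : r1 < d3.
  by apply: le_lt_trans (_ : r1 <= d3 / 2) _; [rewrite ge_min lexx|rewrite ltr_pdivrMr // ltr_pMr // ltr1n].
have r1e : r1 <= e / 8 / (`|c| + 1) by rewrite ge_min lexx orbT.
have nr1 : `|r1| < d3 by rewrite gtr0_norm.
have nr1' : `|- r1| < d3 by rewrite normrN gtr0_norm.
have [_ sp] := near_s _ nr1; have [_ sm'] := near_s _ nr1'.
have dd r : - r1 <= r <= r1 -> `|r| < d.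
  move=> h; have h3 : `|r| < d3 by apply: le_lt_trans r13; rewrite ler_norml.
  by have [] := near_s r h3.
exists (r1 * `|c| / 2); first by rewrite divr_gt0 // mulr_gt0.
move=> s sd.
have [r rin rs] : exists2 r, r \in `[(- r1), r1] & sigma r = s.
  (* [sigma r] differs from r c by at most |c| |r| / 2, so at the two ends it has opposite signs and
     absolute value at least r1 |c| / 2. *)
  apply: IVT.
  - lra.
  - apply/continuous_within_itvP; first lra.
    have ct r : - r1 <= r <= r1 -> {for r, continuous sigma} by move=> /dd; exact: cs.
    split.
    + by move=> r; rewrite in_itv /= => /andP[h1 h2]; apply: ct; rewrite !ltW.
    + by apply: cvg_at_right_filter; apply: ct; lra.
    + by apply: cvg_at_left_filter; apply: ct; lra.
  - move: sp sm' sd; rewrite normrN (gtr0_norm r10) mulNr opprK !ler_norml !ltr_norml ge_min le_max.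
    have [cp|cn] := leP 0 c.
      by rewrite (ger0_norm cp) => a1 a2 a3; apply/andP; split; apply/orP; [left|right]; lra.
    by rewrite (ltr0_norm cn) => a1 a2 a3; apply/andP; split; apply/orP; [right|left]; lra.
move: rin; rewrite in_itv /= => /dd rd; have [dr gr] := gs r rd; rewrite rs in gr.
split; last by exists (t0 + r).
apply: eU; have [_ b] := enorm_svec0 s; apply: le_lt_trans b _.
have : r1 * (`|c| + 1) <= e / 8 by rewrite -ler_pdivlMr.
have : `|s| < r1 * `|c| / 2 := sd.
lra.
Unshelve. all: by end_near. Qed.

End leaf_geometry.

(** * Null sets and stable leaves in the charts *)

Section charts.
Context {R : realType}.
Local Notation mR := (measurableTypeR R).
Local Notation RR := (measurableTypeR R * measurableTypeR R)%type.
Local Notation leb := (@lebesgue_measure R).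
Variables (eps : R) (eps_itv : 0 <= eps <= 1 / 2).
Local Notation mut := (mut eps_itv).
Local Notation mut0 := (mut0 eps_itv).
Local Notation tprob := (tprob eps_itv).
Local Notation nus := (nus eps_itv).

Lemma mut0_fubini s0 (Y : set RR) : measurable Y ->
  (mut0 s0 Y = \int[nus s0]_u leb (ysection Y u))%E.
Proof.
move=> mY; have mqY : measurable (qmap0 eps s0 @^-1` Y).
  by exact: preim_measurable (qmap0_measurable eps_itv s0) mY.
transitivity ((leb \x^ leb) (qmap0 eps s0 @^-1` Y))%E.
  apply: (@product_measure_unique _ _ _ _ R leb leb (leb \x^ leb)%E) mqY => A1 A2 mA1 mA2.
  exact: product_measure2E.
have mh : measurable_fun setT (fun u => leb (ysection Y u)).
  exact: (measurable_fun_ysection leb mY).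
apply/esym; apply: (eq_trans (ge0_integral_pushforward (quantr_measurable eps_itv s0) leb measurableT mh _)).
  by move=> u _.
by apply: eq_integral => p _ /=; congr (leb _); apply/seteqP; split=> s; rewrite !ysectionE.
Qed.

Lemma pproj_null (N : set (torus R)) : measurable N -> tprob N = 0%E -> mut (pproj @^-1` N) = 0%E.
Proof.
move=> mN N0; have mY : measurable (pproj @^-1` N) by exact: preim_measurable pproj_measurable mN.
have f0 : mut (pproj @^-1` N `&` fdom) = 0%E.
  move: N0; rewrite tprobE => /eqP; rewrite mule_eq0 => /orP[|/eqP//].
  by rewrite eqe gt_eqF // tnorm_gt0.
have mp n : measurable (piece (pproj @^-1` N) n) by exact: piece_measurable.
apply/eqP; rewrite eq_le measure_ge0 andbT.
have sub : pproj @^-1` N `<=` \bigcup_n piece (pproj @^-1` N) n by rewrite bigcup_piece.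
apply: le_trans (measure_sigma_subadditive mut mp mY sub) _.
rewrite eseries0 // => n _ _; rewrite /piece; case: pickle_inv => [k|]; last exact: measure0.
apply: (eq_trans _ f0); apply: (eq_trans _ (mut_ptrans eps_itv k (measurableI _ _ mY fdom_measurable))).
by congr (mut _); apply/seteqP; split=> z [h1 h2]; split=> //; move: h1; rewrite /= pproj_ptrans.
Qed.

(** The image of [Y] under the projection, written through the Borel section [loc] so that it is
    measurable. *)
Definition pimg (Y : set RR) : set (torus R) := [set x | sat Y (loc x)].

Lemma pimgP Y x : pimg Y x <-> exists2 z, Y z & pproj z = x.
Proof.
split=> [[_ [z Yz e]]|[z Yz e]]; first by exists z; rewrite // e pproj_loc.
by split; [exact: fdom_loc|exists z; rewrite // pproj_loc].
Qed.

Lemma pimg_measurable Y : measurable Y -> measurable (pimg Y).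
Proof. by move=> mY; exact: preim_measurable loc_measurable (sat_measurable mY). Qed.

Lemma tprob_pimg Y : measurable Y -> (forall z z', Y z -> Y z' -> pproj z = pproj z' -> z = z') ->
  tprob (pimg Y) = ((tnorm eps_itv)%:E * mut Y)%E.
Proof.
move=> mY Yinj; rewrite (@tprob_chart _ _ eps_itv Y) //.
- by congr (_ * mut _)%E; apply/seteqP; split=> z; [case|move=> Yz; split=> //; apply/pimgP; exists z].
- exact: pimg_measurable.
- by move=> x /pimgP[z Yz <-]; exists z.
Qed.

(* A null set of the plane meets almost every leaf in a null set. *)
Lemma leafwise_null (Y : set RR) : measurable Y -> mut Y = 0%E ->
  exists Bd : set RR, [/\ measurable Bd, mut Bd = 0%E & forall z, ~ Bd z ->
    leb ([set s | `|s - z.1| <= 1 / 2 /\ Y (s, z.2)] : set mR) = 0%E].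
Proof.
move=> mY Y0.
(* Windows of bounded width, so that [mut_le] applies with distance 1, and countably many. Every
   segment of half-length 1/2 lies in one of them. *)
pose S (p : rat) : set mR := `[(ratr p - 1), (ratr p + 1)]%classic.
have mS p : measurable (S p) by exact: measurable_itv.
pose YS p : set RR := Y `&` (S p `*` setT).
have mYS p : measurable (YS p) by apply: measurableI => //; exact: measurableX.
have SE p s : S p s <-> `|s - ratr p| <= 1.
  by rewrite /S /= in_itv /= ler_norml; split=> h; apply/andP; split; lra.
have Sd p (z : RR) : (S p `*` setT) z -> `|z.1 - ratr p| <= 1 by move=> [/SE].
pose V p : set mR := [set u | (0 < leb (ysection (YS p) u))%E].
have mh p : measurable_fun setT (fun u => leb (ysection (YS p) u)).
  exact: (measurable_fun_ysection leb (mYS p)).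
have mV p : measurable (V p).
  by have := measurable_lte measurableT (@measurable_cst _ _ mR (\bar R) setT 0%E) (mh p); rewrite setTI.
have mSV p : measurable (S p `*` V p) by exact: measurableX.
have V0 p : mut (S p `*` V p) = 0%E.
  have mut0Y : mut0 (ratr p) (YS p) = 0%E.
    have [_ h] := mut_le eps_itv (mYS p) (@ler01 R) (fun z (h : YS p z) => Sd p z h.2).
    apply/eqP; rewrite eq_le measure_ge0 andbT; apply: le_trans h _.
    rewrite (_ : mut (YS p) = 0%E) ?mule0 //.
    by apply: (subset_measure0 (mYS p) mY) Y0 => z [].
  have nuV : nus (ratr p) (V p) = 0%E.
    move: mut0Y; rewrite mut0_fubini // => h.
    have := (ae_eq_integral_abs (nus (ratr p)) measurableT (mh p)).1.
    under [X in X = _ -> _]eq_integral do rewrite gee0_abs //.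
    move=> /(_ h)[N [mN N0 VN]]; apply: (subset_measure0 (mV p) mN) N0 => u Vu.
    apply: VN => /(_ I) e; move: Vu; rewrite /V /= e ltxx //.
  have [h _] := mut_le eps_itv (mSV p) (@ler01 R) (fun z (h : (S p `*` V p) z) => Sd p z (conj h.1 I)).
  apply/eqP; rewrite eq_le measure_ge0 andbT; apply: le_trans h _.
  by rewrite mut0_rect // nuV mule0 mule0.
pose Sn (n : nat) : set RR := if @pickle_inv rat n is Some p then S p `*` V p else set0.
have mSn n : measurable (Sn n) by rewrite /Sn; case: pickle_inv.
exists (\bigcup_n Sn n); split.
- exact: bigcup_measurable.
- apply/eqP; rewrite eq_le measure_ge0 andbT.
  apply: le_trans (measure_sigma_subadditive mut mSn (bigcup_measurable (fun k _ => mSn k)) (@subset_refl _ _)) _.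
  by rewrite eseries0 // => n _ _; rewrite /Sn; case: pickle_inv => [p|]; rewrite ?measure0.
move=> z nBd; have [p hp] : exists p : rat, `|ratr p - z.1| <= 1 / 2.
  have zlt : z.1 - 1 / 2 < z.1 + 1 / 2 by lra.
  have [p] := rat_in_itvoo zlt; rewrite in_itv /= => hp; exists p.
  by rewrite ler_norml; lra.
have nV : ~ V p z.2.
  move=> Vz; apply: nBd; exists (pickle p); first exact: I.
  rewrite /Sn (pickleK_inv p); split=> //; apply/SE; move: hp; rewrite !ler_norml; lra.
have my : measurable (ysection (YS p) z.2) by exact: measurable_ysection.
apply/eqP; rewrite -measure_le0; apply: (@le_trans _ _ (leb (ysection (YS p) z.2))); last first.
  by rewrite leNgt; apply/negP.
apply: le_measure; rewrite ?inE //.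
  have -> : [set s | `|s - z.1| <= 1 / 2 /\ Y (s, z.2)] =
      (`[(z.1 - 1 / 2), (z.1 + 1 / 2)]%classic : set mR) `&` ysection Y z.2.
    by apply/seteqP; split=> s; rewrite /= ysectionE in_itv /= ler_norml => -[h1 h2]; split=> //; lra.
  by apply: measurableI; [exact: measurable_itv|exact: measurable_ysection].
move=> s /= [h1 h2]; rewrite ysectionE; split=> //; split=> //; apply/SE.
by move: hp h1; rewrite /= !ler_norml; lra.
Qed.

End charts.

(** * Conditional measures have bounded density across strips *)

Section leaf_densities.
Context {R : realType}.
Local Notation mR := (measurableTypeR R).
Local Notation RR := (measurableTypeR R * measurableTypeR R)%type.
Local Notation leb := (@lebesgue_measure R).
Variables (eps : R) (eps_itv : 0 <= eps <= 1 / 2).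
Local Notation mut := (mut eps_itv).
Local Notation mut0 := (mut0 eps_itv).
Local Notation tprob := (tprob eps_itv).
Local Notation nus := (nus eps_itv).

Lemma integral_gt_null d (T : measurableType d) (mu : probability T R) (C : set T)
    (f : T -> \bar R) (r : R) : measurable C -> measurable_fun setT f ->
  (forall x, 0 <= f x <= 1)%E -> 0 <= r -> (forall x, C x -> r%:E < f x)%E ->
  (\int[mu]_(x in C) f x <= r%:E * mu C)%E -> mu C = 0%E.
Proof.
move=> mC mf f01 r0 fr le.
have ff x : f x \is a fin_num.
  by have /andP[h1 h2] := f01 x; rewrite ge0_fin_numE //; exact: le_lt_trans h2 (ltry _).
have mg : measurable_fun C (fun x => f x - r%:E)%E.
  by apply: emeasurable_funB => //; exact: measurable_funS mf.
have g0 x : C x -> (0 <= f x - r%:E)%E by move=> /fr /ltW h; rewrite sube_ge0.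
have fC : mu C \is a fin_num by exact: fin_num_measure.
have e0 : (\int[mu]_(x in C) `|f x - r%:E| = 0)%E.
  have -> : (\int[mu]_(x in C) `|f x - r%:E| = \int[mu]_(x in C) (f x - r%:E))%E.
    by apply: eq_integral => x /set_mem Cx; rewrite gee0_abs // g0.
  apply/eqP; rewrite eq_le integral_ge0 // andbT.
  have add : (\int[mu]_(x in C) f x = \int[mu]_(x in C) (f x - r%:E) + r%:E * mu C)%E.
    rewrite -(integral_cst mu mC r%:E) -ge0_integralD //.
    by apply: eq_integral => x _; rewrite subeK.
  move: le; rewrite add -leeBrDr ?fin_numM // subee ?fin_numM //.
have [N [mN N0 CN]] := (ae_eq_integral_abs mu mC mg).1 e0.
apply: (subset_measure0 mC mN) N0 => x Cx; apply: CN => h.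
have := fr x Cx; rewrite -(sube_gt0 (f x) r%:E) || rewrite -sube_gt0.
by have -> := h Cx; rewrite /= ltxx.
Qed.

Variables (xi : torus R -> set (torus R)) (part_xi : is_partition xi).
Variables (m : R.-pker torus R ~> torus R) (cm : conditional_measures tprob xi m).
Variables (X : set (torus R)) (A : nat -> set (torus R)).
Hypotheses (mX : measurable X) (X1 : tprob X = 1%E) (mA : forall n, measurable (A n)).
Hypothesis XA : forall x y, X x -> X y -> (xi x y <-> forall n, A n x <-> A n y).
Hypothesis Xm : forall x y, X x -> X y -> xi x y -> forall B, measurable B -> m x B = m y B.

(** On the full set [X] this is membership in a common atom, in a form that is measurable in the
    pair. *)
Definition same_atom (x y : torus R) := X x /\ X y /\ forall n, A n x <-> A n y.

Local Notation index := (rat * rat * (rat * rat))%type.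
Implicit Types (i : index).

Definition ivl i : set mR := `](ratr i.1.1), (ratr i.1.2)]%classic.

(* For [w = ((u, s), s')]: the points with coordinates [s] and [s'] on the
   segment [ivl i] of the leaf [u] are not in the same atom. *)
Definition splits i : set ((mR * mR) * mR) := [set w | ivl i w.1.2 /\ ivl i w.2 /\
  ~ same_atom (pproj (w.1.2, w.1.1)) (pproj (w.2, w.1.1))].

Definition often_split i : set (mR * mR) := [set v | (0 < leb (xsection (splits i) v))%E].

(* The leaves whose segment [ivl i] lies, up to length zero, in one atom. *)
Definition unsplit_leaves i : set mR :=
  `](ratr i.2.1), (ratr i.2.2)]%classic `&` [set u | leb (xsection (often_split i) u) = 0%E].

Definition strip i (J : set mR) : set RR := (ivl i `&` J) `*` unsplit_leaves i.

Definition small_index i := [/\ (ratr i.1.1 : R) < ratr i.1.2,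
  (ratr i.1.2 : R) - ratr i.1.1 <= 1 / 100 & (ratr i.2.2 : R) - ratr i.2.1 <= 1 / 100].

Lemma splits_measurable i : measurable (splits i).
Proof.
have m1 : measurable_fun setT (fun w : (mR * mR) * mR => pproj (w.1.2, w.1.1)).
  apply: (measurableT_comp (@pproj_measurable R)); apply: measurable_fun_pair;
    by apply: (@measurableT_comp _ _ _ _ _ _ _ _ fst).
have m2 : measurable_fun setT (fun w : (mR * mR) * mR => pproj (w.2, w.1.1)).
  apply: (measurableT_comp (@pproj_measurable R)); apply: measurable_fun_pair; first exact: measurable_snd.
  by apply: (@measurableT_comp _ _ _ _ _ _ _ _ fst).
have mi : measurable (ivl i) by exact: measurable_itv.
pose P1 (B : set (torus R)) := (fun w : (mR * mR) * mR => pproj (w.1.2, w.1.1)) @^-1` B.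
pose P2 (B : set (torus R)) := (fun w : (mR * mR) * mR => pproj (w.2, w.1.1)) @^-1` B.
have mP1 B : measurable B -> measurable (P1 B) by exact: preim_measurable.
have mP2 B : measurable B -> measurable (P2 B) by exact: preim_measurable.
pose S := (P1 X `&` P2 X) `&` \bigcap_n ((P1 (A n) `&` P2 (A n)) `|` (P1 (~` A n) `&` P2 (~` A n))).
have mS : measurable S.
  apply: measurableI; first exact: measurableI (mP1 _ mX) (mP2 _ mX).
  apply: bigcapT_measurable => n; have mAc := measurableC (mA n).
  by apply: measurableU; apply: measurableI; (exact: mP1 || exact: mP2).
rewrite (_ : splits i = ((fun w => w.1.2) @^-1` ivl i `&` snd @^-1` ivl i) `&` ~` S).
  apply: measurableI (measurableC mS); apply: measurableI.
    apply: (preim_measurable _ mi).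
    by apply: (@measurableT_comp _ _ _ _ _ _ _ _ fst).
  by apply: (preim_measurable _ mi); exact: measurable_snd.
apply/seteqP; split=> w.
  move=> [h1 [h2 h3]]; split=> // -[[x1 x2] h]; apply: h3; split=> //; split=> // n.
  by have [[]|[]] := h n I.
move=> [[h1 h2] nS]; split=> //; split=> // -[x1 [x2 h]]; apply: nS; split=> // n _.
by have [p|p] := pselect (A n (pproj (w.1.2, w.1.1))); [left|right]; split=> //; [exact/h|move=> /h].
Qed.

Lemma often_split_measurable i : measurable (often_split i).
Proof.
have mh := measurable_fun_xsection leb (splits_measurable i).
by have := measurable_lte measurableT (@measurable_cst _ _ _ (\bar R) setT 0%E) mh; rewrite setTI.
Qed.

Lemma unsplit_leaves_measurable i : measurable (unsplit_leaves i).
Proof.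
apply: measurableI; first exact: measurable_itv.
have mh := measurable_fun_xsection leb (often_split_measurable i).
exact: (preim_measurable mh (emeasurable_set1 0%E)).
Qed.

Lemma strip_measurable i J : measurable J -> measurable (strip i J).
Proof.
move=> mJ; apply: measurableX (unsplit_leaves_measurable i); apply: measurableI mJ.
exact: measurable_itv.
Qed.

Lemma strip_small i J z z' : small_index i -> strip i J z -> strip i J z' ->
  enorm (pvec z - pvec z') < 1 / 2.
Proof.
move=> [_ si1 si2] [[h1 _] [h2 _]] [[h1' _] [h2' _]].
have -> : pvec z - pvec z' = pvec (z.1 - z'.1, z.2 - z'.2) by rewrite /pvec svecN svecD.
move: h1 h2 h1' h2'; rewrite /ivl /= !in_itv /= => h1 h2 h1' h2'.
have p : 0 < 1 / 50 :> R by rewrite divr_gt0.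
by apply: lt_trans (enorm_pvec_lt p _ _) _ => /=; rewrite ?ltr_norml; lra.
Qed.

Lemma strip_inj i J z z' : small_index i -> strip i J z -> strip i J z' ->
  pproj z = pproj z' -> z = z'.
Proof.
move=> si zJ zJ' e; apply: pvec_inj; apply: (addIr (- pvec z')).
apply: tproj_inj_small; last by rewrite !tprojB; congr (_ - _).
  exact: strip_small si zJ zJ'.
by rewrite subrr enorm0 divr_gt0.
Qed.

(** A zero-one law. On an unsplit leaf almost every point of the segment shares its atom with almost
    every other; one such point in [C] brings almost the whole segment into [C], and if there is
    none then [T] is null. *)
Lemma unsplit_alternative i u (C : set (torus R)) :
  (forall x y, X x -> X y -> xi x y -> C x -> C y) -> measurable C ->
  unsplit_leaves i u ->
  let T : set mR := [set s | ivl i s /\ C (pproj (s, u))] in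
  leb T = 0%E \/ leb T = leb (ivl i).
Proof.
move=> Cinv mC [_ Eu] T.
have mi : measurable (ivl i) by exact: measurable_itv.
have mT : measurable T.
  apply: measurableI => //; apply: (preim_measurable _ mC).
  by apply: (measurableT_comp (@pproj_measurable R)); exact: measurable_fun_pair.
have mE : measurable (xsection (often_split i) u) by exact: measurable_xsection (often_split_measurable i).
have [[s [Ts nE]]|no] := pselect (exists s, T s /\ ~ xsection (often_split i) u s); last first.
  left; apply: (subset_measure0 mT mE) Eu => s Ts; apply: contrapT => nE.
  by apply: no; exists s.
right; have mW : measurable (xsection (splits i) (u, s)) by exact: measurable_xsection (splits_measurable i).
have W0 : leb (xsection (splits i) (u, s)) = 0%E.
  apply/eqP; rewrite -measure_le0 leNgt; apply/negP => h; apply: nE.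
  by rewrite xsectionE.
have D0 : leb (ivl i `\` T) = 0%E.
  apply: (subset_measure0 (measurableD mi mT) mW) W0 => s' [is' nT].
  have [is_ Cs] := Ts.
  rewrite xsectionE; split=> //; split=> // -[x1 [x2 h]]; apply: nT; split=> //.
  by apply: Cinv Cs => //; apply/XA.
have e : (leb (ivl i) = 0 + leb (ivl i `&` T))%E.
  by apply: (eq_trans (measureDI leb mi mT)); congr (_ + _)%E; exact: D0.
apply: esym; apply: (eq_trans e); rewrite add0e; congr (leb _).
by apply/seteqP; split=> [s' [h1 h2]|s' [_ h]] //; split.
Qed.

(** The proportion of the segment [ivl i] filled by an interval of length [c], with one distortion
    factor for passing from [mut] to the product measure and one for passing back. *)
Definition leaf_bound i (c : R) : R :=
  distortion 1 * distortion 1 * (c / (ratr i.1.2 - ratr i.1.1)).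

(** The set [C] where the bound [r] fails is on [X] a union of atoms, so integrating [m x B] over
    [C] gives the measure of [B] inside [C]. On each unsplit leaf [C] fills none or all of the
    segment, so its part over []c, d]] is at most the proportion of lengths times the whole;
    distortion turns this into [r] times the measure of [C]. As the integrand exceeds [r] on [C],
    the set is null. *)
Lemma kernel_strip_le i (c d : R) : small_index i -> c <= d ->
  {ae tprob, forall x, m x (pimg (strip i `]c, d]%classic)) <= (leaf_bound i (d - c))%:E}%E.
Proof.
move=> si cd; have [ab si1 si2] := si; set J : set mR := `]c, d]%classic.
have mJ : measurable J by exact: measurable_itv.
set B := pimg (strip i J); set r := leaf_bound i (d - c).
have mB : measurable B by apply: pimg_measurable; exact: strip_measurable.
have mk := measurable_kernel m _ mB.
pose C := [set x | (r%:E < m x B)%E].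
have mC : measurable C.
  by have := measurable_lte measurableT (@measurable_cst _ _ _ (\bar R) setT r%:E) mk; rewrite setTI.
have Cinv x y : X x -> X y -> xi x y -> C x -> C y.
  by move=> hx hy xy; rewrite /C /= (Xm hx hy xy).
have loc := conditional_localize part_xi cm mX X1 mC mB Cinv.
have mPC : measurable (pproj @^-1` C) by exact: preim_measurable (@pproj_measurable R) mC.
pose Y1 := strip i J `&` pproj @^-1` C; pose Y2 := strip i setT `&` pproj @^-1` C.
have mY1 : measurable Y1 by apply: measurableI => //; exact: strip_measurable.
have mY2 : measurable Y2 by apply: measurableI => //; exact: strip_measurable.
have inj1 z z' : Y1 z -> Y1 z' -> pproj z = pproj z' -> z = z'.
  by move=> [h _] [h' _]; exact: strip_inj si h h'.
have inj2 z z' : Y2 z -> Y2 z' -> pproj z = pproj z' -> z = z'.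
  by move=> [h _] [h' _]; exact: strip_inj si h h'.
have BC : B `&` C = pimg Y1.
  apply/seteqP; split=> [x [/pimgP[z Yz e] Cx]|x /pimgP[z [Yz Cz] e]].
    by apply/pimgP; exists z => //; split=> //; rewrite /preimage /mkset e.
  by split; [apply/pimgP; exists z|rewrite -e].
have Y2C : pimg Y2 `<=` C by move=> x /pimgP[z [_ Cz] <-].
pose k := (d - c) / (ratr i.1.2 - ratr i.1.1 : R).
have ab0 : 0 < ratr i.1.2 - ratr i.1.1 :> R by rewrite subr_gt0.
have k0 : 0 <= k by rewrite divr_ge0 ?subr_ge0 // ltW.
have K0 : 0 <= distortion 1 :> R by rewrite expR_ge0.
have near_a J' z : strip i J' z -> `|z.1 - ratr i.1.1| <= 1.
  by move=> [[h _] _]; move: h; rewrite /ivl /= in_itv /= ler_norml; lra.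
have d1 z : Y1 z -> `|z.1 - ratr i.1.1| <= 1 by move=> [h _]; exact: near_a h.
have d2 z : Y2 z -> `|z.1 - ratr i.1.1| <= 1 by move=> [h _]; exact: near_a h.
have [le1 _] := mut_le eps_itv mY1 (@ler01 R) d1.
have [_ le2] := mut_le eps_itv mY2 (@ler01 R) d2.
have le12 : (mut0 (ratr i.1.1) Y1 <= k%:E * mut0 (ratr i.1.1) Y2)%E.
  rewrite !mut0_fubini //.
  have mh1 : measurable_fun setT (fun u => leb (ysection Y1 u)) by exact: (measurable_fun_ysection leb mY1).
  have mh2 : measurable_fun setT (fun u => leb (ysection Y2 u)) by exact: (measurable_fun_ysection leb mY2).
  rewrite -(@ge0_integralZl_EFin _ _ _ (nus (ratr i.1.1)) _ measurableT (fun u => leb (ysection Y2 u)) (fun u _ => measure_ge0 leb _) mh2 k k0).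
  apply: ge0_le_integral => //.
  - exact: (measurable_funeM k%:E mh2).
  - move=> u _; have ys1 : measurable (ysection Y1 u) by exact: measurable_ysection.
    have ys2 : measurable (ysection Y2 u) by exact: measurable_ysection.
    have s12 : ysection Y1 u `<=` ysection Y2 u.
      by move=> s; rewrite !ysectionE => -[[[h1 _] h2] h3]; split=> //; split.
    have [Uu|nU] := pselect (unsplit_leaves i u); last first.
      rewrite (_ : ysection Y1 u = set0) ?measure0 ?mule_ge0 ?lee_fin //.
      by apply/seteqP; split=> // s; rewrite ysectionE => -[[_ h] _].
    have := unsplit_alternative Cinv mC Uu.
    rewrite (_ : [set s | _] = ysection Y2 u); last first.
      apply/seteqP; split=> s; rewrite ysectionE; first by move=> [h1 h2].
      by move=> [[[h1 _] _] h2].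
    move=> [T0|->].
      by rewrite (subset_measure0 ys1 ys2 s12 T0) mule_ge0 // lee_fin.
    rewrite /ivl lebesgue_measure_oc ?(ltW ab) // -EFinM /k divfK ?gt_eqF //.
    rewrite -lebesgue_measure_oc //; apply: le_measure; rewrite ?inE //.
    by move=> s; rewrite ysectionE => -[[[_ h] _] _].
have C0 : tprob C = 0%E.
  apply: (integral_gt_null (f := fun x => m x B) (r := r)) => //.
  - by move=> x; rewrite measure_ge0 pker_le1.
  - by rewrite /r /leaf_bound mulr_ge0 // mulr_ge0.
  - rewrite loc BC (tprob_pimg eps_itv mY1 inj1).
    apply: (@le_trans _ _ (r%:E * tprob (pimg Y2))%E); last first.
      apply: lee_wpmul2l; first by rewrite lee_fin /r /leaf_bound mulr_ge0 // mulr_ge0.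
      by apply: le_measure; rewrite ?inE //; exact: pimg_measurable.
    rewrite (tprob_pimg eps_itv mY2 inj2) muleCA.
    apply: lee_wpmul2l; first by rewrite lee_fin ltW // tnorm_gt0.
    apply: le_trans le1 _; rewrite /r /leaf_bound -/k -(mulrA (distortion 1)) EFinM -muleA.
    apply: lee_wpmul2l; first by rewrite lee_fin.
    apply: le_trans le12 _; rewrite (mulrC (distortion 1)) (EFinM k) -(muleA k%:E).
    by apply: lee_wpmul2l; rewrite ?lee_fin.
exists C; split=> // x /= h; rewrite /C /= ltNge; exact/negP.
Qed.

(** For almost every x, a stable segment about x lies in its atom and, by [leafwise_null], meets the
    exceptional set in length zero. So almost all pairs of points of a short rational segment about
    x are in the same atom, and x lies on an unsplit leaf. *)
Lemma unsplit_cover : {ae tprob, forall x, exists2 d : R, 0 < d & forall s, `|s| < d -> xi x (leaf x s)} ->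
  {ae tprob, forall x, exists i, small_index i /\ pimg (strip i setT) x}.
Proof.
move=> [N [mN N0 segN]]; pose N' := N `|` ~` X.
have mN' : measurable N' by apply: measurableU => //; exact: measurableC.
have N'0 : tprob N' = 0%E.
  by apply: null_set_setU => //; [exact: measurableC|exact: probability_compl0].
have mY : measurable (pproj @^-1` N') by exact: preim_measurable (@pproj_measurable R) mN'.
have [Bd [mBd Bd0 BdP]] := leafwise_null mY (pproj_null mN' N'0).
pose M := N' `|` loc @^-1` Bd.
have mM2 : measurable (loc @^-1` Bd : set (torus R)) by exact: preim_measurable (@loc_measurable R) mBd.
exists M; split; first exact: measurableU.
  apply: null_set_setU => //.
  apply: (eq_trans (tprobE eps_itv _)); rewrite (_ : mut _ = 0%E) ?mule0 //.
  apply: (subset_measure0 _ mBd) Bd0.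
    by apply: measurableI (@fdom_measurable R); exact: preim_measurable (@pproj_measurable R) mM2.
  by move=> z [h fz]; rewrite -[z]fz.
move=> x; apply: contraPP => /not_orP[nN' nBd] /=; apply.
have xX : X x by apply: contrapT => h; apply: nN'; right.
have [d d0 seg] : exists2 d : R, 0 < d & forall s, `|s| < d -> xi x (leaf x s).
  by apply: contrapT => h; apply: nN'; left; apply: segN.
have z0 := BdP _ nBd; set z := loc x in nBd z0.
(* Rational endpoints within [e] give sides below 2/300 < 1/100, as [small_index] asks, and a
   segment within the distance [d] where the atom is known. *)
pose e := Num.min (d / 2) (1 / 300); have e0 : 0 < e by rewrite lt_min; lra.
have ed : e <= d / 2 by rewrite ge_min lexx.
have e3 : e <= 1 / 300 by rewrite ge_min lexx orbT.
have near (t : R) : exists p q : rat, [/\ t - e < ratr p, ratr p < t, t < ratr q & ratr q < t + e].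
  have l1 : t - e < t by lra.
  have l2 : t < t + e by lra.
  have [p] := rat_in_itvoo l1; have [q] := rat_in_itvoo l2.
  by rewrite !in_itv /= => /andP[h1 h2] /andP[h3 h4]; exists p, q.
have [a [b [a1 a2 b1 b2]]] := near z.1; have [q [q' [q1 q2 q3 q4]]] := near z.2.
pose i : index := ((a, b), (q, q')); exists i; split; first by split => /=; lra.
pose Ys : set mR := [set s | `|s - z.1| <= 1 / 2 /\ (pproj @^-1` N') (s, z.2)].
have mYs : measurable Ys.
  rewrite (_ : Ys = (`[(z.1 - 1 / 2), (z.1 + 1 / 2)]%classic : set mR) `&` ysection (pproj @^-1` N') z.2).
    by apply: measurableI; [exact: measurable_itv|exact: measurable_ysection].
  by apply/seteqP; split=> s; rewrite /Ys /= ysectionE in_itv /= ler_norml => -[h1 h2]; split=> //; lra.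
have ivlP (s : R) : ivl i s -> `|s - z.1| < e.
  rewrite /ivl /i /= in_itv /= => /andP[h1 h2].
  have [k1 k2] : (ratr a : R) < s /\ s <= (ratr b : R) by [].
  by rewrite ltr_norml; apply/andP; split; [rewrite ltrBrDl|rewrite ltrBlDl];
    [apply: (lt_trans _ k1)|apply: (le_lt_trans k2)].
have good (s : R) : ivl i s -> ~ Ys s -> X (pproj (s, z.2)) /\ xi x (pproj (s, z.2)).
  move=> /ivlP se nY.
  have nN : ~ N' (pproj (s, z.2)).
    by move=> h; apply: nY; split=> //; lra.
  split; first by apply: contrapT => h; apply: nN; right.
  have -> : pproj (s, z.2) = leaf x (s - z.1).
    rewrite /leaf -[in RHS](pproj_loc x) -/z /pproj -tprojD /pvec svecD /= addr0.
    by congr (torus_proj (svec _ _)); ring.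
  by apply: seg; lra.
apply/pimgP; exists z; last exact: pproj_loc.
have iz : ivl i z.1 by rewrite /ivl /= in_itv /=; apply/andP; split; [exact: a2|exact: ltW b1].
split; first by split.
split; first by rewrite /= in_itv /=; apply/andP; split; [exact: q2|exact: ltW q3].
have mE := measurable_xsection z.2 (often_split_measurable i).
apply: (subset_measure0 mE mYs _ z0) => s; rewrite xsectionE => Es.
have mW := measurable_xsection (z.2, s) (splits_measurable i).
apply: contrapT => nYs; have : leb (xsection (splits i) (z.2, s)) = 0%E.
  apply: (subset_measure0 mW mYs _ z0) => s'; rewrite xsectionE => -[is_ [is' ns]].
  apply: contrapT => nYs'; apply: ns.
  have [x1 x2] := good _ is_ nYs; have [x3 x4] := good _ is' nYs'.
  split=> //; split=> // n.
  have h1 := (XA xX x1).1 x2 n; have h2 := (XA xX x3).1 x4 n.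
  by split=> h; [apply/h2/h1|apply/h1/h2].
by move=> h; move: Es; rewrite /often_split /preimage /mkset h ltxx.
Qed.

End leaf_densities.

(** * Length on embedded curves *)

Section curve_length.
Context {R : realType}.
Local Notation mR := (measurableTypeR R).
Local Notation leb := (@lebesgue_measure R).
Implicit Types (gamma : R -> torus R).

Lemma ler_enormB (v w : 'rV[R]_2) : `|enorm v - enorm w| <= enorm (v - w).
Proof.
have h1 := enormD (v - w) w; have h2 := enormD (w - v) v.
by move: h1 h2; rewrite !subrK -(enormN (w - v)) opprB ler_norml; lra.
Qed.

Lemma locally_holder_continuous (alpha : R) (D : set R) (v : R -> 'rV[R]_2) : 0 < alpha -> open D ->
  locally_holder (fun s t => `|s - t|) edist alpha D v ->
  {in D, continuous (fun t => enorm (v t))}.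
Proof.
move=> a0 oD hv t /set_mem Dt; have [V Vt [C CV]] := hv t Dt.
apply/cvgrPdist_lt => e e0.
have C0 : 0 < `|C| + 1 by rewrite ltr_wpDl.
pose d := (e / (`|C| + 1)) `^ alpha^-1.
have q0 : 0 < e / (`|C| + 1) by rewrite divr_gt0.
have d0 : 0 < d by rewrite powR_gt0.
have nD : nbhs t (D : set R) by exact: open_nbhs_nbhs.
near=> s.
have VDs : (D `&` V) s by split; near: s.
have VDt : (D `&` V) t by split; [|exact: nbhs_singleton Vt].
have sd : `|t - s| < d by near: s; exact: cvgr_dist_lt.
apply: le_lt_trans (ler_enormB _ _) _; apply: le_lt_trans (CV _ _ VDt VDs) _.
apply: (@le_lt_trans _ _ (`|C| * `|t - s| `^ alpha)).
  by apply: ler_wpM2r; rewrite ?powR_ge0 ?ler_norm.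
apply: (@le_lt_trans _ _ ((`|C| + 1) * `|t - s| `^ alpha)).
  by apply: ler_wpM2r; rewrite ?powR_ge0 // lerDl.
rewrite mulrC -ltr_pdivlMr //.
have -> : e / (`|C| + 1) = d `^ alpha by rewrite /d -powRrM mulVf ?gt_eqF // powRr1 // ltW.
by apply: gt0_ltr_powR; rewrite ?nnegrE // ltW.
Unshelve. all: by end_near.
Qed.

Lemma curve_open_measurable gamma (U : set (torus R)) :
  (forall t, curve_dom t -> has_velocity gamma t (velocity gamma t)) -> open U ->
  measurable (curve_dom `&` gamma @^-1` U : set mR).
Proof.
move=> gv oU; apply: open_measurable; rewrite openE => t [Dt Ut].
have [L [d [L0 d0 dP]]] := embedded_continuity (gv t Dt).
have /nbhs_torusP[e e0 eU] : nbhs (gamma t) U by exact: open_nbhs_nbhs.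
have nD : nbhs t (@curve_dom R) by apply: open_nbhs_nbhs; split=> //; exact: interval_open.
have Le0 : 0 < e / L by rewrite divr_gt0.
near=> s.
have Ds : curve_dom s by near: s.
have sd : `|s - t| < d by rewrite distrC; near: s; exact: cvgr_dist_lt.
have se : `|s - t| < e / L by rewrite distrC; near: s; exact: cvgr_dist_lt.
split=> //; have [k gk kL] := dP _ sd; rewrite /preimage /mkset -(subrKC t s) addrC subrK.
by rewrite -(subrK t s) addrC gk; apply: eU; apply: le_lt_trans kL _; rewrite mulrC -ltr_pdivlMr.
Unshelve. all: by end_near.
Qed.

(** The speed vanishes nowhere, so zero length forces a null set of parameters. *)
Lemma Leb_curve_null gamma (A : set (torus R)) : embedded_C1plus_curve gamma -> measurable A ->
  Leb_curve gamma A = 0%E -> leb.-negligible (curve_dom `&` gamma @^-1` A : set mR).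
Proof.
move=> [gv gn [alpha a0 hv] _] mA LA.
have oD : open (@curve_dom R) by exact: interval_open.
have mg : measurable_fun (curve_dom : set mR) gamma.
  by apply: (measurability (@open (torus R))) => // _ [U oU <-]; exact: curve_open_measurable.
have mD : measurable (curve_dom `&` gamma @^-1` A : set mR).
  by apply: mg => //; exact: open_measurable.
have mv : measurable_fun (curve_dom `&` gamma @^-1` A : set mR) (fun t => (enorm (velocity gamma t))%:E).
  apply/measurable_EFinP; apply: (@measurable_funS _ _ _ _ curve_dom); first exact: open_measurable.
    by move=> t [].
  by apply: open_continuous_measurable_fun => //; exact: locally_holder_continuous a0 oD hv.
have e0 : (\int[leb]_(t in curve_dom `&` gamma @^-1` A) `|(enorm (velocity gamma t))%:E| = 0)%E.
  by rewrite -LA; apply: eq_integral => t _; rewrite gee0_abs // lee_fin enorm_ge0.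
have [N [mN N0 DN]] := (ae_eq_integral_abs leb mD mv).1 e0.
exists N; split=> // t Dt; apply: DN => h.
have := h Dt => -[] /eqP; rewrite enorm_eq0; apply/negP; exact: gn Dt.1.
Qed.

End curve_length.

(** * From strip bounds to absolute continuity *)

Section strip_null_sets.
Context {R : realType}.
Local Notation mR := (measurableTypeR R).
Local Notation RR := (measurableTypeR R * measurableTypeR R)%type.
Local Notation leb := (@lebesgue_measure R).
Variables (X : set (torus R)) (A : nat -> set (torus R)).
Hypotheses (mX : measurable X) (mA : forall n, measurable (A n)).
Local Notation strip := (strip X A).

Lemma leaf_bound_linear i (r : R) : leaf_bound i r = leaf_bound i 1 * r.
Proof. by rewrite /leaf_bound mul1r (mulrC r) mulrA. Qed.

Lemma leaf_bound_ge0 i : @small_index R i -> 0 <= leaf_bound i 1 :> R.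
Proof.
by move=> [ab _ _]; rewrite /leaf_bound !mulr_ge0 ?expR_ge0 // invr_ge0 ltW // subr_gt0.
Qed.

(** The kernel bounds hold off a null set for each strip, hence simultaneously only for countably
    many; an arbitrary interval is enclosed in a slightly longer rational one. *)
Lemma strip_bound_real (nu : {measure set (torus R) -> \bar R}) i (c d : R) :
  @small_index R i -> c <= d ->
  (forall p q : rat, ((ratr p : R) <= ratr q)%R ->
     nu (pimg (strip i `](ratr p : R), (ratr q : R)]%classic)) <= (leaf_bound i (ratr q - ratr p)%R)%:E)%E ->
  (nu (pimg (strip i `]c, d]%classic)) <= (leaf_bound i (d - c)%R)%:E)%E.
Proof.
move=> si cd nub.
suff H (e : R) : 0 < e ->
    (nu (pimg (strip i `]c, d]%classic)) <= (leaf_bound i (d - c)%R)%:E + e%:E)%E.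
  by apply/lee_addgt0Pr => e; exact: H.
move=> e0.
pose K : R := leaf_bound i 1.
have K0 : 0 <= K := leaf_bound_ge0 si.
have K10 : 0 < 2 * (K + 1) by lra.
have q0 : 0 < e / (2 * (K + 1)) by rewrite divr_gt0.
set q := e / (2 * (K + 1)) in q0.
have l1 : c - q < c by lra.
have l2 : d < d + q by lra.
have [p] := rat_in_itvoo l1; have [r] := rat_in_itvoo l2.
rewrite !in_itv /= => /andP[r1 r2] /andP[p1 p2].
have pr : (ratr p : R) <= ratr r by lra.
have mS (a b : R) : measurable (pimg (strip i `]a, b]%classic)).
  by apply: pimg_measurable; apply: strip_measurable => //; exact: measurable_itv.
apply: (@le_trans _ _ (nu (pimg (strip i `](ratr p : R), (ratr r : R)]%classic)))).
  apply: le_measure; rewrite ?inE //.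
  move=> x /pimgP[z [[h1 h2] h3] e']; apply/pimgP; exists z => //; split=> //; split=> //.
  move: h2; rewrite /= !in_itv /= => /andP[h4 h5].
  by apply/andP; split; [exact: lt_trans p2 h4|exact: le_trans h5 (ltW r1)].
apply: le_trans (nub _ _ pr) _; rewrite -EFinD lee_fin !(leaf_bound_linear i (_ - _)) -/K.
have Kq : K * q * 2 <= e.
  have -> : e = (K + 1) * q * 2 by rewrite /q; field; lra.
  by rewrite ler_pM2r // ler_pM2r // lerDl.
have : K * (ratr r - ratr p) <= K * (d - c + q * 2) by apply: ler_wpM2l => //; lra.
by rewrite mulrDr mulrA; lra.
Qed.

Lemma strip_negligible (nu : {measure set (torus R) -> \bar R}) i (S : set mR) :
  @small_index R i ->
  (forall c d : R, (c <= d)%R -> nu (pimg (strip i `]c, d]%classic)) <= (leaf_bound i (d - c)%R)%:E)%E ->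
  leb.-negligible S -> nu.-negligible (pimg (strip i S)).
Proof.
move=> si nub S0; apply: negligible_small => e e0.
pose K : R := leaf_bound i 1.
have K0 : 0 <= K := leaf_bound_ge0 si.
have K10 : 0 < K + 1 by lra.
have q0 : 0 < e / (K + 1) by rewrite divr_gt0.
have [F [F12 SF Fe]] := negligible_cover S0 q0.
pose G k := pimg (strip i `](F k).1, (F k).2]%classic).
have mG k : measurable (G k).
  by apply: pimg_measurable; apply: strip_measurable => //; exact: measurable_itv.
have mGU : measurable (\bigcup_k G k) by exact: bigcupT_measurable.
exists (\bigcup_k G k); split=> //.
  move=> x /pimgP[z [[h1 h2] h3] e']; have [k _ kz] := SF _ h2.
  by exists k => //; apply/pimgP; exists z => //; split=> //; split.
apply: le_trans (measure_sigma_subadditive nu mG mGU (@subset_refl _ _)) _.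
apply: (@le_trans _ _ (\sum_(k <oo) (K%:E * ((F k).2 - (F k).1)%:E))%E).
  apply: lee_nneseries => [k _ _|k _]; first exact: measure_ge0.
  by rewrite -EFinM -leaf_bound_linear; apply: nub.
rewrite nneseriesZl => [|k _]; last by rewrite lee_fin subr_ge0.
apply: le_trans (lee_wpmul2l _ Fe) _; first by rewrite lee_fin.
by rewrite -EFinM lee_fin mulrA ler_pdivrMr // (mulrC e) ler_pM2r // lerDl.
Qed.

(** The stable coordinate of [gamma t] is locally Lipschitz among the parameters whose points lie in
    the strip, because the strip is small enough to lift displacements to the plane. Thus a null set
    of parameters has a null set of stable coordinates. *)
Lemma curve_strip_null gamma i (D : set mR) : @small_index R i ->
  (forall t, curve_dom t -> has_velocity gamma t (velocity gamma t)) ->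
  D `<=` curve_dom -> leb.-negligible D ->
  leb.-negligible ([set s | exists t u, [/\ D t, strip i setT (s, u) & pproj (s, u) = gamma t]] : set mR).
Proof.
move=> si gv Dd D0.
pose D' : set mR := [set t | D t /\ exists z, strip i setT z /\ pproj z = gamma t].
have D'0 : leb.-negligible D' by apply: negligibleS D0 => t [].
have /choice[f fP] (t : R) : exists z : RR, D' t -> strip i setT z /\ pproj z = gamma t.
  have [[Dt [z zP]]|h] := pselect (D' t); [by exists z|by exists (0, 0)].
have lip t : D' t -> exists L d : R, 0 < d /\
    forall t', D' t' -> `|t' - t| < d -> `|(f t').1 - (f t).1| <= L * `|t' - t|.
  move=> D't; have [L [d [L0 d0 dP]]] := embedded_continuity (gv t (Dd _ D't.1)).
  exists (4 * L), (Num.min d (1 / 2 / L)); split; first by rewrite lt_min d0 divr_gt0.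
  move=> t' D't'; rewrite lt_min => /andP[td tL].
  have [k gk kL] := dP _ td; have [s1 e1] := fP _ D't; have [s2 e2] := fP _ D't'.
  move: gk; rewrite subrKC -e1 -e2 => gk.
  have ek : pvec (f t') - pvec (f t) = k.
    apply: tproj_inj_small.
    - exact: strip_small si s2 s1.
    - by apply: le_lt_trans kL _; rewrite mulrC -ltr_pdivlMr.
    - by apply: (addIr (pproj (f t))); rewrite (addrC (torus_proj k)) -gk -tprojD subrK.
  have [h _] := coord_le_enorm (pvec (f t') - pvec (f t)).
  have es : scoord (pvec (f t') - pvec (f t)) = (f t').1 - (f t).1.
    by rewrite /pvec svecN svecD scoord_svec.
  move: h; rewrite es ek => h; apply: le_trans h _.
  by rewrite -mulrA ler_wpM2l.
apply: negligibleS (lipschitz_image_negligible (f := fun t => (f t).1) D'0 lip).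
move=> s [t [u [Dt su e]]]; have D't : D' t by split=> //; exists (s, u).
exists t => //; have [h e'] := fP _ D't.
by have -> : f t = (s, u) by apply: (strip_inj si h su); rewrite e e'.
Qed.

(** A set of zero length on the curve has, in each strip, stable coordinates in a null set, and the
    linear bound makes the part of the strip over such a set negligible. Countably many strips and
    the curve carry all of [nu]. *)
Lemma curve_dominates (nu : {measure set (torus R) -> \bar R}) gamma :
  embedded_C1plus_curve gamma -> nu.-negligible (~` curve gamma) ->
  nu.-negligible (~` [set x | exists i, @small_index R i /\ pimg (strip i setT) x]) ->
  (forall i, @small_index R i -> forall c d : R, (c <= d)%R ->
     nu (pimg (strip i `]c, d]%classic)) <= (leaf_bound i (d - c)%R)%:E)%E ->
  nu `<< Leb_curve gamma.
Proof.
move=> eg n1 n2 nub N LN B mB BN; apply: (measure_negligible mB).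
have D0 := Leb_curve_null eg mB (LN B mB BN); have [gv _ _ _] := eg.
set D := (D in leb.-negligible D) in D0.
have Dd : D `<=` curve_dom by move=> t [].
pose S i : set mR := [set s | exists t u, [/\ D t, strip i setT (s, u) & pproj (s, u) = gamma t]].
pose T n := if pickle_inv n is Some i then
  [set x | @small_index R i /\ pimg (strip i (S i)) x] else set0.
have nT n : nu.-negligible (T n).
  rewrite /T; case: pickle_inv => [i|]; last exact: negligible_set0.
  have [si|nsi] := pselect (@small_index R i); last first.
    by apply: negligibleS (negligible_set0 nu) => x [].
  apply: negligibleS (strip_negligible si (nub i si) (curve_strip_null si gv Dd D0)).
  by move=> x [].
apply: (negligibleS _ (negligibleU (negligibleU n1 n2) (negligible_bigcup nT))) => x Bx.
have [[t Dt tx]|] := pselect (curve gamma x); last by left; left.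
have [[i [si /pimgP[z zs zx]]]|] := pselect (exists i, @small_index R i /\ pimg (strip i setT) x);
  last by left; right.
right; exists (pickle i); first exact: I.
rewrite /T pickleK_inv; split; first exact: si.
apply/pimgP; exists z; last exact: zx.
split; last exact: zs.2.
split; first exact: zs.1.1.
by exists t, z.2; case: z zs zx => s u zs zx; split=> //; [split=> //; rewrite /preimage /mkset tx|rewrite tx].
Qed.

End strip_null_sets.

(** For almost every x, the conditional measure lives on the curve [Ws x] and on the union [G] of
    the good strips, and satisfies the strip bounds for all rational data at once; [curve_dominates]
    then applies. *)
Lemma tmap_inverse_SRB (R : realType) (eps : R) (eps_itv : 0 <= eps <= 1 / 2) :
  inverse_SRB (@tmap R) (tprob eps_itv).
Proof.
split; [exact: tmap_preserves|exact: tmap_hyperbolic|].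
move=> Ws xi m [part_xi [X0 [A [mX0 X01 mA XA0]]]] sub cm.
have [mum mxi [X1 [mX1 X11 Xm1]]] := cm.
pose X := X0 `&` X1; have mX : measurable X by exact: measurableI.
have X_1 := probability_setI1 mX0 mX1 X01 X11.
have XA x y : X x -> X y -> (xi x y <-> forall n, A n x <-> A n y).
  by move=> [h _] [h' _]; exact: XA0.
have Xm x y : X x -> X y -> xi x y -> forall B, measurable B -> m x B = m y B.
  by move=> [_ h] [_ h']; exact: Xm1.
have seg : {ae tprob eps_itv, forall x, exists2 d : R, 0 < d & forall s, `|s| < d -> xi x (leaf x s)}.
  apply: filterS sub => x [sm _ [U [oU Ux Uxi]]].
  have [d d0 h] := stable_manifold_segment sm oU Ux.
  by exists d => // s /h; exact: Uxi.
have cov := unsplit_cover mX X_1 mA XA seg.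
pose G := [set x | exists i, @small_index R i /\ pimg (strip X A i setT) x].
have mG : measurable G.
  pose T n := if pickle_inv n is Some i then
    [set x | @small_index R i /\ pimg (strip X A i setT) x] else set0.
  rewrite (_ : G = \bigcup_n T n).
    apply: bigcupT_measurable => n; rewrite /T; case: pickle_inv => [i|//].
    have [si|nsi] := pselect (@small_index R i).
      rewrite (_ : [set x | _] = pimg (strip X A i setT)).
        by apply: pimg_measurable; exact: strip_measurable.
      by apply/seteqP; split=> x // [].
    by rewrite (_ : [set x | _] = set0) //; apply/seteqP; split=> x // [].
  apply/seteqP; split=> [x [i ix]|x [n _]].
    by exists (pickle i); [exact: I|rewrite /T pickleK_inv; exact: ix].
  by rewrite /T; case: pickle_inv => // i ix; exists i.
have mGc := measurableC mG.
have G0 : tprob eps_itv (~` G) = 0%E by exact: measure_negligible mGc cov.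
have G1 : tprob eps_itv G = 1%E.
  by have := probability_setC (tprob eps_itv) mGc; rewrite setCK G0 sube0.
have bd : {ae tprob eps_itv, forall x, forall n : nat,
    if pickle_inv n is Some (i, (p, q)) then @small_index R i -> (ratr p : R) <= ratr q ->
      (m x (pimg (strip X A i `](ratr p : R), (ratr q : R)]%classic)) <=
        (leaf_bound i (ratr q - ratr p)%R)%:E)%E else True}.
  apply: ae_foralln => n; case: pickle_inv => [[i [p q]]|]; last exact: aeW.
  have [si|nsi] := pselect (@small_index R i); last by apply: aeW => x /nsi.
  have [pq|npq] := pselect ((ratr p : R) <= ratr q); last by apply: aeW => x _ /npq.
  by have h := kernel_strip_le part_xi cm mX X_1 mA XA Xm si pq; apply: filterS h.
apply: filterS3 (filterI sub mxi) (full_set_kernel mum mG G1) bd.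
move=> x [[[eg _ _] xiW _] xin] [_ mG0] bx.
apply: (@curve_dominates _ X A) => //.
- by apply: negligibleS xin => y ny /xiW.
- by exists (~` G); split; [exact: mGc|exact: mG0|exact: subset_refl].
move=> i si c d cd; apply: strip_bound_real => // p q pq.
by have := bx (pickle (i, (p, q))); rewrite pickleK_inv; apply.
Qed.

Theorem proposition1p1 (R : realType) :
  exists (g : torus R -> torus R) (mu1 mu2 : probability (torus R) R)
         (muh1 muh2 : probability (bisequence R) R),
    [/\ End1plus g, topologically_transitive g,
        inverse_SRB g mu1 & inverse_SRB g mu2] /\
    [/\ is_lift g mu1 muh1, is_lift g mu2 muh2 &
        folding_entropy g mu1 <> folding_entropy g mu2] /\
    [/\ disintegrate_differently g mu1 mu2 muh1 muh2,
        pi0 @` backward_basin g muh1 = [set: torus R] &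
        pi0 @` backward_basin g muh2 = [set: torus R]].
Proof.
exists (@tmap R), (tprob (@eps0_itv R)), (tprob (@epsh_itv R)),
  (tlift (@eps0_itv R)), (tlift (@epsh_itv R)).
split; last split.
- split; [exact: tmap_End1plus|exact: tmap_transitive|exact: tmap_inverse_SRB|exact: tmap_inverse_SRB].
- split; [exact: tlift_is_lift|exact: tlift_is_lift|exact: folding_entropies_differ].
- split; [exact: lift_disintegrate_differently|exact: basin_full|exact: basin_full].
Qed.
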